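(* Let $\varepsilon>0$ be given. For an unweighted undirected multigraph $G$ on a fixed set of $n$ vertices that is dynamically updated by edge insertions and deletions, there is a data structure that maintains explicitly an orientation of $G$ with maximum in-degree at most $(1+\varepsilon)\mathrm{OPT}_{LP}+O(\log n/\varepsilon)$, and implicitly a subgraph of $G$ with density at least $(1-\varepsilon)\mathrm{OPT}_{LP}-O(\log n/\varepsilon)$, in $O(\log n/\varepsilon^2)$ amortized time per update. The data structure uses $O(m+n)$ space, where $m$ is the current number of edges.
   Context: An orientation of an undirected multigraph directs each edge (each parallel copy separately) towards one of its endpoints; the in-degree of a vertex is the number of edges directed into it. The density of a vertex set $S\neq\emptyset$ is $|E(S)|/|S|$, where $E(S)$ is the multiset of edges with both endpoints in $S$, and the density of a subgraph is that of its vertex set. $\mathrm{OPT}_{LP}$ denotes the current maximum density $\max_{\emptyset\ne S\subseteq V}|E(S)|/|S|$ (equivalently, the minimum over fractional orientations, where each edge $\{u,v\}$ is split as $y(e,u)+y(e,v)=1$ with $y\ge 0$, of the maximum fractional in-degree). Maintaining a subgraph ''implicitly'' means the data structure maintains a representation from which the vertices of the subgraph can be listed in $O(1)$ time per vertex. All bounds hold at all times with respect to the current graph; hidden constants are absolute.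
   Formalization: Inside the O-terms ε is replaced by min(ε,1): for large ε the literal bound O(log n/ε²) would be less than one step per update, which is impossible; for ε ≤ 1 the claim is unchanged. *)

(* Defs.v *)
From HB Require Import structures.
From mathcomp Require Import all_boot all_order all_algebra finmap.
From mathcomp Require Import reals exp.
Set Implicit Arguments.
Unset Strict Implicit.
Unset Printing Implicit Defensive.
Import Order.TTheory GRing.Theory Num.Theory.

(* A word RAM with dynamically allocated arrays.  Memory is a collection of
  blocks (arrays of words) addressed by number; [heap] lists them, and an
  address whose block is empty is free.  Words are the naturals below [W]: an
  expression or an address that does not fit in a word, an access outside a
  live block, or the release of a dead one makes the machine stuck (there is no
  [exec] derivation).  Statements quantify over [W] to express that words have
  logarithmically many bits, so that large integers cannot be used to hide
  work or space. *)

Inductive binop := Add | Sub | Mul | Div | Leq.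

Definition binop_fun (o : binop) : nat -> nat -> nat :=
  match o with
  | Add => addn | Sub => subn | Mul => muln | Div => divn
  | Leq => fun a b => a <= b
  end.

Inductive expr :=
| Cst of nat
| Var of nat
| Bin of binop & expr & expr
| Get of expr & expr. (* [Get b i]: cell [i] of the block at address [b] *)

Inductive cmd :=
| Skip
| Assign of nat & expr
| Store of expr & expr & expr (* [Store b i e]: cell [i] of block [b] := [e] *)
| Alloc of nat & expr (* [Alloc x e]: register [x] := address of a new block *)
| Free of expr
| Emit of expr
| Seq of cmd & cmd
| If of expr & cmd & cmd
| While of expr & cmd.

Definition heap := seq (seq nat).
Definition block (h : heap) (b : nat) : seq nat := nth [::] h b.
Definition cell (h : heap) (b i : nat) : nat := nth 0 (block h b) i.
Definition used_space (h : heap) : nat := sumn (map size h).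

(* [peak] is the largest space in use so far. *)
Record state := State {
  regs : nat -> nat; mem : heap; out : seq nat; time : nat; peak : nat }.

Definition word (W a : nat) : option nat := if a < W then Some a else None.

Fixpoint eval (W : nat) (s : state) (e : expr) : option nat :=
  match e with
  | Cst a => word W a
  | Var x => Some (regs s x)
  | Bin o e1 e2 =>
      if eval W s e1 is Some a then
        if eval W s e2 is Some b then word W (binop_fun o a b) else None
      else None
  | Get e1 e2 =>
      if eval W s e1 is Some b then
        if eval W s e2 is Some i then
          if i < size (block (mem s) b) then Some (cell (mem s) b i) else None
        else None
      else None
  end.

Definition tick (t : nat) (s : state) : state :=
  State (regs s) (mem s) (out s) (time s + t) (peak s).
Definition set_reg (x a : nat) (s : state) : state :=
  State [eta regs s with x |-> a] (mem s) (out s) (time s) (peak s).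
Definition set_block (b : nat) (r : seq nat) (s : state) : state :=
  let h := set_nth [::] (mem s) b r in
  State (regs s) h (out s) (time s) (maxn (peak s) (used_space h)).
Definition emit (a : nat) (s : state) : state :=
  State (regs s) (mem s) (rcons (out s) a) (time s) (peak s).

(* The first address that is not in use. *)
Definition fresh (h : heap) : nat := find (@nilp nat) h.

(* Every executed command or test takes one unit of time, and allocating [k]
   (zero-initialised) cells takes [k] more.  Expressions are part of the
   program text, so their evaluation takes bounded time for a fixed program. *)
Inductive exec (W : nat) : cmd -> state -> state -> Prop :=
| ExecSkip s : exec W Skip s (tick 1 s)
| ExecAssign s x e a :
    eval W s e = Some a ->
    exec W (Assign x e) s (tick 1 (set_reg x a s))
| ExecStore s e1 e2 e b i a :
    eval W s e1 = Some b -> eval W s e2 = Some i -> eval W s e = Some a ->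
    i < size (block (mem s) b) ->
    exec W (Store e1 e2 e) s
      (tick 1 (set_block b (set_nth 0 (block (mem s) b) i a) s))
| ExecAlloc s x e k :
    eval W s e = Some k -> 0 < k -> fresh (mem s) < W ->
    exec W (Alloc x e) s
      (tick (1 + k) (set_reg x (fresh (mem s))
         (set_block (fresh (mem s)) (nseq k 0) s)))
| ExecFree s e b :
    eval W s e = Some b -> 0 < size (block (mem s) b) ->
    exec W (Free e) s (tick 1 (set_block b [::] s))
| ExecEmit s e a :
    eval W s e = Some a -> exec W (Emit e) s (tick 1 (emit a s))
| ExecSeq s1 s2 s3 c1 c2 :
    exec W c1 s1 s2 -> exec W c2 s2 s3 -> exec W (Seq c1 c2) s1 s3
| ExecIf s s' e c1 c2 a :
    eval W s e = Some a ->
    exec W (if a != 0 then c1 else c2) (tick 1 s) s' ->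
    exec W (If e c1 c2) s s'
| ExecWhileEnd s e c :
    eval W s e = Some 0 -> exec W (While e c) s (tick 1 s)
| ExecWhileLoop s1 s2 s3 e c a :
    eval W s1 e = Some a -> a != 0 ->
    exec W c (tick 1 s1) s2 -> exec W (While e c) s2 s3 ->
    exec W (While e c) s1 s3.

Lemma exec_deterministic W c s s1 s2 : exec W c s s1 -> exec W c s s2 -> s1 = s2.
Proof.
move=> H; elim: H s2 => {c s s1}.
- by move=> s s2 H; inversion H.
- by move=> s x e a E s2 H; inversion H; subst; congruence.
- by move=> s e1 e2 e b i a E1 E2 E3 Hi s2 H; inversion H; subst; congruence.
- by move=> s x e k E1 E2 E3 s2 H; inversion H; subst; congruence.
- by move=> s e b E1 E2 s2 H; inversion H; subst; congruence.
- by move=> s e a E1 s2 H; inversion H; subst; congruence.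
- move=> s1 s2 s3 c1 c2 _ I1 _ I2 s4 H.
  inversion H as [| | | | | |? s2' ? ? ? H1 H2| | |]; subst.
  by apply: I2; rewrite (I1 _ H1).
- move=> s s' e c1 c2 a E _ I s4 H.
  inversion H as [| | | | | | |? ? ? ? ? a' E' H'| |]; subst.
  by apply: I; move: E'; rewrite E => -[->].
- move=> s e c E s2 H.
  inversion H as [| | | | | | | | |? ? ? ? ? a' E' N]; subst=> //.
  by move: E' N; rewrite E => -[<-].
- move=> s1 s2 s3 e c a E N _ I1 _ I2 s4 H.
  inversion H as [| | | | | | | |? ? ? E'|? s2' ? ? ? a' E' N' H1 H2]; subst.
    by move: E' N; rewrite E => -[->].
  by apply: I2; rewrite (I1 _ H1).
Qed.

(* Termination of [p] on memory [h], with the arguments in registers 0, 1, ...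
   and 0 in all others; registers do not survive the call, so what is kept
   between two calls is exactly the memory.  The result is the new memory, the
   list of emitted words, the running time and the peak space. *)
Definition call (W : nat) (p : cmd) (args : seq nat) (h h' : heap)
    (o : seq nat) (t pk : nat) : Prop :=
  exists r : nat -> nat,
    exec W p (State (nth 0 args) h [::] 0 (used_space h)) (State r h' o t pk).

(* A multigraph on the vertex set ['I_n] maps each edge name to the pair of endpoints of the edge; two
   parallel edges are two names with the same endpoints.  Loops are excluded by [ReachInsert] below. *)

Local Open Scope fset_scope.
Local Open Scope fmap_scope.
Local Open Scope ring_scope.

Definition mgraph (n : nat) : Type := {fmap nat -> 'I_n * 'I_n}.

Section Multigraph.
Variable n : nat.
Implicit Types (G : mgraph n) (S : {set 'I_n}).

Definition nb_edges G : nat := #|` domf G|.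

(* The number of edges with both endpoints in [S]. *)
Definition edges_in G S : nat :=
  #|[set e : domf G | ((G e).1 \in S) && ((G e).2 \in S)]%SET|.

Definition density (R : realType) G S : R := (edges_in G S)%:R / #|S|%:R.

(* The default value 0 is irrelevant for n > 0, densities being nonnegative. *)
Definition OPT (R : realType) G : R :=
  \big[Num.max/0]_(S : {set 'I_n} | S != finset.set0) density R G S.

(* [o e] is the vertex towards which the edge [e] is directed. *)
Definition orientation G (o : domf G -> 'I_n) : Prop :=
  forall e : domf G, o e = (G e).1 \/ o e = (G e).2.

Definition indegree G (o : domf G -> 'I_n) (v : 'I_n) : nat :=
  #|[set e : domf G | o e == v]%SET|.

(* The orientation is written in memory: the name of an edge is the address of
   a live block whose cell 0 holds the vertex towards which it is directed. *)
Definition stores_orientation (h : heap) G (o : domf G -> 'I_n) : Prop :=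
  forall e : domf G,
    (0 < size (block h (val e)))%N /\ cell h (val e) 0 = o e :> nat.

End Multigraph.

Record dyn_struct := DynStruct {
  ds_init : cmd;    (* arguments: the number of vertices, the precision *)
  ds_insert : cmd;  (* arguments: the endpoints; emits the name of the edge *)
  ds_delete : cmd;  (* argument: the name of the edge *)
  ds_report : cmd   (* no argument; emits the vertices of the subgraph *)
}.

(* Words can hold any integer below a polynomial of degree [c] in the number
   of vertices, the number [m] of edges and the precision [k]. *)
Definition fits (W n k c m : nat) : Prop := ((n + m + k) ^ c <= W)%N.

(* [reach D W k c h G T t]: some sequence of [T] updates, starting with the
   initialisation of [D] on the edgeless graph, leads to the current graph [G]
   and memory [h]; [t] is the total running time of these [T] updates.  Updates
   may depend arbitrarily on the past; an edge to be deleted is designated by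
   the name that was returned when it was inserted. *)
Inductive reach (D : dyn_struct) (W n k c : nat) :
    heap -> mgraph n -> nat -> nat -> Prop :=
| ReachInit h t pk :
    fits W n k c 0 ->
    call W (ds_init D) [:: n; k] [::] h [::] t pk ->
    reach D W k c h [fmap] 0 0
| ReachInsert h G T t (u v : 'I_n) h' e t' pk :
    reach D W k c h G T t -> u != v -> fits W n k c (nb_edges G).+1 ->
    call W (ds_insert D) [:: val u; val v] h h' [:: e] t' pk ->
    reach D W k c h' G.[e <- (u, v)] T.+1 (t + t')
| ReachDelete h G T t e h' t' pk :
    reach D W k c h G T t -> e \in domf G ->
    call W (ds_delete D) [:: e] h h' [::] t' pk ->
    reach D W k c h' G.[~ e] T.+1 (t + t').

(* Main.v *)
(* Every vertex has a level, and the in-degree of a vertex of level i lies between T(i) and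
   T(i + 2), where T(0) = B and T(j + 1) = T(j) + T(j) / K + 1 (rounded down) for some K of order
   log n / eps^2; only the lower bound at level 0 may fail.  The level of the head of an edge
   exceeds that of its tail by at most 2.  Hence every edge whose head is in the set V(l) of
   vertices of level at least l lies inside V(l - 2), which therefore spans at least T(l) |V(l)|
   edges.  Starting from the top level and descending by 2, one finds after O(log n / eps) steps
   an l with |V(l - 2)| <= (1 + eps / 4) |V(l)|, and then the density of V(l - 2) is nearly the
   maximum in-degree, which bounds OPT from above.

   A vertex whose in-degree exceeds its upper bound flips an in-edge with a tail of lower level,
   which passes the surplus on, or ascends once a scan of all its in-edges has found none; a
   vertex that falls below its lower bound flips an out-edge with a head of higher level or
   descends.  With f(x) the number of thresholds up to x, every flip along such a chain changes f
   by at least 1, and the sum over the vertices v of f(0) + ... + f(d(v) - 1), minus the least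
   value of this sum over all orientations, pays for the flips.  One update raises this
   difference by O(K): if the edges of one orientation are among those of another one, and in
   both f of a head exceeds f of the tail by O(1) at most, then f of an in-degree in the first is
   at most O(K + log n) larger than in the second.  A change of level costs the in-degree d,
   which is paid by K |d - T(i + 1)|.  The number of levels is O(K log n) as long as B is of the
   order of the average degree; otherwise everything is rebuilt with B = m / 2n. *)

Require Import Defs.
From HB Require Import structures.
From mathcomp Require Import all_boot zify.
Set Implicit Arguments.
Unset Strict Implicit.
Unset Printing Implicit Defensive.

(** * A program logic for the machine *)

(** The number of levels is of order K log n, too many for a linear search whenever an edge is
    filed. Labels are therefore grouped into classes of K consecutive ones, and an index links only
    the last bucket of each class: O(log n) index steps and at most K chain steps find any label. In
    a flip the label lies within O(1) of the top of its chain, so the same search takes constant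
    time. The vertices are themselves items, filed at an extra block, the root: one routine relabels
    a vertex with its in-edges, and a report reads the vertices by decreasing level. A chain of
    flips changes no stored degree before its last vertex; the surplus or deficit travels in a
    register. The range from T(i) to T(i + 2) has two gaps so that a vertex that has just changed
    its level stands next to the middle threshold and must cross a whole gap, about d / K, before
    the next change. With k = ceil(1 / eps) and kk = 4k, K is 2 kk^2 times the binary logarithm of
    n. A report takes fewer than kk log n steps of two levels while the set grows by 1 + 1 / kk each
    time, so it spans at most K / kk thresholds, over which degrees change by a factor of about 1 +
    1 / kk. *)

Notation "c1 ;; c2" := (Seq c1 c2) (at level 80, right associativity).

Definition store := nat -> nat -> nat.
Definition regfile := nat -> nat.

Definition upd (s : store) (a f v : nat) : store :=
  fun a' f' => if (a' == a) && (f' == f) then v else s a' f'.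
Definition rset (r : regfile) (x v : nat) : regfile :=
  fun y => if y == x then v else r y.

(** Vertices, edges, buckets and the root share one size, so that space is counted in blocks and a
    freed address can serve any purpose. *)
Definition blksize := 16.

(** The store [s] is total and unconstrained outside [A], so values can be computed without bounds;
    whether an access is legal is a matter of [A] alone. *)
Record model (h : heap) (s : store) (A : seq nat) : Prop := Model {
  model_uniq : uniq A;
  model_size : forall a, a \in A -> size (block h a) = blksize;
  model_cell : forall a f, a \in A -> f < blksize -> cell h a f = s a f;
  model_dead : forall a, a \notin A -> block h a = [::];
  model_used : used_space h = blksize * size A }.

Lemma block_set h b c a :
  block (set_nth [::] h b c) a = if a == b then c else block h a.
Proof. by rewrite /block nth_set_nth /=. Qed.

Lemma used_space_set h b c :
  used_space (set_nth [::] h b c) + size (block h b) = used_space h + size c.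
Proof.
rewrite /used_space /block; elim: h b => [|x h IH] [|b] //=.
- by lia.
- by elim: b => [|b IHb] /=; lia.
- by lia.
- by rewrite -addnA IH addnA.
Qed.

Lemma fresh_dead h : block h (fresh h) = [::].
Proof.
rewrite /block /fresh; case: (ltnP (find (@nilp nat) h) (size h)) => H.
  by apply/nilP; apply: nth_find; rewrite has_find.
by rewrite nth_default.
Qed.

Lemma fresh_below h a : a < fresh h -> block h a != [::].
Proof. by move=> /(before_find [::]); rewrite /nilp size_eq0 => ->. Qed.

(** Every address below [fresh h] holds at least one cell. A bound on the space is thus a bound on
    the next address, which is why addresses fit in words. *)
Lemma fresh_le_used h : fresh h <= used_space h.
Proof.
rewrite /fresh /used_space; elim: h => [|x h IH] //=.
by case: x => [|y x] //=; rewrite addSn ltnS; apply: leq_trans IH (leq_addl _ _).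
Qed.

Lemma model_perm h s A A' : perm_eq A A' -> model h s A -> model h s A'.
Proof.
move=> pA [u Hs Hc Hd Hu]; split.
- by rewrite -(perm_uniq pA).
- by move=> a; rewrite -(perm_mem pA); apply: Hs.
- by move=> a f; rewrite -(perm_mem pA); apply: Hc.
- by move=> a; rewrite -(perm_mem pA); apply: Hd.
- by rewrite -(perm_size pA).
Qed.

Lemma model_nil : model [::] (fun _ _ => 0) [::].
Proof. by split=> //= a _; rewrite /block nth_nil. Qed.

Lemma model_store h s A b i v :
  model h s A -> b \in A -> i < blksize ->
  model (set_nth [::] h b (set_nth 0 (block h b) i v)) (upd s b i v) A.
Proof.
move=> [u Hs Hc Hd Hu] bA iB.
have sz : size (set_nth 0 (block h b) i v) = blksize.
  by rewrite size_set_nth (Hs _ bA); apply/maxn_idPr.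
split=> //.
- by move=> a aA; rewrite block_set; case: eqP => // _; apply: Hs.
- move=> a f aA fB; rewrite /cell block_set /upd; case: eqP => [->|_] /=; last exact: Hc.
  by rewrite nth_set_nth /=; case: eqP => // _; apply: Hc.
- move=> a aA; rewrite block_set; case: eqP => [E|_]; last exact: Hd.
  by rewrite E bA in aA.
- by have := used_space_set h b (set_nth 0 (block h b) i v); rewrite sz (Hs _ bA); lia.
Qed.

Definition clear (s : store) (b : nat) : store :=
  fun a f => if a == b then 0 else s a f.

Lemma model_alloc h s A :
  model h s A ->
  model (set_nth [::] h (fresh h) (nseq blksize 0)) (clear s (fresh h)) (fresh h :: A).
Proof.
move=> [u Hs Hc Hd Hu].
have fA : fresh h \notin A.
  by apply/negP => /Hs; rewrite fresh_dead.
split.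
- by rewrite /= fA.
- move=> a; rewrite inE block_set; case: eqP => [_ _|_ /=]; last exact: Hs.
  by rewrite size_nseq.
- move=> a f; rewrite inE /cell block_set /clear; case: eqP => [_ _|_ /=]; last exact: Hc.
  by rewrite nth_nseq => ->.
- move=> a; rewrite inE negb_or block_set; case: eqP => [//|_ /=]; exact: Hd.
- by have := used_space_set h (fresh h) (nseq blksize 0); rewrite size_nseq fresh_dead /=; lia.
Qed.

Lemma model_free h s A b :
  model h s (b :: A) -> model (set_nth [::] h b [::]) s A.
Proof.
move=> [/= /andP[bA u] Hs Hc Hd Hu]; split=> //.
- move=> a aA; rewrite block_set; case: eqP => [E|_]; first by rewrite -E aA in bA.
  by apply: Hs; rewrite inE aA orbT.
- move=> a f aA fB; rewrite /cell block_set; case: eqP => [E|_]; first by rewrite -E aA in bA.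
  by apply: Hc; rewrite // inE aA orbT.
- move=> a aA; rewrite block_set; case: eqP => // /eqP ab.
  by apply: Hd; rewrite inE negb_or ab.
- have := used_space_set h b [::]; rewrite (Hs b) ?inE ?eqxx //= in Hu *; lia.
Qed.

(** * Total evaluation of expressions and proof rules for the commands *)

Fixpoint vl (r : regfile) (s : store) (e : expr) : nat :=
  match e with
  | Cst a => a
  | Var x => r x
  | Bin o e1 e2 => binop_fun o (vl r s e1) (vl r s e2)
  | Get e1 e2 => s (vl r s e1) (vl r s e2)
  end.

(** Kept apart from [vl] so that values simplify by rewriting. Registers carry no bound, because
    [eval] checks only constants and results of operations. *)
Fixpoint safe (W : nat) (r : regfile) (s : store) (A : seq nat) (e : expr) : Prop :=
  match e with
  | Cst a => a < W
  | Var x => True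
  | Bin o e1 e2 => [/\ safe W r s A e1, safe W r s A e2 & binop_fun o (vl r s e1) (vl r s e2) < W]
  | Get e1 e2 => [/\ safe W r s A e1, safe W r s A e2, vl r s e1 \in A & vl r s e2 < blksize]
  end.

Lemma eval_vl W r h o t p s A e :
  model h s A -> safe W r s A e -> eval W (State r h o t p) e = Some (vl r s e).
Proof.
move=> M; elim: e => [a|x|b e1 IH1 e2 IH2|e1 IH1 e2 IH2] //=.
- by rewrite /word => ->.
- by move=> [/IH1-> /IH2->]; rewrite /word => ->.
- move=> [/IH1-> /IH2-> H1 H2].
  by rewrite (model_size M H1) H2 (model_cell M H1 H2).
Qed.

Section Runs.
Variables W P : nat.

(* [P] bounds the space at all times; the blocks all have size [blksize] and
   nothing is emitted. *)
Definition runs (c : cmd) (r : regfile) (s : store) (A : seq nat)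
    (Q : regfile -> store -> seq nat -> nat -> Prop) : Prop :=
  forall h o t p, model h s A -> maxn p (used_space h) <= P ->
  exists r' h' s' A' dt p',
    [/\ exec W c (State r h o t p) (State r' h' o (t + dt) p'),
        model h' s' A', maxn p' (used_space h') <= P & Q r' s' A' dt].

Lemma runs_seq c1 c2 r s A Q :
  runs c1 r s A (fun r1 s1 A1 d1 =>
    runs c2 r1 s1 A1 (fun r2 s2 A2 d2 => Q r2 s2 A2 (d1 + d2))) ->
  runs (Seq c1 c2) r s A Q.
Proof.
move=> H h o t p M pP; have [r1 [h1 [s1 [A1 [d1 [p1 [E1 M1 pP1 H1]]]]]]] := H h o t p M pP.
have [r2 [h2 [s2 [A2 [d2 [p2 [E2 M2 pP2 q]]]]]]] := H1 h1 o (t + d1) p1 M1 pP1.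
exists r2, h2, s2, A2, (d1 + d2), p2; split=> //.
by rewrite addnA; apply: ExecSeq E1 E2.
Qed.

Lemma runs_skip r s A (Q : _ -> _ -> _ -> _ -> Prop) : Q r s A 1 -> runs Skip r s A Q.
Proof.
move=> q h o t p M pP; exists r, h, s, A, 1, p; split=> //.
exact: (ExecSkip W (State r h o t p)).
Qed.

Lemma runs_assign x e r s A (Q : _ -> _ -> _ -> _ -> Prop) :
  safe W r s A e -> Q (rset r x (vl r s e)) s A 1 -> runs (Assign x e) r s A Q.
Proof.
move=> ok q h o t p M pP; exists (rset r x (vl r s e)), h, s, A, 1, p; split=> //.
exact: (ExecAssign x (eval_vl o t p M ok)).
Qed.

Lemma peak_le p u u' : maxn p u <= P -> u' <= P -> maxn (maxn p u') u' <= P.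
Proof. by rewrite !geq_max => /andP[-> _] ->. Qed.

Lemma runs_store e1 e2 e r s A (Q : _ -> _ -> _ -> _ -> Prop) :
  safe W r s A e1 -> safe W r s A e2 -> safe W r s A e ->
  vl r s e1 \in A -> vl r s e2 < blksize ->
  Q r (upd s (vl r s e1) (vl r s e2) (vl r s e)) A 1 ->
  runs (Store e1 e2 e) r s A Q.
Proof.
move=> ok1 ok2 ok3 bA iB q h o t p M pP.
have M' := model_store (vl r s e) M bA iB.
set h' := set_nth _ _ _ _ in M'.
exists r, h', (upd s (vl r s e1) (vl r s e2) (vl r s e)), A, 1, (maxn p (used_space h')).
split=> //; last first.
  apply: (peak_le pP); move: pP; rewrite geq_max (model_used M) (model_used M').
  by case/andP.
apply: (ExecStore (eval_vl o t p M ok1) (eval_vl o t p M ok2) (eval_vl o t p M ok3)) => /=.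
by rewrite (model_size M bA).
Qed.

(** The new address is known only as the least free one. That is enough to make the first
    allocations of the initialisation return 0, ..., n. *)
Lemma runs_alloc x r s A (Q : _ -> _ -> _ -> _ -> Prop) :
  P < W -> blksize < W -> blksize * (size A).+1 <= P ->
  (forall b, b \notin A -> (forall a, a < b -> a \in A) -> b < W ->
     Q (rset r x b) (clear s b) (b :: A) blksize.+1) ->
  runs (Alloc x (Cst blksize)) r s A Q.
Proof.
move=> PW bW szA q h o t p M pP.
have M' := model_alloc M.
set h' := set_nth _ _ _ _ in M'.
have fW : fresh h < W.
  apply: leq_ltn_trans (fresh_le_used h) _; rewrite (model_used M).
  by apply: leq_ltn_trans PW; apply: leq_trans szA; rewrite leq_mul.
exists (rset r x (fresh h)), h', (clear s (fresh h)), (fresh h :: A), blksize.+1,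
  (maxn p (used_space h')).
split=> //; last 1 first.
- apply: q => //; first by have /= /andP[] := model_uniq M'.
  move=> a /fresh_below H; apply/negPn/negP => aA.
  by rewrite (model_dead M aA) in H.
- have -> : blksize.+1 = 1 + blksize by [].
  by apply: (@ExecAlloc W (State r h o t p) x (Cst blksize)) => //=; rewrite /word bW.
- by apply: (peak_le pP); rewrite (model_used M').
Qed.

Lemma runs_free e r s A A' (Q : _ -> _ -> _ -> _ -> Prop) :
  safe W r s A e -> perm_eq A (vl r s e :: A') -> Q r s A' 1 -> runs (Free e) r s A Q.
Proof.
move=> ok pA q h o t p M pP.
have M' := model_free (model_perm pA M).
set h' := set_nth _ _ _ _ in M'.
have bA : vl r s e \in A by rewrite (perm_mem pA) inE eqxx.
exists r, h', s, A', 1, (maxn p (used_space h')).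
split=> //; last first.
  apply: (peak_le pP); move: pP; rewrite geq_max (model_used M) (model_used M').
  rewrite (perm_size pA) /= => /andP[_]; exact: leq_trans (leq_mul _ _).
apply: (ExecFree (eval_vl o t p M ok)) => /=.
by rewrite (model_size M bA).
Qed.

Lemma runs_if e c1 c2 r s A (Q : _ -> _ -> _ -> _ -> Prop) :
  safe W r s A e ->
  (vl r s e != 0 -> runs c1 r s A (fun r1 s1 A1 d => Q r1 s1 A1 d.+1)) ->
  (vl r s e = 0 -> runs c2 r s A (fun r1 s1 A1 d => Q r1 s1 A1 d.+1)) ->
  runs (If e c1 c2) r s A Q.
Proof.
move=> ok q1 q2 h o t p M pP.
have : runs (if vl r s e != 0 then c1 else c2) r s A (fun r1 s1 A1 d => Q r1 s1 A1 d.+1).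
  by case: eqP => [/q2|/eqP/q1].
move=> /(_ h o t.+1 p M pP) [r' [h' [s' [A' [dt [p' [E M' pP' q]]]]]]].
exists r', h', s', A', dt.+1, p'; split=> //.
apply: (ExecIf (eval_vl o t p M ok)).
by rewrite /tick /= addn1 -addSnnS.
Qed.

(** A single unfolding; termination comes from the induction in which the rule is applied. *)
Lemma runs_while e c r s A (Q : _ -> _ -> _ -> _ -> Prop) :
  safe W r s A e ->
  (vl r s e = 0 -> Q r s A 1) ->
  (vl r s e != 0 -> runs c r s A (fun r1 s1 A1 d1 =>
     runs (While e c) r1 s1 A1 (fun r2 s2 A2 d2 => Q r2 s2 A2 (d1 + d2).+1))) ->
  runs (While e c) r s A Q.
Proof.
move=> ok q1 q2 h o t p M pP.
case: (eqVneq (vl r s e) 0) => H.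
  exists r, h, s, A, 1, p; split=> //; last exact: q1.
  have -> : State r h o (t + 1) p = tick 1 (State r h o t p) by [].
  by apply: ExecWhileEnd; rewrite (eval_vl o t p M ok) H.
have [r1 [h1 [s1 [A1 [d1 [p1 [E1 M1 pP1 H1]]]]]]] := q2 H h o t.+1 p M pP.
have [r2 [h2 [s2 [A2 [d2 [p2 [E2 M2 pP2 q]]]]]]] := H1 h1 o (t.+1 + d1) p1 M1 pP1.
exists r2, h2, s2, A2, (d1 + d2).+1, p2; split=> //.
have -> : t + (d1 + d2).+1 = t.+1 + d1 + d2 by lia.
apply: ExecWhileLoop E2 => //; first exact: (eval_vl o t p M ok).
  by [].
by rewrite /tick /= addn1.
Qed.

End Runs.

(** * Circular doubly linked lists *)

Definition lk (s : store) (f : nat) : rel nat :=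
  fun x y => (s x f == y) && (s y f.+1 == x).

(* A circular doubly linked list with sentinel [c] and nodes [l]; the forward
   pointers are in cell [f], the backward pointers in cell [f.+1]. *)
Definition cyc (s : store) (f c : nat) (l : seq nat) : bool :=
  path (lk s f) c (rcons l c).

Definition link (s : store) (f y x : nat) : store :=
  upd (upd (upd (upd s x f (s y f)) x f.+1 y) y f x) (s y f) f.+1 x.

Definition unlink (s : store) (f x : nat) : store :=
  upd (upd s (s x f.+1) f (s x f)) (s x f) f.+1 (s x f.+1).

Lemma updE s a f v a' f' :
  upd s a f v a' f' = if (a' == a) && (f' == f) then v else s a' f'.
Proof. by []. Qed.

Lemma upd_eq s a f v : upd s a f v a f = v.
Proof. by rewrite /upd !eqxx. Qed.

Lemma upd_fld s a f v a' f' : f' != f -> upd s a f v a' f' = s a' f'.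
Proof. by rewrite /upd => /negbTE->; rewrite andbF. Qed.

Lemma upd_adr s a f v a' f' : a' != a -> upd s a f v a' f' = s a' f'.
Proof. by rewrite /upd => /negbTE->. Qed.

Lemma link_fld s f y x a g : g != f -> g != f.+1 -> link s f y x a g = s a g.
Proof. by move=> H1 H2; rewrite /link !upd_fld. Qed.

Lemma unlink_fld s f x a g : g != f -> g != f.+1 -> unlink s f x a g = s a g.
Proof. by move=> H1 H2; rewrite /unlink !upd_fld. Qed.

Lemma path_frame s s' f c p :
  {in belast c p, forall a, s' a f = s a f} ->
  {in p, forall a, s' a f.+1 = s a f.+1} ->
  path (lk s f) c p -> path (lk s' f) c p.
Proof.
elim: p c => [|x p IH] c //= H1 H2 /andP[/andP[E1 E2] E3].
rewrite /lk H1 ?inE ?eqxx // H2 ?inE ?eqxx // E1 E2 /=.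
by apply: IH E3 => a Ha; [apply: H1|apply: H2]; rewrite inE Ha orbT.
Qed.

Lemma cyc_frame s s' f c l :
  {in c :: l, forall a, s' a f = s a f /\ s' a f.+1 = s a f.+1} ->
  cyc s f c l -> cyc s' f c l.
Proof.
move=> H; apply: path_frame => a; rewrite ?belast_rcons => Ha.
  by case: (H a Ha).
by case: (H a _) => //; move: Ha; rewrite mem_rcons.
Qed.

Lemma cyc_next s f c l1 l2 : cyc s f c (l1 ++ l2) -> s (last c l1) f = head c l2.
Proof.
rewrite /cyc rcons_cat cat_path => /andP[_].
by case: l2 => [|x l2] /= /andP[/andP[/eqP->]].
Qed.

Lemma cyc_prev s f c l1 x l2 : cyc s f c (l1 ++ x :: l2) -> s x f.+1 = last c l1.
Proof.
by rewrite /cyc rcons_cat cat_path => /andP[_] /= /andP[/andP[_ /eqP->]].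
Qed.

Lemma cyc_last s f c l : cyc s f c l -> s c f.+1 = last c l.
Proof.
by rewrite /cyc rcons_path => /andP[_] /andP[_ /eqP].
Qed.

Lemma cyc_next_mem s f c l y : cyc s f c l -> y \in c :: l -> s y f \in c :: l.
Proof.
move=> H; rewrite inE => /orP[/eqP->|/splitPr E].
  by rewrite -[l]/([::] ++ l) in H; rewrite (cyc_next H); case: (l) => [|a m]; rewrite /= !inE eqxx ?orbT.
case: E H => l1 l2; rewrite -cat_rcons => H.
have := cyc_next H; rewrite last_rcons => ->.
by case: (l2) => [|a m] /=; rewrite !inE ?eqxx // mem_cat inE eqxx !orbT.
Qed.

Lemma cyc_prev_mem s f c l y : cyc s f c l -> y \in c :: l -> s y f.+1 \in c :: l.
Proof.
move=> H; rewrite inE => /orP[/eqP->|/splitPr E].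
  by rewrite (cyc_last H) mem_last.
case: E H => l1 l2 H; rewrite (cyc_prev H).
have := mem_last c l1; rewrite !inE mem_cat => /orP[->//|->]; by rewrite orbT.
Qed.

(** Only the new node, its predecessor [last c l1] and its successor [head c l2] are written; for
    empty lists these neighbours are the sentinel itself. *)
Lemma cyc_link s f c l1 l2 x :
  uniq (c :: l1 ++ l2) -> x \notin c :: l1 ++ l2 -> cyc s f c (l1 ++ l2) ->
  cyc (link s f (last c l1) x) f c (l1 ++ x :: l2).
Proof.
move=> U X H; have N := cyc_next H; set y := last c l1; set s' := link _ _ _ _.
have yin : y \in c :: l1 ++ l2.
  by have := mem_last c l1; rewrite -/y !inE mem_cat => /orP[->|->]; rewrite ?orbT.
have xy : x != y by apply: contraNneq X => ->.
have zin : head c l2 \in c :: l1 ++ l2.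
  by case: (l2) => [|z m] /=; rewrite !inE ?eqxx // mem_cat inE eqxx !orbT.
have xz : x != head c l2 by apply: contraNneq X => ->.
have fS : f != f.+1 by rewrite neq_ltn ltnSn.
have Sf : f.+1 != f by rewrite eq_sym.
have e1 a : a != x -> a != y -> s' a f = s a f.
  by move=> ax ay; rewrite /s' /link upd_fld // upd_adr // upd_fld // upd_adr.
have e2 a : a != x -> a != head c l2 -> s' a f.+1 = s a f.+1.
  by move=> ax ay; rewrite /s' /link -/y N upd_adr // upd_fld // upd_adr // upd_fld.
have e3 : s' y f = x by rewrite /s' /link -/y upd_fld // upd_eq.
have e4 : s' x f.+1 = y.
  by rewrite /s' /link -/y N upd_adr // upd_fld // upd_eq.
have e5 : s' x f = head c l2.
  by rewrite /s' /link -/y N upd_fld // upd_adr // upd_fld // upd_eq.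
have e6 : s' (head c l2) f.+1 = x by rewrite /s' /link -/y N upd_eq.
have U1 : uniq (c :: l1) by move: U; rewrite -cat_cons cat_uniq => /and3P[].
move: H; rewrite /cyc !rcons_cat !cat_path -/y => /andP[p1 p2].
apply/andP; split.
  apply: path_frame p1 => a Ha.
    apply: e1; first by apply: contraNneq X => <-; move: (mem_belast Ha); rewrite !inE mem_cat => /orP[->|->]; rewrite ?orbT.
    by move: U1; rewrite lastI rcons_uniq -/y => /andP[H _]; apply: contraNneq H => <-.
  apply: e2; first by apply: contraNneq X => <-; rewrite inE mem_cat Ha orbT.
  move: U; rewrite /= mem_cat negb_or cat_uniq => /andP[/andP[cl1 _] /and3P[_ H _]].
  case: (l2) H => [|z m] /= => [_|]; first by apply: contraNneq cl1 => <-.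
  by rewrite negb_or => /andP[Z _]; apply: contraNneq Z => <-.
rewrite /= /lk e3 e4 !eqxx /=.
case: l2 p2 U X {N yin zin} xz e2 e5 e6 => [|z m] /= p2 U X xz e2 e5 e6.
  by rewrite e5 e6 !eqxx.
rewrite e5 e6 !eqxx /=; case/andP: p2 => _; apply: path_frame => a.
  rewrite belast_rcons => Ha; apply: e1.
    by apply: contraNneq X => <-; rewrite inE mem_cat Ha !orbT.
  apply: contraTneq Ha => ->; move: U; rewrite mem_cat negb_or cat_uniq.
  move=> /andP[/andP[_ cm] /and3P[_ H _]].
  have := mem_last c l1; rewrite -/y in_cons => /orP[/eqP->|yl] //.
  by apply: contraNN H => H; apply/hasP; exists y; rewrite // inE.
rewrite mem_rcons => Ha; apply: e2.
  apply: contraNneq X => <-; move: Ha; rewrite !inE mem_cat inE => /orP[->|->]; by rewrite ?orbT.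
move: U; rewrite mem_cat inE !negb_or cat_uniq /= => /andP[/and3P[_ cz _] /and3P[_ _ /andP[zm _]]].
by move: Ha; rewrite inE => /orP[/eqP->|H] //; apply: contraNneq zm => <-.
Qed.

Lemma cyc_unlink s f c l1 x l2 :
  uniq (c :: l1 ++ x :: l2) -> cyc s f c (l1 ++ x :: l2) ->
  cyc (unlink s f x) f c (l1 ++ l2).
Proof.
move=> U H; have N := cyc_prev H; have N2 : s x f = head c l2.
  by move: H; rewrite -cat_rcons => /cyc_next; rewrite last_rcons.
set y := last c l1; set s' := unlink _ _ _.
have fS : f != f.+1 by rewrite neq_ltn ltnSn.
have Sf : f.+1 != f by rewrite eq_sym.
have e1 a : a != y -> s' a f = s a f.
  by move=> ay; rewrite /s' /unlink N -/y upd_fld // upd_adr.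
have e2 a : a != head c l2 -> s' a f.+1 = s a f.+1.
  by move=> ay; rewrite /s' /unlink N N2 -/y upd_adr // upd_fld.
have e3 : s' y f = head c l2 by rewrite /s' /unlink N N2 -/y upd_fld // upd_eq.
have e4 : s' (head c l2) f.+1 = y by rewrite /s' /unlink N N2 upd_eq.
have U1 : uniq (c :: l1) by move: U; rewrite -cat_cons cat_uniq => /and3P[].
move: H; rewrite /cyc !rcons_cat !cat_path -/y => /andP[p1 p2].
apply/andP; split.
  apply: path_frame p1 => a Ha.
    apply: e1.
    by move: U1; rewrite lastI rcons_uniq -/y => /andP[H _]; apply: contraNneq H => <-.
  apply: e2.
  move: U; rewrite /= mem_cat negb_or cat_uniq => /andP[/andP[cl1 _] /and3P[_ H _]].
  case: (l2) H => [|z m] /= => [_|]; first by apply: contraNneq cl1 => <-.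
  by rewrite !negb_or => /and3P[_ Z _]; apply: contraNneq Z => <-.
case: l2 p2 U {N2} e2 e3 e4 => [|z m] /= p2 U e2 e3 e4.
  by rewrite /lk e3 e4 !eqxx.
rewrite /lk e3 e4 !eqxx /=; case/and3P: p2 => _ _; apply: path_frame => a.
  rewrite belast_rcons => Ha; apply: e1.
  apply: contraTneq Ha => ->; have U' : uniq (c :: l1 ++ [:: x, z & m]) := U.
  move: U'; rewrite [uniq _]/= mem_cat negb_or cat_uniq => /andP[/andP[_ cm] /and3P[_ H _]].
  have := mem_last c l1; rewrite -/y in_cons => /orP[/eqP->|yl].
    by apply: contraNN cm => H'; rewrite in_cons H' orbT.
  by apply: contraNN H => H; apply/hasP; exists y; rewrite // in_cons H orbT.
rewrite mem_rcons => Ha; apply: e2.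
move: U; rewrite mem_cat !inE !negb_or cat_uniq /= => /andP[/and4P[_ _ cz _] /and4P[_ _ _ /andP[zm _]]].
by move: Ha; rewrite inE => /orP[/eqP->|H] //; apply: contraNneq zm => <-.
Qed.

(** A list is closed under its own pointers, so the three blocks written belong to [x :: c :: l] and
    a disjoint list does not notice. *)
Lemma cyc_link_other s f c l y x d m :
  cyc s f c l -> y \in c :: l -> cyc s f d m ->
  {in d :: m, forall a, a \notin x :: c :: l} ->
  cyc (link s f y x) f d m.
Proof.
move=> H yl H2 D; apply: cyc_frame H2 => a /D; rewrite inE negb_or => /andP[ax al].
have ay : a != y by apply: contraNneq al => ->.
have az : a != s y f by apply: contraNneq al => ->; apply: cyc_next_mem.
by rewrite /link !upd_adr.
Qed.

Lemma cyc_unlink_other s f c l x d m :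
  cyc s f c l -> x \in c :: l -> cyc s f d m ->
  {in d :: m, forall a, a \notin c :: l} ->
  cyc (unlink s f x) f d m.
Proof.
move=> H yl H2 D; apply: cyc_frame H2 => a /D al.
have ay : a != s x f.+1 by apply: contraNneq al => ->; apply: cyc_prev_mem.
have az : a != s x f by apply: contraNneq al => ->; apply: cyc_next_mem.
by rewrite /unlink !upd_adr.
Qed.

Definition fld (x f : nat) : expr := Get (Var x) (Cst f).
Definition LINK (f y x t : nat) : cmd :=
  Assign t (fld y f) ;;
  Store (Var x) (Cst f) (Var t) ;; Store (Var x) (Cst f.+1) (Var y) ;;
  Store (Var y) (Cst f) (Var x) ;; Store (Var t) (Cst f.+1) (Var x).
Definition UNLINK (f x t1 t2 : nat) : cmd :=
  Assign t1 (fld x f.+1) ;; Assign t2 (fld x f) ;;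
  Store (Var t1) (Cst f) (Var t2) ;; Store (Var t2) (Cst f.+1) (Var t1).

Section RunsLists.
Variables W P : nat.
Hypothesis W16 : 100 < W.

Lemma runs_LINK f y x t r s A (Q : _ -> _ -> _ -> _ -> Prop) :
  x != t -> y != t -> f.+1 < blksize ->
  r x \in A -> r y \in A -> s (r y) f \in A ->
  Q (rset r t (s (r y) f)) (link s f (r y) (r x)) A 5 ->
  runs W P (LINK f y x t) r s A Q.
Proof.
move=> /negbTE xt /negbTE yt fB xA yA zA q.
have fB' : f < blksize by apply: ltnW.
have cW g : g < blksize -> g < W by move=> H; apply: leq_trans (ltnW W16); apply: leq_trans H _.
apply: runs_seq; apply: runs_assign => /=; first by split=> //; apply: cW.
apply: runs_seq; apply: runs_store => //=; rewrite ?/rset ?xt ?yt ?eqxx //; try exact: cW.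
apply: runs_seq; apply: runs_store => //=; rewrite ?/rset ?xt ?yt ?eqxx //; try exact: cW.
apply: runs_seq; apply: runs_store => //=; rewrite ?/rset ?xt ?yt ?eqxx //; try exact: cW.
by apply: runs_store => //=; rewrite ?/rset ?xt ?yt ?eqxx //; try exact: cW.
Qed.

Lemma runs_UNLINK f x t1 t2 r s A (Q : _ -> _ -> _ -> _ -> Prop) :
  x != t1 -> t1 != t2 -> f.+1 < blksize ->
  r x \in A -> s (r x) f \in A -> s (r x) f.+1 \in A ->
  Q (rset (rset r t1 (s (r x) f.+1)) t2 (s (r x) f)) (unlink s f (r x)) A 4 ->
  runs W P (UNLINK f x t1 t2) r s A Q.
Proof.
move=> /negbTE xt /negbTE tt fB xA zA wA q.
have fB' : f < blksize by apply: ltnW.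
have cW g : g < blksize -> g < W by move=> H; apply: leq_trans (ltnW W16); apply: leq_trans H _.
apply: runs_seq; apply: runs_assign => /=; first by split=> //; apply: cW.
apply: runs_seq; apply: runs_assign => /=; rewrite ?/rset ?xt ?tt ?eqxx //; first by split=> //; apply: cW.
apply: runs_seq; apply: runs_store => //=; rewrite ?/rset ?xt ?tt ?eqxx //; try exact: cW.
by apply: runs_store => //=; rewrite ?/rset ?xt ?tt ?eqxx //; try exact: cW.
Qed.

End RunsLists.

(** * Chains of buckets *)

Section Bottoms.
Variable g : nat -> nat.

Definition hdc (l : seq nat) (e : nat) : nat := if l is y :: _ then g y else e.

(* The last element of each maximal run of [l] on which [g] is constant; [e] is
   the value of [g] after the end of [l]. *)
Fixpoint botsn (l : seq nat) (e : nat) : seq nat :=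
  if l is x :: l' then (if g x == hdc l' e then [::] else [:: x]) ++ botsn l' e
  else [::].

Lemma botsn_cat l1 l2 e : botsn (l1 ++ l2) e = botsn l1 (hdc l2 e) ++ botsn l2 e.
Proof.
elim: l1 => [|x l1 IH] //=; rewrite IH catA; congr ((_ ++ _) ++ _).
by case: (l1).
Qed.

Lemma botsn_rcons l x e :
  botsn (rcons l x) e = botsn l (g x) ++ (if g x == e then [::] else [:: x]).
Proof. by rewrite -cats1 botsn_cat /= cats0. Qed.

Lemma botsn_subseq l e : subseq (botsn l e) l.
Proof.
elim: l => [|x l IH] //=; case: eqP => _ //=; last by rewrite eqxx.
exact: subseq_trans IH (subseq_cons _ _).
Qed.

Lemma mem_botsn l e x : x \in botsn l e -> x \in l.
Proof. exact: (mem_subseq (botsn_subseq l e)). Qed.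

Lemma botsn_uniq u l1 l2 e :
  uniq (u :: l1 ++ l2) -> uniq (u :: botsn l1 (hdc l2 e) ++ botsn l2 e).
Proof.
rewrite -botsn_cat /= => /andP[H1 H2]; rewrite (subseq_uniq (botsn_subseq _ _) H2) andbT.
by apply: contraNN H1; apply: mem_botsn.
Qed.

(** [x] and [z] are the chain neighbours of the new bucket [b]. If [z] is in the class of [b], the
    last bucket of the class is unchanged; otherwise [b] becomes last and replaces [x] if [x] is in
    this class too. Linking [b] behind [x] before [x] is removed avoids a search for the index
    predecessor of [x]. *)
Definition idx_new (s : store) (x b z : nat) : store :=
  if g z == g b then s else
  if g x == g b then unlink (link s 9 x b) 9 x else link s 9 x b.

(** The reverse of [idx_new]: if [b] ended its class, the role passes to [x] when [x] is in the same
    class, and the class disappears from the index otherwise. *)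
Definition idx_del (s : store) (x b z : nat) : store :=
  if g z == g b then s else
  if g x == g b then unlink (link s 9 b x) 9 b else unlink s 9 b.

Lemma hdc_head u l : g u = 0 -> hdc l 0 = g (head u l).
Proof. by case: l => //= ->. Qed.

Lemma cyc_idx_new s u l1 b l2 :
  uniq (u :: l1 ++ l2) -> b \notin u :: l1 ++ l2 -> g u = 0 -> g b != 0 ->
  (l1 != [::] -> g b <= g (last u l1)) -> hdc l2 0 <= g b ->
  cyc s 9 u (botsn (l1 ++ l2) 0) ->
  cyc (idx_new s (last u l1) b (head u l2)) 9 u (botsn (l1 ++ b :: l2) 0).
Proof.
move=> U X u0 b0 H1 H2 C; rewrite /idx_new -hdc_head //.
case: eqP => [E|/eqP E]; first by rewrite botsn_cat /= -E eqxx -botsn_cat.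
have U' := botsn_uniq 0 U; have X' : b \notin u :: botsn (l1 ++ l2) 0.
  by apply: contraNN X; rewrite !inE => /orP[->|/mem_botsn->]; rewrite ?orbT.
rewrite (botsn_cat l1 l2) in C X'.
case/lastP: l1 U X H1 U' C X' => [|l1 x] U X H1 U' C X' /=.
  rewrite u0 eq_sym (negbTE b0) eq_sym (negbTE E) /=.
  exact: (cyc_link (l1 := [::])).
rewrite last_rcons; rewrite last_rcons in H1.
(* Classes do not increase along a chain and [b] differs from what follows it, so [x] ended its
   class before the insertion and is present in the index. *)
have xh : g x != hdc l2 0.
  by apply: contraNneq E => E; have := H1 _; rewrite -size_eq0 size_rcons => /(_ isT); lia.
rewrite botsn_rcons (negbTE xh) in C U' X'.
have C1 := cyc_link U' X' C; rewrite last_cat /= in C1.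
rewrite botsn_cat /= [g b == _]eq_sym (negbTE E) botsn_rcons.
case: eqP => [E2|_]; last exact: C1.
rewrite -catA in C1; rewrite cats0; apply: cyc_unlink C1.
set B := botsn _ _ in U' X' *; set R := botsn _ _ in U' X' *.
have -> : uniq (u :: B ++ [:: x] ++ b :: R) = uniq (b :: u :: (B ++ [:: x]) ++ R).
  by apply: perm_uniq; apply/permP => p; rewrite /= !count_cat /=; lia.
by rewrite [uniq _]/= -/(uniq (u :: _)) X' U'.
Qed.

Lemma cyc_idx_del s u l1 b l2 :
  uniq (u :: l1 ++ b :: l2) -> g u = 0 -> g b != 0 ->
  (l1 != [::] -> g b <= g (last u l1)) -> hdc l2 0 <= g b ->
  cyc s 9 u (botsn (l1 ++ b :: l2) 0) ->
  cyc (idx_del s (last u l1) b (head u l2)) 9 u (botsn (l1 ++ l2) 0).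
Proof.
move=> U u0 b0 H1 H2; rewrite /idx_del -hdc_head // [botsn (_ ++ _ :: _) _]botsn_cat [hdc (_ :: _) _]/=.
have /= := botsn_uniq 0 U.
rewrite [g b == _]eq_sym; case: eqP => [E|/eqP E] U'; first by rewrite botsn_cat E.
rewrite botsn_cat; case/lastP: l1 U H1 U' => [|l1 x] U H1 /= U' C.
  by rewrite u0 eq_sym (negbTE b0); apply: (cyc_unlink (l1 := [::])) U' C.
rewrite !last_rcons in H1 *.
have xb : g b <= g x by apply: H1; rewrite -size_eq0 size_rcons.
rewrite !botsn_rcons in U' C *.
have -> : (g x == hdc l2 0) = false by apply/negbTE/eqP => E2; move/eqP: E; lia.
case: eqP U' C => [E2|_] U' C; last first.
  exact: cyc_unlink U' C.
rewrite cats0 in U' C; set B := botsn l1 _ in U' C *; set R := botsn l2 _ in U' C *.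
have X : x \notin u :: B ++ b :: R.
  have : uniq (x :: u :: l1 ++ b :: l2).
    move: U; congr is_true; apply: perm_uniq; apply/permP => p.
    by rewrite /= !count_cat -cats1 !count_cat /=; lia.
  rewrite [uniq _]/= => /andP[X _]; apply: contraNN X.
  rewrite !inE !mem_cat !inE => /or4P[->|/mem_botsn->|->|/mem_botsn->];
    by rewrite ?orbT.
rewrite -[B ++ b :: R]cat_rcons in U' C X.
have C' := cyc_link U' X C; rewrite last_rcons cat_rcons in C'.
have := cyc_unlink _ C'; rewrite -catA /=; apply.
rewrite -[_ && _]/(uniq (u :: B ++ [:: b, x & R])).
have -> : uniq (u :: B ++ [:: b, x & R]) = uniq (x :: u :: rcons B b ++ R).
  by apply: perm_uniq; apply/permP => p; rewrite /= !count_cat -cats1 !count_cat /=; lia.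
by rewrite cons_uniq X cons_uniq.
Qed.

End Bottoms.

(** * Sorted chains of buckets with their class index, and the elementary changes *)

Section Buckets.
Variables K n : nat.
Hypothesis K0 : 0 < K.

Definition cls (s : store) (b : nat) : nat := s b 11 %/ K.
Definition above (s : store) : rel nat := fun a b => s b 11 < s a 11.

(* Every owner [u <= n] has a chain [cl u] of buckets with decreasing labels
   (cell 11), and every bucket [b] a list [tl b] of items.  The bucket of an item is
   kept in cell 6, the owner of a bucket in cell 1.  The cells 9 and 10 link the
   last buckets of the classes (quotients of the labels by [K]), so that a label
   can be searched without visiting all buckets.  The buckets in [ex] may be
   empty. *)
Record OS (s : store) (ex Bk J : seq nat) (own lab : nat -> nat)
    (cl tl : nat -> seq nat) : Prop := MkOS {
  os_uB : uniq Bk;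
  os_uJ : uniq J;
  os_BJ : forall b, b \in Bk -> n < b /\ b \notin J;
  os_J : forall y, y \in J ->
    [/\ s y 6 \in Bk, s (s y 6) 1 = own y, s (s y 6) 11 = lab y & own y <= n];
  os_c : forall u, u <= n -> cyc s 7 u (cl u);
  os_x : forall u, u <= n -> cyc s 9 u (botsn (cls s) (cl u) 0);
  os_0 : forall u, u <= n -> s u 11 = 0;
  os_sorted : forall u, u <= n -> pairwise (above s) (cl u);
  os_cl : forall u b, u <= n -> (b \in cl u) = (b \in Bk) && (s b 1 == u);
  os_own : forall b, b \in Bk -> s b 1 <= n;
  os_K : forall b, b \in Bk -> K <= s b 11;
  os_t : forall b, b \in Bk -> cyc s 4 b (tl b) /\ uniq (tl b);
  os_tl : forall b y, b \in Bk -> (y \in tl b) = (y \in J) && (s y 6 == b);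
  os_ne : forall b, b \in Bk -> b \notin ex -> tl b != [::] }.

Lemma above_irr s : irreflexive (above s).
Proof. by move=> x; rewrite /above ltnn. Qed.

Lemma eq_above s s' l : {in l, forall b, s' b 11 = s b 11} ->
  pairwise (above s') l = pairwise (above s) l.
Proof.
elim: l => [|x l IH] //= H; rewrite IH; last by move=> b bl; apply: H; rewrite inE bl orbT.
congr (_ && _); apply: eq_in_all => b bl.
by rewrite /above !H ?inE ?eqxx ?bl ?orbT.
Qed.

Lemma eq_botsn (g g' : nat -> nat) l e : {in l, g =1 g'} -> botsn g l e = botsn g' l e.
Proof.
elim: l => [|x l IH] //= H; rewrite IH => [|b bl]; last by apply: H; rewrite inE bl orbT.
congr (_ ++ _); rewrite H ?inE ?eqxx //.
by case: (l) H => //= y m H; rewrite H // !inE eqxx orbT.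
Qed.

Lemma os_uniq_chain s ex Bk J own lab cl tl u :
  OS s ex Bk J own lab cl tl -> u <= n -> uniq (u :: cl u).
Proof.
move=> H un /=; rewrite (pairwise_uniq (@above_irr s) (os_sorted H un)) andbT.
by rewrite (os_cl H _ un); apply/negP => /andP[/(os_BJ H)[]]; rewrite ltnNge un.
Qed.

(** The structure reads only the cells 4 to 11 and, in buckets, the owner in cell 1. Owners and
    labels of items enter through [own] and [lab], which may change outside [J]. *)
Lemma os_frame s s' ex Bk J own lab own' lab' cl tl :
  OS s ex Bk J own lab cl tl ->
  (forall a f, [|| a <= n, a \in J | a \in Bk] -> 4 <= f <= 11 -> s' a f = s a f) ->
  {in Bk, forall b, s' b 1 = s b 1} ->
  {in J, own' =1 own} -> {in J, lab' =1 lab} ->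
  OS s' ex Bk J own' lab' cl tl.
Proof.
move=> H E E1 Eo El.
have EB b f : b \in Bk -> 4 <= f <= 11 -> s' b f = s b f.
  by move=> bB; apply: E; rewrite bB !orbT.
have EJ b f : b \in J -> 4 <= f <= 11 -> s' b f = s b f.
  by move=> bB; apply: E; rewrite bB !orbT.
have En b f : b <= n -> 4 <= f <= 11 -> s' b f = s b f.
  by move=> bB; apply: E; rewrite bB.
have Ecl u b : u <= n -> b \in cl u -> b \in Bk by move=> un; rewrite (os_cl H) // => /andP[].
split.
- exact: os_uB H.
- exact: os_uJ H.
- exact: os_BJ H.
- move=> y yJ; have [b1 b2 b3 b4] := os_J H yJ.
  by rewrite EJ // E1 // EB // Eo // El.
- move=> u un; apply: cyc_frame (os_c H un) => a; rewrite inE => /orP[/eqP->|/Ecl aB].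
    by rewrite !En.
  by rewrite !EB ?aB.
- move=> u un; have -> : botsn (cls s') (cl u) 0 = botsn (cls s) (cl u) 0.
    by apply: eq_botsn => b /Ecl bB; rewrite /cls EB // bB.
  apply: cyc_frame (os_x H un) => a; rewrite inE => /orP[/eqP->|/mem_botsn/Ecl aB].
    by rewrite !En.
  by rewrite !EB ?aB.
- by move=> u un; rewrite En // (os_0 H).
- move=> u un; rewrite (@eq_above s) ?(os_sorted H) // => b /Ecl bB.
  by rewrite EB // bB.
- move=> u b un; rewrite (os_cl H) //; case bB: (b \in Bk) => //=.
  by rewrite E1.
- by move=> b bB; rewrite E1 // (os_own H).
- by move=> b bB; rewrite EB // (os_K H).
- move=> b bB; have [c1 c2] := os_t H bB; split=> //.
  apply: cyc_frame c1 => a; rewrite inE => /orP[/eqP->|]; first by rewrite !EB.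
  by rewrite (os_tl H) // => /andP[aJ _]; rewrite !EJ.
- move=> b y bB; rewrite (os_tl H) //; case yJ: (y \in J) => //=.
  by rewrite EJ.
- exact: os_ne H.
Qed.


Lemma rem_mid (y : nat) l1 l2 : y \notin l1 -> rem y (l1 ++ y :: l2) = l1 ++ l2.
Proof.
elim: l1 => [|x l1 IH] /=; first by rewrite eqxx.
by rewrite inE negb_or eq_sym => /andP[/negbTE-> /IH->].
Qed.

Lemma os_uniq_items s ex Bk J own lab cl tl b :
  OS s ex Bk J own lab cl tl -> b \in Bk -> uniq (b :: tl b).
Proof.
move=> H bB; have [_ U] := os_t H bB; rewrite cons_uniq U andbT.
by rewrite (os_tl H) //; have [_ /negbTE->] := os_BJ H bB.
Qed.

Lemma os_items_disj s ex Bk J own lab cl tl b b' a :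
  OS s ex Bk J own lab cl tl -> b \in Bk -> b' \in Bk ->
  a \in b :: tl b -> a \in b' :: tl b' -> b = b'.
Proof.
move=> H bB bB'; rewrite !inE !(os_tl H) //.
have [_ bJ] := os_BJ H bB; have [_ bJ'] := os_BJ H bB'.
case/orP=> [/eqP E|/andP[aJ /eqP E]]; case/orP=> [/eqP E'|/andP[aJ' /eqP E']].
- by rewrite -E.
- by rewrite -E aJ' in bJ.
- by rewrite -E' aJ in bJ'.
- by rewrite -E.
Qed.

Lemma os_chain_disj s ex Bk J own lab cl tl u u' a :
  OS s ex Bk J own lab cl tl -> u <= n -> u' <= n ->
  a \in u :: cl u -> a \in u' :: cl u' -> u = u'.
Proof.
move=> H un un'; rewrite !inE !(os_cl H) //.
case/orP=> [/eqP E|/andP[aJ /eqP E]]; case/orP=> [/eqP E'|/andP[aJ' /eqP E']].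
- by rewrite -E.
- by have [] := os_BJ H aJ'; rewrite E ltnNge un.
- by have [] := os_BJ H aJ; rewrite E' ltnNge un'.
- by rewrite -E.
Qed.

(** The bucket left behind may be empty and stays in the chain for the moment: [REFILE] needs its
    neighbourhood to place the item again, and only then is it deleted. *)
Lemma os_unlink s Bk J own lab cl tl y :
  OS s [::] Bk J own lab cl tl -> y \in J ->
  OS (unlink s 4 y) [:: s y 6] Bk (rem y J) own lab cl (fun b => rem y (tl b)).
Proof.
move=> H yJ; have [b1 b2 b3 b4] := os_J H yJ; set b0 := s y 6 in b1 b2 b3 *.
have E a f : f != 4 -> f != 5 -> unlink s 4 y a f = s a f by apply: unlink_fld.
have Ecl u b : u <= n -> b \in cl u -> b \in Bk by move=> un; rewrite (os_cl H) // => /andP[].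
have ytl : y \in tl b0 by rewrite (os_tl H) // yJ eqxx.
split.
- exact: os_uB H.
- exact: rem_uniq (os_uJ H).
- by move=> b /(os_BJ H)[? /negP bJ]; split=> //; apply/negP => /mem_rem.
- by move=> z /mem_rem zJ; have [c1 c2 c3 c4] := os_J H zJ; rewrite !E.
- by move=> u un; apply: cyc_frame (os_c H un) => a _; rewrite !E.
- move=> u un; have -> : botsn (cls (unlink s 4 y)) (cl u) 0 = botsn (cls s) (cl u) 0.
    by apply: eq_botsn => b _; rewrite /cls E.
  by apply: cyc_frame (os_x H un) => a _; rewrite !E.
- by move=> u un; rewrite E // (os_0 H).
- by move=> u un; rewrite (@eq_above s) ?(os_sorted H) // => b _; rewrite E.
- by move=> u b un; rewrite E // (os_cl H).
- by move=> b bB; rewrite E // (os_own H).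
- by move=> b bB; rewrite E // (os_K H).
- move=> b bB; have [c1 c2] := os_t H bB; split; last exact: rem_uniq.
  have [c3 c4] := os_t H b1.
  case: (eqVneq b b0) => [->|bb].
    have U := os_uniq_items H b1.
    have [l1 [l2 El]] : exists l1 l2, tl b0 = l1 ++ y :: l2.
      by case/splitPr: ytl => l1 l2; exists l1, l2.
    rewrite El in c3 c4 U *; rewrite rem_mid; first exact: cyc_unlink U c3.
    by move: c4; rewrite cat_uniq /= negb_or => /and3P[_ /andP[]].
  rewrite rem_id; last first.
    apply: contraNN bb => yb; apply/eqP.
    by apply: (os_items_disj H bB b1 (a := y)); rewrite inE ?yb ?ytl orbT.
  apply: (cyc_unlink_other c3 _ c1) => [|a ab]; first by rewrite inE ytl orbT.
  by apply: contraNN bb => ab'; apply/eqP; apply: (os_items_disj H bB b1 ab ab').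
- move=> b z bB; have [_ c2] := os_t H bB.
  rewrite !mem_rem_uniq ?(os_uJ H) // !inE E // (os_tl H) //.
  by case: (z != y).
- move=> b bB; rewrite inE => bb; have := os_ne H bB isT.
  rewrite rem_id //; apply: contraNN bb => yb; apply/eqP.
  by apply: (os_items_disj H bB b1 (a := y)); rewrite inE ?yb ?ytl orbT.
Qed.

Lemma os_link s ex Bk J own lab cl tl b y :
  OS s ex Bk J own lab cl tl -> b \in Bk -> y \notin J -> y \notin Bk ->
  OS (upd (link s 4 b y) y 6 b) [seq x <- ex | x != b] Bk (y :: J)
    (fun z => if z == y then s b 1 else own z)
    (fun z => if z == y then s b 11 else lab z)
    cl (fun c => if c == b then y :: tl c else tl c).
Proof.
move=> H b1 yJ yB; set s' := upd _ _ _ _.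
have E a f : f != 4 -> f != 5 -> f != 6 -> s' a f = s a f.
  by move=> *; rewrite /s' upd_fld // link_fld.
have E6 a : a != y -> s' a 6 = s a 6.
  by move=> *; rewrite /s' upd_adr // link_fld.
have E6y : s' y 6 = b by rewrite /s' upd_eq.
have Ecl u c : u <= n -> c \in cl u -> c \in Bk by move=> un; rewrite (os_cl H) // => /andP[].
have nJ z : z \in J -> z != y by apply: contraTneq => ->.
split.
- exact: os_uB H.
- by rewrite /= yJ (os_uJ H).
- move=> c cB; have [? cJ] := os_BJ H cB; split=> //; rewrite inE negb_or cJ andbT.
  by apply: contraNneq yB => <-.
- move=> z; rewrite inE => /orP[/eqP->|zJ].
    by rewrite E6y eqxx !E //; split=> //; apply: (os_own H).
  by rewrite (negbTE (nJ _ zJ)) E6 ?nJ // !E //; apply: (os_J H).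
- by move=> u un; apply: cyc_frame (os_c H un) => a _; rewrite !E.
- move=> u un; have -> : botsn (cls s') (cl u) 0 = botsn (cls s) (cl u) 0.
    by apply: eq_botsn => c _; rewrite /cls E.
  by apply: cyc_frame (os_x H un) => a _; rewrite !E.
- by move=> u un; rewrite E // (os_0 H).
- by move=> u un; rewrite (@eq_above s) ?(os_sorted H) // => c _; rewrite E.
- by move=> u c un; rewrite E // (os_cl H).
- by move=> c cB; rewrite E // (os_own H).
- by move=> c cB; rewrite E // (os_K H).
- have [c3 c4] := os_t H b1; have U := os_uniq_items H b1.
  have yt c : c \in Bk -> y \notin c :: tl c.
    move=> cB; rewrite inE (os_tl H) // (negbTE yJ) andFb orbF.
    by apply: contraNneq yB => ->.
  have F l c : cyc (link s 4 b y) 4 c l -> cyc s' 4 c l.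
    by apply: cyc_frame => a _; rewrite /s' !upd_fld.
  move=> c cB; have [c1 c2] := os_t H cB.
  case: (eqVneq c b) => [->|cb].
    split; first by apply: F; apply: (cyc_link (l1 := [::])) => //; apply: yt.
    by rewrite /= c4 andbT; have := yt b b1; rewrite inE negb_or => /andP[].
  split=> //; apply: F; apply: (cyc_link_other c3 _ c1); rewrite ?inE ?eqxx //.
  move=> a ac; rewrite inE negb_or; apply/andP; split.
    by apply: contraTneq ac => ->; apply: yt.
  by apply: contraNN cb => ab'; apply/eqP; apply: (os_items_disj H cB b1 ac ab').
- move=> c z cB; rewrite !inE.
  case: (eqVneq z y) => [->|zy]; last first.
    by rewrite E6 //= -(os_tl H) //; case: eqP => // _; rewrite inE (negbTE zy).
  rewrite E6y /=; case: (eqVneq c b) => [->|cb]; first by rewrite inE !eqxx.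
  by rewrite (os_tl H) // (negbTE yJ).
- move=> c cB; rewrite mem_filter negb_and negbK; case: eqP => //= _; exact: (os_ne H cB).
Qed.

Definition newb (s : store) (b u T x z : nat) : store :=
  let s1 := upd (upd (upd (upd (clear s b) b 11 T) b 1 u) b 4 b) b 5 b in
  link (idx_new (cls s1) s1 x b z) 7 x b.

Lemma idx_new_fld g s x b z a f : f != 9 -> f != 10 -> idx_new g s x b z a f = s a f.
Proof.
by move=> H1 H2; rewrite /idx_new; do 2 case: ifP => _ //; rewrite ?unlink_fld // link_fld.
Qed.

Lemma idx_del_fld g s x b z a f : f != 9 -> f != 10 -> idx_del g s x b z a f = s a f.
Proof.
by move=> H1 H2; rewrite /idx_del; do 2 case: ifP => _ //; rewrite ?unlink_fld // link_fld.
Qed.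

Lemma newb_old s b u T x z a f : ~~ (7 <= f <= 10) -> a != b -> newb s b u T x z a f = s a f.
Proof.
move=> H ab; have [h1 h2 h3 h4] : [/\ f != 7, f != 8, f != 9 & f != 10].
  by split; apply: contraNneq H => ->.
by rewrite /newb link_fld // idx_new_fld // !upd_adr // /clear (negbTE ab).
Qed.

Lemma newb_new s b u T x z :
  [/\ newb s b u T x z b 11 = T, newb s b u T x z b 1 = u,
      newb s b u T x z b 4 = b & newb s b u T x z b 5 = b].
Proof.
rewrite /newb; split; rewrite link_fld // idx_new_fld //; rewrite /upd !eqxx //=.
Qed.

Lemma split_at (u x : nat) l : x \in u :: l ->
  exists l1 l2, l = l1 ++ l2 /\ x = last u l1.
Proof.
rewrite inE => /orP[/eqP->|/splitPr[l1 l2]]; first by exists [::], l.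
by exists (rcons l1 x), l2; rewrite cat_rcons last_rcons.
Qed.

Lemma cyc_idx_new_other g s u d l m x b z :
  cyc s 9 u l -> (g z != g b -> x \in u :: l) -> cyc s 9 d m ->
  uniq (u :: l) -> b \notin u :: l ->
  {in d :: m, forall a, a \notin b :: u :: l} ->
  cyc (idx_new g s x b z) 9 d m.
Proof.
move=> H xl C U X D; rewrite /idx_new; case: eqP xl => [//|_ /(_ isT) xl].
case: ifP => _; last exact: (cyc_link_other H xl C D).
have [l1 [l2 [El Ex]]] := split_at xl.
rewrite El in H xl U X D.
have C2 : cyc (link s 9 x b) 9 u (l1 ++ b :: l2) by rewrite Ex; apply: cyc_link.
apply: (cyc_unlink_other C2 _ (cyc_link_other H xl C D)) => [|a /D].
  by move: xl; rewrite !inE !mem_cat !inE => /or3P[] ->; rewrite ?orbT.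
by apply: contraNN; rewrite !inE !mem_cat !inE => /or4P[] ->; rewrite ?orbT.
Qed.

Lemma cyc_idx_del_other g s u d l m x b z :
  cyc s 9 u l -> (g z != g b -> b \in u :: l) -> cyc s 9 d m ->
  uniq (u :: l) ->
  (g z != g b -> g x == g b -> x \notin u :: l) ->
  {in d :: m, forall a, a \notin x :: u :: l} ->
  cyc (idx_del g s x b z) 9 d m.
Proof.
move=> H xl C U X D; rewrite /idx_del; case: eqP xl X => [//|_ /(_ isT) xl /(_ isT) X].
case: ifP => [xb|_]; last first.
  by apply: (cyc_unlink_other H xl C) => a /D; rewrite inE negb_or => /andP[].
have {}X := X xb; have [l1 [l2 [El Ex]]] := split_at xl.
rewrite El in H xl U X D.
have C2 : cyc (link s 9 b x) 9 u (l1 ++ x :: l2) by rewrite Ex; apply: cyc_link.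
apply: (cyc_unlink_other C2 _ (cyc_link_other H xl C D)) => [|a /D].
  by move: xl; rewrite !inE !mem_cat !inE => /or3P[] ->; rewrite ?orbT.
by apply: contraNN; rewrite !inE !mem_cat !inE => /or4P[] ->; rewrite ?orbT.
Qed.

Lemma last_mem (u : nat) l1 l2 : last u l1 \in u :: l1 ++ l2.
Proof. by have := mem_last u l1; rewrite !inE mem_cat => /orP[]->; rewrite ?orbT. Qed.

Lemma botsn_last g (u : nat) l1 l2 : g u = 0 ->
  (l1 != [::] -> g (last u l1) != hdc g l2 0) ->
  last u l1 \in u :: botsn g (l1 ++ l2) 0.
Proof.
move=> u0; case/lastP: l1 => [|l1 x]; first by move=> _; rewrite inE eqxx.
rewrite -size_eq0 size_rcons last_rcons => /(_ isT) H.
by rewrite botsn_cat botsn_rcons (negbTE H) !inE !mem_cat inE eqxx !orbT.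
Qed.

Lemma last_in (u : nat) l : l != [::] -> last u l \in l.
Proof. by case: l => //= x l _; apply: mem_last. Qed.

Lemma hdc_le (g : nat -> nat) l m : {in l, forall c, g c <= m} -> hdc g l 0 <= m.
Proof. by case: l => //= x l; apply; rewrite inE eqxx. Qed.

Lemma os_newb s ex Bk J own lab cl tl b u T l1 l2 :
  OS s ex Bk J own lab cl tl -> u <= n -> cl u = l1 ++ l2 -> K <= T ->
  all (fun c => T < s c 11) l1 -> all (fun c => s c 11 < T) l2 ->
  n < b -> b \notin J -> b \notin Bk ->
  OS (newb s b u T (last u l1) (head u l2)) (b :: ex) (b :: Bk) J own lab
    (fun v => if v == u then l1 ++ b :: l2 else cl v)
    (fun c => if c == b then [::] else tl c).
Proof.
move=> H un El KT a1 a2 nb bJ bB; set s' := newb _ _ _ _ _ _.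
have E a f : ~~ (7 <= f <= 10) -> a != b -> s' a f = s a f by apply: newb_old.
have [N1 N2 N3 N4] := newb_new s b u T (last u l1) (head u l2); rewrite -/s' in N1 N2 N3 N4.
have Bb c : c \in Bk -> c != b by apply: contraTneq => ->.
have nb' c : c <= n -> c != b by move=> H1; rewrite neq_ltn (leq_ltn_trans H1).
have Jb c : c \in J -> c != b by apply: contraTneq => ->.
have Ecl v c : v <= n -> c \in cl v -> c \in Bk by move=> vn; rewrite (os_cl H) // => /andP[].
have clb v c : v <= n -> c \in v :: cl v -> c != b.
  by move=> vn; rewrite inE => /orP[/eqP->|/(Ecl _ _ vn)/Bb//]; apply: nb'.
have Uu := os_uniq_chain H un.
have bu : b \notin u :: cl u by apply/negP => /(clb _ _ un); rewrite eqxx.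
pose s1 := upd (upd (upd (upd (clear s b) b 11 T) b 1 u) b 4 b) b 5 b.
have E1 a f : a != b -> s1 a f = s a f.
  by move=> ab; rewrite /s1 !upd_adr // /clear (negbTE ab).
pose s2 := idx_new (cls s1) s1 (last u l1) b (head u l2).
have E7 a f : a != b -> f != 9 -> f != 10 -> s2 a f = s a f.
  by move=> *; rewrite /s2 idx_new_fld // E1.
have C2 v : v <= n -> cyc s2 7 v (cl v).
  by move=> vn; apply: cyc_frame (os_c H vn) => a /(clb _ _ vn) ab; rewrite !E7.
have C1 v : v <= n -> cyc s1 9 v (botsn (cls s) (cl v) 0).
  move=> vn; apply: cyc_frame (os_x H vn) => a; rewrite inE => /orP[/eqP->|/mem_botsn aB].
    by rewrite !E1 ?nb'.
  by rewrite !E1 // (clb v) // inE aB orbT.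
have G a : a != b -> cls s1 a = cls s a by move=> ab; rewrite /cls E1.
have G' a : cls s' a = cls s1 a.
  rewrite /cls; case: (eqVneq a b) => [->|ab]; last by rewrite E // E1.
  by rewrite N1 /s1 /upd !eqxx.
have gb : cls s1 b = T %/ K by rewrite /cls /s1 /upd !eqxx.
(* Labels are at least [K], so no bucket has class 0, which is reserved for the owners in their role
   as sentinels. *)
have gb0 : cls s1 b != 0 by rewrite gb -lt0n divn_gt0.
have gu0 v : v <= n -> cls s1 v = 0 by move=> vn; rewrite G ?nb' // /cls (os_0 H) // div0n.
have Gcl v : v <= n -> botsn (cls s) (cl v) 0 = botsn (cls s1) (cl v) 0.
  by move=> vn; apply: eq_botsn => c cv; rewrite G // (clb v) // inE cv orbT.
have ge1 : l1 != [::] -> cls s1 b <= cls s1 (last u l1).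
  move=> /(last_in u) xl; rewrite gb G; last first.
    by apply: (clb u); rewrite // El last_mem.
  by apply: leq_div2r; apply: ltnW; apply: (allP a1).
have ge2 : hdc (cls s1) l2 0 <= cls s1 b.
  apply: hdc_le => x xl; rewrite gb G; first by apply: leq_div2r; apply: ltnW; apply: (allP a2).
  by apply: (clb u); rewrite // El inE mem_cat xl !orbT.
split.
- by rewrite /= bB (os_uB H).
- exact: os_uJ H.
- by move=> c; rewrite inE => /orP[/eqP->|/(os_BJ H)].
- move=> y yJ; have [b1 b2 b3 b4] := os_J H yJ.
  have [h1 h2] := (Jb _ yJ, Bb _ b1).
  by rewrite !E // inE b1 orbT.
- move=> v vn /=; case: eqP => [->|/eqP vu].
    rewrite /s' /newb; apply: cyc_link; rewrite -?El //; exact: C2.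
  apply: (cyc_link_other (C2 u un) _ (C2 v vn)); first by rewrite El last_mem.
  move=> a av; rewrite inE negb_or (clb v) //=.
  by apply: contraNN vu => au; apply/eqP; apply: (os_chain_disj H vn un av au).
- move=> v vn; set B := botsn _ _ _.
  have {B} -> : B = botsn (cls s1) (if v == u then l1 ++ b :: l2 else cl v) 0.
    by apply: eq_botsn => c _; rewrite G'.
  have F m : cyc s2 9 v m -> cyc s' 9 v m.
    by apply: cyc_frame => a _; rewrite /s' /newb !link_fld.
  apply: F; case: eqP => [->|/eqP vu].
    apply: cyc_idx_new; rewrite -?El // ?gu0 //.
    by rewrite -Gcl //; apply: C1.
  have Cu := C1 u un; have Cv := C1 v vn.
  rewrite !Gcl // in Cu Cv; rewrite /s2.
  have U0 : uniq (u :: botsn (cls s1) (cl u) 0).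
    by rewrite -[cl u]cat0s botsn_cat; apply: botsn_uniq.
  have sb w c : w <= n -> c \in w :: botsn (cls s1) (cl w) 0 -> c \in w :: cl w.
    by move=> wn; rewrite !inE => /orP[->//|/mem_botsn->]; rewrite orbT.
  apply: (cyc_idx_new_other Cu _ Cv U0); last first.
  + move=> a /(sb _ _ vn) av; rewrite inE negb_or (clb v) //=.
    by apply: contraNN vu => /(sb _ _ un) au; apply/eqP; apply: (os_chain_disj H vn un av au).
  + by apply: contraNN bu => /(sb _ _ un).
  (* The index is changed only where a class ends, and there [last u l1] is either the owner or the
     last bucket of its class, hence in the index. *)
  rewrite -(hdc_head l2 (gu0 u un)) => hz; rewrite El; apply: botsn_last; first by rewrite gu0.
  by move=> l10; apply: contraNneq hz => E2; rewrite eqn_leq ge2 -E2 ge1.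
- by move=> v vn; rewrite E ?nb' // (os_0 H).
- move=> v vn; have Ea c : c \in cl v -> s' c 11 = s c 11.
    by move=> cv; rewrite E // (clb v) // inE cv orbT.
  case: eqP => [vu|_]; last by rewrite (@eq_above s) ?(os_sorted H) // => b' /Ea.
  have := os_sorted H vn; rewrite vu El !pairwise_cat allrel_consr /=.
  rewrite vu El in Ea.
  case/and3P=> r1 r2 r3.
  have L1 c : c \in l1 -> s' c 11 = s c 11 by move=> c1; rewrite Ea // mem_cat c1.
  have L2 c : c \in l2 -> s' c 11 = s c 11 by move=> c1; rewrite Ea // mem_cat c1 orbT.
  rewrite (@eq_above s) // r2 (@eq_above s s' l2) // r3 !andbT /=.
  rewrite -andbA; apply/and3P; split.
  + by apply/allP => c c1; rewrite /above N1 L1 // (allP a1).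
  + by apply/allrelP => c d c1 d1; rewrite /above (L1 c c1) (L2 d d1); apply: (allrelP r1).
  + by apply/allP => c c1; rewrite /above N1 L2 // (allP a2).
- move=> v c vn; rewrite inE; case: (eqVneq c b) => [->|cb] /=.
    rewrite N2; case: (eqVneq v u) => [_|vu]; first by rewrite mem_cat inE eqxx orbT.
    by rewrite (os_cl H) // (negbTE bB).
  rewrite E // -(os_cl H) //; case: eqP => // ->.
  by rewrite El !mem_cat inE (negbTE cb).
- move=> c; rewrite inE => /orP[/eqP->|cB]; first by rewrite N2.
  by rewrite E ?Bb // (os_own H).
- move=> c; rewrite inE => /orP[/eqP->|cB]; first by rewrite N1.
  by rewrite E ?Bb // (os_K H).
- move=> c; rewrite inE; case: eqP => [-> _|/eqP cb /= cB].
    by rewrite /cyc /= /lk N3 N4 !eqxx.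
  have [c1 c2] := os_t H cB; split=> //; apply: cyc_frame c1 => a.
  rewrite inE => /orP[/eqP->|]; first by rewrite !E.
  by rewrite (os_tl H) // => /andP[/Jb ab _]; rewrite !E.
- move=> c y; rewrite inE; case: eqP => [-> _|/eqP cb /= cB].
    rewrite in_nil; case yJ: (y \in J) => //=; rewrite E ?Jb //.
    by have [/Bb/negbTE->] := os_J H yJ.
  by rewrite (os_tl H) //; case yJ: (y \in J) => //=; rewrite E ?Jb.
- move=> c; rewrite !inE negb_or; case: eqP => [//|_ /= cB ce].
  exact: (os_ne H cB ce).
Qed.

Definition delb (s : store) (b x z : nat) : store :=
  unlink (idx_del (cls s) s x b z) 7 b.

Lemma delb_fld s b x z a f : ~~ (7 <= f <= 10) -> delb s b x z a f = s a f.
Proof.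
move=> H; have [h1 h2 h3 h4] : [/\ f != 7, f != 8, f != 9 & f != 10].
  by split; apply: contraNneq H => ->.
by rewrite /delb unlink_fld // idx_del_fld.
Qed.

Lemma os_delb s b Bk J own lab cl tl u l1 l2 :
  OS s [:: b] Bk J own lab cl tl -> b \in Bk -> tl b = [::] -> u = s b 1 ->
  cl u = l1 ++ b :: l2 ->
  OS (delb s b (last u l1) (head u l2)) [::] (rem b Bk) J own lab
    (fun v => if v == u then l1 ++ l2 else cl v) tl.
Proof.
move=> H bB tlb Eu El; set s' := delb _ _ _ _.
have un : u <= n by rewrite Eu (os_own H).
have E a f : ~~ (7 <= f <= 10) -> s' a f = s a f by apply: delb_fld.
have remB c : (c \in rem b Bk) = (c != b) && (c \in Bk).
  by rewrite mem_rem_uniq ?(os_uB H) // inE.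
have Ecl v c : v <= n -> c \in cl v -> c \in Bk by move=> vn; rewrite (os_cl H) // => /andP[].
have Uu := os_uniq_chain H un.
have bcl v : v <= n -> v != u -> b \notin cl v.
  by move=> vn vu; rewrite (os_cl H) // -Eu [u == v]eq_sym (negbTE vu) andbF.
pose s2 := idx_del (cls s) s (last u l1) b (head u l2).
have gu0 v : v <= n -> cls s v = 0 by move=> vn; rewrite /cls (os_0 H) // div0n.
have gb0 : cls s b != 0 by rewrite -lt0n divn_gt0 // (os_K H).
have := os_sorted H un; rewrite El pairwise_cat allrel_consr /=.
case/and3P=> /andP[r1 r1'] r2 /andP[r3 r4].
have ge1 : l1 != [::] -> cls s b <= cls s (last u l1).
  by move=> /(last_in u) xl; apply: leq_div2r; apply: ltnW; apply: (allP r1).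
have ge2 : hdc (cls s) l2 0 <= cls s b.
  by apply: hdc_le => x xl; apply: leq_div2r; apply: ltnW; apply: (allP r3).
have C2 v : v <= n -> cyc s2 7 v (cl v).
  by move=> vn; apply: cyc_frame (os_c H vn) => a _; rewrite /s2 !idx_del_fld.
split.
- exact: rem_uniq (os_uB H).
- exact: os_uJ H.
- by move=> c; rewrite remB => /andP[_ /(os_BJ H)].
- move=> y yJ; have [b1 b2 b3 b4] := os_J H yJ; rewrite !E // remB b1 andbT.
  split=> //; apply/eqP => E6; have : y \in tl b by rewrite (os_tl H) // yJ E6 eqxx.
  by rewrite tlb.
- move=> v vn; case: eqP => [->|/eqP vu].
    by rewrite /s' /delb; apply: cyc_unlink; rewrite -El //; apply: C2.
  apply: (cyc_unlink_other (C2 u un) _ (C2 v vn)).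
    by rewrite El inE mem_cat inE eqxx !orbT.
  move=> a av; apply: contraNN vu => au; apply/eqP.
  exact: (os_chain_disj H vn un av au).
- move=> v vn; set B := botsn _ _ _.
  have {B} -> : B = botsn (cls s) (if v == u then l1 ++ l2 else cl v) 0.
    by apply: eq_botsn => c _; rewrite /cls E.
  have F m : cyc s2 9 v m -> cyc s' 9 v m.
    by apply: cyc_frame => a _; rewrite /s' /delb !unlink_fld.
  apply: F; case: eqP => [->|/eqP vu].
    apply: cyc_idx_del; rewrite -?El // ?gu0 //.
    exact: (os_x H).
  have U0 : uniq (u :: botsn (cls s) (cl u) 0).
    by rewrite -[cl u]cat0s botsn_cat; apply: botsn_uniq.
  have sb w c : w <= n -> c \in w :: botsn (cls s) (cl w) 0 -> c \in w :: cl w.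
    by move=> wn; rewrite !inE => /orP[->//|/mem_botsn->]; rewrite orbT.
  apply: (cyc_idx_del_other (os_x H un) _ (os_x H vn) U0); last first.
  + move=> a /(sb _ _ vn) av; rewrite inE negb_or; apply/andP; split; last first.
      by apply: contraNN vu => /(sb _ _ un) au; apply/eqP; apply: (os_chain_disj H vn un av au).
    apply: contraNN vu => /eqP Ea; apply/eqP; apply: (os_chain_disj H vn un av).
    by rewrite Ea El last_mem.
  + rewrite -(hdc_head l2 (gu0 u un)) => hz xb.
    have l10 : l1 != [::].
      by apply: contraNneq gb0 => l10; rewrite -(eqP xb) l10 /= gu0.
    rewrite El botsn_cat; move: l10 El Uu xb; clear -s; case/lastP: l1 => [//|l1 x] _ El Uu xb.
    rewrite last_rcons in xb *; rewrite botsn_rcons /= (eqP xb) eqxx cats0.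
    have : uniq (x :: u :: l1 ++ b :: l2).
      move: Uu; congr is_true; rewrite El; apply: perm_uniq; apply/permP => p.
      by rewrite /= !count_cat -cats1 !count_cat /=; lia.
    rewrite cons_uniq => /andP[X _]; apply: contraNN X.
    rewrite !inE !mem_cat => /or3P[->//|/mem_botsn->|]; first by rewrite orbT.
    case/orP=> [|/mem_botsn xl]; last by rewrite in_cons xl !orbT.
    by case: ifP => // _; rewrite !inE => ->; rewrite !orbT.
  rewrite -(hdc_head l2 (gu0 u un)) => hz; rewrite El botsn_cat /= eq_sym (negbTE hz).
  by rewrite !inE mem_cat inE eqxx !orbT.
- by move=> v vn; rewrite E // (os_0 H).
- move=> v vn; rewrite (@eq_above s) => [|b' _]; last by rewrite E.
  case: eqP => [_|_]; last exact: (os_sorted H).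
  by rewrite pairwise_cat r1' r2 r4.
- move=> v c vn; rewrite remB E //.
  case: eqP => [->|/eqP vu]; last first.
    rewrite (os_cl H) //; case: (eqVneq c b) => [->|_] //=.
    by rewrite -Eu [u == v]eq_sym (negbTE vu) andbF.
  rewrite -andbA -(os_cl H) // El !mem_cat !inE.
  case: (eqVneq c b) => [->|cb] //=.
  move: Uu; rewrite El cons_uniq cat_uniq /= negb_or => /and3P[_ _ /and3P[/andP[h1 _] h2 _]].
  by rewrite (negbTE h1) (negbTE h2).
- by move=> c; rewrite remB => /andP[_ cB]; rewrite E // (os_own H).
- by move=> c; rewrite remB => /andP[_ cB]; rewrite E // (os_K H).
- move=> c; rewrite remB => /andP[_ cB]; have [c1 c2] := os_t H cB; split=> //.
  by apply: cyc_frame c1 => a _; rewrite !E.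
- by move=> c y; rewrite remB => /andP[_ cB]; rewrite E // (os_tl H).
- by move=> c; rewrite remB => /andP[cb cB] _; apply: (os_ne H cB); rewrite inE.
Qed.
End Buckets.

(** * Filing an item under a label *)

Arguments rset r x v y /.

(* The vertices are the blocks [0], ..., [n - 1] and the root is the block [n]; edges and buckets
   are further blocks.  Items are the edges and the vertices; a vertex is its own head, and its
   owner is the root.  Cells of a block:
   0 head; 1 tail, which owns the item (in a bucket: its owner);
   2, 3 list of the in-edges of a vertex (of the root: edges still to be reinserted);
   4, 5 list of the items of a bucket; 6 bucket of an item;
   7, 8 list of the buckets of an owner; 9, 10 list of the last buckets of the classes;
   11 label of a bucket, 0 in an owner;
   12 in-degree, 13 [K] + level, 14 threshold of the level, 15 first in-edge not yet scanned.
   In the root, the cells 12 to 15 hold [K], [4 * k], the number of edges, and [B]. *)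
Definition eqe (a b : expr) : expr := Bin Mul (Bin Leq a b) (Bin Leq b a).
Definition dive (a b : expr) : expr := Bin Div a b.
(** A strict comparison in spite of the name. The increment is itself an expression and must fit in
    a word; this is the origin of the many side conditions with [.+1 < W]. *)
Definition lte (a b : expr) : expr := Bin Leq (Bin Add a (Cst 1)) b.
Definition adr (x f : nat) (e : expr) : cmd := Store (Var x) (Cst f) e.

Definition WALK (f : nat) (e : expr) : cmd := While e (Assign 20 (fld 20 f)).
Definition NEWB : cmd :=
  Alloc 27 (Cst blksize) ;; adr 27 11 (Var 21) ;; adr 27 1 (Var 23) ;;
  adr 27 4 (Var 27) ;; adr 27 5 (Var 27) ;;
  If (eqe (dive (fld 26 11) (Var 10)) (dive (Var 21) (Var 10))) Skip
     (LINK 9 20 27 30 ;;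
      If (eqe (dive (fld 20 11) (Var 10)) (dive (Var 21) (Var 10)))
         (UNLINK 9 20 30 31) Skip) ;;
  LINK 7 20 27 30 ;; Assign 26 (Var 27).
Definition PLACE : cmd :=
  WALK 7 (lte (Var 21) (Get (fld 20 7) (Cst 11))) ;;
  Assign 26 (fld 20 7) ;;
  If (Bin Leq (Var 21) (fld 26 11)) Skip NEWB ;;
  LINK 4 26 22 30 ;; adr 22 6 (Var 26).
Definition DELB : cmd :=
  If (eqe (fld 25 4) (Var 25))
    (Assign 20 (fld 25 8) ;; Assign 26 (fld 25 7) ;;
     If (eqe (dive (fld 26 11) (Var 10)) (dive (fld 25 11) (Var 10))) Skip
       (If (eqe (dive (fld 20 11) (Var 10)) (dive (fld 25 11) (Var 10)))
          (LINK 9 25 20 30) Skip ;;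
        UNLINK 9 25 30 31) ;;
     UNLINK 7 25 30 31 ;; Free (Var 25))
    Skip.
(** The walk on the index (cell 9) passes all classes above that of the label; what remains to be
    passed on the chain (cell 7) lies in a single class. *)
Definition FILE : cmd :=
  Assign 20 (Var 23) ;;
  WALK 9 (lte (dive (Var 21) (Var 10)) (dive (Get (fld 20 9) (Cst 11)) (Var 10))) ;;
  PLACE.
Definition UNFILE : cmd := Assign 25 (fld 22 6) ;; UNLINK 4 22 30 31 ;; DELB.
(** A label moves by at most one, so the search starts at the chain predecessor of the old bucket.
    This one may carry the new label itself; then one more step back is needed, because [PLACE] must
    start strictly above the label. *)
Definition REFILE : cmd :=
  Assign 25 (fld 22 6) ;; Assign 20 (fld 25 8) ;;
  If (eqe (fld 20 11) (Var 21)) (Assign 20 (fld 20 8)) Skip ;;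
  Assign 23 (fld 25 1) ;; UNLINK 4 22 30 31 ;; PLACE ;; DELB.

Lemma lt_neq (k a b : nat) : k < a -> a <= b -> (k == b) = false.
Proof. by move=> h1 h2; apply: ltn_eqF; apply: leq_trans h1 h2. Qed.

Lemma eqe_vl r s a b : vl r s (eqe a b) = (vl r s a == vl r s b).
Proof. by rewrite /= eqn_leq; case: (vl r s a <= vl r s b); case: (_ <= _). Qed.

Lemma lte_vl r s a b : vl r s (lte a b) = (vl r s a < vl r s b).
Proof. by rewrite /= addn1. Qed.

Section RunsBuckets.
Variables W P : nat.
Hypothesis W16 : 100 < W.

Lemma fld_small f : f < blksize -> f < W.
Proof. by move: W16; rewrite /blksize => *; lia. Qed.

Lemma safe_cst r s A c : c <= 100 -> safe W r s A (Cst c).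
Proof. by move=> /= H; apply: leq_ltn_trans W16. Qed.

Lemma safe_fld r s A x f : r x \in A -> f < blksize -> safe W r s A (fld x f).
Proof. by move=> H fB; split=> //=; apply: fld_small. Qed.

Lemma safe_get r s A e f : safe W r s A e -> vl r s e \in A -> f < blksize ->
  safe W r s A (Get e (Cst f)).
Proof. by move=> H1 H fB; split=> //=; apply: fld_small. Qed.

Lemma safe_leq r s A a b : safe W r s A a -> safe W r s A b -> safe W r s A (Bin Leq a b).
Proof. by move=> h1 h2; split=> //=; apply: leq_ltn_trans (leq_b1 _) (ltn_trans _ W16). Qed.

Lemma safe_lte r s A a b : safe W r s A a -> safe W r s A b -> (vl r s a).+1 < W ->
  safe W r s A (lte a b).
Proof.
move=> h1 h2 h; apply: safe_leq => //; split=> //=; last by rewrite addn1.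
exact: ltn_trans W16.
Qed.

Lemma safe_eqe r s A a b : safe W r s A a -> safe W r s A b -> safe W r s A (eqe a b).
Proof.
move=> h1 h2; split; try exact: safe_leq.
have E := eqe_vl r s a b; rewrite /eqe /= in E; rewrite /= E; exact: leq_ltn_trans (leq_b1 _) (ltn_trans _ W16).
Qed.

Lemma safe_div r s A a b : safe W r s A a -> safe W r s A b -> vl r s a < W ->
  safe W r s A (dive a b).
Proof. by move=> h1 h2 h; split=> //=; apply: leq_ltn_trans h; apply: leq_div. Qed.

Ltac sf1 := match goal with |- safe _ _ _ _ ?e =>
  match e with
  | eqe _ _ => apply: safe_eqe | lte _ _ => apply: safe_lte
  | dive _ _ => apply: safe_div | Bin Leq _ _ => apply: safe_leq
  | fld _ _ => apply: safe_fld | Get _ (Cst _) => apply: safe_get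
  | Cst _ => apply: safe_cst | Var _ => exact I
  end end.
Ltac sf := repeat sf1; rewrite //=.

Lemma runs_adr x f e r s A (Q : _ -> _ -> _ -> _ -> Prop) :
  f < blksize -> r x \in A -> safe W r s A e ->
  Q r (upd s (r x) f (vl r s e)) A 1 -> runs W P (adr x f e) r s A Q.
Proof.
move=> fB xA ok q; apply: runs_store => //=.
exact: fld_small.
Qed.

Lemma runs_if_eqe a b c1 c2 r s A (Q : _ -> _ -> _ -> _ -> Prop) :
  safe W r s A (eqe a b) ->
  (vl r s a = vl r s b -> runs W P c1 r s A (fun r1 s1 A1 d => Q r1 s1 A1 d.+1)) ->
  (vl r s a != vl r s b -> runs W P c2 r s A (fun r1 s1 A1 d => Q r1 s1 A1 d.+1)) ->
  runs W P (If (eqe a b) c1 c2) r s A Q.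
Proof.
move=> ok q1 q2; apply: (runs_if ok); rewrite eqe_vl.
  by rewrite eqb0 negbK => /eqP.
by move/eqP; rewrite eqb0.
Qed.

Lemma runs_if_leq a b c1 c2 r s A (Q : _ -> _ -> _ -> _ -> Prop) :
  safe W r s A (Bin Leq a b) ->
  (vl r s a <= vl r s b -> runs W P c1 r s A (fun r1 s1 A1 d => Q r1 s1 A1 d.+1)) ->
  (vl r s b < vl r s a -> runs W P c2 r s A (fun r1 s1 A1 d => Q r1 s1 A1 d.+1)) ->
  runs W P (If (Bin Leq a b) c1 c2) r s A Q.
Proof.
move=> ok q1 q2; apply: (runs_if ok) => /=.
  by rewrite eqb0 negbK.
by move/eqP; rewrite eqb0 -ltnNge.
Qed.

Lemma runs_if_lte a b c1 c2 r s A (Q : _ -> _ -> _ -> _ -> Prop) :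
  safe W r s A (lte a b) ->
  (vl r s a < vl r s b -> runs W P c1 r s A (fun r1 s1 A1 d => Q r1 s1 A1 d.+1)) ->
  (vl r s b <= vl r s a -> runs W P c2 r s A (fun r1 s1 A1 d => Q r1 s1 A1 d.+1)) ->
  runs W P (If (lte a b) c1 c2) r s A Q.
Proof.
move=> ok q1 q2; apply: (runs_if_leq ok); rewrite /= addn1 //; exact: q2.
Qed.

(** [l1] has been passed and [l2] is still ahead. The sentinel has value 0 and stops the walk at the
    latest; the time is charged to the nodes [m1] that are passed. *)
Lemma runs_walk f e g t u l1 l2 r s A (Q : _ -> _ -> _ -> _ -> Prop) :
  cyc s f u (l1 ++ l2) -> {subset u :: l1 ++ l2 <= A} -> f < blksize -> g u = 0 ->
  (forall r', (forall x, x != 20 -> r' x = r x) -> r' 20 \in u :: l1 ++ l2 ->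
     safe W r' s A e /\ vl r' s e = (t < g (s (r' 20) f))) ->
  r 20 = last u l1 ->
  (forall r' m1 m2, l2 = m1 ++ m2 -> all (fun c => t < g c) m1 -> g (head u m2) <= t ->
     (forall x, x != 20 -> r' x = r x) -> r' 20 = last u (l1 ++ m1) ->
     Q r' s A (2 * size m1).+1) ->
  runs W P (WALK f e) r s A Q.
Proof.
move=> C S fB gu He; elim: l2 l1 r Q C S He => [|x l2 IH] l1 r Q C S He Hr q.
  have rin : r 20 \in u :: l1 ++ [::] by rewrite Hr last_mem.
  have [ok v] := He r (fun _ _ => erefl) rin.
  rewrite Hr (cyc_next C) /= gu ltn0 /= in v.
  apply: (runs_while ok) => [_|]; last by rewrite v.
  by apply: (q r [::] [::]) => //=; rewrite ?gu // cats0.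
have rin : r 20 \in u :: l1 ++ x :: l2 by rewrite Hr last_mem.
have [ok v] := He r (fun _ _ => erefl) rin.
rewrite Hr (cyc_next C) /= in v.
apply: (runs_while ok) => v0.
  apply: (q r [::] (x :: l2)) => //=; last by rewrite cats0.
  by move: v; rewrite v0 leqNgt; case: ltnP.
apply: runs_assign; first by apply: safe_fld => //; apply: S.
rewrite -cat_rcons in C S He.
apply: (IH _ _ _ C S).
- move=> r' Hr'; apply: He => z z20; rewrite Hr' //=; by rewrite (negbTE z20).
- by rewrite last_rcons /= Hr; rewrite cat_rcons in C; rewrite (cyc_next C).
- move=> r' m1 m2 E a1 a2 H1 H2.
  have -> : (1 + (2 * size m1).+1).+1 = (2 * size (x :: m1)).+1 by rewrite /=; lia.
  apply: (q r' (x :: m1) m2) => //=.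
  + by rewrite E.
  + by rewrite a1 andbT; move: v v0; case: (t < g x) => // ->.
  + by move=> z z20; rewrite H1 //= (negbTE z20).
  + by rewrite H2 cat_rcons.
Qed.

End RunsBuckets.

Ltac sf1 := match goal with |- safe _ _ _ _ ?e =>
  match e with
  | eqe _ _ => apply: safe_eqe | lte _ _ => apply: safe_lte
  | dive _ _ => apply: safe_div | Bin Leq _ _ => apply: safe_leq
  | fld _ _ => apply: safe_fld | Get _ (Cst _) => apply: safe_get
  | Cst _ => apply: safe_cst | Var _ => exact I
  end end.
Ltac sf := repeat sf1; rewrite //=.
Section RunsPlace.
Variables W P K n : nat.
Hypothesis PW : P < W.
Hypothesis W16 : 100 < W.
Hypothesis K0 : 0 < K.

Lemma os_sub s ex ex' Bk J own lab cl tl :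
  {subset ex <= ex'} -> OS K n s ex Bk J own lab cl tl -> OS K n s ex' Bk J own lab cl tl.
Proof.
move=> S [? ? ? ? ? ? ? ? ? ? ? ? ? ne]; split=> // b bB bx; apply: ne => //.
by apply: contraNN bx => /S.
Qed.

Lemma runs_NEWB r s A u T x z (Q : _ -> _ -> _ -> _ -> Prop) :
  r 10 = K -> r 20 = x -> r 21 = T -> r 23 = u -> r 26 = z ->
  x \in A -> z \in A -> s x 7 \in A ->
  (s z 11 %/ K != T %/ K -> s x 9 \in A /\ s x 10 \in A) ->
  T < W -> s z 11 < W -> s x 11 < W -> blksize * (size A).+1 <= P ->
  (forall r' b dt, b \notin A -> dt <= 50 -> (forall y, y < 26 -> r' y = r y) -> r' 26 = b ->
    Q r' (newb K s b u T x z) (b :: A) dt) ->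
  runs W P NEWB r s A Q.
Proof.
move=> r10 r20 r21 r23 r26 xA zA s7 s9 TW zW xW szA q.
have lt26 y k : y < 26 -> 26 <= k -> (y == k) = false.
  by move=> h1 h2; apply: ltn_eqF; apply: leq_trans h1 h2.
apply: runs_seq; apply: runs_alloc => // [|b bA _ bW]; first exact: leq_trans W16.
set A' := b :: A; have bA' : b \in A' by rewrite inE eqxx.
have sub a : a \in A -> a \in A' by move=> aA; rewrite inE aA orbT.
have nb a : a \in A -> (a == b) = false by move=> aA; apply: contraNF bA => /eqP<-.
do 4 (apply: runs_seq; apply: runs_adr => //=).
rewrite r21 r23; set s1 := upd _ b 5 b.
have e1 a f : a \in A -> s1 a f = s a f.
  by move=> aA; rewrite /s1 !upd_adr ?nb // /clear nb.
have eb : s1 b 11 = T by rewrite /s1 /upd !eqxx.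
apply: runs_seq; apply: runs_if_eqe.
- by sf; rewrite ?r26 ?r21 ?e1 ?sub.
- rewrite /= r10 r21 r26 e1 // => E.
  apply: runs_skip; apply: runs_seq; apply: runs_LINK => //=; rewrite ?r20 ?sub ?e1 //.
  apply: runs_assign => //=.
  have -> : link s1 7 x b = newb K s b u T x z.
    rewrite /newb -/s1 /idx_new /cls (e1 z) // eb.
    by rewrite E eqxx.
  by apply: q => //= y y26; rewrite !(lt26 _ _ y26).
rewrite /= r10 r21 r26 e1 // => E'.
have [x9 x10] := s9 E'.
apply: runs_seq; apply: runs_LINK => //=; rewrite ?r20 ?sub ?e1 //.
have eN : newb K s b u T x z =
    link (if s x 11 %/ K == T %/ K then unlink (link s1 9 x b) 9 x else link s1 9 x b) 7 x b.
  by rewrite /newb -/s1 /idx_new /cls (e1 z) // (e1 x) // eb (negbTE E').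
have l11 : link s1 9 x b x 11 = s x 11 by rewrite link_fld // e1.
have l7 : link s1 9 x b x 7 = s x 7 by rewrite link_fld // e1.
apply: runs_if_eqe.
- by sf; rewrite ?r20 ?r21 ?l11 ?sub.
- rewrite /= r10 r20 r21 l11 => E2; rewrite E2 eqxx in eN.
  have h9 : link s1 9 x b x 9 \in A' by rewrite /link upd_fld // upd_eq.
  have h10 : link s1 9 x b x 10 \in A'.
    rewrite /link updE; case: ifP => // _.
    by rewrite upd_fld // upd_adr ?nb // upd_fld // e1 // sub.
  apply: runs_UNLINK => //=; rewrite ?r20 ?h9 ?h10 ?sub //.
  apply: runs_seq; apply: runs_LINK => //=; rewrite ?r20 ?sub //; first by rewrite unlink_fld // l7.
  apply: runs_assign => //=; rewrite -eN; apply: q => //= y y26.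
  by rewrite !(lt26 _ _ y26).
- rewrite /= r10 r20 r21 l11 => E2; rewrite (negbTE E2) in eN; apply: runs_skip.
  apply: runs_seq; apply: runs_LINK => //=; rewrite ?r20 ?sub //; first by rewrite l7.
  apply: runs_assign => //=; rewrite -eN; apply: q => //= y y26.
  by rewrite !(lt26 _ _ y26).
Qed.

(** The live blocks split into the buckets, which come and go within the filing operations, and the
    rest [O]: vertices, root, filed edges, and edges that are in no list at the moment. *)
Definition env (A O Bk J : seq nat) : Prop :=
  [/\ perm_eq A (O ++ Bk), uniq (O ++ Bk), forall a, a <= n -> a \in O & {subset J <= O}].

Definition keeps (s s' : store) (O : seq nat) : Prop :=
  forall a f, a \in O -> ~~ (4 <= f <= 11) -> s' a f = s a f.

Lemma env_mem A O Bk J : env A O Bk J ->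
  [/\ {subset O <= A}, {subset Bk <= A} & forall b, b \in Bk -> b \notin O].
Proof.
move=> [p U _ _]; split=> [a aO|a aB|b bB].
- by rewrite (perm_mem p) mem_cat aO.
- by rewrite (perm_mem p) mem_cat aB orbT.
- apply/negP => bO; move: U; rewrite cat_uniq => /and3P[_ /hasPn H _].
  by have := H b bB; rewrite /= bO.
Qed.

Lemma os_chain_mem s ex A O Bk J own lab cl tl u :
  OS K n s ex Bk J own lab cl tl -> env A O Bk J -> u <= n -> {subset u :: cl u <= A}.
Proof.
move=> H E un; have [OA BA _] := env_mem E; have [_ _ nO _] := E.
move=> a; rewrite inE => /orP[/eqP->|]; first by apply: OA; apply: nO.
by rewrite (os_cl H) // => /andP[/BA].
Qed.

(** The walk may start anywhere in the chain: [l1] is the part already known to lie above [T]. So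
    the index can serve as entry point as well as a neighbouring bucket, and only the buckets of
    [l2] above [T] cost time. *)
Lemma runs_PLACE r s A O ex Bk J own lab cl tl y u T l1 l2 (Q : _ -> _ -> _ -> _ -> Prop) :
  OS K n s ex Bk J own lab cl tl -> env A O Bk J -> y \in O -> y \notin J ->
  u <= n -> cl u = l1 ++ l2 -> K <= T -> T.+1 < W -> all (fun c => T < s c 11) l1 ->
  {in Bk, forall b, (s b 11).+1 < W} ->
  r 10 = K -> r 20 = last u l1 -> r 21 = T -> r 22 = y -> r 23 = u ->
  blksize * (size A).+1 <= P ->
  (forall r' s' A' Bk' cl' tl' dt,
     OS K n s' ex Bk' (y :: J) (fun z => if z == y then u else own z)
       (fun z => if z == y then T else lab z) cl' tl' ->
     env A' O Bk' (y :: J) -> {subset Bk <= Bk'} -> size Bk' <= (size Bk).+1 ->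
     {in Bk', forall b, (s' b 11).+1 < W} -> keeps s s' O ->
     (forall x, x < 20 -> r' x = r x) -> r' 25 = r 25 ->
     dt <= 2 * count (fun c => T < s c 11) l2 + 70 -> Q r' s' A' dt) ->
  runs W P PLACE r s A Q.
Proof.
move=> H E yO yJ un El KT TW a1 lbW r10 r20 r21 r22 r23 szA q.
have [OA BA BO] := env_mem E; have [pA U nO JO] := E.
have cA := os_chain_mem H E un.
have yB : y \notin Bk by apply: contraTN yO; apply: BO.
have clB c : c \in cl u -> c \in Bk by rewrite (os_cl H) // => /andP[].
have mW c : c \in u :: cl u -> (s c 11).+1 < W.
  rewrite inE => /orP[/eqP->|/clB/lbW//]; rewrite (os_0 H) //.
  exact: leq_ltn_trans W16.
apply: runs_seq; apply: (runs_walk W16 (g := fun c => s c 11) (t := T) (u := u) (l1 := l1) (l2 := l2)).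
- by rewrite -El; apply: os_c H _ un.
- by rewrite -El.
- by [].
- exact: os_0 H _ un.
- move=> r' Hr' rin; have nx := cyc_next_mem (os_c H un); rewrite El in nx.
  have rA : r' 20 \in A by apply: cA; rewrite El.
  split; last by rewrite lte_vl /= (Hr' 21) // r21.
  by sf; rewrite ?(Hr' 21) ?r21 //; apply: cA; rewrite El nx.
- exact: r20.
move=> r1 m1 m2 El2 am ge Hr1 r120.
have Ec : cl u = (l1 ++ m1) ++ m2 by rewrite El El2 catA.
set x := last u (l1 ++ m1) in r120; set z := head u m2 in ge.
have xin : x \in u :: cl u by rewrite Ec last_mem.
have zin : z \in u :: cl u.
  rewrite Ec /z; case: (m2) => [|c m] /=; first by rewrite inE eqxx.
  by rewrite inE !mem_cat inE eqxx !orbT.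
have s7 : s x 7 = z by have := os_c H un; rewrite Ec => /cyc_next.
have cnt : size m1 <= count (fun c => T < s c 11) l2.
  by rewrite El2 count_cat -[count _ m1]/(count (fun c => T < s c 11) m1);
     move: am; rewrite all_count => /eqP->; rewrite leq_addr.
apply: runs_seq; apply: runs_assign; first by sf; rewrite r120; apply: cA.
rewrite /= r120 s7.
have fin r2 s2 A2 ex2 Bk2 cl2 tl2 b (D : nat -> nat) :
  OS K n s2 ex2 Bk2 J own lab cl2 tl2 -> env A2 O Bk2 J -> {subset Bk <= Bk2} ->
  size Bk2 <= (size Bk).+1 -> {in Bk2, forall b, (s2 b 11).+1 < W} -> keeps s s2 O ->
  {subset [seq c <- ex2 | c != b] <= ex} -> b \in Bk2 -> s2 b 1 = u -> s2 b 11 = T ->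
  (forall x, x < 26 -> r2 x = r1 x) -> r2 26 = b -> (forall d, D d <= 60 + 2 * size m1 + d) ->
  runs W P (LINK 4 26 22 30 ;; adr 22 6 (Var 26)) r2 s2 A2
    (fun r3 s3 A3 d3 => Q r3 s3 A3 (D d3)).
  move=> H2 E2 SB sz lb2 kp sx bB b1 b11 Hr2 r26 dle.
  have [OA2 BA2 BO2] := env_mem E2; have [pA2 U2 _ JO2] := E2.
  have r222 : r2 22 = y by rewrite Hr2 // Hr1.
  have yB2 : y \notin Bk2 by apply: contraTN yO; apply: BO2.
  have [c4 _] := os_t H2 bB.
  have b4 : s2 b 4 \in A2.
    have := cyc_next_mem c4; move/(_ b); rewrite !inE eqxx => /(_ isT) /orP[/eqP->|]; first exact: BA2.
    by rewrite (os_tl H2) // => /andP[/JO2/OA2].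
  apply: runs_seq; apply: runs_LINK => //=; rewrite ?r222 ?r26 //; try exact: OA2; try exact: BA2.
  apply: runs_adr => //=; first by rewrite r222; apply: OA2.
  rewrite r222 r26.
  have := os_link H2 bB yJ yB2; rewrite b1 b11 => /(os_sub sx) H3.
  apply: (q _ _ _ Bk2 _ _ _ H3).
  - split=> //; move=> a; rewrite inE => /orP[/eqP->//|]; exact: JO2.
  - exact: SB.
  - exact: sz.
  - by move=> c cB; rewrite upd_fld // link_fld // lb2.
  - move=> a f aO fN; have [h1 h2 h3] : [/\ f != 4, f != 5 & f != 6].
      by split; apply: contraNneq fN => ->.
    by rewrite upd_fld // link_fld // kp.
  - move=> k k20 /=; rewrite ifN; last by rewrite neq_ltn (ltn_trans k20).
    rewrite Hr2; last exact: ltn_trans k20 _.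
    by apply: Hr1; rewrite neq_ltn k20.
  - by rewrite /= Hr2 // Hr1.
  - by move: cnt (dle (5 + 1)); clear; lia.
apply: runs_seq; apply: runs_if_leq; [by sf; apply: cA| |]; rewrite /= ?(Hr1 21) // ?r21.
- move=> Tz; apply: runs_skip.
  have zT : s z 11 = T by apply/eqP; rewrite eqn_leq ge.
  (* [z] might be the sentinel, but its label is 0 whereas [T] is at least [K]. *)
  have zB : z \in Bk.
    move: zin; rewrite inE => /orP[/eqP zu|/clB//]; by move: KT; rewrite -zT zu (os_0 H) // leqn0 (gtn_eqF K0).
  apply: (fin _ _ _ ex Bk cl tl z) => //.
  + by move=> c; rewrite mem_filter => /andP[].
  + move: zin; rewrite inE => /orP[/eqP zu|]; last by rewrite (os_cl H) // => /andP[_ /eqP].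
    by move: KT; rewrite -zT zu (os_0 H) // leqn0 (gtn_eqF K0).
  + by move=> k k26 /=; rewrite ifN // neq_ltn k26.
  + by move=> d; clear; lia.
move=> zT.
have a1' : all (fun c => T < s c 11) (l1 ++ m1) by rewrite all_cat a1.
have a2' : all (fun c => s c 11 < T) m2.
  apply/allP => c; rewrite /z in zT; have := os_sorted H un; rewrite Ec pairwise_cat => /and3P[_ _].
  case: (m2) zT => [//|z' m] /= zT /andP[+ _]; rewrite inE => /allP al /orP[/eqP->//|/al].
  by move=> h; apply: ltn_trans h zT.
have nx := cyc_next_mem (os_x H un); have pv := cyc_prev_mem (os_x H un).
have bA c : c \in u :: botsn (cls K s) (cl u) 0 -> c \in A.
  by rewrite inE => h; apply: cA; rewrite inE; case/orP: h => [->//|/mem_botsn->]; rewrite orbT.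
apply: (runs_NEWB (u := u) (T := T) (x := x) (z := z)) => /=; rewrite ?(Hr1 10) ?(Hr1 21) ?(Hr1 23) //.
- exact: cA.
- exact: cA.
- by rewrite s7; apply: cA.
- move=> zc; have xb : x \in u :: botsn (cls K s) (cl u) 0.
    rewrite Ec; apply: botsn_last; first by rewrite /cls (os_0 H) // div0n.
    move=> l10; rewrite (hdc_head _ (u := u)); last by rewrite /cls (os_0 H) // div0n.
    rewrite -/z -/x /cls; apply: contraNneq zc => E3.
    have Tx : T < s x 11 by apply: (allP a1'); apply: last_in.
    by rewrite eqn_leq leq_div2r ?(ltnW zT) // -E3 leq_div2r // ltnW.
  by split; apply: bA; [apply: nx|apply: pv].
- exact: ltnW.
- by apply: ltnW; apply: mW.
- by apply: ltnW; apply: mW.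
move=> r2 b dt bA' dle Hr2 r26.
have nb : n < b.
  by rewrite ltnNge; apply: contraNN bA' => bn; apply: OA; apply: nO.
have bO : b \notin O by apply: contraNN bA'; apply: OA.
have bB : b \notin Bk by apply: contraNN bA'; apply: BA.
have bJ : b \notin J by apply: contraNN bO; apply: JO.
have [N1 N2 _ _] := newb_new K s b u T x z.
have H2 := os_newb K0 H un Ec KT a1' a2' nb bJ bB.
apply: (fin _ _ _ (b :: ex) (b :: Bk) _ _ b _ H2) => //.
- split=> //.
    by rewrite perm_sym -cat1s perm_catCA /= perm_cons perm_sym.
  rewrite -cat1s (uniq_catCA O [:: b] Bk) /= U andbT mem_cat negb_or bO bB.
  by [].
- by move=> c cB; rewrite inE cB orbT.
- move=> c; rewrite inE => /orP[/eqP->|cB]; first by rewrite N1.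
  by rewrite newb_old ?lbW //; apply: contraNneq bB => <-.
- move=> a f aO fN; rewrite newb_old //; last by apply: contraNneq bO => <-.
  by apply: contraNN fN => /andP[h1 h2]; apply/andP; split; [apply: leq_trans h1|apply: leq_trans h2 _].
- by move=> c; rewrite mem_filter inE => /andP[/negbTE->].
- by rewrite inE eqxx.
- by move=> k k26; rewrite Hr2 //= ifN // neq_ltn k26.
- by move=> d; move: dle; clear; lia.
Qed.
End RunsPlace.

(** Strictly decreasing values are distinct, and those counted lie among [t.+1], ..., [M]. *)
Lemma dec_count (g : nat -> nat) t M l :
  pairwise (fun a b => g b < g a) l -> {in l, forall c, g c <= M} ->
  count (fun c => t < g c) l <= M - t.
Proof.
move=> pw le; rewrite -size_filter; set l' := filter _ l.
have U : uniq (map g l').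
  have pw' : pairwise (fun a b => g b < g a) l' by apply: (subseq_pairwise (filter_subseq _ _)).
  elim: l' pw' => [|x m IH] //= /andP[/allP al /IH->]; rewrite andbT.
  by apply/negP => /mapP[y /al H E]; rewrite E ltnn in H.
rewrite -(size_map g) -(size_iota t.+1 (M - t)); apply: uniq_leq_size => // x /mapP[y].
rewrite mem_filter mem_iota => /andP[ty /le yM] ->; lia.
Qed.

Lemma botsn_class (g : nat -> nat) l e c : c \in l -> g c != e ->
  exists2 b, b \in botsn g l e & g b = g c.
Proof.
elim: l c => [|x l IH] c //; rewrite inE => /orP[/eqP->|cl] ne /=.
  case: eqP => [E|_]; last by exists x; rewrite // inE eqxx.
  case: l IH E => [|y l] IH /= E; first by rewrite E eqxx in ne.
  have [|b bin Eb] := IH y (mem_head _ _); first by rewrite -E.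
  by exists b; rewrite // Eb.
by have [b bin E] := IH c cl ne; exists b; rewrite // mem_cat bin orbT.
Qed.

Lemma botsn_dec (g : nat -> nat) l e :
  pairwise (fun a b => g b <= g a) l -> pairwise (fun a b => g b < g a) (botsn g l e).
Proof.
elim: l => [|x l IH] //= /andP[al /[dup] pl /IH pw].
case: eqP => //= E; rewrite pw andbT; apply/allP => c /mem_botsn.
case: l E al pl {IH pw} => [//|y l] /= E /andP[yx _] /andP[yl _].
rewrite inE => cin; apply: (@leq_ltn_trans (g y)).
  by case/orP: cin => [/eqP->//|]; apply: (allP yl).
by rewrite ltn_neqAle yx andbT; apply/eqP => E'; apply: E.
Qed.

Section RunsFiling.
Variables W P K n : nat.
Hypothesis PW : P < W.
Hypothesis W16 : 100 < W.
Hypothesis K0 : 0 < K.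

Lemma leq_sub_div M T : M %/ K - T %/ K <= M - T.
Proof.
case: (leqP T M) => [H|H]; last first.
  by rewrite (_ : _ - _ = 0) //; apply/eqP; rewrite subn_eq0 leq_div2r // ltnW.
rewrite -{1}(subnKC H) leq_subLR.
apply: (@leq_trans ((T + (M - T) * K) %/ K)); first by apply: leq_div2r; rewrite leq_add2l leq_pmulr.
by rewrite divnDMl.
Qed.

Lemma runs_DELB r s A O b Bk J own lab cl tl (Q : _ -> _ -> _ -> _ -> Prop) :
  OS K n s [:: b] Bk J own lab cl tl -> env n A O Bk J -> b \in Bk ->
  {in Bk, forall b, (s b 11).+1 < W} ->
  r 10 = K -> r 25 = b ->
  (forall r' s' A' Bk' cl' dt,
     OS K n s' [::] Bk' J own lab cl' tl ->
     env n A' O Bk' J -> {subset Bk' <= Bk} -> size Bk' <= size Bk ->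
     {in Bk', forall b, (s' b 11).+1 < W} -> keeps s s' O ->
     (forall x, x < 20 -> r' x = r x) ->
     dt <= 50 -> Q r' s' A' dt) ->
  runs W P DELB r s A Q.
Proof.
move=> H E bB lbW r10 r25 q.
have [OA BA BO] := env_mem E; have [pA U nO JO] := E.
have bA := BA b bB.
have [c4 _] := os_t H bB; have N4 := cyc_next (l1 := [::]) c4; rewrite /= in N4.
apply: runs_if_eqe; [by sf; rewrite r25| |]; rewrite /= r25 N4 => E4; last first.
  apply: runs_skip; apply: (q _ _ _ Bk cl) => //.
  split; try by case: H.
  move=> c cB _; case: (eqVneq c b) => [->|cb]; last by apply: (os_ne H cB); rewrite inE.
  by apply: contraNneq E4 => ->.
have tlb : tl b = [::].
  case: (tl b) (os_uniq_items H bB) E4 => [|c m] //= U' E4; by rewrite E4 inE eqxx in U'.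
pose u := s b 1; have un : u <= n by apply: (os_own H).
have bcl : b \in cl u by rewrite (os_cl H) // bB eqxx.
have [l1 [l2 El]] : exists l1 l2, cl u = l1 ++ b :: l2.
  by case/splitPr: bcl => l1 l2; exists l1, l2.
have cA := os_chain_mem H E un.
have clB c : c \in cl u -> c \in Bk by rewrite (os_cl H) // => /andP[].
have mW c : c \in u :: cl u -> s c 11 < W.
  rewrite inE => /orP[/eqP->|/clB/lbW/ltnW//]; rewrite (os_0 H) //.
  exact: leq_ltn_trans W16.
have c7 := os_c H un; rewrite El in c7.
have s8 : s b 8 = last u l1 by apply: cyc_prev c7.
have s7 : s b 7 = head u l2.
  by move: c7; rewrite -cat_rcons => /cyc_next; rewrite last_rcons.
set x := last u l1 in s8; set z := head u l2 in s7.
have xin : x \in u :: cl u by rewrite El last_mem.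
have zin : z \in u :: cl u.
  rewrite El /z; case: (l2) => [|c m] /=; first by rewrite inE eqxx.
  by rewrite inE !mem_cat !inE eqxx !orbT.
have xb : b != x.
  have := os_uniq_chain H un; rewrite El -cat_cons cat_uniq => /and3P[_ /hasPn h _].
  have := h b; rewrite inE eqxx => /(_ isT); apply: contraNneq => ->; exact: mem_last.
apply: runs_seq; apply: runs_assign; first by sf; rewrite r25.
apply: runs_seq; apply: runs_assign; first by sf; rewrite r25.
rewrite /= r25 s8 s7.
have szB : size (rem b Bk) <= size Bk by rewrite size_rem // leq_pred.
have uB := os_uB H.
have pB : perm_eq A (b :: (O ++ rem b Bk)).
  apply: perm_trans pA _; apply: perm_trans (_ : perm_eq _ (O ++ b :: rem b Bk)) _.
    by rewrite perm_cat2l perm_to_rem.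
  by rewrite -cat1s perm_catCA.
have fin r2 s2 (D : nat -> nat) : s2 = idx_del (cls K s) s x b z ->
  (forall k, k < 30 -> r2 k = rset (rset r 20 x) 26 z k) -> (forall d, D d <= 30 + d) ->
  runs W P (UNLINK 7 25 30 31 ;; Free (Var 25)) r2 s2 A
    (fun r3 s3 A3 d3 => Q r3 s3 A3 (D d3)).
  move=> -> Hr2 HD.
  have r225 : r2 25 = b by rewrite Hr2.
  apply: runs_seq; apply: runs_UNLINK => //=; rewrite ?r225 ?idx_del_fld // ?s7 ?s8; try exact: cA.
  apply: (@runs_free _ _ _ _ _ _ (O ++ rem b Bk)) => //=; first by rewrite r225.
  rewrite -/(delb K s b x z).
  have H2 := os_delb K0 H bB tlb erefl El.
  apply: (q _ _ _ (rem b Bk) _ _ H2) => //.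
  - split=> //; move: U; rewrite !cat_uniq => /and3P[u1 /hasPn u2 u3].
    rewrite u1 rem_uniq // andbT; apply/hasPn => c /mem_rem; exact: u2.
  - exact: mem_rem.
  - by move=> c /mem_rem cB; rewrite delb_fld // lbW.
  - move=> a f aO fN; rewrite delb_fld //.
    by apply: contraNN fN => /andP[h1 h2]; apply/andP; split; [apply: leq_trans h1|apply: leq_trans h2 _].
  - move=> k k20 /=; rewrite !ifN ?neq_ltn ?(ltn_trans k20) // Hr2 /=; last exact: ltn_trans k20 _.
    by rewrite !ifN // neq_ltn ?k20 // (ltn_trans k20).
  - by apply: leq_trans (HD _) _.
apply: runs_seq; apply: runs_if_eqe.
- sf; rewrite ?r25 //; try exact: cA; apply: mW => //.
  by rewrite El inE mem_cat inE eqxx !orbT.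
all: rewrite /= r10 r25 => zc.
- apply: runs_skip; apply: fin => // [|d]; last by clear; lia.
  by rewrite /idx_del /cls zc eqxx.
have bA' c : c \in u :: botsn (cls K s) (cl u) 0 -> c \in A.
  by rewrite inE => h; apply: cA; rewrite inE; case/orP: h => [->//|/mem_botsn->]; rewrite orbT.
have gu0 : cls K s u = 0 by rewrite /cls (os_0 H) // div0n.
have bx : b \in u :: botsn (cls K s) (cl u) 0.
  rewrite El botsn_cat /= (hdc_head l2 gu0) -/z ifN; last by rewrite eq_sym.
  by rewrite inE mem_cat inE eqxx !orbT.
have b9 := bA' _ (cyc_next_mem (os_x H un) bx).
have b10 := bA' _ (cyc_prev_mem (os_x H un) bx).
apply: runs_seq; apply: runs_if_eqe.
- sf; rewrite ?r25 //; try exact: cA; apply: mW => //.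
  by rewrite El inE mem_cat inE eqxx !orbT.
all: rewrite /= r10 r25 => xc.
- apply: runs_LINK => //=; rewrite ?r25 //; first exact: cA.
  have h9 : link s 9 b x b 9 = x by rewrite /link upd_fld // upd_eq.
  have h10 : link s 9 b x b 10 \in A.
    rewrite /link updE; case: ifP => [_|_]; first exact: cA.
    by rewrite upd_fld // upd_adr // upd_fld.
  apply: runs_UNLINK => //=; rewrite ?r25 ?h9 ?h10 //; first exact: cA.
  apply: fin => [|k k30|d]; last by clear; lia.
    by rewrite /idx_del /cls (negbTE zc) xc eqxx.
  by rewrite /= ?(ltn_eqF (ltn_trans k30 (ltnSn _))) ?(ltn_eqF k30).
- apply: runs_skip.
  apply: runs_UNLINK => //=; rewrite ?r25 //.
  apply: fin => [|k k30|d]; last by clear; lia.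
    by rewrite /idx_del /cls (negbTE zc) (negbTE xc).
  by rewrite /= ?(ltn_eqF (ltn_trans k30 (ltnSn _))) ?(ltn_eqF k30).
Qed.

Lemma runs_UNFILE r s A O Bk J own lab cl tl y (Q : _ -> _ -> _ -> _ -> Prop) :
  OS K n s [::] Bk J own lab cl tl -> env n A O Bk J -> y \in J ->
  {in Bk, forall b, (s b 11).+1 < W} ->
  r 10 = K -> r 22 = y ->
  (forall r' s' A' Bk' cl' tl' dt,
     OS K n s' [::] Bk' (rem y J) own lab cl' tl' ->
     env n A' O Bk' (rem y J) -> size Bk' <= size Bk ->
     {in Bk', forall b, (s' b 11).+1 < W} -> keeps s s' O ->
     (forall x, x < 20 -> r' x = r x) ->
     dt <= 60 -> Q r' s' A' dt) ->
  runs W P UNFILE r s A Q.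
Proof.
move=> H E yJ lbW r10 r22 q.
have [OA BA BO] := env_mem E; have [pA U nO JO] := E.
have [b1 b2 b3 b4] := os_J H yJ; have [c4 _] := os_t H b1.
have yt : y \in s y 6 :: tl (s y 6) by rewrite inE (os_tl H) // yJ eqxx orbT.
have tA c : c \in s y 6 :: tl (s y 6) -> c \in A.
  rewrite inE => /orP[/eqP->|]; first exact: BA.
  by rewrite (os_tl H) // => /andP[/JO/OA].
apply: runs_seq; apply: runs_assign; first by sf; rewrite r22; apply: tA.
apply: runs_seq; apply: runs_UNLINK => //=; rewrite ?r22; try apply: tA => //.
- exact: cyc_next_mem c4 _.
- exact: cyc_prev_mem c4 _.
have H2 := os_unlink H yJ.
have E2 : env n A O Bk (rem y J) by split=> // a /mem_rem/JO.
apply: (runs_DELB H2 E2) => //=; last first.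
- move=> r' s' A' Bk' cl' dt H' E' SB sz lb' kp Hr dle.
  apply: (q _ _ _ _ _ _ _ H' E') => //.
  + move=> a f aO fN; rewrite kp // unlink_fld //; by apply: contraNneq fN => ->.
  + move=> k k20; by rewrite Hr //= !(lt_neq k20).
  + by move: dle; clear; lia.
- by move=> c cB; rewrite unlink_fld // lbW.
Qed.

Lemma os_classes s ex Bk J own lab cl tl u :
  OS K n s ex Bk J own lab cl tl -> u <= n ->
  pairwise (fun a b => cls K s b <= cls K s a) (cl u).
Proof.
move=> H un; apply: sub_pairwise (os_sorted H un) => a b /ltnW h.
exact: leq_div2r.
Qed.

(** Two bounds for one search. The first is constant in a flip, where no label of the chain exceeds
    [T] by more than a constant; the second serves the insertion of an edge: [M %/ K] classes on the
    index and then at most [K] buckets within a class. *)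
Lemma runs_FILE r s A O Bk J own lab cl tl y u T M (Q : _ -> _ -> _ -> _ -> Prop) :
  OS K n s [::] Bk J own lab cl tl -> env n A O Bk J -> y \in O -> y \notin J ->
  u <= n -> K <= T -> T.+1 < W -> {in cl u, forall b, s b 11 <= M} ->
  {in Bk, forall b, (s b 11).+1 < W} ->
  r 10 = K -> r 21 = T -> r 22 = y -> r 23 = u -> K < W ->
  blksize * (size A).+1 <= P ->
  (forall r' s' A' Bk' cl' tl' dt,
     OS K n s' [::] Bk' (y :: J) (fun z => if z == y then u else own z)
       (fun z => if z == y then T else lab z) cl' tl' ->
     env n A' O Bk' (y :: J) -> {subset Bk <= Bk'} -> size Bk' <= (size Bk).+1 ->
     {in Bk', forall b, (s' b 11).+1 < W} -> keeps s s' O ->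
     (forall x, x < 20 -> r' x = r x) ->
     dt <= 4 * (M - T) + 80 -> dt <= 2 * (M %/ K + K) + 80 -> Q r' s' A' dt) ->
  runs W P FILE r s A Q.
Proof.
move=> H E yO yJ un KT TW leM lbW r10 r21 r22 r23 KW szA q.
have cA := os_chain_mem H E un.
have gu0 : cls K s u = 0 by rewrite /cls (os_0 H) // div0n.
have clB c : c \in cl u -> c \in Bk by rewrite (os_cl H) // => /andP[].
have mW c : c \in u :: cl u -> (s c 11) < W.
  rewrite inE => /orP[/eqP->|/clB/lbW/ltnW//]; rewrite (os_0 H) //.
  exact: leq_ltn_trans W16.
set B := botsn (cls K s) (cl u) 0.
have Bc c : c \in u :: B -> c \in u :: cl u.
  by rewrite !inE => /orP[->//|/mem_botsn->]; rewrite orbT.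
have Tq : (T %/ K).+1 < W.
  by apply: leq_ltn_trans TW; rewrite ltnS; apply: leq_div.
apply: runs_seq; apply: runs_assign; first by [].
apply: runs_seq; apply: (runs_walk W16 (g := cls K s) (t := T %/ K) (u := u) (l1 := [::]) (l2 := B)).
- exact: (os_x H un).
- by move=> c /Bc/cA.
- by [].
- exact: gu0.
- move=> r' Hr' rin; have nx := cyc_next_mem (os_x H un) rin.
  have rA : r' 20 \in A by apply: cA; apply: Bc.
  have nA := cA _ (Bc _ nx).
  split; last by rewrite lte_vl /= (Hr' 21) // (Hr' 10) //= r10 r21.
  by sf; rewrite ?(Hr' 21) ?(Hr' 10) //= ?r21 ?r10 //; [exact: ltnW | apply: mW; apply: Bc].
- by rewrite /= r23.
move=> r1 m1 m2 EB am ge Hr1 r120.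
have {}r120 : r1 20 = last u m1 := r120; set x := last u m1 in r120.
have xin : x \in u :: cl u by apply: Bc; rewrite EB last_mem.
have [l1 [l2 [El Ex]]] := split_at xin.
have pc := os_classes H un.
have pa := os_sorted H un.
have a1 : all (fun c => T < s c 11) l1.
  apply/allP => c cl1; case/lastP: l1 El Ex cl1 => [//|l1 x'] El; rewrite last_rcons => Ex.
  have Tx : T < s x 11.
    have xm1 : x \in m1.
      have : x \in u :: m1 by exact: mem_last.
      rewrite inE => /orP[/eqP xu|//]; have := os_uniq_chain H un.
      by rewrite El -xu Ex /= mem_cat mem_rcons inE eqxx.
    by have := allP am _ xm1; rewrite /= /cls => h; rewrite ltnNge; apply: contraTN h => h; rewrite -leqNgt leq_div2r.
  rewrite mem_rcons inE => /orP[/eqP->|cin]; first by rewrite -Ex.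
  move: pa; rewrite El pairwise_cat pairwise_rcons => /and3P[_ /andP[/allP al _] _].
  by apply: ltn_trans Tx _; rewrite Ex; apply: al.
(* The last bucket [b] of the class of [c] is in the index and behind [x] in the chain. In [m1] it
   would come before [x] or be [x], and in [m2] the classes are at most that of [T]. *)
have small c : c \in l2 -> cls K s c <= T %/ K.
  move=> cl2; rewrite leqNgt; apply/negP => gt.
  have c0 : cls K s c != 0 by rewrite -lt0n; apply: leq_ltn_trans gt.
  have [b bb Eb] := botsn_class cl2 c0.
  have bl2 := mem_botsn bb.
  have bB : b \in B by rewrite /B El botsn_cat mem_cat bb orbT.
  move: bB; rewrite EB mem_cat => /orP[bm1|bm2]; last first.
    have := botsn_dec 0 pc; rewrite -/B EB pairwise_cat => /and3P[_ _].
    case: (m2) bm2 ge => [//|c' m] /=; rewrite inE => h ge /andP[/allP al _].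
    case/orP: h => [/eqP E'|/al h]; first by move: gt; rewrite -Eb E' ltnNge ge.
    by move: gt; rewrite -Eb ltnNge (leq_trans (ltnW h) ge).
  have bx : s x 11 <= s b 11.
    have pb : pairwise (above s) B by apply: subseq_pairwise (botsn_subseq _ _ _) pa.
    move: pb; rewrite EB pairwise_cat => /and3P[_ + _]; rewrite /x.
    case/lastP: (m1) bm1 => [//|m x']; rewrite last_rcons pairwise_rcons mem_rcons inE.
    by move=> /orP[/eqP->//|bm] /andP[/allP al _]; apply: ltnW; apply: al.
  have xb : above s x b.
    have xm1 : x \in m1 by apply: last_in; apply: contraTneq bm1 => ->.
    have xcl : x \in cl u by apply: (mem_botsn (e := 0) (g := cls K s)); rewrite -/B EB mem_cat xm1.
    have xl1 : x \in l1.
      rewrite Ex; apply: last_in; apply: contraTneq xcl => l10; rewrite Ex l10 /=.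
      by have /= /andP[] := os_uniq_chain H un.
    by move: pa; rewrite El pairwise_cat => /and3P[/allrelP al _ _]; apply: al.
  by move: xb; rewrite /above ltnNge bx.
have cnt1 : size m1 <= M %/ K - T %/ K.
  apply: leq_trans (@dec_count (cls K s) (T %/ K) _ B _ _).
  - by rewrite EB count_cat; move: am; rewrite all_count => /eqP->; rewrite leq_addr.
  - exact: botsn_dec.
  - by move=> c /mem_botsn cc; apply: leq_div2r; apply: leM.
have l2cl c : c \in l2 -> c \in cl u by rewrite El mem_cat => ->; rewrite orbT.
have p2 : pairwise (above s) l2 by move: pa; rewrite El pairwise_cat => /and3P[].
have cnt2 : count (fun c => T < s c 11) l2 <= M - T.
  by apply: (dec_count T p2) => c /l2cl/leM.
(* What remains above [T] in [l2] has the class of [T], so its labels are distinct numbers of one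
   block of [K] consecutive ones. *)
have cnt3 : count (fun c => T < s c 11) l2 <= K.
  apply: leq_trans (dec_count (M := (T %/ K) * K + K.-1) T p2 _) _.
    move=> c /small; rewrite /cls => h; have := ltn_pmod (s c 11) K0.
    by rewrite {2}(divn_eq (s c 11) K) => h2; apply: leq_add; [rewrite leq_mul2r h orbT|rewrite -ltnS prednK].
  by have := leq_trunc_div T K; move: K0; clear; lia.
apply: (runs_PLACE PW W16 K0 (y := y) (u := u) (T := T) (l1 := l1) (l2 := l2) H E) => //;
  rewrite ?(Hr1 10) ?(Hr1 21) ?(Hr1 22) ?(Hr1 23) //=.
- by rewrite r120 Ex.
move=> r' s' A' Bk' cl' tl' dt H' E' SB sz lb' kp Hr r25 dle.
have := leq_sub_div M T.
move=> h; apply: (q _ _ _ _ _ _ _ H' E') => //.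
- move=> k k20; rewrite Hr // Hr1 //= ?(lt_neq k20) //; by rewrite neq_ltn k20.
- by move: dle (leq_trans cnt1 h) cnt2; clear; lia.
- by move: dle (leq_trans cnt1 (leq_subr _ _)) cnt3; move: (M %/ K) => a; clear; lia.
Qed.

Lemma os_perm s ex Bk J J' own lab cl tl :
  perm_eq J J' -> OS K n s ex Bk J own lab cl tl -> OS K n s ex Bk J' own lab cl tl.
Proof.
move=> pJ H; have mJ := perm_mem pJ; case: H => h1 h2 h3 h4 h5 h6 h7 h8 h9 h10 h11 h12 h13 h14.
split=> //.
- by rewrite -(perm_uniq pJ).
- by move=> b /h3; rewrite mJ.
- by move=> y; rewrite -mJ => /h4.
- by move=> b y bB; rewrite h13 // mJ.
Qed.

Lemma runs_REFILE r s A O Bk J own lab cl tl y T (Q : _ -> _ -> _ -> _ -> Prop) :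
  OS K n s [::] Bk J own lab cl tl -> env n A O Bk J -> y \in J ->
  K <= T -> T.+1 < W -> T <= (lab y).+1 -> lab y <= T.+1 ->
  {in Bk, forall b, (s b 11).+1 < W} ->
  r 10 = K -> r 21 = T -> r 22 = y ->
  blksize * (size A).+1 <= P ->
  (forall r' s' A' Bk' cl' tl' dt,
     OS K n s' [::] Bk' J own (fun z => if z == y then T else lab z) cl' tl' ->
     env n A' O Bk' J -> size Bk' <= (size Bk).+1 ->
     {in Bk', forall b, (s' b 11).+1 < W} -> keeps s s' O ->
     (forall x, x < 20 -> r' x = r x) -> dt <= 150 -> Q r' s' A' dt) ->
  runs W P REFILE r s A Q.
Proof.
move=> H E yJ KT TW T1 T2 lbW r10 r21 r22 szA q.
have [OA BA BO] := env_mem E; have [pA U nO JO] := E.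
have [b1 b2 b3 b4] := os_J H yJ; have [c4 _] := os_t H b1.
set b := s y 6 in b1 b2 b3 b4 c4; set u := own y in b2 b4.
have yt : y \in b :: tl b by rewrite inE (os_tl H) // yJ eqxx orbT.
have tA c : c \in b :: tl b -> c \in A.
  rewrite inE => /orP[/eqP->|]; first exact: BA.
  by rewrite (os_tl H) // => /andP[/JO/OA].
have cA := os_chain_mem H E b4.
have bcl : b \in cl u by rewrite (os_cl H) // b1 b2 eqxx.
have [la [lb El]] : exists l1 l2, cl u = l1 ++ b :: l2.
  by case/splitPr: bcl => l1 l2; exists l1, l2.
have c7 := os_c H b4; rewrite El in c7.
have s8 : s b 8 = last u la by apply: cyc_prev c7.
set p := last u la in s8.
have pin : p \in u :: cl u by rewrite El last_mem.
have bA := BA b b1.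
have := os_sorted H b4; rewrite El pairwise_cat => /and3P[/allrelP ala pla /=].
move=> /andP[/allP alb plb].
apply: runs_seq; apply: runs_assign; first by sf; rewrite r22; apply: tA.
rewrite /= r22 -/b.
apply: runs_seq; apply: runs_assign; first by sf.
rewrite /= s8.
have uJ : perm_eq (y :: rem y J) J by rewrite perm_sym perm_to_rem.
have E2 : env n A O Bk (rem y J) by split=> // a /mem_rem/JO.
have H2 := os_unlink H yJ.
have yJ2 : y \notin rem y J by rewrite mem_rem_uniq ?(os_uJ H) // inE eqxx.
have fin r2 l1 l2 (D : nat -> nat) :
  cl u = l1 ++ l2 -> all (fun c => T < s c 11) l1 -> count (fun c => T < s c 11) l2 <= 1 ->
  (forall k, k < 20 -> r2 k = r k) -> r2 21 = T -> r2 22 = y -> r2 25 = b ->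
  r2 20 = last u l1 -> (forall d, D d <= 20 + d) ->
  runs W P (Assign 23 (fld 25 1);; UNLINK 4 22 30 31;; PLACE;; DELB) r2 s A
    (fun r3 s3 A3 d3 => Q r3 s3 A3 (D d3)).
  move=> El1 a1 cnt Hr2 r221 r222 r225 r220 HD.
  apply: runs_seq; apply: runs_assign; first by sf; rewrite r225.
  rewrite /= r225 b2.
  apply: runs_seq; apply: runs_UNLINK => //=; rewrite ?r222; try apply: tA => //.
  - exact: cyc_next_mem c4 _.
  - exact: cyc_prev_mem c4 _.
  apply: runs_seq.
  apply: (runs_PLACE PW W16 K0 (y := y) (u := u) (T := T) (l1 := l1) (l2 := l2) H2 E2) => //=.
  - exact: JO.
  - by apply: sub_all a1 => c; rewrite unlink_fld.
  - by move=> c cB; rewrite unlink_fld // lbW.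
  - by rewrite Hr2.
  move=> r3 s3 A3 Bk3 cl3 tl3 d3 H3 E3 SB sz lb3 kp Hr3 r325 dle.
  have cnt' : count (fun c => T < unlink s 4 y c 11) l2 <= 1.
    by apply: leq_trans cnt; apply: eq_leq; apply: eq_count => c; rewrite unlink_fld.
  apply: (runs_DELB H3 E3) => //.
  - exact: SB.
  - by rewrite Hr3 //= Hr2.
  - by rewrite r325 /= r225.
  move=> r4 s4 A4 Bk4 cl4 d4 H4 E4 SB4 sz4 lb4 kp4 Hr4 d4le.
  apply: (q _ _ _ Bk4 cl4 tl3).
  - apply: os_perm uJ _; apply: os_frame H4 _ _ _ _ => // z zJ.
    by case: eqP => // ->.
  - case: E4 => e1 e2 e3 e4; split=> //.
  - exact: leq_trans sz4 sz.
  - exact: lb4.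
  - move=> a f aO fN; rewrite kp4 // kp // unlink_fld //; by apply: contraNneq fN => ->.
  - by move=> k k20; rewrite Hr4 // Hr3 //= !(lt_neq k20) // Hr2.
  - apply: leq_trans (HD _) _; move: dle cnt' d4le; clear; lia.
have pW : s p 11 < W.
  move: pin; rewrite inE => /orP[/eqP->|]; first by rewrite (os_0 H) // (ltn_trans _ W16).
  by rewrite (os_cl H) // => /andP[/lbW/ltnW].
(* The predecessor has a label above [lab y], so it is at least [T] unless [T] is [lab y + 1], and
   equality is the case in which the walk starts one bucket earlier. *)
apply: runs_seq; apply: runs_if_eqe; [by sf; apply: cA| |]; rewrite /= r21 => ET.
- apply: runs_assign; first by sf; apply: cA.
  have la0 : la != [::].
    apply: contraTneq KT => la0; rewrite -ltnNge -ET /p la0 /= (os_0 H) //.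
  have [la' Ela] : exists la', la = rcons la' p.
    by case/lastP: (la) la0 @p {s8 pin ET pW} => // la' p' _; rewrite last_rcons; exists la'.
  rewrite /=; have s8' : s p 8 = last u la'.
    by move: (os_c H b4); rewrite El Ela cat_rcons => /cyc_prev.
  rewrite Ela in pla ala.
  have TL : forall c, c \in la' -> T < s c 11.
    by rewrite pairwise_rcons in pla; move=> c cl'; move: pla => /andP[/allP al _]; rewrite -ET; apply: al.
  apply: (fin _ la' (p :: b :: lb)) => //=.
  + by rewrite El Ela cat_rcons.
  + exact/allP.
  + rewrite ET ltnn add0n; set c1 := (T < s b 11); have -> : c1 = false.
      rewrite /c1 ltnNge -ET; have := ala p b; rewrite mem_rcons !inE !eqxx => /(_ isT isT).
      by rewrite /above => /ltnW->.
    rewrite (_ : count _ _ = 0) //; apply/eqP; rewrite -leqn0 leqNgt -has_count.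
    apply/hasPn => c cb; rewrite -leqNgt -ET; have := ala p c; rewrite mem_rcons !inE !eqxx cb orbT.
    by move=> /(_ isT isT) /ltnW.
  + by move=> k k20; rewrite !(lt_neq k20).
  + by move=> d; clear; lia.
- apply: runs_skip; apply: (fin _ la (b :: lb)) => //=.
  + apply/allP => c cla.
    have Tp : T < s p 11.
      have pla' : p \in la by apply: last_in; apply: contraTneq cla => ->.
      have := ala p b pla' (mem_head _ _); rewrite /above b3 => h.
      by rewrite ltn_neqAle eq_sym ET; apply: leq_trans T1 h.
    have Tp' : T < s (last u la) 11 := Tp.
    case/lastP: (la) pla cla Tp' => // la' p'; rewrite last_rcons pairwise_rcons mem_rcons inE.
    move=> /andP[/allP al _] /orP[/eqP->//|cl'] Tp2.
    exact: ltn_trans Tp2 (al _ cl').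
  + apply: leq_trans (dec_count (M := T.+1) T (l := b :: lb) (g := fun c => s c 11) _ _) _.
    * by rewrite /= plb andbT; apply/allP.
    * move=> c; rewrite inE => /orP[/eqP->|/alb]; first by rewrite b3.
      by rewrite /above b3 => /ltnW h; apply: leq_trans h T2.
    * by rewrite subSn // subnn.
  + by move=> k k20; rewrite !(lt_neq k20).
  + by move=> d; clear; lia.
Qed.
End RunsFiling.

(** * Edges and their buckets *)

(* The registers 9 and 10 hold the root and [K], 11 the edge that is moved, 12 and 13 its head and
   tail, 14 the vertex whose degree changes; registers from 20 on are scratch. *)
Definition DETACH : cmd :=
  Assign 12 (fld 11 0) ;;
  If (eqe (fld 12 15) (Var 11)) (adr 12 15 (fld 11 2)) Skip ;;
  UNLINK 2 11 30 31 ;; Assign 22 (Var 11) ;; UNFILE.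
(** The edge enters at the front of the in-list, that is, among the scanned edges. Edges are
    attached only where the level of the head is at most one above that of the tail, so this is
    legitimate and no later scan has to be paid for. *)
Definition ATTACH : cmd :=
  adr 11 0 (Var 12) ;; adr 11 1 (Var 13) ;; LINK 2 12 11 30 ;;
  Assign 22 (Var 11) ;; Assign 23 (Var 13) ;; Assign 21 (fld 12 13) ;; FILE.
Definition RELABEL_STEP : cmd :=
  Assign 22 (Var 15) ;; Assign 21 (fld 14 13) ;; REFILE ;;
  Assign 15 (fld 15 2) ;;
  If (eqe (Var 15) (Var 14)) (Assign 16 (Cst 0)) Skip.
(** The round starts at the sentinel of the in-list, the vertex itself. As a vertex is an item whose
    head is itself, the same step refiles it and its in-edges. *)
Definition RELABEL : cmd :=
  adr 14 15 (fld 14 2) ;; Assign 15 (Var 14) ;; Assign 16 (Cst 1) ;;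
  While (Var 16) RELABEL_STEP.

Section GraphOps.
Variables W P K n : nat.
Hypothesis PW : P < W.
Hypothesis W16 : 100 < W.
Hypothesis K0 : 0 < K.
Hypothesis KW : K < W.

(* [E] lists the edges that are in the graph; the in-edges of [v] are [sc v],
   which have been scanned since the last change of the level of [v], followed by
   [un v].  The edges and the vertices (as items of the root [n]) are filed under
   the level (cell 13) of their head (cell 0). *)
Record IL (s : store) (E : seq nat) (sc un : nat -> seq nat) : Prop := MkIL {
  il_v : forall v, v < n -> s v 0 = v /\ s v 1 = n;
  il_e : forall e, e \in E -> [/\ n < e, s e 0 < n, s e 1 < n & s e 0 != s e 1];
  il_c : forall v, v < n -> cyc s 2 v (sc v ++ un v);
  il_u : forall v, v < n -> uniq (sc v ++ un v);
  il_m : forall v e, v < n -> (e \in sc v ++ un v) = (e \in E) && (s e 0 == v);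
  il_cu : forall v, v < n -> s v 15 = head v (un v);
  il_K : forall v, v < n -> K <= s v 13 /\ (s v 13).+2 < W }.

Definition items (E : seq nat) : seq nat := iota 0 n ++ E.

Lemma mem_items E y : (y \in items E) = (y < n) || (y \in E).
Proof. by rewrite mem_cat mem_iota. Qed.

Definition own (s : store) (y : nat) : nat := s y 1.
Definition lab (s : store) (y : nat) : nat := s (s y 0) 13.

Record GI (s : store) (A O E Bk : seq nat) (sc un cl tl : nat -> seq nat) : Prop := MkGI {
  gi_il : IL s E sc un;
  gi_os : OS K n s [::] Bk (items E) (own s) (lab s) cl tl;
  gi_env : env n A O Bk (items E) }.

Lemma il_frame s s' E sc un :
  IL s E sc un ->
  (forall a f, (a < n) || (a \in E) -> f \in [:: 0; 1; 2; 3; 13; 15] -> s' a f = s a f) ->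
  IL s' E sc un.
Proof.
move=> H F.
have Fv v f : v < n -> f \in [:: 0; 1; 2; 3; 13; 15] -> s' v f = s v f.
  by move=> vn; apply: F; rewrite vn.
have Fe e f : e \in E -> f \in [:: 0; 1; 2; 3; 13; 15] -> s' e f = s e f.
  by move=> vn; apply: F; rewrite vn orbT.
split.
- by move=> v vn; rewrite !Fv //; apply: (il_v H).
- by move=> e eE; rewrite !Fe //; apply: (il_e H).
- move=> v vn; apply: cyc_frame (il_c H vn) => a; rewrite inE => /orP[/eqP->|].
    by rewrite !Fv.
  by rewrite (il_m H) // => /andP[aE _]; rewrite !Fe.
- exact: il_u H.
- move=> v e vn; rewrite (il_m H) //; case eE: (e \in E) => //=; by rewrite Fe.
- by move=> v vn; rewrite Fv // (il_cu H).
- by move=> v vn; rewrite Fv //; apply: (il_K H).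
Qed.

Lemma il_lab s E sc un y : IL s E sc un -> y \in items E -> s y 0 < n.
Proof.
by move=> H; rewrite mem_items => /orP[yn|/(il_e H)[]//]; have [->] := il_v H yn.
Qed.

Lemma gi_labels s A O E Bk sc un cl tl b :
  GI s A O E Bk sc un cl tl -> b \in Bk ->
  exists2 y, y \in items E & s y 6 = b /\ s b 11 = lab s y.
Proof.
move=> [H1 H2 _] bB; have := os_ne H2 bB isT.
case E1: (tl b) => [|y m] // _; have : y \in tl b by rewrite E1 inE eqxx.
rewrite (os_tl H2) // => /andP[yJ /eqP yb]; exists y => //; split=> //.
by have [_ _ <- _] := os_J H2 yJ; rewrite yb.
Qed.

Lemma gi_lbW s A O E Bk sc un cl tl :
  GI s A O E Bk sc un cl tl -> {in Bk, forall b, (s b 11).+1 < W}.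
Proof.
move=> H b /(gi_labels H)[y yJ [_ ->]]; apply: ltnW.
by have [] := il_K (gi_il H) (il_lab (gi_il H) yJ).
Qed.

Lemma il_list_mem s E sc un v a :
  IL s E sc un -> v < n -> a \in v :: sc v ++ un v -> (a < n) || (a \in E).
Proof.
move=> H vn; rewrite inE => /orP[/eqP->|]; first by rewrite vn.
by rewrite (il_m H) // => /andP[-> _]; rewrite orbT.
Qed.

Lemma il_uniq s E sc un v : IL s E sc un -> v < n -> uniq (v :: sc v ++ un v).
Proof.
move=> H vn; rewrite cons_uniq (il_u H) // andbT (il_m H) //.
by apply/negP => /andP[/(il_e H)[nv _ _ _] _]; rewrite ltnNge ltnW in nv.
Qed.

Lemma il_disj s E sc un v v' a :
  IL s E sc un -> v < n -> v' < n -> a \in v :: sc v ++ un v -> a \in v' :: sc v' ++ un v' ->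
  v = v'.
Proof.
move=> H vn vn'; rewrite !(in_cons, il_m H) //.
have nE b : b < n -> b \in E -> False.
  by move=> bn /(il_e H)[nb _ _ _]; rewrite ltnNge ltnW in nb.
case/orP=> [/eqP E1|/andP[aE /eqP E1]]; case/orP=> [/eqP E2|/andP[aE2 /eqP E2]].
- by rewrite -E1.
- by case: (nE a); rewrite // E1.
- by case: (nE a); rewrite // E2.
- by rewrite -E1.
Qed.

Lemma filter_mid (e : nat) l1 l2 : uniq (l1 ++ e :: l2) ->
  [seq x <- l1 ++ e :: l2 | x != e] = l1 ++ l2.
Proof.
rewrite cat_uniq /= negb_or filter_cat /= eqxx /= => /and3P[_ /andP[h1 _] /andP[h2 _]].
by rewrite !(all_filterP _) //; apply/allP => x; apply: contraTneq => ->.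
Qed.

Lemma filter_notin (e : nat) l : e \notin l -> [seq x <- l | x != e] = l.
Proof. by move=> h; apply/all_filterP/allP => x; apply: contraTneq => ->. Qed.

(** The second alternative protects the links of the root and of the pending edges in its list,
    which use the cells 2 and 3 during a rebuilding. *)
Definition gkeeps (s s' : store) (O E : seq nat) (e : nat) : Prop :=
  forall a f, a \in O -> ~~ (4 <= f <= 11) ->
    (a != e) && (f \notin [:: 2; 3; 15]) || (n <= a) && (a \notin e :: E) -> s' a f = s a f.

Lemma runs_DETACH r s A O E Bk sc un cl tl e (Q : _ -> _ -> _ -> _ -> Prop) :
  GI s A O E Bk sc un cl tl -> e \in E -> r 10 = K -> r 11 = e ->
  (forall r' s' A' Bk' cl' tl' dt,
     GI s' A' O (rem e E) Bk' (fun v => [seq x <- sc v | x != e])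
       (fun v => [seq x <- un v | x != e]) cl' tl' ->
     size Bk' <= size Bk -> gkeeps s s' O E e -> s' e 0 = s e 0 -> s' e 1 = s e 1 ->
     (forall x, x < 20 -> x != 12 -> r' x = r x) -> dt <= 100 -> Q r' s' A' dt) ->
  runs W P DETACH r s A Q.
Proof.
move=> [HI HO HE] eE r10 r11 q.
have [OA BA BO] := env_mem HE; have [pA U nO JO] := HE.
have [ne h0 t0 ht] := il_e HI eE; set h := s e 0 in h0 ht.
have eJ : e \in items E by rewrite mem_items eE orbT.
have eO := JO _ eJ; have eA := OA _ eO.
have hO : h \in O by apply: nO; apply: ltnW.
have hA := OA _ hO.
have iA a : (a < n) || (a \in E) -> a \in A.
  by move=> h'; apply: OA; apply: JO; rewrite mem_items.
have el : e \in sc h ++ un h by rewrite (il_m HI) // eE eqxx.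
have C := il_c HI h0; have UU := il_uniq HI h0.
have e2 : s e 2 \in A by apply: iA; apply: (il_list_mem HI h0); apply: (cyc_next_mem C); rewrite inE el orbT.
have e3 : s e 3 \in A by apply: iA; apply: (il_list_mem HI h0); apply: (cyc_prev_mem C); rewrite inE el orbT.
have eh : e != h by rewrite neq_ltn (ltn_trans h0 ne) orbT.
have uE := os_uJ HO; have uE' : uniq E by move: uE; rewrite cat_uniq => /and3P[].
have eI : e \notin iota 0 n by rewrite mem_iota /= -leqNgt ltnW.
have remJ : rem e (items E) = items (rem e E).
  by rewrite /items; elim: (iota 0 n) eI => [|x m IH] //=; rewrite inE negb_or eq_sym => /andP[/negbTE-> /IH->].
(* If the scan of the head has stopped right before [e], it must continue with the next in-edge. *)
pose s1 := if head h (un h) == e then upd s h 15 (s e 2) else s.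
have s1E a f : f != 15 -> s1 a f = s a f by move=> f15; rewrite /s1; case: ifP => // _; rewrite upd_fld.
apply: runs_seq; apply: runs_assign; first by sf; rewrite r11.
rewrite /= r11 -/h.
have fin r2 (D : nat -> nat) : (forall x, x < 20 -> x != 12 -> r2 x = r x) ->
   (forall d, D d <= 20 + d) ->
   runs W P (UNLINK 2 11 30 31 ;; Assign 22 (Var 11) ;; UNFILE) r2 s1 A
     (fun r3 s3 A3 d3 => Q r3 s3 A3 (D d3)).
  move=> Hr2 HD; have r211 : r2 11 = e by rewrite Hr2.
  apply: runs_seq; apply: runs_UNLINK => //=; rewrite ?r211 ?s1E //.
  apply: runs_seq; apply: runs_assign => //=; rewrite r211.
  set s2 := unlink s1 2 e.
  have s2E a f : f \notin [:: 2; 3; 15] -> s2 a f = s a f.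
    rewrite !inE !negb_or => /and3P[f2 f3 f15]; by rewrite /s2 unlink_fld // s1E.
  have HO2 : OS K n s2 [::] Bk (items E) (own s) (lab s) cl tl.
    apply: os_frame HO _ _ _ _ => // [a f _ f4|b _]; last by rewrite s2E.
    by rewrite s2E // !inE; apply/negP => /or3P[] /eqP E1; rewrite E1 in f4.
  apply: (runs_UNFILE W16 K0 HO2 HE eJ) => //=.
  - by move=> b bB; rewrite s2E // (gi_lbW (MkGI HI HO HE)).
  - by rewrite Hr2.
  move=> r3 s3 A3 Bk3 cl3 tl3 d3 H3 E3 sz lb3 kp Hr3 dle.
  rewrite remJ in H3 E3.
  have s3E a f : a \in O -> ~~ (4 <= f <= 11) -> f \notin [:: 2; 3; 15] -> s3 a f = s a f.
    by move=> aO f4 f2; rewrite kp // s2E.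
  have inO a : (a < n) || (a \in E) -> a \in O by rewrite -mem_items; apply: JO.
  have rE a : a \in rem e E -> a \in E by apply: mem_rem.
  have EO a : a \in E -> a \in O by move=> aE; apply: inO; rewrite aE orbT.
  have vO v : v < n -> v \in O by move=> vn; apply: inO; rewrite vn.
  apply: (q _ _ _ Bk3 cl3 tl3) => //.
  - split=> //; last first.
      apply: os_frame H3 _ _ _ _ => // y yJ.
        rewrite /own s3E //; apply: inO; move: yJ; rewrite mem_items => /orP[->//|/rE->]; by rewrite orbT.
      have yJ' : y \in items E by move: yJ; rewrite !mem_items => /orP[->//|/rE->]; rewrite orbT.
      have yO := JO _ yJ'.
      by rewrite /lab s3E // s3E // vO // (il_lab HI yJ').
    have un1 v : v < n -> v != h -> e \notin sc v ++ un v.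
      by move=> vn vh; rewrite (il_m HI) // -/h [h == v]eq_sym (negbTE vh) andbF.
    split.
    + by move=> v vn; rewrite !s3E ?vO //; apply: (il_v HI).
    + by move=> a /rE aE; rewrite !s3E ?EO //; apply: (il_e HI).
    + move=> v vn; rewrite -filter_cat.
      have K3 l : {in v :: l, forall a, a \in O} -> cyc s2 2 v l -> cyc s3 2 v l.
        by move=> lO; apply: cyc_frame => a /lO aO; rewrite !kp.
      have c1 w l : cyc s 2 w l -> cyc s1 2 w l by apply: cyc_frame => a _; rewrite !s1E.
      apply: K3.
        move=> a; rewrite inE mem_filter => al; apply: inO; apply: (il_list_mem HI vn).
        by rewrite inE; case/orP: al => [->//|/andP[_ ->]]; rewrite orbT.
      case: (eqVneq v h) => [->|vh].
        case/splitPr E1: _ / el => [l1 l2]; have Uh := UU; rewrite E1 in C Uh.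
        rewrite filter_mid; last by move: Uh => /= /andP[].
        by apply: cyc_unlink => //; apply: c1.
      rewrite filter_notin ?un1 //; apply: (cyc_unlink_other (c1 _ _ C) _ (c1 _ _ (il_c HI vn))).
        by rewrite inE el orbT.
      by move=> a av; apply: contraNN vh => ah; apply/eqP; apply: (il_disj HI vn h0 av ah).
    + by move=> v vn; rewrite -filter_cat filter_uniq // (il_u HI).
    + move=> v a vn; rewrite -filter_cat mem_filter (il_m HI) // mem_rem_uniq // inE andbA.
      case: eqP => //= _; case aE: (a \in E) => //=; by rewrite s3E // EO.
    + move=> v vn; rewrite kp ?vO // /s2 unlink_fld // /s1.
      case: (eqVneq v h) => [->|vh]; last first.
        have -> : (if head h (un h) == e then upd s h 15 (s e 2) else s) v 15 = s v 15.
          by case: ifP => // _; rewrite upd_adr.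
        rewrite (il_cu HI) // filter_notin //.
        by have := un1 v vn vh; rewrite mem_cat negb_or => /andP[].
      case Eu: (un h) => [|a m] /=; first by rewrite eq_sym (negbTE eh) (il_cu HI) // Eu.
      case: (eqVneq a e) => [ae|ae] /=; last by rewrite (il_cu HI) // Eu.
      rewrite upd_eq; rewrite Eu ae in C UU; rewrite -cat_rcons in C.
      have := cyc_next C; rewrite last_rcons => ->; congr head.
      have /= := UU; rewrite cat_uniq /= => /andP[_ /and3P[_ _ /andP[em _]]].
      by rewrite filter_notin.
    + by move=> v vn; rewrite s3E ?vO //; apply: (il_K HI).
  - move=> a f aO f4 /orP[/andP[ae f2]|/andP[na aE]]; first exact: s3E.
    rewrite kp //; move: aE; rewrite inE negb_or => /andP[ae aE].
    have al : a \notin h :: sc h ++ un h.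
      by apply/negP => /(il_list_mem HI h0); rewrite ltnNge na (negbTE aE).
    rewrite /s2 /unlink !upd_adr.
    - rewrite /s1; case: ifP => // _; rewrite upd_adr //; by apply: contraNneq al => ->; rewrite inE eqxx.
    - by apply: contraNneq al => ->; rewrite s1E //; apply: (cyc_prev_mem C); rewrite inE el orbT.
    - by apply: contraNneq al => ->; rewrite s1E //; apply: (cyc_next_mem C); rewrite inE el orbT.
  - by rewrite s3E.
  - by rewrite s3E.
  - move=> x x20 x12; rewrite Hr3 //= !(lt_neq x20) //; exact: Hr2.
  - by apply: leq_trans (HD _) _; move: dle; clear; lia.
have cu : s h 15 = head h (un h) by apply: (il_cu HI).
apply: runs_seq; apply: runs_if_eqe; [by sf; rewrite r11 | |]; rewrite /= r11 cu => Ecu.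
- apply: runs_adr => //; first by sf; rewrite r11.
  rewrite /= r11.
  have -> : upd s h 15 (s e 2) = s1 by rewrite /s1 Ecu eqxx.
  apply: fin => [x x20 x12|d]; first by rewrite /= (negbTE x12).
  by clear; lia.
- apply: runs_skip; have {1}-> : s = s1 by rewrite /s1 (negbTE Ecu).
  apply: fin => [x x20 x12|d]; first by rewrite /= (negbTE x12).
  by clear; lia.
Qed.

Lemma runs_ATTACH r s A O E Bk sc un cl tl e h t M (Q : _ -> _ -> _ -> _ -> Prop) :
  GI s A O E Bk sc un cl tl -> e \in O -> n < e -> e \notin E ->
  h < n -> t < n -> h != t ->
  (forall y, y \in E -> s y 1 = t -> lab s y <= M) ->
  r 10 = K -> r 11 = e -> r 12 = h -> r 13 = t ->
  blksize * (size A).+1 <= P ->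
  (forall r' s' A' Bk' cl' tl' dt,
     GI s' A' O (e :: E) Bk' (fun v => if v == h then e :: sc v else sc v) un cl' tl' ->
     size Bk' <= (size Bk).+1 -> gkeeps s s' O E e -> s' e 0 = h -> s' e 1 = t ->
     (forall x, x < 20 -> r' x = r x) ->
     dt <= 4 * (M - s h 13) + 100 -> dt <= 2 * (M %/ K + K) + 100 -> Q r' s' A' dt) ->
  runs W P ATTACH r s A Q.
Proof.
move=> [HI HO HE] eO ne eE hn tn ht HM r10 r11 r12 r13 szA q.
have [OA BA BO] := env_mem HE; have [pA U nO JO] := HE.
have eA := OA _ eO; have hA : h \in A by apply: OA; apply: nO; apply: ltnW.
have eh : e != h by rewrite neq_ltn (ltn_trans hn ne) orbT.
have eB : e \notin Bk by apply: contraTN eO; apply: BO.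
have eJ : e \notin items E by rewrite mem_items negb_or eE andbT -leqNgt ltnW.
have neJ y : y \in items E -> y != e by apply: contraTneq => ->.
have C := il_c HI hn; have UU := il_uniq HI hn.
have iA a : (a < n) || (a \in E) -> a \in A.
  by move=> h'; apply: OA; apply: JO; rewrite mem_items.
have h2 : s h 2 \in A.
  by apply: iA; apply: (il_list_mem HI hn); apply: (cyc_next_mem C); rewrite inE eqxx.
apply: runs_seq; apply: runs_adr => //=; first by rewrite r11.
apply: runs_seq; apply: runs_adr => //=; first by rewrite r11.
rewrite r11 r12 r13; set s1 := upd _ e 1 t.
have s1E a f : f != 0 -> f != 1 -> s1 a f = s a f by move=> f0 f1; rewrite /s1 !upd_fld.
have s1e a f : a != e -> s1 a f = s a f by move=> ae; rewrite /s1 !upd_adr.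
apply: runs_seq; apply: runs_LINK => //=; rewrite ?r11 ?r12 ?s1E //.
apply: runs_seq; apply: runs_assign => //=; rewrite r11.
apply: runs_seq; apply: runs_assign => //=; rewrite r13.
apply: runs_seq; apply: runs_assign; first by sf; rewrite r12.
rewrite /= r12 link_fld // s1E //.
set s2 := link s1 2 h e.
have s2E a f : a != e -> f \notin [:: 2; 3] -> s2 a f = s a f.
  by rewrite !inE negb_or => ae /andP[f2 f3]; rewrite /s2 link_fld // s1e.
have s2F a f : f \notin [:: 0; 1; 2; 3] -> s2 a f = s a f.
  by rewrite !inE !negb_or => /and4P[f0 f1 f2 f3]; rewrite /s2 link_fld // s1E.
have HO2 : OS K n s2 [::] Bk (items E) (own s) (lab s) cl tl.
  apply: os_frame HO _ _ _ _ => // [a f _ f4|b bB].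
    by rewrite s2F // !inE; apply/negP => /or4P[] /eqP E1; rewrite E1 in f4.
  by rewrite s2E //; apply: contraNneq eB => <-.
(* No bucket is empty, so each label in the chain of [t] is the level of the head of some out-edge
   of [t]; vertices are owned by the root and do not occur here. *)
have leM : {in cl t, forall b, s2 b 11 <= M}.
  move=> b; rewrite (os_cl HO) ?(ltnW tn) // => /andP[bB /eqP b1]; rewrite s2F //.
  have [y yJ [y6 ->]] := gi_labels (MkGI HI HO HE) bB.
  have [_ o1 _ _] := os_J HO yJ; rewrite y6 b1 in o1.
  move: yJ; rewrite mem_items => /orP[yn|yE]; last exact: HM.
  by move: o1; rewrite /own; have [_ ->] := il_v HI yn => E1; rewrite E1 ltnn in tn.
have [LK LW] := il_K HI hn.
apply: (runs_FILE PW W16 K0 (y := e) (u := t) (T := s h 13) (M := M) HO2 HE) => //=.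
- exact: ltnW.
- exact: ltnW.
- by move=> b bB; rewrite s2F // (gi_lbW (MkGI HI HO HE)).
move=> r3 s3 A3 Bk3 cl3 tl3 d3 H3 E3 SB sz lb3 kp Hr3 dle1 dle2.
have pJ : perm_eq (e :: items E) (items (e :: E)).
  by rewrite /items -cat1s perm_catCA.
have s3E a f : a \in O -> ~~ (4 <= f <= 11) -> a != e -> f \notin [:: 2; 3] -> s3 a f = s a f.
  by move=> aO f4 ae f2; rewrite kp // s2E.
have inO a : (a < n) || (a \in E) -> a \in O by rewrite -mem_items; apply: JO.
have nen a : (a < n) || (a \in E) -> a != e by rewrite -mem_items; apply: neJ.
have s30 : s3 e 0 = h by rewrite kp // /s2 link_fld // /s1 /upd !eqxx.
have s31 : s3 e 1 = t by rewrite kp // /s2 link_fld // /s1 /upd !eqxx.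
have vO v : v < n -> v \in O by move=> vn; apply: inO; rewrite vn.
have ve v : v < n -> v != e by move=> vn; apply: nen; rewrite vn.
have EO a : a \in E -> a \in O by move=> vn; apply: inO; rewrite vn orbT.
have Ee a : a \in E -> a != e by move=> vn; apply: nen; rewrite vn orbT.
apply: (q _ _ _ Bk3 cl3 tl3) => //.
- split; last first.
  + case: E3 => e1 e2 e3 e4; split=> // a; rewrite -(perm_mem pJ); exact: e4.
  + have := os_perm pJ H3; move=> H4; apply: os_frame H4 _ _ _ _ => // y; rewrite -(perm_mem pJ) inE.
      case: eqP => [-> _|/eqP ye /= yJ]; first by rewrite /own s31.
      by rewrite /own s3E //; apply: JO.
    case: eqP => [-> _|/eqP ye /= yJ]; first by rewrite /lab s30 s3E ?vO ?ve.
    have yn := il_lab HI yJ.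
    by rewrite /lab (s3E y) ?(JO _ yJ) // s3E ?vO ?ve.
  split.
  + by move=> v vn; rewrite !s3E ?vO ?ve //; apply: (il_v HI).
  + move=> a; rewrite inE => /orP[/eqP->|aE]; first by rewrite s30 s31.
    by rewrite !s3E ?EO ?Ee //; apply: (il_e HI).
  + move=> v vn.
    have K3 l : {in v :: l, forall a, a \in O} -> cyc s2 2 v l -> cyc s3 2 v l.
      by move=> lO; apply: cyc_frame => a /lO aO; rewrite !kp.
    have c1 w l : cyc s 2 w l -> cyc s1 2 w l by apply: cyc_frame => a _; rewrite !s1E.
    have xe w : w < n -> e \notin w :: sc w ++ un w.
      by move=> wn; apply/negP => /(il_list_mem HI wn)/nen; rewrite eqxx.
    apply: K3.
      move=> a; have := il_list_mem HI vn (a := a); case: (eqVneq v h) => [->|vh] h' al.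
        move: al; rewrite cat_cons !inE => /or3P[h1|/eqP->//|h1]; apply: inO; apply: (il_list_mem HI hn).
          by rewrite inE h1.
        by rewrite inE h1 orbT.
      by apply: inO; apply: h'.
    case: (eqVneq v h) => [->|vh].
      by apply: (cyc_link (l1 := [::])) => //; [apply: xe | apply: c1].
    apply: (cyc_link_other (c1 _ _ C) _ (c1 _ _ (il_c HI vn))); first by rewrite inE eqxx.
    move=> a av; rewrite inE negb_or; apply/andP; split.
      by apply: contraTneq av => ->; apply: xe.
    by apply: contraNN vh => ah; apply/eqP; apply: (il_disj HI vn hn av ah).
  + move=> v vn; case: eqP => [->|_]; last exact: (il_u HI).
    by rewrite /= (il_u HI) // andbT (il_m HI) // (negbTE eE).
  + move=> v a vn; rewrite inE; case: (eqVneq a e) => [->|ae] /=.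
      rewrite s30 eq_sym; case: (eqVneq v h) => [_|_]; first by rewrite inE eqxx.
      by rewrite (il_m HI) // (negbTE eE).
    have -> : (a \in (if v == h then e :: sc v else sc v) ++ un v) = (a \in sc v ++ un v).
      by case: eqP => // _; rewrite inE (negbTE ae).
    rewrite (il_m HI) //; case aE: (a \in E) => //=; by rewrite s3E // EO.
  + by move=> v vn; rewrite s3E ?vO ?ve // (il_cu HI).
  + by move=> v vn; rewrite s3E ?vO ?ve //; apply: (il_K HI).
- move=> a f aO f4 /orP[/andP[ae f2]|/andP[na aE]].
    by rewrite s3E //; move: f2; rewrite !inE !negb_or => /and3P[-> ->].
  move: aE; rewrite inE negb_or => /andP[ae aE]; rewrite kp //.
  rewrite /s2 /link !upd_adr ?s1e //.
    by apply: contraTneq na => ->; rewrite -ltnNge.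
  apply/eqP => E1; have := il_list_mem HI hn (cyc_next_mem C (mem_head _ _)).
  by rewrite -E1 (negbTE aE) orbF ltnNge na.
  by rewrite eq_sym.
- by move=> x x20; rewrite Hr3 //= !(lt_neq x20).
- by move: dle1; clear; lia.
- by move: dle2; move: (M %/ K) => a; clear; lia.
Qed.

(** The first items of the buckets are distinct. With it, a bound on the number of items bounds the
    whole space. *)
Lemma os_size s Bk J ow lb cl tl :
  OS K n s [::] Bk J ow lb cl tl -> size Bk <= size J.
Proof.
move=> H; have hd b : b \in Bk -> head 0 (tl b) \in tl b.
  by move=> bB; have := os_ne H bB isT; case: (tl b) => //= y m _; rewrite inE eqxx.
rewrite -(size_map (fun b => head 0 (tl b))); apply: uniq_leq_size.
  rewrite map_inj_in_uniq; first exact: os_uB H.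
  move=> b b' bB bB' E.
  by apply: (os_items_disj H bB bB' (a := head 0 (tl b))); rewrite inE ?hd ?E ?hd ?orbT.
by move=> y /mapP[b bB ->]; have := hd b bB; rewrite (os_tl H) // => /andP[].
Qed.

Lemma env_size A O Bk E ow lb cl tl s :
  OS K n s [::] Bk (items E) ow lb cl tl -> env n A O Bk (items E) ->
  size A <= size O + (n + size E).
Proof.
move=> H [pA _ _ _]; rewrite (perm_size pA) size_cat leq_add2l.
by apply: leq_trans (os_size H) _; rewrite size_cat size_iota.
Qed.

(** In the course of a relabelling, cell 13 of [x] already has the new level while the items headed
    by [x] move one at a time, so [lab] does not yet describe the buckets. *)
Definition midlab (s : store) (x T T0 : nat) (done : seq nat) (z : nat) : nat :=
  if s z 0 == x then if z \in done then T else T0 else lab s z.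

Lemma relabel_step x T T0 O E y done r s A Bk cl tl sc un (Q : _ -> _ -> _ -> _ -> Prop) :
  IL s E sc un -> x < n -> s x 13 = T -> y \in x :: sc x ++ un x -> y \notin done ->
  OS K n s [::] Bk (items E) (own s) (midlab s x T T0 done) cl tl ->
  env n A O Bk (items E) -> T <= T0.+1 -> T0 <= T.+1 ->
  {in Bk, forall b, (s b 11).+1 < W} ->
  r 10 = K -> r 14 = x -> r 15 = y ->
  blksize * (size O + (n + size E)).+1 <= P ->
  (forall r' s' A' Bk' cl' tl' dt,
     IL s' E sc un -> OS K n s' [::] Bk' (items E) (own s') (midlab s' x T T0 (rcons done y)) cl' tl' ->
     env n A' O Bk' (items E) -> {in Bk', forall b, (s' b 11).+1 < W} -> keeps s s' O ->
     (forall k, k < 15 -> r' k = r k) -> r' 15 = s y 2 ->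
     r' 16 = (if s y 2 == x then 0 else r 16) ->
     dt <= 158 -> Q r' s' A' dt) ->
  runs W P RELABEL_STEP r s A Q.
Proof.
move=> HI xn Tx yl yd H HE T1 T2 lbW r10 r14 r15 PO q.
have [OA BA BO] := env_mem HE; have [pA U nO JO] := HE.
have xO : x \in O by apply: nO; apply: ltnW.
have yJ : y \in items E by rewrite mem_items; apply: (il_list_mem HI xn).
have yO := JO _ yJ; have yA := OA _ yO.
have y0 : s y 0 = x.
  by move: yl; rewrite inE => /orP[/eqP->|]; [have [] := il_v HI xn | rewrite (il_m HI) // => /andP[_ /eqP]].
have [LK LW] := il_K HI xn; rewrite Tx in LK LW.
apply: runs_seq; apply: runs_assign => //=; rewrite r15.
apply: runs_seq; apply: runs_assign; first by sf; rewrite r14; apply: OA.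
rewrite /= r14 Tx.
apply: runs_seq; apply: (runs_REFILE PW W16 K0 (y := y) (T := T) H HE yJ) => //=.
- exact: ltnW.
- by rewrite /midlab y0 eqxx (negbTE yd).
- by rewrite /midlab y0 eqxx (negbTE yd).
- by apply: leq_trans PO; rewrite leq_mul2l /= ltnS (env_size H HE).
move=> r2 s2 A2 Bk2 cl2 tl2 d2 H2 E2 sz lb2 kp Hr2 dle.
have inO a : (a < n) || (a \in E) -> a \in O by rewrite -mem_items; apply: JO.
have HI2 : IL s2 E sc un.
  apply: il_frame HI _ => a f /inO aO fin; apply: kp => //.
  by move: fin; rewrite !inE; repeat case/orP; move=> /eqP->.
have e2 : s2 y 2 = s y 2 by rewrite kp.
have [OA2 BA2 BO2] := env_mem E2.
have k0 z : z \in items E -> s2 z 0 = s z 0 by move=> zJ; rewrite kp // JO.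
have H3 : OS K n s2 [::] Bk2 (items E) (own s2) (midlab s2 x T T0 (rcons done y)) cl2 tl2.
  apply: os_frame H2 _ _ _ _ => // z zJ; first by rewrite /own kp ?JO.
  rewrite /midlab mem_rcons inE k0 //; case: (eqVneq z y) => [->|_] /=; first by rewrite y0 eqxx.
  by case: eqP => // _; rewrite /lab k0 // kp // JO // mem_items (il_lab HI zJ).
apply: runs_seq; apply: runs_assign; first by sf; rewrite Hr2 //= r15; apply: OA2.
have r215 : r2 15 = y by rewrite Hr2.
have r214 : r2 14 = x by rewrite Hr2.
rewrite /= r215 e2.
apply: runs_if_eqe; first by sf.
all: rewrite /= r214 => Ex.
- apply: runs_assign; first by sf.
  apply: (q _ _ _ Bk2 cl2 tl2) => //=.
  + move=> k k15; rewrite (ltn_eqF k15) (lt_neq k15) // Hr2 //=; last exact: ltn_trans k15 _.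
    by rewrite !(lt_neq k15).
  + by rewrite Ex eqxx.
  + by move: dle; clear; lia.
- apply: runs_skip; apply: (q _ _ _ Bk2 cl2 tl2) => //=.
  + move=> k k15; rewrite (ltn_eqF k15) Hr2 //=; last exact: ltn_trans k15 _.
    by rewrite !(lt_neq k15).
  + by rewrite (negbTE Ex) Hr2.
  + by move: dle; clear; lia.
Qed.

(** The current node may be the sentinel itself, which is where a relabelling starts; this is the
    case of an empty [d]. *)
Lemma cyc_next_cons s f x c d y m :
  cyc s f x c -> x :: c = d ++ y :: m -> s y f = head x m.
Proof.
case: d => [|z d] C /= [E1 E2]; first by rewrite -E1 -E2; apply: (cyc_next (l1 := [::]) C).
by move: C; rewrite E2 -cat_rcons => /cyc_next; rewrite last_rcons.
Qed.

Lemma relabel_loop x T T0 O E rest : forall y done r s A Bk cl tl sc un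
   (Q : _ -> _ -> _ -> _ -> Prop),
  IL s E sc un -> x < n -> s x 13 = T -> x :: sc x ++ un x = done ++ y :: rest ->
  OS K n s [::] Bk (items E) (own s) (midlab s x T T0 done) cl tl ->
  env n A O Bk (items E) -> T <= T0.+1 -> T0 <= T.+1 ->
  {in Bk, forall b, (s b 11).+1 < W} ->
  r 10 = K -> r 14 = x -> r 15 = y -> r 16 != 0 ->
  blksize * (size O + (n + size E)).+1 <= P ->
  (forall r' s' A' Bk' cl' tl' dt,
     GI s' A' O E Bk' sc un cl' tl' -> keeps s s' O ->
     (forall k, k < 15 -> r' k = r k) ->
     dt <= 160 * size (y :: rest) + 1 -> Q r' s' A' dt) ->
  runs W P (While (Var 16) RELABEL_STEP) r s A Q.
Proof.
elim: rest => [|y' rest IH] y done r s A Bk cl tl sc un Q HI xn Tx El H HE T1 T2 lbW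
  r10 r14 r15 r16 PO q.
all: have yl : y \in x :: sc x ++ un x by rewrite El mem_cat inE eqxx orbT.
all: have UU := il_uniq HI xn; have C := il_c HI xn.
all: have xO : x \in O by [have [_ _ nO _] := HE; apply: nO; apply: ltnW].
all: have yd : y \notin done by
  [move: UU; rewrite El cat_uniq => /and3P[_ /hasPn h _]; apply: h; rewrite inE eqxx].
all: apply: runs_while => //; first by rewrite /= => h; rewrite h in r16.
all: move=> _; apply: (relabel_step HI xn Tx yl yd H HE) => //.
all: move=> r2 s2 A2 Bk2 cl2 tl2 d2 HI2 H2 E2 lb2 kp Hr2 r215 r216 dle.
all: have in2 z : z \in items E -> s2 z 0 = x -> z \in x :: sc x ++ un x by
  [rewrite mem_items => /orP[zn|zE] z0; [have [] := il_v HI2 zn; rewrite z0 => <-; rewrite inE eqxx |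
   rewrite inE (il_m HI2) // zE z0 eqxx orbT]].
- have e2 : s y 2 = x by rewrite (cyc_next_cons C El).
  rewrite e2 eqxx in r216.
  apply: runs_while => //=; last by rewrite r216.
  move=> _; apply: (q _ _ _ Bk2 cl2 tl2) => //.
  + split=> //; apply: os_frame H2 _ _ _ _ => // z zJ.
    rewrite /midlab; case: eqP => // z0; rewrite /lab z0 kp // Tx.
    by have := in2 z zJ z0; rewrite El cats1 => ->.
  + by move: dle; clear; rewrite /=; lia.
- have e2 : s y 2 = y' by rewrite (cyc_next_cons C El).
  have y'x : (y' == x) = false.
    apply/negP => /eqP E1; move: UU; rewrite cons_uniq => /andP[+ _].
    by move: El; case: (done) => [|z d] [Ea Eb]; rewrite Eb E1 ?mem_cat !inE eqxx ?orbT.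
  rewrite e2 y'x in r216; rewrite e2 in r215.
  apply: (IH y' (rcons done y) _ _ _ Bk2 cl2 tl2 sc un) => //.
  + by rewrite kp.
  + by rewrite El cat_rcons.
  + by rewrite Hr2.
  + by rewrite Hr2.
  + by rewrite r216.
  move=> r3 s3 A3 Bk3 cl3 tl3 d3 H3 kp3 Hr3 dle3.
  apply: (q _ _ _ Bk3 cl3 tl3) => //.
  + by move=> a f aO fN; rewrite kp3 // kp.
  + by move=> k k15; rewrite Hr3 // Hr2.
  + by move: dle dle3; clear; rewrite /=; lia.
Qed.

(** After a change of level all in-edges count as unscanned again; [Pot] charges this to the same
    term that pays for the relabelling. *)
Lemma il_reset s E sc un x :
  IL s E sc un -> x < n ->
  IL (upd s x 15 (s x 2)) E (fun v => if v == x then [::] else sc v)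
    (fun v => if v == x then sc x ++ un x else un v).
Proof.
move=> H xn; set s' := upd _ _ _ _.
have E1 a f : f != 15 -> s' a f = s a f by move=> f15; rewrite /s' upd_fld.
have ifE v : (if v == x then [::] else sc v) ++ (if v == x then sc x ++ un x else un v) = sc v ++ un v.
  by case: eqP => // ->.
split.
- by move=> v vn; rewrite !E1 //; apply: (il_v H).
- by move=> e eE; rewrite !E1 //; apply: (il_e H).
- by move=> v vn; rewrite ifE; apply: cyc_frame (il_c H vn) => a _; rewrite !E1.
- by move=> v vn; rewrite ifE; apply: (il_u H).
- by move=> v e vn; rewrite ifE E1 //; apply: (il_m H).
- move=> v vn; case: eqP => [->|/eqP vx].
    by rewrite /s' upd_eq; apply: (cyc_next (l1 := [::]) (il_c H xn)).
  by rewrite /s' upd_adr // (il_cu H).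
- by move=> v vn; rewrite !E1 //; apply: (il_K H).
Qed.

Lemma runs_RELABEL r s A O E Bk sc un cl tl x T T0 (Q : _ -> _ -> _ -> _ -> Prop) :
  IL s E sc un -> x < n -> s x 13 = T ->
  OS K n s [::] Bk (items E) (own s) (midlab s x T T0 [::]) cl tl ->
  env n A O Bk (items E) -> T <= T0.+1 -> T0 <= T.+1 ->
  {in Bk, forall b, (s b 11).+1 < W} ->
  r 10 = K -> r 14 = x ->
  blksize * (size O + (n + size E)).+1 <= P ->
  (forall r' s' A' Bk' cl' tl' dt,
     GI s' A' O E Bk' (fun v => if v == x then [::] else sc v)
       (fun v => if v == x then sc x ++ un x else un v) cl' tl' ->
     keeps (upd s x 15 (s x 2)) s' O ->
     (forall k, k < 15 -> r' k = r k) ->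
     dt <= 160 * (size (sc x ++ un x)).+1 + 10 -> Q r' s' A' dt) ->
  runs W P RELABEL r s A Q.
Proof.
move=> HI xn Tx H HE T1 T2 lbW r10 r14 PO q.
have [OA BA BO] := env_mem HE; have [pA U nO JO] := HE.
have xA : x \in A by apply: OA; apply: nO; apply: ltnW.
apply: runs_seq; apply: runs_adr => //; rewrite ?r14 //; first by sf; rewrite r14.
rewrite /= r14; set s1 := upd _ _ _ _.
have HI1 := il_reset HI xn; rewrite -/s1 in HI1.
apply: runs_seq; apply: runs_assign => //=.
apply: runs_seq; apply: runs_assign; first by sf.
have E1 a f : f != 15 -> s1 a f = s a f by move=> f15; rewrite /s1 upd_fld.
apply: (relabel_loop (x := x) (T := T) (T0 := T0) (O := O) (y := x) (done := [::])
  (rest := sc x ++ un x) (Bk := Bk) (cl := cl) (tl := tl) HI1) => //=.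
- by rewrite E1.
- by rewrite eqxx.
- apply: os_frame H _ _ _ _ => // [a f _ f4|b bB|z zJ|z zJ]; first by rewrite E1 //; apply: contraTneq f4 => ->.
  by rewrite E1.
  by rewrite /own E1.
  by rewrite /midlab /lab !E1.
- by move=> b bB; rewrite E1 // lbW.
move=> r2 s2 A2 Bk2 cl2 tl2 d2 H2 kp Hr2 dle.
apply: (q _ _ _ Bk2 cl2 tl2) => //.
- by move=> k k15; rewrite Hr2 //= !(lt_neq k15).
- by move: dle; clear; lia.
Qed.
End GraphOps.

(** * Thresholds and stable orientations *)

Section Thresholds.
Variables K B : nat.
Hypothesis K0 : 0 < K.

Definition nxt (t : nat) : nat := t + t %/ K + 1.
Definition prv (t : nat) : nat := t - 1 - (t - 1) %/ (K + 1).

(* The degrees at which the levels begin; they grow by the factor [1 + 1/K] and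
   are computed in both directions by integer arithmetic. *)
Fixpoint thr (i : nat) : nat := if i is j.+1 then nxt (thr j) else B.

(** With [t = q * K + r] and [r < K], one has [t + q = q * (K + 1) + r], so division by [K + 1]
    recovers [q]. Hence a descending vertex finds its previous threshold without any table. *)
Lemma nxtK t : prv (nxt t) = t.
Proof.
have E : t + t %/ K = t %/ K * (K + 1) + t %% K.
  by rewrite mulnDr muln1 addnAC -divn_eq.
have Q : (t + t %/ K) %/ (K + 1) = t %/ K.
  rewrite E addn1 divnMDl // [_ %/ K.+1]divn_small ?addn0 //.
  by rewrite ltnS ltnW // ltn_pmod.
by rewrite /prv /nxt addnK Q addnK.
Qed.

Lemma thrS i : thr i < thr i.+1.
Proof. by rewrite /= /nxt addn1 ltnS leq_addr. Qed.

Lemma thr_mono i j : i <= j -> thr i <= thr j.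
Proof. by move=> /subnK <-; elim: (j - i) => // m IH; apply: leq_trans IH (ltnW (thrS _)). Qed.

Lemma thr_lt i j : i < j -> thr i < thr j.
Proof. by move=> ij; apply: leq_trans (thrS i) (thr_mono ij). Qed.

Lemma thr_ge i : i + B <= thr i.
Proof. by elim: i => // i IH; apply: leq_trans (thrS i); rewrite addSn ltnS. Qed.

Lemma nxt_le t : nxt t <= 2 * t + 1.
Proof. by rewrite /nxt leq_add2r mul2n -addnn leq_add2l leq_div. Qed.

(** The gap is [t %/ K + 1], which exceeds [t / K]. A vertex that has moved across one gap has
    therefore earned [K] times the gap, enough to visit all its in-edges. *)
Lemma nxt_gap t : t <= K * (nxt t - t).
Proof.
rewrite /nxt -addnA addnC addnK addn1.
by rewrite {1}(divn_eq t K) mulnC mulnS addnC leq_add2r ltnW // ltn_pmod.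
Qed.

(** Gaps do not decrease, so [j] steps gain at least [j] times the first gap. *)
Lemma thr_lin i j : thr i + j * (nxt (thr i) - thr i) <= thr (i + j).
Proof.
elim: j => [|j IH]; first by rewrite mul0n !addn0.
rewrite addnS mulSn addnCA /=.
have le : thr i <= thr (i + j) by apply: thr_mono; rewrite leq_addr.
apply: leq_trans (_ : (nxt (thr i) - thr i) + thr (i + j) <= _); first by rewrite leq_add2l.
rewrite /nxt -!addnA [thr i + _]addnC addnK addnC leq_add2l leq_add2r.
exact: leq_div2r.
Qed.

Lemma thr_dbl i : 2 * thr i <= thr (i + K).
Proof.
apply: leq_trans (thr_lin i K); rewrite mul2n -addnn leq_add2l; exact: nxt_gap.
Qed.

(** Doubling every [K] levels; this is what limits the number of levels to the order of [K] times a
    logarithm. *)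
Lemma thr_pow j : 2 ^ j * B.+1 <= thr (K * j.+1).
Proof.
elim: j => [|j IH]; last first.
  rewrite expnS -mulnA [K * j.+2]mulnS [K + _]addnC; apply: leq_trans (thr_dbl _).
  by rewrite leq_mul2l.
rewrite expn0 mul1n muln1; apply: leq_trans (thr_ge K); rewrite -[B.+1]add1n leq_add2r //.
Qed.

(* The number of thresholds that do not exceed [x]. *)
Definition fl (x : nat) : nat := find (fun j => x < thr j) (iota 0 x.+2).

(** The range of [find] is long enough because [thr j] is at least [j]; in particular [thr x.+1]
    exceeds [x]. *)
Lemma flP j x : (j < fl x) = (thr j <= x).
Proof.
have h : has (fun j => x < thr j) (iota 0 x.+2).
  apply/hasP; exists x.+1; first by rewrite mem_iota /=.
  by apply: leq_trans (thr_ge _); rewrite leq_addr.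
have fx : fl x < x.+2 by rewrite -[X in _ < X](size_iota 0) -has_find.
have := nth_find 0 h; rewrite -/(fl x) nth_iota // add0n => gt.
apply/idP/idP => [lt|le].
  have := before_find 0 lt; rewrite nth_iota ?(ltn_trans lt) // add0n => /negbT.
  by rewrite -leqNgt.
rewrite ltnNge; apply/negP => /thr_mono h2.
by have := leq_trans gt (leq_trans h2 le); rewrite ltnn.
Qed.

Lemma fl_le x y : x <= y -> fl x <= fl y.
Proof.
move=> xy; rewrite leqNgt flP; apply/negP => /leq_trans /(_ xy); by rewrite -flP ltnn.
Qed.

Lemma fl_lt x : x < thr (fl x).
Proof. by rewrite ltnNge -flP ltnn. Qed.

Lemma flS x : fl x.+1 <= (fl x).+1.
Proof.
rewrite leqNgt flP; apply/negP => h.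
have := thrS (fl x); have := fl_lt x; lia.
Qed.

Lemma fl_pred x : fl x <= (fl x.-1).+1.
Proof. by case: x => [|x] //=; apply: flS. Qed.

Lemma fl_thr i : fl (thr i) = i.+1.
Proof.
apply/eqP; rewrite eqn_leq flP leqnn andbT leqNgt flP -ltnNge; exact: thrS.
Qed.

Lemma fl_thr_pred i : 0 < i -> fl (thr i).-1 = i.
Proof.
case: i => // i _; have := thrS i; case E : (thr i.+1) => [|t] //= lt.
by apply/eqP; rewrite eqn_leq leqNgt !flP E ltnn.
Qed.

End Thresholds.

Lemma thrE K B i : thr K B i.+1 = nxt K (thr K B i).
Proof. by []. Qed.

Arguments thr : simpl never.

(** * The potential of an orientation and the comparison of stable orientations *)

Section Orientations.
Variables (K B n : nat).
Hypothesis K0 : 0 < K.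
Notation fl := (fl K B).
Notation thr := (thr K B).

Definition Fpot (x : nat) : nat := \sum_(0 <= y < x) fl y.

Lemma FpotS x : Fpot x.+1 = Fpot x + fl x.
Proof. by rewrite /Fpot big_nat_recr. Qed.

Definition vsum (g : nat -> nat) : nat := \sum_(v <- iota 0 n) g v.

Lemma eq_vsum g g' : (forall v, v < n -> g v = g' v) -> vsum g = vsum g'.
Proof.
move=> H; apply: eq_big_seq => v; rewrite mem_iota /= => vn; exact: H.
Qed.

Lemma leq_vsum g g' : (forall v, v < n -> g v <= g' v) -> vsum g <= vsum g'.
Proof.
move=> H; rewrite /vsum !big_seq; apply: leq_sum => v; rewrite mem_iota /=; exact: H.
Qed.

Lemma vsum_upd g g' x : x < n -> (forall v, v < n -> v != x -> g' v = g v) ->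
  vsum g' + g x = vsum g + g' x.
Proof.
move=> xn H; have xi : x \in iota 0 n by rewrite mem_iota.
rewrite /vsum !(bigD1_seq x) ?iota_uniq //= addnAC [RHS]addnAC [g' x + g x]addnC.
congr (_ + _); rewrite big_seq_cond [RHS]big_seq_cond; apply: eq_bigr => v.
by rewrite mem_iota /= => /andP[vn vx]; apply: H.
Qed.

Definition deg (E : seq nat) (hd : nat -> nat) (v : nat) : nat := count (fun e => hd e == v) E.
Definition PF (E : seq nat) (hd : nat -> nat) : nat := vsum (fun v => Fpot (deg E hd v)).

Definition loopless (E : seq nat) (hd tl : nat -> nat) : Prop :=
  forall e, e \in E -> [/\ hd e < n, tl e < n & hd e != tl e].

Definition orient (E : seq nat) (hd tl hd' tl' : nat -> nat) : Prop :=
  forall e, e \in E -> (hd' e = hd e /\ tl' e = tl e) \/ (hd' e = tl e /\ tl' e = hd e).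

Definition stable (s : nat) (E : seq nat) (hd tl : nat -> nat) : Prop :=
  forall e, e \in E -> fl (deg E hd (hd e)) <= fl (deg E hd (tl e)) + s.

Lemma sum_deg E hd (A : seq nat) : uniq A ->
  \sum_(y <- A) deg E hd y = count (fun e => hd e \in A) E.
Proof.
move=> U; elim: E => [|e E IH] /=; first by rewrite big1_seq.
rewrite -IH; under eq_bigr do rewrite /deg /=.
rewrite big_split /=; congr (_ + _).
case: (boolP (hd e \in A)) => H.
  rewrite (bigD1_seq (hd e)) //= eqxx big1 //= => y; rewrite eq_sym => /negbTE->//.
by rewrite big1_seq // => y /andP[_ yA]; case: eqP => // E1; rewrite E1 yA in H.
Qed.

Lemma count_subseq (p q : pred nat) (E1 E2 : seq nat) :
  uniq E1 -> {subset E1 <= E2} -> (forall e, e \in E1 -> p e -> q e) ->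
  count p E1 <= count q E2.
Proof.
move=> U S H; rewrite -!size_filter; apply: uniq_leq_size; first exact: filter_uniq.
by move=> e; rewrite !mem_filter => /andP[pe eE]; rewrite S // H.
Qed.

Lemma pow_half_le (L m : nat) : 2 ^ L <= m -> n < 2 ^ L -> m <= n -> False.
Proof. by move=> h1 h2 h3; have := leq_trans h2 (leq_trans h1 h3); rewrite ltnn. Qed.

(* If [fl (d1 x)] were much larger than [fl (d2 x)], then the sets
   [{ y | fl (d1 y) >= fl (d1 x) - s j /\ fl (d2 y) <= fl (d2 x) + s j }] would double
   with every [j]: an edge with its first head in the [j]-th set has its second
   head in the next one, where the second degrees are at most half as large. *)
Lemma compare (L s : nat) E1 E2 hd1 tl1 hd2 tl2 x :
  0 < s -> n < 2 ^ L -> uniq E1 -> {subset E1 <= E2} -> loopless E1 hd1 tl1 ->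
  orient E1 hd1 tl1 hd2 tl2 -> stable s E1 hd1 tl1 -> stable s E2 hd2 tl2 ->
  x < n -> fl (deg E1 hd1 x) <= fl (deg E2 hd2 x) + (K + s * (2 * L).+1 + 1).
Proof.
move=> s0 nL U S Hp Ho St1 St2 xn; rewrite leqNgt; apply/negP => gap.
pose a := fl (deg E1 hd1 x); pose b := fl (deg E2 hd2 x).
pose p j y := (a <= fl (deg E1 hd1 y) + s * j) && (fl (deg E2 hd2 y) <= b + s * j).
pose A j := [seq y <- iota 0 n | p j y].
have UA j : uniq (A j) by rewrite filter_uniq // iota_uniq.
have dbl j : j < L -> 2 * size (A j) <= size (A j.+1).
  move=> jL.
  have lo : size (A j) * thr (a - s * j - 1) <= \sum_(y <- A j) deg E1 hd1 y.
    rewrite -sum1_size big_distrl /= !big_seq; apply: leq_sum => y.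
    rewrite mem_filter => /andP[/andP[h _] _]; rewrite mul1n -flP //.
    rewrite -/a -/b in gap *; move: h gap; nia.
  have hi : \sum_(y <- A j.+1) deg E2 hd2 y <= size (A j.+1) * thr (b + s * j.+1).
    rewrite -sum1_size big_distrl /= !big_seq; apply: leq_sum => y.
    rewrite mem_filter => /andP[/andP[_ h] _]; rewrite mul1n.
    by apply: ltnW; rewrite ltnNge -flP // -leqNgt.
  have mid : \sum_(y <- A j) deg E1 hd1 y <= \sum_(y <- A j.+1) deg E2 hd2 y.
    rewrite !sum_deg //; apply: count_subseq => // e eE.
    have [h1n t1n _] := Hp e eE; rewrite !mem_filter !mem_iota /= => /andP[/andP[q1 q2] _].
    have s1 := St1 e eE; have s2 := St2 e (S e eE).
    (* If [e] is directed differently in the two orientations, its second head is its first tail: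
       there [s1] bounds the first function from below and [s2] the second one from above. *)
    case: (Ho e eE) => [] [E3 E4]; rewrite E3 E4 in s2 *; rewrite ?h1n ?t1n andbT /p mulnS.
      by apply/andP; split; [move: q1|move: q2]; clear; lia.
    by apply/andP; split; [move: q1 s1|move: q2 s2]; clear; lia.
  (* By [gap] at least [K] thresholds lie between the two indices as long as [j < L], and [K]
     thresholds double the degree. *)
  have tt : 2 * thr (b + s * j.+1) <= thr (a - s * j - 1).
    apply: (@leq_trans (thr (b + s * j.+1 + K))); [exact: thr_dbl|apply: thr_mono].
    rewrite -/a -/b in gap; move: gap jL; nia.
  have t0 : 0 < thr (b + s * j.+1).
    have : 0 < b + s * j.+1 by rewrite addn_gt0 muln_gt0 s0 orbT.
    by case: (b + s * j.+1) => // i _; apply: leq_ltn_trans (thrS _ _ i).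
  rewrite -(leq_pmul2r t0); apply: leq_trans hi; apply: leq_trans mid; apply: leq_trans lo.
  by rewrite mulnAC mulnC leq_mul2l tt orbT.
have pw j : j <= L -> 2 ^ j <= size (A j).
  elim: j => [_|j IH jL].
    rewrite expn0 -has_predT; apply/hasP; exists x => //.
    by rewrite mem_filter mem_iota xn /p !muln0 !addn0 !leqnn.
  by rewrite expnS; apply: leq_trans (dbl j jL); rewrite leq_mul2l /= IH // ltnW.
have h := pw L (leqnn _); apply: (pow_half_le h nL).
by rewrite size_filter; apply: leq_trans (count_size _ _) _; rewrite size_iota.
Qed.

Lemma deg_rem E hd e v : uniq E -> e \in E ->
  deg E hd v = (hd e == v) + deg (rem e E) hd v.
Proof. by move=> U eE; rewrite /deg (permP (perm_to_rem eE)). Qed.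

Lemma deg_mem E hd hd' v : {in E, hd =1 hd'} -> deg E hd v = deg E hd' v.
Proof. by move=> H; apply: eq_in_count => e /H ->. Qed.

(** Flipping an unstable edge removes [fl] of the degree of the head minus one from [PF] and adds
    [fl] of the degree of the tail. The first is larger, since [fl] drops by at most one between
    consecutive degrees; so [PF] decreases and the process ends. *)
Lemma exists_stable_aux N E hd tl : uniq E -> loopless E hd tl -> PF E hd <= N ->
  exists hd' tl', [/\ orient E hd tl hd' tl', PF E hd' <= PF E hd & stable 1 E hd' tl'].
Proof.
elim: N hd tl => [|N IH] hd tl U Hp le.
all: case: (boolP (all (fun e => fl (deg E hd (hd e)) <= fl (deg E hd (tl e)) + 1) E)) =>
  [/allP st|/allPn[e eE]].
1,3: by exists hd, tl; split=> // e eE; left.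
all: rewrite -ltnNge => unst; have [hn tn ht] := Hp e eE.
all: pose hd1 x := if x == e then tl e else hd x; pose tl1 x := if x == e then hd e else tl x.
all: have d1 v : deg (rem e E) hd1 v = deg (rem e E) hd v by
  [apply: deg_mem => x; rewrite mem_rem_uniq // inE /hd1 => /andP[/negbTE->]].
all: have dv v : deg E hd1 v + (hd e == v) = deg E hd v + (tl e == v) by
  [rewrite !(deg_rem _ _ U eE) d1 {1}/hd1 eqxx; lia].
all: have dh : deg E hd (hd e) = (deg E hd1 (hd e)).+1 by
  [have := dv (hd e); rewrite eqxx [tl e == _]eq_sym (negbTE ht) addn0 addn1].
all: have dt : deg E hd1 (tl e) = (deg E hd (tl e)).+1 by
  [have := dv (tl e); rewrite eqxx (negbTE ht) addn0 addn1].
all: have lt : PF E hd1 < PF E hd.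
1,3: pose g v := Fpot (if v == tl e then deg E hd v else deg E hd1 v).
1,2: have s1 : PF E hd1 + g (tl e) = vsum g + Fpot (deg E hd1 (tl e)) by
  [apply: vsum_upd => // v _ vt; rewrite /g (negbTE vt)].
1,2: have s2 : PF E hd + g (hd e) = vsum g + Fpot (deg E hd (hd e)) by
  [apply: vsum_upd => // v _ vt; rewrite /g; case: (eqVneq v (tl e)) => // vt2;
   have := dv v; rewrite [hd e == v]eq_sym (negbTE vt) [tl e == v]eq_sym (negbTE vt2) !addn0 => ->].
1,2: have f1 := @flS K B K0 (deg E hd1 (hd e)).
1,2: move: s1 s2; rewrite /g eqxx (negbTE ht) dt dh !FpotS; rewrite dh in unst; move: unst f1; clear; lia.
- by move: lt; rewrite leqn0 in le; rewrite (eqP le).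
have Ho1 : orient E hd tl hd1 tl1.
  by move=> x xE; rewrite /hd1 /tl1; case: eqP => [->|_]; [right|left].
have Hp1 : loopless E hd1 tl1.
  by move=> x xE; have [? ? ?] := Hp x xE; rewrite /hd1 /tl1; case: eqP => [E1|_] //; rewrite eq_sym.
have [|hd2 [tl2 [Ho2 le2 st2]]] := IH hd1 tl1 U Hp1; first by rewrite -ltnS; apply: leq_trans lt le.
exists hd2, tl2; split=> //; last exact: leq_trans le2 (ltnW lt).
by move=> x xE; case: (Ho1 x xE) (Ho2 x xE) => [] [-> ->] [] []; [left|right|right|left].
Qed.

Lemma exists_stable E hd tl : uniq E -> loopless E hd tl ->
  exists hd' tl', [/\ orient E hd tl hd' tl', PF E hd' <= PF E hd & stable 1 E hd' tl'].
Proof. by move=> U Hp; apply: exists_stable_aux U Hp (leqnn _). Qed.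

Lemma orient_sym E hd tl hd' tl' : orient E hd tl hd' tl' -> orient E hd' tl' hd tl.
Proof. by move=> H e /H [] [-> ->]; [left|right]. Qed.

Lemma orient_trans E hd tl hd' tl' hd'' tl'' :
  orient E hd tl hd' tl' -> orient E hd' tl' hd'' tl'' -> orient E hd tl hd'' tl''.
Proof. by move=> H1 H2 x xE; case: (H1 x xE) (H2 x xE) => [] [-> ->] [] []; [left|right|right|left]. Qed.

Lemma orient_proper E hd tl hd' tl' : orient E hd tl hd' tl' -> loopless E hd tl -> loopless E hd' tl'.
Proof. by move=> H1 H2 x xE; have [? ? ?] := H2 x xE; case: (H1 x xE) => [] [-> ->] //; rewrite eq_sym. Qed.

Lemma stable_le s s' E hd tl : s <= s' -> stable s E hd tl -> stable s' E hd tl.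
Proof. by move=> h H e /H h2; apply: leq_trans h2 _; rewrite leq_add2l. Qed.

Lemma PF_cons e E hd : hd e < n -> PF (e :: E) hd = PF E hd + fl (deg E hd (hd e)).
Proof.
move=> hn; have H v : v < n -> v != hd e -> Fpot (deg (e :: E) hd v) = Fpot (deg E hd v).
  by move=> _ /negbTE vh; rewrite /deg /= eq_sym vh.
have := vsum_upd hn H; rewrite /PF [deg (e :: E) hd (hd e)]/= eqxx add1n FpotS.
by rewrite -/(deg E hd (hd e)); clear; lia.
Qed.

Lemma PF_perm E E' hd : perm_eq E E' -> PF E hd = PF E' hd.
Proof. by move=> p; apply: eq_vsum => v _; rewrite /deg (permP p). Qed.

(** The bound of [compare] for [s = 5]. The maintained orientation is 5-stable: the level of a head
    exceeds that of the tail by at most 2, and [fl] of a degree is between the level and the level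
    plus 3. *)
Definition slack (L : nat) : nat := K + 5 * (2 * L).+1 + 1.

(** A rival orientation of the larger graph is first made stable, which does not raise its [PF].
    Then [compare], applied at the rival head of [e], bounds what [e] adds to the own potential by
    what it adds to the rival one plus [slack L + 4]: 3 for the choice between the two ends of [e],
    1 for counting [e] itself. *)
Lemma insert_pot L E hd tl e hd' tl' Y Z c :
  n < 2 ^ L -> uniq (e :: E) -> loopless (e :: E) hd tl -> stable 5 E hd tl ->
  fl (deg E hd (hd e)) <= fl (deg E hd (tl e)) + 3 -> orient (e :: E) hd tl hd' tl' ->
  (forall hd'' tl'', orient E hd tl hd'' tl'' -> Z + c * PF E hd <= Y + c * PF E hd'') ->
  Z + c * (PF E hd + fl (deg E hd (hd e))) <= Y + c * (slack L + 4) + c * PF (e :: E) hd'.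
Proof.
move=> nL U Hp St le Ho H; have Hp' := orient_proper Ho Hp.
have [h2 [t2 [Ho2 le2 st2]]] := exists_stable U Hp'.
have Ho3 := orient_trans Ho Ho2; have SE : {subset E <= e :: E} by move=> x xE; rewrite inE xE orbT.
have Ho4 : orient E hd tl h2 t2 by move=> x /SE; apply: Ho3.
have uE : uniq E by case/andP: U.
have [hn2 _ _] := orient_proper Ho3 Hp (mem_head e E).
have C := compare (L := L) (s := 5) isT nL uE SE (fun x xE => Hp x (SE x xE)) Ho4 St (stable_le _ st2) hn2.
have {}C := C isT; rewrite -/(slack L) in C.
have e1 : fl (deg (e :: E) h2 (h2 e)) <= (fl (deg E h2 (h2 e))).+1.
  by rewrite {1}/deg /= eqxx add1n; apply: flS.
have e2 : fl (deg E hd (hd e)) <= fl (deg E hd (h2 e)) + 3.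
  by case: (Ho3 e (mem_head e E)) => [] [-> _]; rewrite ?leq_addr.
have := H _ _ Ho4; rewrite PF_cons // in le2.
have e3 : fl (deg E hd (hd e)) <= fl (deg E h2 (h2 e)) + (slack L + 4).
  by move: C e1 e2; move: (slack L) => X; clear; lia.
have : c * (PF E h2 + fl (deg E hd (hd e))) <= c * (slack L + 4) + c * PF (e :: E) hd'.
  rewrite -mulnDr leq_mul2l; apply/orP; right.
  by move: e3 le2; move: (slack L) => X; clear; lia.
rewrite !mulnDr; clear; lia.
Qed.

(** Here the stabilised rival lives on the smaller graph; it is extended by [e] as currently
    directed, and [compare] is used with the roles exchanged. *)
Lemma delete_pot L E hd tl e hd' tl' Y Z c :
  n < 2 ^ L -> uniq E -> e \in E -> loopless E hd tl -> stable 5 E hd tl ->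
  orient (rem e E) hd tl hd' tl' ->
  (forall hd'' tl'', orient E hd tl hd'' tl'' -> Z + c * PF E hd <= Y + c * PF E hd'') ->
  Z + c * PF E hd <=
    Y + c * (slack L + 1) + c * fl (deg E hd (hd e)).-1 + c * PF (rem e E) hd'.
Proof.
move=> nL U eE Hp St Ho H; have SE : {subset rem e E <= E} by move=> x; apply: mem_rem.
have uE := rem_uniq e U; have Hp0 : loopless (rem e E) hd tl by move=> x /SE; apply: Hp.
have [h2 [t2 [Ho2 le2 st2]]] := exists_stable uE (orient_proper Ho Hp0).
have Ho3 := orient_trans Ho Ho2.
pose h3 x := if x == e then hd e else h2 x; pose t3 x := if x == e then tl e else t2 x.
have Ho4 : orient E hd tl h3 t3.
  move=> x xE; rewrite /h3 /t3; case: eqP => [->|/eqP xe]; first by left.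
  by apply: Ho3; rewrite mem_rem_uniq // inE xe.
have [hn _ _] := Hp e eE.
have C := compare (L := L) (s := 5) isT nL uE SE (orient_proper Ho3 Hp0) (orient_sym Ho3) (stable_le (isT : 1 <= 5) st2) St hn.
rewrite -/(slack L) in C.
have PE : PF E h3 = PF (rem e E) h2 + fl (deg (rem e E) h2 (hd e)).
  have e3 x : x \in rem e E -> h3 x = h2 x.
    by rewrite mem_rem_uniq // inE /h3 => /andP[/negbTE->].
  have h3e : h3 e = hd e by rewrite /h3 eqxx.
  rewrite (PF_perm _ (perm_to_rem eE)) PF_cons h3e //.
  rewrite (deg_mem _ e3); congr (_ + _).
  by apply: eq_vsum => v _; rewrite (deg_mem _ e3).
have := H _ _ Ho4; rewrite PE => h.
have f := fl_pred B K0 (deg E hd (hd e)).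
apply: leq_trans h _; move: (slack L) C => X C.
rewrite -!addnA leq_add2l -!mulnDr leq_mul2l.
apply/orP; right; move: C f le2; clear; lia.
Qed.
End Orientations.

(** * Chains of flips *)

Definition nxe (e : expr) : expr := Bin Add (Bin Add e (dive e (Var 10))) (Cst 1).
Definition pve (e : expr) : expr :=
  Bin Defs.Sub (Bin Defs.Sub e (Cst 1)) (dive (Bin Defs.Sub e (Cst 1)) (Bin Add (Var 10) (Cst 1))).
Definition FLIP : cmd := DETACH ;; Assign 12 (Var 18) ;; Assign 13 (Var 19) ;; ATTACH.
(** Register 14 holds the vertex with one in-edge that cell 12 does not count yet. Register 18 is
    first the upper bound [thr i.+2], computed from the stored threshold, and then the tail of the
    edge under scrutiny. Cell 15 pointing to the vertex itself means that the scan is complete. *)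
Definition BUMP_STEP : cmd :=
  Assign 18 (nxe (fld 14 14)) ;; Assign 18 (nxe (Var 18)) ;;
  If (lte (fld 14 12) (Var 18))
    (adr 14 12 (Bin Add (fld 14 12) (Cst 1)) ;; Assign 17 (Cst 0))
    (Assign 11 (fld 14 15) ;;
     If (eqe (Var 11) (Var 14))
       (adr 14 14 (nxe (fld 14 14)) ;; adr 14 13 (Bin Add (fld 14 13) (Cst 1)) ;; RELABEL ;;
        adr 14 12 (Bin Add (fld 14 12) (Cst 1)) ;; Assign 17 (Cst 0))
       (Assign 18 (fld 11 1) ;;
        If (lte (fld 18 13) (fld 14 13))
          (Assign 19 (Var 14) ;; FLIP ;; Assign 14 (Var 18)) (adr 14 15 (fld 11 2)))).
Definition BUMP : cmd := Assign 17 (Cst 1) ;; While (Var 17) BUMP_STEP.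
Definition DROP_STEP : cmd :=
  If (lte (fld 14 14) (fld 14 12))
    (adr 14 12 (Bin Defs.Sub (fld 14 12) (Cst 1)) ;; Assign 17 (Cst 0))
    (If (Bin Leq (fld 14 13) (Var 10))
       (adr 14 12 (Bin Defs.Sub (fld 14 12) (Cst 1)) ;; Assign 17 (Cst 0))
       (Assign 18 (fld 14 7) ;;
        If (lte (fld 14 13) (fld 18 11))
          (Assign 11 (fld 18 4) ;; Assign 19 (fld 11 0) ;; Assign 18 (Var 14) ;; FLIP ;;
           Assign 14 (Var 19))
          (adr 14 14 (pve (fld 14 14)) ;; adr 14 13 (Bin Defs.Sub (fld 14 13) (Cst 1)) ;; RELABEL ;;
           adr 14 12 (Bin Defs.Sub (fld 14 12) (Cst 1)) ;; Assign 17 (Cst 0)))).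
Definition DROP : cmd := Assign 17 (Cst 1) ;; While (Var 17) DROP_STEP.

Section Chains.
Variables W P K n B : nat.
Hypothesis PW : P < W.
Hypothesis W16 : 100 < W.
Hypothesis K0 : 0 < K.
Hypothesis KW : K < W.
Notation thr := (thr K B).
Notation fl := (fl K B).
Notation GI := (GI W K n).
Notation IL := (IL W K n).
Notation vsum := (vsum n).

Definition hdf (s : store) (e : nat) : nat := s e 0.
Definition tlf (s : store) (e : nat) : nat := s e 1.
Definition lev (s : store) (v : nat) : nat := s v 13 - K.

(* Levels are stored in cell 13, shifted by [K] so that their classes are
   positive; the thresholds and the degrees are in the cells 14 and 12. *)
Record LI (s : store) (E : seq nat) (sc : nat -> seq nat) : Prop := MkLI {
  li_th : forall v, v < n -> s v 14 = thr (lev s v);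
  li_lo : forall v, v < n -> 0 < lev s v -> thr (lev s v) <= s v 12;
  li_hi : forall v, v < n -> s v 12 <= thr (lev s v).+2;
  li_st : forall e, e \in E -> s (s e 0) 13 <= s (s e 1) 13 + 2;
  li_sc : forall v e, v < n -> e \in sc v -> s v 13 <= s (s e 1) 13 + 1 }.

Lemma il_size s E sc un v : IL s E sc un -> uniq E -> v < n ->
  size (sc v ++ un v) = deg E (hdf s) v.
Proof.
move=> H U vn; rewrite /deg -size_filter; apply: perm_size; apply: uniq_perm.
- exact: (il_u H).
- exact: filter_uniq.
- by move=> e; rewrite (il_m H) // mem_filter andbC.
Qed.

Lemma items_perm E E' : perm_eq E E' -> perm_eq (items n E) (items n E').
Proof. by move=> p; rewrite /items perm_cat2l. Qed.

Lemma gi_perm s A O E E' Bk sc un cl tl : perm_eq E E' ->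
  GI s A O E Bk sc un cl tl -> GI s A O E' Bk sc un cl tl.
Proof.
move=> p [HI HO HE]; have m := perm_mem p; split.
- case: HI => h1 h2 h3 h4 h5 h6 h7; split=> //.
    by move=> e; rewrite -m; apply: h2.
  by move=> v e vn; rewrite -m; apply: h5.
- exact: os_perm (items_perm p) HO.
- case: HE => h1 h2 h3 h4; split=> // a; rewrite -(perm_mem (items_perm p)); exact: h4.
Qed.

Lemma deg_flip E (hd hd' : nat -> nat) e v : uniq E -> e \in E ->
  (forall y, y \in E -> y != e -> hd' y = hd y) ->
  deg E hd' v + (hd e == v) = deg E hd v + (hd' e == v).
Proof.
move=> U eE H; rewrite !(deg_rem _ _ U eE).
have -> : deg (rem e E) hd' v = deg (rem e E) hd v.
  by apply: deg_mem => x; rewrite mem_rem_uniq // inE => /andP[xe xE]; apply: H.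
by clear; lia.
Qed.

(** The heads of the out-edges of the old head are at most two levels above it, and the new head is
    at most two levels below it; so the label lies near the top of the chain and the search takes
    constant time. *)
Lemma runs_FLIP r s A O E Bk sc un cl tl e (Q : _ -> _ -> _ -> _ -> Prop) :
  GI s A O E Bk sc un cl tl -> LI s E sc -> e \in E ->
  s (s e 1) 13 <= s (s e 0) 13 + 1 ->
  r 10 = K -> r 11 = e -> r 18 = s e 1 -> r 19 = s e 0 ->
  blksize * (size O + (n + size E)).+1 <= P ->
  (forall r' s' A' Bk' sc' un' cl' tl' dt,
     GI s' A' O E Bk' sc' un' cl' tl' -> LI s' E sc' ->
     (forall v f, v < n -> f \in [:: 12; 13; 14] -> s' v f = s v f) ->
     s' e 0 = s e 1 -> s' e 1 = s e 0 ->
     (forall y, y \in E -> y != e -> s' y 0 = s y 0 /\ s' y 1 = s y 1) ->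
     (forall v, v < n -> size (un' v) <= size (un v)) ->
     (forall a f, a \in O -> n <= a -> a \notin E -> ~~ (4 <= f <= 11) -> s' a f = s a f) ->
     (forall k, k < 20 -> k \notin [:: 12; 13] -> r' k = r k) -> dt <= 250 -> Q r' s' A' dt) ->
  runs W P FLIP r s A Q.
Proof.
move=> HG HL eE le r10 r11 r18 r19 PO q.
have [HI HO HE] := HG; have [ne h0 t0 ht] := il_e HI eE.
set h := s e 0 in h0 ht le r19; set t := s e 1 in t0 ht le r18.
have uE : uniq E by have := os_uJ HO; rewrite cat_uniq => /and3P[].
have [_ _ nO JO] := HE; have eO : e \in O by apply: JO; rewrite mem_items eE orbT.
have vO v : v < n -> v \in O by move=> vn; apply: nO; apply: ltnW.
have EO y : y \in E -> y \in O by move=> yE; apply: JO; rewrite mem_items yE orbT.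
have ve v : v < n -> v != e by move=> vn; rewrite neq_ltn (ltn_trans vn ne).
apply: runs_seq; apply: (runs_DETACH W16 K0 HG eE) => //.
move=> r1 s1 A1 Bk1 cl1 tl1 d1 H1 sz1 kp1 e10 e11 Hr1 d1le.
apply: runs_seq; apply: runs_assign => //=; rewrite Hr1 // r18.
apply: runs_seq; apply: runs_assign => //=; rewrite Hr1 // r19.
have mr : e \notin rem e E by rewrite mem_rem_uniq // inE eqxx.
have rE y : y \in rem e E -> y \in E /\ y != e.
  by rewrite mem_rem_uniq // inE => /andP[].
have k1v v f : v < n -> f \in [:: 0; 1; 12; 13; 14] -> s1 v f = s v f.
  move=> vn ff; apply: kp1; rewrite ?vO ?ve //; first by move: ff; rewrite !inE; repeat case/orP; move=> /eqP->.
  by move: ff; rewrite !inE; repeat case/orP; move=> /eqP->.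
have k1e y f : y \in E -> y != e -> f \in [:: 0; 1] -> s1 y f = s y f.
  move=> yE ye ff; apply: kp1; rewrite ?EO ?ye //; by move: ff; rewrite !inE; case/orP => /eqP->.
have [L1 L2] : s h 13 <= s t 13 + 2 /\ s t 13 <= s h 13 + 1 by split=> //; apply: (li_st HL).
apply: (runs_ATTACH PW W16 K0 KW (e := e) (h := t) (t := h) (M := s h 13 + 2) H1) => //=.
- by rewrite eq_sym.
- move=> y /rE[yE ye]; rewrite /lab !(k1e y) // => y1.
  have [_ y0n _ _] := il_e HI yE; rewrite k1v // -y1; exact: (li_st HL).
- by rewrite Hr1.
- by rewrite Hr1.
- apply: leq_trans PO; rewrite leq_mul2l /= ltnS.
  have [_ h2 h3] := H1; apply: leq_trans (env_size h2 h3) _.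
  by rewrite !leq_add2l size_rem // leq_pred.
move=> r2 s2 A2 Bk2 cl2 tl2 d2 H2 sz2 kp2 e20 e21 Hr2 dle2 _.
have k2v v f : v < n -> f \in [:: 0; 1; 12; 13; 14] -> s2 v f = s v f.
  move=> vn ff; rewrite -(k1v v f) //; apply: kp2; rewrite ?vO ?ve //; first by move: ff; rewrite !inE; repeat case/orP; move=> /eqP->.
  by move: ff; rewrite !inE; repeat case/orP; move=> /eqP->.
have k2e y f : y \in E -> y != e -> f \in [:: 0; 1] -> s2 y f = s y f.
  move=> yE ye ff; rewrite -(k1e y f) //; apply: kp2; rewrite ?EO ?ye //; by move: ff; rewrite !inE; case/orP => /eqP->.
have pE : perm_eq (e :: rem e E) E by rewrite perm_sym perm_to_rem.
apply: (q _ _ _ Bk2 _ _ cl2 tl2).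
- exact: (gi_perm pE H2).
- have lv v : v < n -> lev s2 v = lev s v by move=> vn; rewrite /lev k2v.
  split.
  + by move=> v vn; rewrite lv // k2v //; apply: (li_th HL).
  + by move=> v vn; rewrite lv // k2v //; apply: (li_lo HL).
  + by move=> v vn; rewrite lv // k2v //; apply: (li_hi HL).
  + move=> y yE; case: (eqVneq y e) => [->|ye].
      by rewrite e20 e21 !k2v //; apply: leq_trans L2 _; rewrite leq_add2l.
    have [_ y0n y1n _] := il_e HI yE.
    by rewrite !(k2e y) // !k2v //; apply: (li_st HL).
  + move=> v y vn; case: (eqVneq v t) => [->|vt]; last first.
      rewrite mem_filter => /andP[ye yv]; have yE : y \in E.
        by have := il_m HI y vn; rewrite mem_cat yv /= => /esym/andP[].
      have [_ y0n y1n _] := il_e HI yE.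
      by rewrite (k2e y) // !k2v //; apply: (li_sc HL).
    rewrite inE => /orP[/eqP->|]; first by rewrite e21 !k2v.
    rewrite mem_filter => /andP[ye yv]; have yE : y \in E.
      by have := il_m HI y t0; rewrite mem_cat yv /= => /esym/andP[].
    have [_ y0n y1n _] := il_e HI yE.
    by rewrite (k2e y) // !k2v //; apply: (li_sc HL).
- move=> v f vn ff; apply: k2v => //; by move: ff; rewrite !inE => /or3P[] ->; rewrite ?orbT.
- exact: e20.
- exact: e21.
- by move=> y yE ye; rewrite !k2e.
- by move=> v vn; rewrite size_filter count_size.
- move=> a f aO na aE fN; have ae : a != e by apply: contraNneq aE => ->.
  have a1 : a \notin e :: rem e E by rewrite (perm_mem pE).
  have a2 : a \notin e :: E by rewrite inE negb_or ae.
  by rewrite kp2 ?na ?a1 ?orbT // kp1 // na a2 orbT.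
- move=> k k20; rewrite !inE negb_or => /andP[k12 k13].
  by rewrite Hr2 //= (negbTE k12) (negbTE k13) Hr1.
- move: d1le dle2 L1; rewrite k1v //; clear; lia.
Qed.

(** The distance from the middle threshold of level [i]. At level 0 a small degree costs nothing:
    nothing descends from there, and vertices without in-edges have potential 0. *)
Definition psi (i d : nat) : nat :=
  (d - thr i.+1) + (if i is 0 then 0 else thr i.+1 - d).

(** 300 covers one flip and 20 the scan of one edge. 400 covers a change of level, which costs 160
    per in-edge for refiling and 20 for the scan to come, at a degree of at most about twice
    [thr i.+1]. *)
Definition Pot (s : store) (un : nat -> seq nat) : nat :=
  300 * vsum (fun v => Fpot K B (s v 12)) +
  400 * (K * vsum (fun v => psi (lev s v) (s v 12))) +
  20 * vsum (fun v => size (un v)).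

Lemma psi_up i d : psi i d.+1 <= (psi i d).+1.
Proof. by rewrite /psi; case: i => [|i]; move: (thr _) => t; clear; lia. Qed.

Lemma psi_down i d : psi i d.-1 <= (psi i d).+1.
Proof. by rewrite /psi; case: i => [|i]; move: (thr _) => t; clear; lia. Qed.

Lemma gi_upd s A O E Bk sc un cl tl a f v : f \in [:: 12; 14] ->
  GI s A O E Bk sc un cl tl -> a \in O -> GI (upd s a f v) A O E Bk sc un cl tl.
Proof.
move=> ff [HI HO HE] aO; have E1 b g : g \notin [:: 12; 14] -> upd s a f v b g = s b g.
  by move=> gg; rewrite upd_fld //; apply: contraNneq gg => ->.
split=> //.
  apply: il_frame HI _ => b g _ gg; rewrite E1 //; by move: gg; rewrite !inE; repeat case/orP; move=> /eqP->.
apply: os_frame HO _ _ _ _ => // [b g _ gg|b _|b _|b _].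
- by rewrite E1 // !inE negb_or; apply/andP; split; apply: contraTneq gg => ->.
- by rewrite E1.
- by rewrite /own E1.
- by rewrite /lab !E1.
Qed.

Lemma il_scan s E sc un x e rest : IL s E sc un -> x < n -> un x = e :: rest ->
  IL (upd s x 15 (s e 2)) E (fun v => if v == x then rcons (sc x) e else sc v)
    (fun v => if v == x then rest else un v).
Proof.
move=> H xn Eu; set s' := upd _ _ _ _.
have E1 a f : f != 15 -> s' a f = s a f by move=> f15; rewrite /s' upd_fld.
have ifE v : (if v == x then rcons (sc x) e else sc v) ++ (if v == x then rest else un v) = sc v ++ un v.
  by case: eqP => // ->; rewrite Eu cat_rcons.
split.
- by move=> v vn; rewrite !E1 //; apply: (il_v H).
- by move=> y yE; rewrite !E1 //; apply: (il_e H).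
- by move=> v vn; rewrite ifE; apply: cyc_frame (il_c H vn) => a _; rewrite !E1.
- by move=> v vn; rewrite ifE; apply: (il_u H).
- by move=> v y vn; rewrite ifE E1 //; apply: (il_m H).
- move=> v vn; case: eqP => [->|/eqP vx].
    rewrite /s' upd_eq; have := il_c H xn; rewrite Eu -cat_rcons => /cyc_next.
    by rewrite last_rcons.
  by rewrite /s' upd_adr // (il_cu H).
- by move=> v vn; rewrite !E1 //; apply: (il_K H).
Qed.

Lemma vl_nxe r s e : r 10 = K -> vl r s (nxe e) = nxt K (vl r s e).
Proof. by move=> /= ->. Qed.

Lemma vl_pve r s e : r 10 = K -> vl r s (pve e) = prv K (vl r s e).
Proof. by move=> /= ->. Qed.

Lemma safe_nxe r s A e : safe W r s A e -> 2 * vl r s e + 1 < W -> safe W r s A (nxe e).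
Proof.
move=> h lt; have h1 : vl r s e < W by move: lt; clear; lia.
have h2 : vl r s e + vl r s e %/ r 10 < W.
  by apply: leq_ltn_trans lt; have := leq_div (vl r s e) (r 10); clear; lia.
split; [split=> //; exact: safe_div | exact: ltn_trans W16 | rewrite /=].
apply: leq_ltn_trans lt; have := leq_div (vl r s e) (r 10); clear; lia.
Qed.

Lemma safe_pve r s A e : safe W r s A e -> vl r s e < W -> (r 10).+1 < W -> safe W r s A (pve e).
Proof.
move=> h lt lt10; have W1 : 1 < W by apply: ltn_trans W16.
have h1 : vl r s e - 1 < W by apply: leq_ltn_trans lt; apply: leq_subr.
have h2 : safe W r s A (Bin Defs.Sub e (Cst 1)) by split.
split=> //; last by apply: leq_ltn_trans h1; apply: leq_subr.
by apply: safe_div => //; split=> //=; rewrite addn1.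
Qed.

Lemma safe_inc r s A e : safe W r s A e -> (vl r s e).+1 < W -> safe W r s A (Bin Add e (Cst 1)).
Proof. by move=> h lt; split=> //=; [apply: ltn_trans W16 | rewrite addn1]. Qed.

Lemma safe_dec r s A e : safe W r s A e -> vl r s e < W -> safe W r s A (Bin Defs.Sub e (Cst 1)).
Proof. by move=> h lt; split=> //=; [apply: ltn_trans W16 | apply: leq_ltn_trans lt; apply: leq_subr]. Qed.

Definition settled (s : store) (E : seq nat) : Prop :=
  forall v, v < n -> s v 12 = deg E (hdf s) v.
Definition outside (s s' : store) (O E : seq nat) : Prop :=
  forall a f, a \in O -> n <= a -> a \notin E -> ~~ (4 <= f <= 11) -> s' a f = s a f.

(** Stored degrees change only at the end of the chain, where the first sum of [Pot] grows by [fl]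
    of the last degree. This is smaller than [fl (s x 12)] by at least one per flip, and the
    difference pays for the flips. The measure [N] is built from the same two quantities that
    pay. *)
Lemma runs_BUMP_loop N : forall x r s A O E Bk sc un cl tl (Q : _ -> _ -> _ -> _ -> Prop),
  300 * fl (s x 12) + 20 * vsum (fun v => size (un v)) < N ->
  GI s A O E Bk sc un cl tl -> LI s E sc -> x < n ->
  (forall v, v < n -> s v 12 + (v == x) = deg E (hdf s) v) ->
  r 10 = K -> r 14 = x -> r 17 != 0 ->
  blksize * (size O + (n + size E)).+1 <= P ->
  8 * (size E + B + n + K) + 100 < W ->
  (forall r' s' A' Bk' sc' un' cl' tl' dt,
     GI s' A' O E Bk' sc' un' cl' tl' -> LI s' E sc' -> settled s' E ->
     orient E (hdf s) (tlf s) (hdf s') (tlf s') -> outside s s' O E ->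
     (forall k, k < 11 -> r' k = r k) ->
     dt + Pot s' un' <= Pot s un + 300 * fl (s x 12) + 1000 * K -> Q r' s' A' dt) ->
  runs W P (While (Var 17) BUMP_STEP) r s A Q.
Proof.
elim: N => [|N IH] x r s A O E Bk sc un cl tl Q leN HG HL xn Hd r10 r14 r17 PO HW q //.
have [HI HO HE] := HG; have [OA BA BO] := env_mem HE; have [pA U nO JO] := HE.
have uE : uniq E by have := os_uJ HO; rewrite cat_uniq => /and3P[].
have xO : x \in O by apply: nO; apply: ltnW.
have xA := OA _ xO.
set d := s x 12; set i := lev s x.
have dE : d < size E.
  have := Hd x xn; rewrite eqxx addn1 -/d => ->; exact: count_size.
have [LK LW] := il_K HI xn.
have th : s x 14 = thr i by apply: (li_th HL).
have hi : d <= thr i.+2 by apply: (li_hi HL).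
have tB : thr i <= size E + B.
  case: (posnP i) => [->|i0]; first by rewrite leq_addl.
  by apply: leq_trans (li_lo HL xn i0) _; apply: leq_trans (ltnW dE) (leq_addr _ _).
have iE : i <= size E + B by apply: leq_trans tB; apply: leq_trans (thr_ge K B i); rewrite leq_addr.
have LVE : s x 13 = K + i by rewrite /i /lev subnKC.
have t1 : thr i.+1 <= 2 * (size E + B) + 1.
  by apply: leq_trans (nxt_le _ _) _; rewrite leq_add2r leq_mul2l tB.
have t2 : thr i.+2 <= 2 * thr i.+1 + 1 by apply: nxt_le.
apply: runs_while => //=; first by move=> h; rewrite h in r17.
move=> _; apply: runs_seq; apply: runs_assign.
  by apply: safe_nxe; [sf; rewrite r14 | rewrite /= r14 th; move: tB HW; clear; lia].
rewrite vl_nxe //= r14 th -thrE.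
apply: runs_seq; apply: runs_assign.
  by apply: safe_nxe => //=; move: t1 HW; clear; lia.
rewrite vl_nxe //= -thrE.
have dW : d.+1 < W by move: dE HW; clear; lia.
(* Both ways out of the loop, with and without an ascent, finish by counting the surplus at [x]. *)
have fin r2 s2 A2 Bk2 sc2 un2 cl2 tl2 D :
  GI s2 A2 O E Bk2 sc2 un2 cl2 tl2 ->
  (forall v, v < n -> v != x -> s2 v 12 = s v 12 /\ s2 v 13 = s v 13) -> s2 x 12 = d ->
  (forall y, y \in E -> s2 y 0 = s y 0 /\ s2 y 1 = s y 1) -> outside s s2 O E ->
  LI (upd s2 x 12 d.+1) E sc2 ->
  (forall k, k < 11 -> r2 k = r k) -> r2 14 = x ->
  (forall d3 d4, D d3 d4 + 400 * (K * psi (lev s2 x) d.+1) + 20 * vsum (fun v => size (un2 v)) <=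
     d3 + d4 + 400 * (K * psi i d) + 20 * vsum (fun v => size (un v)) + 990 * K) ->
  runs W P (adr 14 12 (Bin Add (fld 14 12) (Cst 1)) ;; Assign 17 (Cst 0)) r2 s2 A2
    (fun r3 s3 A3 d3 => runs W P (While (Var 17) BUMP_STEP) r3 s3 A3
       (fun r4 s4 A4 d4 => Q r4 s4 A4 (D d3 d4))).
  move=> H2 sv sx se Ho HL2 Hr2 r214 HD.
  have [_ _ E2] := H2; have [OA2 _ _] := env_mem E2.
  have xA2 := OA2 _ xO.
  apply: runs_seq; apply: (runs_adr W16); [by [] | by rewrite r214 | |].
    by apply: safe_inc; [sf; rewrite r214 | rewrite /= r214 sx].
  rewrite /= r214 sx addn1; apply: runs_assign; first by sf.
  apply: runs_while => //= _; set s3 := upd s2 x 12 d.+1.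
  have s3E a f : f != 12 -> s3 a f = s2 a f by move=> f12; rewrite /s3 upd_fld.
  have s3x : s3 x 12 = d.+1 by rewrite /s3 upd_eq.
  have s3v v : v != x -> s3 v 12 = s2 v 12 by move=> vx; rewrite /s3 upd_adr.
  have hdE : {in E, hdf s3 =1 hdf s} by move=> y yE; rewrite /hdf s3E //; have [] := se y yE.
  apply: (q _ _ _ Bk2 sc2 un2 cl2 tl2) => //.
  - exact: gi_upd.
  - move=> v vn; rewrite (deg_mem _ hdE) -Hd //.
    case: (eqVneq v x) => [->|vx]; first by rewrite s3x addn1.
    by rewrite s3v // addn0; have [] := sv v vn vx.
  - by move=> y yE; left; rewrite /hdf /tlf !s3E //; exact: se.
  - move=> a f aO na aE fN; rewrite -(Ho a f) // /s3 upd_adr //.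
    by apply: contraTneq na => ->; rewrite -ltnNge.
  - by move=> k k11; rewrite /= (lt_neq k11) // Hr2.
  have lx : lev s3 x = lev s2 x by rewrite /lev s3E.
  have p1 : vsum (fun v => Fpot K B (s3 v 12)) = vsum (fun v => Fpot K B (s v 12)) + fl d.
    have h v : v < n -> v != x -> Fpot K B (s3 v 12) = Fpot K B (s v 12).
      by move=> vn vx; rewrite s3v //; have [->] := sv v vn vx.
    by have := vsum_upd xn h; rewrite s3x -/d FpotS; clear; lia.
  have p2 : vsum (fun v => psi (lev s3 v) (s3 v 12)) + psi i d =
            vsum (fun v => psi (lev s v) (s v 12)) + psi (lev s2 x) d.+1.
    have h v : v < n -> v != x -> psi (lev s3 v) (s3 v 12) = psi (lev s v) (s v 12).
      by move=> vn vx; rewrite s3v // /lev s3E //; have [-> ->] := sv v vn vx.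
    by have := vsum_upd xn h; rewrite s3x lx.
  have := HD (1 + 1) 1; rewrite /Pot p1 -/d.
  have : K * vsum (fun v => psi (lev s3 v) (s3 v 12)) + K * psi i d =
         K * vsum (fun v => psi (lev s v) (s v 12)) + K * psi (lev s2 x) d.+1.
    by rewrite -!mulnDr p2.
  rewrite mulnDr; move: K0; clear; lia.
apply: runs_if_lte; [by sf; rewrite r14 // -/d | |]; rewrite /= r14 -/d => dlt.
  apply: (fin _ _ _ Bk sc un cl tl _ HG) => //.
  - have hl v : lev (upd s x 12 d.+1) v = lev s v by rewrite /lev upd_fld.
    split.
    + by move=> v vn; rewrite hl upd_fld //; apply: (li_th HL).
    + move=> v vn; rewrite hl updE andbT.
      by case: eqP => [->|_]; [move=> i0; apply: leq_trans (li_lo HL xn i0) _ | apply: (li_lo HL)].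
    + move=> v vn; rewrite hl updE andbT.
      by case: eqP => [->|_] //; apply: (li_hi HL).
    + by move=> y yE; rewrite !upd_fld //; apply: (li_st HL).
    + by move=> v y vn yv; rewrite !upd_fld //; apply: (li_sc HL).
  - by move=> k k11; rewrite /= (lt_neq k11).
  - move=> d3 d4; rewrite -/i; have := psi_up i d; rewrite -(leq_pmul2l K0) mulnS; move: K0; clear; lia.
have dT : d = thr i.+2 by apply/eqP; rewrite eqn_leq hi.
have cu : s x 15 = head x (un x) by apply: (il_cu HI).
have vO v : v < n -> v \in O by move=> vn; apply: nO; apply: ltnW.
have EO y : y \in E -> y \in O by move=> yE; apply: JO; rewrite mem_items yE orbT.
have nx v : n <= v -> v != x by move=> nv; rewrite neq_ltn (leq_trans xn nv) orbT.
have Ex y : y \in E -> y != x by move=> /(il_e HI)[ny _ _ _]; apply: nx; apply: ltnW.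
apply: runs_seq; apply: runs_assign; first by sf; rewrite r14.
rewrite /= r14 cu.
apply: runs_if_eqe; first by sf.
all: rewrite /= r14 => Eun.
  have un0 : un x = [::].
    case: (un x) (il_uniq HI xn) Eun => [|e m] //= /andP[+ _] Ee.
    by rewrite Ee mem_cat inE eqxx orbT.
  apply: runs_seq; apply: (runs_adr W16); [by [] | by rewrite /= r14 | |].
    by apply: safe_nxe; [sf; rewrite r14 | rewrite /= r14 th; move: tB HW; clear; lia].
  rewrite vl_nxe //= r14 th -thrE; set s1 := upd s x 14 _.
  apply: runs_seq; apply: (runs_adr W16); [by [] | by rewrite /= r14 | |].
    apply: safe_inc; [sf; rewrite ?r14 // | rewrite /= r14 /s1 upd_fld // LVE].
    by move: iE HW; clear; lia.
  rewrite /= r14 {2}/s1 upd_fld // addn1 LVE; set s2 := upd s1 x 13 _.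
  have s2E a f : (f != 13) && (f != 14) || (a != x) -> s2 a f = s a f.
    by case/orP=> [/andP[f3 f4]|ax]; [rewrite /s2 upd_fld // /s1 upd_fld | rewrite /s2 upd_adr // /s1 upd_adr].
  have s2x : s2 x 13 = (K + i).+1 by rewrite /s2 upd_eq.
  have s2v v : s2 v 13 = if v == x then (K + i).+1 else s v 13.
    by case: eqP => [->//|/eqP vx]; rewrite s2E // vx orbT.
  have HI2 : IL s2 E sc un.
    case: (HI) => h1 h2 h3 h4 h5 h6 h7; split.
    - by move=> v vn; rewrite !s2E //; apply: h1.
    - by move=> e eE; rewrite !s2E //; apply: h2.
    - by move=> v vn; apply: cyc_frame (h3 v vn) => a _; rewrite !s2E.
    - exact: h4.
    - by move=> v e vn; rewrite s2E //; apply: h5.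
    - by move=> v vn; rewrite s2E //; apply: h6.
    - move=> v vn; rewrite s2v; case: eqP => _; last exact: h7.
      by split; [apply: leq_trans (leq_addr _ _) (leqnSn _) | move: iE HW; clear; lia].
  have H2 : OS K n s2 [::] Bk (items n E) (own s2) (midlab s2 x (K + i).+1 (K + i) [::]) cl tl.
    apply: os_frame HO _ _ _ _ => // [a f _ ff|b bB|y yJ|y yJ].
    - by rewrite s2E //; apply/orP; left; apply/andP; split; apply: contraTneq ff => ->.
    - by rewrite s2E.
    - by rewrite /own s2E.
    - rewrite /midlab s2E //; case: eqP => [y0|y0] //=; first by rewrite /lab y0 LVE.
      by rewrite /lab (s2E y 0) // s2v; case: eqP.
  have lb2 : {in Bk, forall b, (s2 b 11).+1 < W}.
    by move=> b bB; rewrite s2E // (gi_lbW HG).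
  apply: runs_seq; apply: (runs_RELABEL PW W16 K0 HI2 xn s2x H2 HE) => //=.
    by apply: leq_trans (leqnSn _) (leqnSn _).
  move=> r3 s3 A3 Bk3 cl3 tl3 d3 H3 kp3 Hr3 dle3.
  have s3E a f : a \in O -> ~~ (4 <= f <= 11) -> (f != 15) || (a != x) -> s3 a f = s2 a f.
    by move=> aO fN /orP[fx|ax]; rewrite kp3 //; [rewrite upd_fld | rewrite upd_adr].
  have s3v v : v < n -> s3 v 13 = if v == x then (K + i).+1 else s v 13.
    by move=> vn; rewrite s3E ?vO // s2v.
  have l3 v : v < n -> lev s3 v = if v == x then i.+1 else lev s v.
    by move=> vn; rewrite /lev s3v //; case: eqP => // _; rewrite -addnS addKn.
  have l3x : lev s3 x = i.+1 by rewrite l3 // eqxx.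
  have e3 y f : y \in E -> f \in [:: 0; 1] -> s3 y f = s y f.
    by move=> yE ff; rewrite s3E ?EO // ?s2E // ?Ex ?orbT //; move: ff; rewrite !inE => /orP[] /eqP->.
  apply: (fin _ _ _ Bk3 _ _ cl3 tl3 _ H3).
  - by move=> v vn vx; rewrite s3v // (negbTE vx) s3E ?vO // s2E.
  - by rewrite s3E // s2E.
  - by move=> y yE; rewrite !e3.
  - by move=> a f aO na aE fN; rewrite s3E ?s2E ?nx ?orbT.
  - have hl v : lev (upd s3 x 12 d.+1) v = lev s3 v by rewrite /lev upd_fld.
    (* As [un x] is empty, every in-edge has been scanned, so its tail is at most one level below
       [x], and at most two after the ascent. *)
    have HS y : y \in E -> s y 0 = x -> s x 13 <= s (s y 1) 13 + 1.
      move=> yE y0; apply: (li_sc HL xn).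
      by have := il_m HI y xn; rewrite un0 cats0 yE y0 eqxx.
    split.
    + move=> v vn; rewrite hl upd_fld // l3 // s3E ?vO //.
      case: (eqVneq v x) => [->|vx]; first by rewrite /s2 upd_fld // /s1 upd_eq.
      by rewrite s2E ?vx ?orbT //; apply: (li_th HL).
    + move=> v vn; rewrite hl l3 // updE andbT.
      case: (eqVneq v x) => [_ _|vx]; first by rewrite dT; apply: leq_trans (ltnW (thrS _ _ _)) (leqnSn _).
      by rewrite s3E ?vO // s2E //; apply: (li_lo HL).
    + move=> v vn; rewrite hl l3 // updE andbT.
      case: (eqVneq v x) => [_|vx]; first by rewrite dT; apply: thrS.
      by rewrite s3E ?vO // s2E //; apply: (li_hi HL).
    + move=> y yE; have [_ y0n y1n y01] := il_e HI yE; rewrite !upd_fld // !(e3 y) // !s3v //.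
      case: (eqVneq (s y 0) x) => [y0|y0].
        have -> : (s y 1 == x) = false by rewrite -y0 eq_sym; apply/negbTE.
        by have := HS y yE y0; rewrite LVE; move: (s (s y 1) 13) => z; clear; lia.
      have := li_st HL yE; case: (eqVneq (s y 1) x) => [->|_] //; rewrite LVE; clear; lia.
    + move=> v y vn; case: (eqVneq v x) => [//|vx] yv; have yE : y \in E.
        by have := il_m HI y vn; rewrite mem_cat yv /= => /esym/andP[].
      have [_ y0n y1n y01] := il_e HI yE; rewrite !upd_fld // (e3 y) // !s3v //.
      rewrite (negbTE vx); have := li_sc HL vn yv.
      by case: (eqVneq (s y 1) x) => [->|_] //; rewrite LVE; clear; lia.
  - by move=> k k11; rewrite Hr3 ?(ltn_trans k11) //= !(lt_neq k11).
  - by rewrite Hr3.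
  - move=> d4 d5; rewrite l3x.
    (* The old upper bound [thr i.+2 = d] is the middle threshold of the new level. *)
    have p0 : psi i.+1 d.+1 = 1.
      by rewrite /psi dT subSnn; apply/eqP; rewrite -[X in _ == X]addn0 eqn_add2l subn_eq0.
    have p1 : thr i.+1 <= K * psi i d.
      by apply: leq_trans (nxt_gap K0 (thr i.+1)) _; rewrite -thrE leq_mul2l -dT leq_addr orbT.
    have szs : size (sc x ++ un x) = d.+1 by rewrite (il_size HI) // -Hd // eqxx addn1.
    have p2 : vsum (fun v => size (if v == x then sc x ++ un x else un v)) =
              vsum (fun v => size (un v)) + d.+1.
      have h v : v < n -> v != x -> size (if v == x then sc x ++ un x else un v) = size (un v).
        by move=> _ /negbTE->.
      by have := vsum_upd xn h; rewrite eqxx szs un0 /= addn0.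
    rewrite p0 p2; rewrite szs in dle3.
    move: dle3 p1 t2 K0; rewrite -dT; move: (thr i.+1) (K * psi i d) (vsum _) => a b c.
    clear; lia.
case Eu : (un x) Eun => [|e rest] /= Eun; first by rewrite eqxx in Eun.
have el : e \in sc x ++ un x by rewrite Eu mem_cat inE eqxx orbT.
have [eE e0] : e \in E /\ s e 0 = x.
  by have := il_m HI e xn; rewrite el => /esym/andP[-> /eqP].
have [ne h0 t0 ht] := il_e HI eE; set w := s e 1 in t0 ht.
have eA : e \in A by apply: OA; apply: EO.
have wA : w \in A by apply: OA; apply: vO.
have ww : s w 13 = K + lev s w by rewrite /lev subnKC //; have [] := il_K HI t0.
have [LKw LWw] := il_K HI t0.
apply: runs_seq; apply: runs_assign; first by sf.
rewrite /= -/w.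
apply: runs_if_lte; first by sf; rewrite ?r14 //; apply: ltnW.
  rewrite /= r14 => lt.
  have wx : w != x by apply: contraTneq lt => ->; rewrite ltnn.
  apply: runs_seq; apply: runs_assign => //=; rewrite r14.
  apply: runs_seq; apply: (runs_FLIP HG HL eE) => //=.
  - by rewrite e0 -/w; apply: leq_trans (ltnW lt) (leq_addr _ _).
  move=> r3 s3 A3 Bk3 sc3 un3 cl3 tl3 d3 H3 HL3 kv e30 e31 ke szu out3 Hr3 dle3.
  apply: runs_assign; first by sf.
  rewrite /= Hr3 //=.
  have lv v : v < n -> lev s3 v = lev s v by move=> vn; rewrite /lev kv.
  (* [fl d] is [i.+3] since [d = thr i.+2], whereas [w] lies below level [i] and so has degree at
     most [thr i.+1]. *)
  have fw : fl (s w 12) < fl d.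
    rewrite dT fl_thr // ltnS; apply: (@leq_trans (fl (thr i.+1))); last by rewrite fl_thr.
    apply: fl_le => //; apply: leq_trans (li_hi HL t0) _; apply: thr_mono.
    by move: lt; rewrite ww LVE ltn_add2l.
  have Ple : Pot s3 un3 <= Pot s un.
    rewrite /Pot; apply: leq_add; last by rewrite leq_mul2l /=; apply: leq_vsum.
    rewrite (_ : vsum (fun v => Fpot K B (s3 v 12)) = vsum (fun v => Fpot K B (s v 12))).
      rewrite (_ : vsum (fun v => psi (lev s3 v) (s3 v 12)) = vsum (fun v => psi (lev s v) (s v 12))) //.
      by apply: eq_vsum => v vn; rewrite lv // kv.
    by apply: eq_vsum => v vn; rewrite kv.
  have ho3 : orient E (hdf s) (tlf s) (hdf s3) (tlf s3).
    move=> y yE; rewrite /hdf /tlf; case: (eqVneq y e) => [->|ye]; first by right.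
    by left; apply: ke.
  apply: (IH w _ _ _ O E Bk3 sc3 un3 cl3 tl3) => //.
  - have : vsum (fun v => size (un3 v)) <= vsum (fun v => size (un v)) by apply: leq_vsum.
    by rewrite kv //; move: leN fw; rewrite -/d; clear; lia.
  - move=> v vn; rewrite kv //.
    have ke0 y : y \in E -> y != e -> hdf s3 y = hdf s y by move=> yE ye; have [] := ke y yE ye.
    have := deg_flip v uE eE ke0; rewrite /hdf e30 -/w e0 -/(hdf s) -/(hdf s3) => Ed.
    by have := Hd v vn; rewrite [v == x]eq_sym [v == w]eq_sym; move: Ed; clear; lia.
  - by rewrite /= Hr3.
  - by rewrite /= Hr3.
  move=> r4 s4 A4 Bk4 sc4 un4 cl4 tl4 d4 H4 HL4 St4 ho4 out4 Hr4 dle4.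
  apply: (q _ _ _ Bk4 sc4 un4 cl4 tl4) => //.
  - exact: orient_trans ho3 ho4.
  - by move=> a f aO na aE fN; rewrite out4 // out3.
  - move=> k k11; rewrite Hr4 //= (lt_neq k11) // Hr3 ?(ltn_trans k11) //=; last first.
      by rewrite !inE !(lt_neq k11).
    by rewrite !(lt_neq k11).
  - rewrite kv // in dle4; move: dle4 Ple dle3 fw; rewrite -/d; move: (Pot _ _) (Pot _ _) (Pot _ _) => a b c.
    move: (fl _) (fl _) => f1 f2; clear; lia.
rewrite /= r14 => le.
apply: (runs_adr W16) => //=; rewrite ?r14 //; first by split=> //; apply: ltn_trans W16.
have HI2 := il_scan HI xn Eu; set s2 := upd s x 15 (s e 2) in HI2 *.
have s2E a f : f != 15 -> s2 a f = s a f by move=> f15; rewrite /s2 upd_fld.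
have lv v : lev s2 v = lev s v by rewrite /lev s2E.
have hs : vsum (fun v => size (if v == x then rest else un v)) < vsum (fun v => size (un v)).
  have h v : v < n -> v != x -> size (if v == x then rest else un v) = size (un v).
    by move=> _ /negbTE->.
  by have := vsum_upd xn h; rewrite eqxx Eu /=; clear; lia.
have dx : s2 x 12 = d by rewrite s2E.
apply: (IH x _ _ _ O E Bk _ _ cl tl _ _ (MkGI HI2 _ HE)) => //.
- by move: leN hs; rewrite dx -/d; clear; lia.
- apply: os_frame HO _ _ _ _ => // [a f _ ff|b bB|y yJ|y yJ].
  + by rewrite s2E //; apply: contraTneq ff => ->.
  + by rewrite s2E.
  + by rewrite /own s2E.
  + by rewrite /lab !s2E.
- split.
  + by move=> v vn; rewrite lv s2E //; apply: (li_th HL).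
  + by move=> v vn; rewrite lv s2E //; apply: (li_lo HL).
  + by move=> v vn; rewrite lv s2E //; apply: (li_hi HL).
  + by move=> y yE; rewrite !s2E //; apply: (li_st HL).
  + move=> v y vn; rewrite !s2E //; case: (eqVneq v x) => [->|vx]; last exact: (li_sc HL).
    rewrite mem_rcons inE => /orP[/eqP->|]; last exact: (li_sc HL).
    by apply: leq_trans le (leq_addr _ _).
- by move=> v vn; rewrite s2E // Hd //; apply: deg_mem => y _; rewrite /hdf s2E.
move=> r4 s4 A4 Bk4 sc4 un4 cl4 tl4 d4 H4 HL4 St4 ho4 out4 Hr4 dle4.
apply: (q _ _ _ Bk4 sc4 un4 cl4 tl4) => //.
- by move=> y yE; have := ho4 y yE; rewrite /hdf /tlf !s2E.
- by move=> a f aO na aE fN; rewrite out4 // /s2 upd_adr // nx.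
- by move=> k k11; rewrite Hr4 //= !(lt_neq k11).
(* Each scanned edge releases 20 units, more than one round of the loop costs. *)
- have : Pot s2 (fun v => if v == x then rest else un v) + 20 <= Pot s un.
    rewrite /Pot; rewrite (_ : vsum (fun v => Fpot K B (s2 v 12)) = vsum (fun v => Fpot K B (s v 12))).
      rewrite (_ : vsum (fun v => psi (lev s2 v) (s2 v 12)) = vsum (fun v => psi (lev s v) (s v 12))).
        by move: hs; move: (vsum _) (vsum _) (K * _) (300 * _) => a b c e'; clear; lia.
      by apply: eq_vsum => v vn; rewrite lv s2E.
    by apply: eq_vsum => v vn; rewrite s2E.
  rewrite dx in dle4; move: dle4; rewrite -/d; move: (Pot _ _) (Pot _ _) (Pot _ _) => a b c.
  move: (fl _) => f1; clear; lia.
Qed.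
End Chains.

(** * Chains of flips that pass on a deficit *)

Section Drops.
Variables W P K n B : nat.
Hypothesis PW : P < W.
Hypothesis W16 : 100 < W.
Hypothesis K0 : 0 < K.
Hypothesis KW : K < W.
Notation thr := (thr K B).
Notation fl := (fl K B).
Notation GI := (GI W K n).
Notation IL := (IL W K n).
Notation vsum := (vsum n).
Notation LI := (LI K n B).
Notation lev := (lev K).
Notation psi := (psi K B).
Notation Pot := (Pot K n B).

Lemma runs_BUMP x r s A O E Bk sc un cl tl (Q : _ -> _ -> _ -> _ -> Prop) :
  GI s A O E Bk sc un cl tl -> LI s E sc -> x < n ->
  (forall v, v < n -> s v 12 + (v == x) = deg E (hdf s) v) ->
  r 10 = K -> r 14 = x ->
  blksize * (size O + (n + size E)).+1 <= P ->
  8 * (size E + B + n + K) + 100 < W ->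
  (forall r' s' A' Bk' sc' un' cl' tl' dt,
     GI s' A' O E Bk' sc' un' cl' tl' -> LI s' E sc' -> settled n s' E ->
     orient E (hdf s) (tlf s) (hdf s') (tlf s') -> outside n s s' O E ->
     (forall k, k < 11 -> r' k = r k) ->
     dt + Pot s' un' <= Pot s un + 300 * fl (s x 12) + 1001 * K -> Q r' s' A' dt) ->
  runs W P BUMP r s A Q.
Proof.
move=> HG HL xn Hd r10 r14 PO HW q.
apply: runs_seq; apply: runs_assign; first exact: ltn_trans W16.
apply: (runs_BUMP_loop PW W16 K0 KW (ltnSn _) HG HL xn) => //.
move=> r1 s1 A1 Bk1 sc1 un1 cl1 tl1 d1 H1 HL1 St1 ho1 out1 Hr1 dle.
apply: (q _ _ _ Bk1 sc1 un1 cl1 tl1) => //.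
- by move=> k k11; rewrite Hr1 // /rset (lt_neq k11).
- by move: dle K0; move: (Pot _ _) (Pot _ _) => a b; clear; lia.
Qed.

(** Chains are sorted by decreasing label and have no empty buckets. Without out-edges the chain is
    its sentinel, whose label 0 makes the comparison in [DROP_STEP] fail by itself. *)
Lemma gi_top s A O E Bk sc un cl tl x : GI s A O E Bk sc un cl tl -> x < n ->
  (s x 7 = x /\ forall y, y \in E -> s y 1 != x) \/
  exists2 e, e \in E & [/\ s x 7 \in Bk, s (s x 7) 4 = e, s e 1 = x, s (s x 7) 11 = s (s e 0) 13 &
    forall y, y \in E -> s y 1 = x -> s (s y 0) 13 <= s (s x 7) 11].
Proof.
move=> [HI HO _] xn; have xn' := ltnW xn.
have mem y : y \in E -> s y 1 = x -> s y 6 \in cl x /\ s (s y 6) 11 = s (s y 0) 13.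
  move=> yE y1; have yJ : y \in items n E by rewrite mem_items yE orbT.
  have [h1 h2 h3 _] := os_J HO yJ; rewrite (os_cl HO) // h1 h2 /own y1 eqxx; split=> //.
have := os_c HO xn'; have := os_sorted HO xn'; case Ec : (cl x) => [|b bs] So.
  move/(@cyc_next _ _ _ [::] [::]) => /= sx; left; split=> // y yE.
  by apply/eqP => /(mem y yE)[]; rewrite Ec.
move/(@cyc_next _ _ _ [::] (b :: bs)) => /= sx; right; rewrite sx.
have : b \in cl x by rewrite Ec mem_head.
rewrite (os_cl HO) // => /andP[bB /eqP b1].
have := os_ne HO bB isT; have [ct _] := os_t HO bB; have := os_tl HO _ bB.
case: (tl b) ct => [|e m] //= /(@cyc_next _ _ _ [::] (e :: m)) /= b4 mt _.
have := mt e; rewrite mem_head => /esym/andP[eJ /eqP e6].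
have [_ h2 h3 _] := os_J HO eJ; rewrite e6 /own /lab in h2 h3.
have eE : e \in E.
  move: eJ; rewrite mem_items => /orP[en|//].
  by have [_ e1] := il_v HI en; move: xn; rewrite -b1 h2 e1 ltnn.
exists e => //; split=> //; first by rewrite -h2.
move=> y yE y1; have [] := mem y yE y1; rewrite Ec inE => /orP[/eqP->|yb] <- //.
by move: So => /= /andP[/allP /(_ _ yb) /ltnW].
Qed.

(** The deficit moves to strictly higher levels, which are bounded by the number of edges; this
    gives termination. The final decrement lowers the first sum of [Pot] by [fl] of the last degree
    minus one, which has grown by at least one per flip. *)
Lemma runs_DROP_loop N : forall x r s A O E Bk sc un cl tl (Q : _ -> _ -> _ -> _ -> Prop),
  size E + 1 < N + lev s x ->
  GI s A O E Bk sc un cl tl -> LI s E sc -> x < n ->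
  (forall v, v < n -> s v 12 = deg E (hdf s) v + (v == x)) ->
  r 10 = K -> r 14 = x -> r 17 != 0 ->
  blksize * (size O + (n + size E)).+1 <= P ->
  8 * (size E + B + n + K) + 100 < W ->
  (forall r' s' A' Bk' sc' un' cl' tl' dt,
     GI s' A' O E Bk' sc' un' cl' tl' -> LI s' E sc' -> settled n s' E ->
     orient E (hdf s) (tlf s) (hdf s') (tlf s') -> outside n s s' O E ->
     (forall k, k < 11 -> r' k = r k) ->
     dt + Pot s' un' + 300 * fl (s x 12).-1 <= Pot s un + 1000 * K -> Q r' s' A' dt) ->
  runs W P (While (Var 17) DROP_STEP) r s A Q.
Proof.
elim: N => [|N IH] x r s A O E Bk sc un cl tl Q leN HG HL xn Hd r10 r14 r17 PO HW q.
all: have [HI HO HE] := HG; have [OA BA BO] := env_mem HE; have [pA U nO JO] := HE.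
all: have uE : uniq E by [have := os_uJ HO; rewrite cat_uniq => /and3P[]].
all: have xO : x \in O by [apply: nO; apply: ltnW].
all: have xA := OA _ xO.
all: set d := s x 12; set i := lev s x.
all: have d0 : 0 < d by [rewrite /d Hd // eqxx addn1].
all: have dE : d <= (size E).+1 by [rewrite /d Hd // eqxx addn1 ltnS; apply: count_size].
all: have iE : i <= size E + 1 by
  [case: (posnP i) => [->//|i0]; apply: leq_trans (leq_trans (li_lo HL xn i0) _);
   [apply: leq_trans (thr_ge K B i); rewrite leq_addr|rewrite addn1]].
  by move: leN iE; rewrite -/i; clear; lia.
have [LK LW] := il_K HI xn.
have th : s x 14 = thr i by apply: (li_th HL).
have hi : d <= thr i.+2 by apply: (li_hi HL).
have LVE : s x 13 = K + i by rewrite /i /lev subnKC.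
apply: runs_while => //=; first by move=> h; rewrite h in r17.
move=> _.
have thB : thr i <= size E + B + 1.
  case: (posnP i) => [->|i0]; first by rewrite addnAC; apply: leq_addl.
  by apply: leq_trans (li_lo HL xn i0) _; move: dE; rewrite -/d; clear; lia.
have vO v : v < n -> v \in O by move=> vn; apply: nO; apply: ltnW.
have EO y : y \in E -> y \in O by move=> yE; apply: JO; rewrite mem_items yE orbT.
have nx v : n <= v -> v != x by move=> nv; rewrite neq_ltn (leq_trans xn nv) orbT.
have Ex y : y \in E -> y != x by move=> /(il_e HI)[ny _ _ _]; apply: nx; apply: ltnW.
have fin r2 s2 A2 Bk2 sc2 un2 cl2 tl2 D :
  GI s2 A2 O E Bk2 sc2 un2 cl2 tl2 ->
  (forall v, v < n -> v != x -> s2 v 12 = s v 12 /\ s2 v 13 = s v 13) -> s2 x 12 = d ->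
  (forall y, y \in E -> s2 y 0 = s y 0 /\ s2 y 1 = s y 1) -> outside n s s2 O E ->
  LI (upd s2 x 12 d.-1) E sc2 ->
  (forall k, k < 11 -> r2 k = r k) -> r2 14 = x ->
  (forall d3 d4, D d3 d4 + 400 * (K * psi (lev s2 x) d.-1) + 20 * vsum (fun v => size (un2 v)) <=
     d3 + d4 + 400 * (K * psi i d) + 20 * vsum (fun v => size (un v)) + 990 * K) ->
  runs W P (adr 14 12 (Bin Defs.Sub (fld 14 12) (Cst 1)) ;; Assign 17 (Cst 0)) r2 s2 A2
    (fun r3 s3 A3 d3 => runs W P (While (Var 17) DROP_STEP) r3 s3 A3
       (fun r4 s4 A4 d4 => Q r4 s4 A4 (D d3 d4))).
  move=> H2 sv sx se Ho HL2 Hr2 r214 HD.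
  have [_ _ E2] := H2; have [OA2 _ _] := env_mem E2.
  have xA2 := OA2 _ xO.
  apply: runs_seq; apply: (runs_adr W16); [by [] | by rewrite r214 | |].
    apply: (safe_dec W16); first by sf; rewrite r214.
    by rewrite /= r214 sx; move: dE HW; clear; lia.
  rewrite /= r214 sx subn1; apply: runs_assign; first by sf.
  apply: runs_while => //= _; set s3 := upd s2 x 12 d.-1.
  have s3E a f : f != 12 -> s3 a f = s2 a f by move=> f12; rewrite /s3 upd_fld.
  have s3x : s3 x 12 = d.-1 by rewrite /s3 upd_eq.
  have s3v v : v != x -> s3 v 12 = s2 v 12 by move=> vx; rewrite /s3 upd_adr.
  have hdE : {in E, hdf s3 =1 hdf s} by move=> y yE; rewrite /hdf s3E //; have [] := se y yE.
  apply: (q _ _ _ Bk2 sc2 un2 cl2 tl2) => //.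
  - exact: gi_upd.
  - move=> v vn; rewrite (deg_mem _ hdE).
    case: (eqVneq v x) => [->|vx]; first by rewrite s3x /d Hd // eqxx addn1.
    by rewrite s3v //; have [-> _] := sv v vn vx; rewrite Hd // (negbTE vx) addn0.
  - by move=> y yE; left; rewrite /hdf /tlf !s3E //; exact: se.
  - move=> a f aO na aE fN; rewrite -(Ho a f) // /s3 upd_adr //.
    by apply: contraTneq na => ->; rewrite -ltnNge.
  - by move=> k k11; rewrite /= (lt_neq k11) // Hr2.
  have lx : lev s3 x = lev s2 x by rewrite /lev s3E.
  have p1 : vsum (fun v => Fpot K B (s3 v 12)) + fl d.-1 = vsum (fun v => Fpot K B (s v 12)).
    have h v : v < n -> v != x -> Fpot K B (s3 v 12) = Fpot K B (s v 12).
      by move=> vn vx; rewrite s3v //; have [->] := sv v vn vx.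
    by have := vsum_upd xn h; rewrite s3x -/d -{1}(prednK d0) FpotS; clear; lia.
  have p2 : vsum (fun v => psi (lev s3 v) (s3 v 12)) + psi i d =
            vsum (fun v => psi (lev s v) (s v 12)) + psi (lev s2 x) d.-1.
    have h v : v < n -> v != x -> psi (lev s3 v) (s3 v 12) = psi (lev s v) (s v 12).
      by move=> vn vx; rewrite s3v // /lev s3E //; have [-> ->] := sv v vn vx.
    by have := vsum_upd xn h; rewrite s3x lx.
  have := HD (1 + 1) 1; rewrite /Pot -p1 -/d.
  have : K * vsum (fun v => psi (lev s3 v) (s3 v 12)) + K * psi i d =
         K * vsum (fun v => psi (lev s v) (s v 12)) + K * psi (lev s2 x) d.-1.
    by rewrite -!mulnDr p2.
  rewrite mulnDr; move: K0; clear; lia.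
have stay r2 D : (forall k, k < 11 -> r2 k = r k) -> r2 14 = x ->
  (0 < i -> thr i < d) -> (forall d3 d4, D d3 d4 <= d3 + d4 + 500 * K) ->
  runs W P (adr 14 12 (Bin Defs.Sub (fld 14 12) (Cst 1)) ;; Assign 17 (Cst 0)) r2 s A
    (fun r3 s3 A3 d3 => runs W P (While (Var 17) DROP_STEP) r3 s3 A3
       (fun r4 s4 A4 d4 => Q r4 s4 A4 (D d3 d4))).
  move=> Hr2 r214 dlt HD; apply: (fin _ _ _ Bk sc un cl tl _ HG) => //.
  - have hl v : lev (upd s x 12 d.-1) v = lev s v by rewrite /lev upd_fld.
    split.
    + by move=> v vn; rewrite hl upd_fld //; apply: (li_th HL).
    + move=> v vn; rewrite hl updE andbT.
      by case: eqP => [->|_]; [move=> /dlt; rewrite -{1}(prednK d0) ltnS | apply: (li_lo HL)].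
    + move=> v vn; rewrite hl updE andbT.
      by case: eqP => [->|_]; [apply: leq_trans (leq_pred _) hi | apply: (li_hi HL)].
    + by move=> y yE; rewrite !upd_fld //; apply: (li_st HL).
    + by move=> v y vn yv; rewrite !upd_fld //; apply: (li_sc HL).
  - move=> d3 d4; rewrite -/i; have := HD d3 d4.
    by have := psi_down K B i d; rewrite -(leq_pmul2l K0) mulnS; move: K0; clear; lia.
apply: runs_if_lte; [by sf; rewrite ?r14 // th; move: thB HW; clear; lia | |];
  rewrite /= r14 -/d th => dth.
  by apply: stay => // d3 d4; move: K0; clear; lia.
(* Level 0 has no lower bound and absorbs the deficit. *)
apply: runs_if_leq; [by sf; rewrite r14 | |]; rewrite /= r14 LVE r10 => iK.
  apply: stay => // [|d3 d4]; last by move: K0; clear; lia.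
  by move: iK; clear; lia.
have i0 : 0 < i by move: iK; clear; lia.
have dT : d = thr i by apply/eqP; rewrite eqn_leq dth (li_lo HL).
apply: runs_seq; apply: runs_assign; first by sf; rewrite r14.
rewrite /= r14.
have bA : s x 7 \in A by case: (gi_top HG xn) => [[-> _]|[e _ [bB _ _ _ _]]] //; apply: BA.
apply: runs_if_lte; first by sf; rewrite ?r14 //; apply: ltnW.
  rewrite /= r14 => lt.
  case: (gi_top HG xn) lt => [[-> _]|]; first by rewrite (os_0 HO) // ltnW.
  move=> [e eE [bB b4 e1 b11 _]] lt; rewrite b11 in lt.
  have [ne h0 t0 ht] := il_e HI eE; set w := s e 0 in h0 ht lt b11.
  have eA : e \in A by apply: OA; apply: EO.
  apply: runs_seq; apply: runs_assign; first by sf.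
  rewrite /= b4.
  apply: runs_seq; apply: runs_assign; first by sf.
  rewrite /= -/w.
  apply: runs_seq; apply: runs_assign => //=.
  apply: runs_seq; apply: (runs_FLIP PW W16 K0 KW HG HL eE) => //=.
  - by rewrite e1 -/w; apply: leq_trans (ltnW lt) (leq_addr _ _).
  - by rewrite r14.
  move=> r3 s3 A3 Bk3 sc3 un3 cl3 tl3 d3 H3 HL3 kv e30 e31 ke szu out3 Hr3 dle3.
  apply: runs_assign; first by sf.
  rewrite /= Hr3 //=.
  have lv v : v < n -> lev s3 v = lev s v by move=> vn; rewrite /lev kv.
  have [LKw LWw] := il_K HI h0.
  have ww : s w 13 = K + lev s w by rewrite /lev subnKC.
  have iw : i < lev s w by move: lt; rewrite ww LVE ltn_add2l.
  (* [fl d.-1] is [i] since [d = thr i]; the level of [w] exceeds [i], hence is positive, and its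
     lower bound is in force. *)
  have fw : fl d.-1 < fl (s w 12).-1.
    rewrite dT fl_thr_pred //; apply: (leq_trans iw).
    rewrite -[X in X <= _](@fl_thr_pred K B (lev s w)); last exact: (leq_ltn_trans _ iw).
    apply: fl_le => //; rewrite -!subn1; apply: leq_sub2r; apply: (li_lo HL) => //.
    exact: (leq_ltn_trans _ iw).
  have Ple : Pot s3 un3 <= Pot s un.
    rewrite /Pot; apply: leq_add; last by rewrite leq_mul2l /=; apply: leq_vsum.
    rewrite (_ : vsum (fun v => Fpot K B (s3 v 12)) = vsum (fun v => Fpot K B (s v 12))).
      rewrite (_ : vsum (fun v => psi (lev s3 v) (s3 v 12)) = vsum (fun v => psi (lev s v) (s v 12))) //.
      by apply: eq_vsum => v vn; rewrite lv // kv.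
    by apply: eq_vsum => v vn; rewrite kv.
  have ho3 : orient E (hdf s) (tlf s) (hdf s3) (tlf s3).
    move=> y yE; rewrite /hdf /tlf; case: (eqVneq y e) => [->|ye]; first by right.
    by left; apply: ke.
  apply: (IH w _ _ _ O E Bk3 sc3 un3 cl3 tl3) => //.
  - by rewrite lv //; move: leN iw; rewrite -/i; clear; lia.
  - move=> v vn; rewrite kv //.
    have ke0 y : y \in E -> y != e -> hdf s3 y = hdf s y by move=> yE ye; have [] := ke y yE ye.
    have := deg_flip v uE eE ke0; rewrite /hdf e30 -/w e1 -/(hdf s) -/(hdf s3) => Ed.
    by have := Hd v vn; rewrite [v == x]eq_sym [v == w]eq_sym; move: Ed; clear; lia.
  - by rewrite /= Hr3.
  - by rewrite /= Hr3.
  move=> r4 s4 A4 Bk4 sc4 un4 cl4 tl4 d4 H4 HL4 St4 ho4 out4 Hr4 dle4.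
  apply: (q _ _ _ Bk4 sc4 un4 cl4 tl4) => //.
  - exact: orient_trans ho3 ho4.
  - by move=> a f aO na aE fN; rewrite out4 // out3.
  - move=> k k11; rewrite Hr4 //= (lt_neq k11) // Hr3 ?(ltn_trans k11) //=; last first.
      by rewrite !inE !(lt_neq k11).
    by rewrite !(lt_neq k11).
  - rewrite kv // in dle4; move: dle4 Ple dle3 fw; rewrite -/d; move: (Pot _ _) (Pot _ _) (Pot _ _) => a b c.
    move: (fl _) (fl _) => f1 f2; clear; lia.
rewrite /= r14 => le.
case Ei : i i0 => [//|j] _.
(* No out-edge of [x] has a head above the level of [x], so after the descent of [x] its out-edges
   may still count as scanned at their heads. *)
have SL y : y \in E -> s y 1 = x -> s (s y 0) 13 <= s x 13.
  move=> yE y1; case: (gi_top HG xn) => [[_ no]|[e _ [_ _ _ _ mx]]].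
    by have := no y yE; rewrite y1 eqxx.
  exact: leq_trans (mx y yE y1) le.
apply: runs_seq; apply: (runs_adr W16); [by [] | by rewrite /= r14 | |].
  apply: (safe_pve W16); first by sf; rewrite r14.
    by rewrite /= r14 th; move: thB HW; clear; lia.
  by rewrite /= r10; move: HW; clear; lia.
rewrite (vl_pve (K := K)) //= r14 th Ei thrE nxtK //; set s1 := upd s x 14 _.
apply: runs_seq; apply: (runs_adr W16); [by [] | by rewrite /= r14 | |].
  apply: (safe_dec W16); [sf; rewrite ?r14 // | rewrite /= r14 /s1 upd_fld // LVE].
  by move: iE HW; clear; lia.
rewrite /= r14 {2}/s1 upd_fld // subn1 LVE Ei addnS /=; set s2 := upd s1 x 13 _.
have s2E a f : (f != 13) && (f != 14) || (a != x) -> s2 a f = s a f.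
  by case/orP=> [/andP[f3 f4]|ax]; [rewrite /s2 upd_fld // /s1 upd_fld | rewrite /s2 upd_adr // /s1 upd_adr].
have s2x : s2 x 13 = K + j by rewrite /s2 upd_eq.
have s2v v : s2 v 13 = if v == x then K + j else s v 13.
  by case: eqP => [->//|/eqP vx]; rewrite s2E // vx orbT.
have HI2 : IL s2 E sc un.
  case: (HI) => h1 h2 h3 h4 h5 h6 h7; split.
  - by move=> v vn; rewrite !s2E //; apply: h1.
  - by move=> e eE; rewrite !s2E //; apply: h2.
  - by move=> v vn; apply: cyc_frame (h3 v vn) => a _; rewrite !s2E.
  - exact: h4.
  - by move=> v e vn; rewrite s2E //; apply: h5.
  - by move=> v vn; rewrite s2E //; apply: h6.
  - move=> v vn; rewrite s2v; case: eqP => _; last exact: h7.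
    by split; [apply: leq_addr | move: iE HW; rewrite Ei; clear; lia].
have H2 : OS K n s2 [::] Bk (items n E) (own s2) (midlab s2 x (K + j) (K + j).+1 [::]) cl tl.
  apply: os_frame HO _ _ _ _ => // [a f _ ff|b bB|y yJ|y yJ].
  - by rewrite s2E //; apply/orP; left; apply/andP; split; apply: contraTneq ff => ->.
  - by rewrite s2E.
  - by rewrite /own s2E.
  - rewrite /midlab s2E //; case: eqP => [y0|y0] //=; first by rewrite /lab y0 LVE Ei addnS.
    by rewrite /lab (s2E y 0) // s2v; case: eqP.
have lb2 : {in Bk, forall b, (s2 b 11).+1 < W}.
  by move=> b bB; rewrite s2E // (gi_lbW HG).
apply: runs_seq; apply: (runs_RELABEL PW W16 K0 HI2 xn s2x H2 HE) => //=.
  by apply: leq_trans (leqnSn _) (leqnSn _).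
move=> r3 s3 A3 Bk3 cl3 tl3 d3 H3 kp3 Hr3 dle3.
have s3E a f : a \in O -> ~~ (4 <= f <= 11) -> (f != 15) || (a != x) -> s3 a f = s2 a f.
  by move=> aO fN /orP[fx|ax]; rewrite kp3 //; [rewrite upd_fld | rewrite upd_adr].
have s3v v : v < n -> s3 v 13 = if v == x then K + j else s v 13.
  by move=> vn; rewrite s3E ?vO // s2v.
have l3 v : v < n -> lev s3 v = if v == x then j else lev s v.
  by move=> vn; rewrite /lev s3v //; case: eqP => // _; rewrite addKn.
have l3x : lev s3 x = j by rewrite l3 // eqxx.
have e3 y f : y \in E -> f \in [:: 0; 1] -> s3 y f = s y f.
  by move=> yE ff; rewrite s3E ?EO // ?s2E // ?Ex ?orbT //; move: ff; rewrite !inE => /orP[] /eqP->.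
have dP : thr j <= d.-1 by rewrite dT Ei; have := thrS K B j; clear; lia.
apply: (fin _ _ _ Bk3 _ _ cl3 tl3 _ H3).
- by move=> v vn vx; rewrite s3v // (negbTE vx) s3E ?vO // s2E.
- by rewrite s3E // s2E.
- by move=> y yE; rewrite !e3.
- by move=> a f aO na aE fN; rewrite s3E ?s2E ?nx ?orbT.
- have hl v : lev (upd s3 x 12 d.-1) v = lev s3 v by rewrite /lev upd_fld.
  split.
  + move=> v vn; rewrite hl upd_fld // l3 // s3E ?vO //.
    case: (eqVneq v x) => [->|vx]; first by rewrite /s2 upd_fld // /s1 upd_eq.
    by rewrite s2E ?vx ?orbT //; apply: (li_th HL).
  + move=> v vn; rewrite hl l3 // updE andbT.
    case: (eqVneq v x) => [_ _|vx] //.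
    by rewrite s3E ?vO // s2E //; apply: (li_lo HL).
  + move=> v vn; rewrite hl l3 // updE andbT.
    case: (eqVneq v x) => [_|vx]; last by rewrite s3E ?vO // s2E //; apply: (li_hi HL).
    by apply: leq_trans (leq_pred _) _; rewrite dT Ei; apply: ltnW (thrS _ _ _).
  + move=> y yE; have [_ y0n y1n y01] := il_e HI yE; rewrite !upd_fld // !(e3 y) // !s3v //.
    case: (eqVneq (s y 1) x) => [y1|y1].
      have -> : (s y 0 == x) = false by rewrite -y1; apply/negbTE.
      by have := SL y yE y1; rewrite LVE Ei; move: (s (s y 0) 13) => z; clear; lia.
    have := li_st HL yE; case: (eqVneq (s y 0) x) => [->|_] //; rewrite LVE Ei; clear; lia.
  + move=> v y vn; case: (eqVneq v x) => [//|vx] yv; have yE : y \in E.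
      by have := il_m HI y vn; rewrite mem_cat yv /= => /esym/andP[].
    have y0 : s y 0 = v.
      by have := il_m HI y vn; rewrite mem_cat yv /= => /esym/andP[_ /eqP].
    have [_ y0n y1n y01] := il_e HI yE; rewrite !upd_fld // (e3 y) // !s3v //.
    rewrite (negbTE vx); have := li_sc HL vn yv.
    case: (eqVneq (s y 1) x) => [y1|_] // _.
    by have := SL y yE y1; rewrite LVE Ei y0; move: (s v 13) => z; clear; lia.
- by move=> k k11; rewrite Hr3 ?(ltn_trans k11) //= !(lt_neq k11).
- by rewrite Hr3.
- move=> d4 d5; rewrite l3x.
  (* The old lower bound [thr j.+1 = d] is the middle threshold of the new level [j]. *)
  have p0 : psi j d.-1 <= 1.
    rewrite /psi dT Ei; have := thrS K B j; move: (thr _) => a; case: (j) => [|z]; clear; lia.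
  have p1 : thr i <= K * psi i d.
    apply: leq_trans (nxt_gap K0 (thr i)) _; rewrite -thrE leq_mul2l /psi Ei -Ei -dT.
    by rewrite leq_addl orbT.
  have szs : size (sc x ++ un x) = d.-1 by rewrite (il_size HI) // /d Hd // eqxx addn1.
  have p2 : vsum (fun v => size (if v == x then sc x ++ un x else un v)) + size (un x) =
            vsum (fun v => size (un v)) + d.-1.
    have h v : v < n -> v != x -> size (if v == x then sc x ++ un x else un v) = size (un v).
      by move=> _ /negbTE->.
    by have := vsum_upd xn h; rewrite eqxx szs.
  rewrite szs in dle3; have p3 : K * psi j d.-1 <= K by rewrite -[X in _ <= X]muln1 leq_mul2l p0 orbT.
  move: dle3 p1 p2 p3 K0; rewrite -dT Ei; move: (K * psi _ _) (K * psi _ _) (vsum _) (vsum _) => a b c e.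
  clear; lia.
Qed.

Lemma runs_DROP x r s A O E Bk sc un cl tl (Q : _ -> _ -> _ -> _ -> Prop) :
  GI s A O E Bk sc un cl tl -> LI s E sc -> x < n ->
  (forall v, v < n -> s v 12 = deg E (hdf s) v + (v == x)) ->
  r 10 = K -> r 14 = x ->
  blksize * (size O + (n + size E)).+1 <= P ->
  8 * (size E + B + n + K) + 100 < W ->
  (forall r' s' A' Bk' sc' un' cl' tl' dt,
     GI s' A' O E Bk' sc' un' cl' tl' -> LI s' E sc' -> settled n s' E ->
     orient E (hdf s) (tlf s) (hdf s') (tlf s') -> outside n s s' O E ->
     (forall k, k < 11 -> r' k = r k) ->
     dt + Pot s' un' + 300 * fl (s x 12).-1 <= Pot s un + 1001 * K -> Q r' s' A' dt) ->
  runs W P DROP r s A Q.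
Proof.
move=> HG HL xn Hd r10 r14 PO HW q.
apply: runs_seq; apply: runs_assign; first exact: ltn_trans W16.
apply: (runs_DROP_loop (leq_addr (lev s x) _) HG HL xn) => //.
move=> r1 s1 A1 Bk1 sc1 un1 cl1 tl1 d1 H1 HL1 St1 ho1 out1 Hr1 dle.
apply: (q _ _ _ Bk1 sc1 un1 cl1 tl1) => //.
- by move=> k k11; rewrite Hr1 // /rset (lt_neq k11).
- by move: dle K0; move: (Pot _ _) (Pot _ _) => a b; clear; lia.
Qed.
End Drops.

(** * Amortized cost of the updates *)

(** A new edge is directed towards the end of lower or equal level, as [ATTACH] demands. *)
Definition ADD : cmd :=
  If (lte (fld 13 13) (fld 12 13))
    (Assign 14 (Var 12) ;; Assign 12 (Var 13) ;; Assign 13 (Var 14)) Skip ;;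
  ATTACH ;; Assign 14 (Var 12) ;; BUMP.
Definition REMOVE : cmd :=
  Assign 11 (Var 0) ;; Assign 14 (fld 11 0) ;; DETACH ;; Free (Var 11) ;; DROP.

Section Updates.
Variables W P K n L : nat.
Hypothesis PW : P < W.
Hypothesis W16 : 100 < W.
Hypothesis K0 : 0 < K.
Hypothesis KW : K < W.
Hypothesis nL : n < 2 ^ L.
Hypothesis LK : L <= K.
Notation GI := (GI W K n).
Notation IL := (IL W K n).

(* The potential is measured against an arbitrary orientation of the current
   graph, so that it need not be compared with an optimal one. *)
Definition Good (B t X : nat) (s : store) (A O E : seq nat) : Prop :=
  exists Bk sc un cl tl,
  [/\ GI s A O E Bk sc un cl tl, LI K n B s E sc, settled n s E &
      forall hd' tl', orient E (hdf s) (tlf s) hd' tl' ->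
        t + Pot K n B s un <= X + 300 * PF K B n E hd'].

Lemma good_time B t X s A O E d d' : d <= d' ->
  Good B t X s A O E -> Good B (t + d) (X + d') s A O E.
Proof.
move=> dd [Bk [sc [un [cl [tl [h1 h2 h3 h4]]]]]]; exists Bk, sc, un, cl, tl; split=> // hd' tl' Ho.
by have := h4 hd' tl' Ho; move: dd; clear; lia.
Qed.

Lemma il_proper s E sc un : IL s E sc un -> loopless n E (hdf s) (tlf s).
Proof. by move=> H e /(il_e H)[]. Qed.

Lemma li_fl B s E sc v : LI K n B s E sc -> v < n ->
  lev K s v <= fl K B (s v 12) <= lev K s v + 3.
Proof.
move=> H vn; apply/andP; split; last first.
  by apply: leq_trans (fl_le K B (li_hi H vn)) _; rewrite fl_thr // addn3.
case: (posnP (lev K s v)) => [->//|i0]; apply: ltnW.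
rewrite -[X in X < _]prednK //; have := li_lo H vn i0; rewrite -flP // => h.
by rewrite prednK.
Qed.

(** A higher level would force an in-degree above [2 ^ L.+2 * B.+1], hence above the number of
    edges. The upper limit on [size E] is what the rebuilding maintains. *)
Lemma li_lev B s E sc v : LI K n B s E sc -> settled n s E -> v < n ->
  size E <= 4 * (n * B.+1) -> lev K s v <= K * (L + 3).
Proof.
move=> HL St vn mE; case: (posnP (lev K s v)) => [->//|i0].
have h := li_lo HL vn i0; rewrite leqNgt; apply/negP => lt.
have h2 := thr_pow B K0 L.+2; have h3 := thr_lt K B lt.
have h4 : s v 12 <= size E by rewrite St //; apply: count_size.
have h5 : 4 * (n * B.+1) <= 2 ^ L.+2 * B.+1.
  by rewrite !expnS !mulnA leq_mul2r leq_mul2l (ltnW nL) orbT.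
rewrite addn3 in h3.
have := leq_trans (leq_trans h4 mE) (leq_trans h5 h2); have := leq_trans h3 h.
by move: (thr _ _ _) => x h6 h7; have := leq_trans h6 h7; rewrite ltnn.
Qed.

(** The credit of [8000 * K] covers 300 times [slack + 4], the search for the label and the constant
    part of [BUMP]; [L <= K] turns all of them into multiples of [K]. *)
Lemma runs_ADD B t X r s A O E e a b (Q : _ -> _ -> _ -> _ -> Prop) :
  Good B t X s A O E -> e \in O -> n < e -> e \notin E ->
  a < n -> b < n -> a != b -> r 10 = K -> r 11 = e -> r 12 = a -> r 13 = b ->
  blksize * (size O + (n + (size E).+1)).+1 <= P ->
  8 * ((size E).+1 + B + n + K) + 100 < W -> size E <= 4 * (n * B.+1) ->
  (forall r' s' A' dt, Good B (t + dt) (X + 80 * (100 * K)) s' A' O (e :: E) ->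
     orient E (hdf s) (tlf s) (hdf s') (tlf s') ->
     s' e 0 = a /\ s' e 1 = b \/ s' e 0 = b /\ s' e 1 = a ->
     outside n s s' O (e :: E) ->
     (forall k, k < 11 -> r' k = r k) -> Q r' s' A' dt) ->
  runs W P ADD r s A Q.
Proof.
move=> [Bk [sc [un [cl [tl [HG HL St Cr]]]]]] eO ne eE an bn ab r10 r11 r12 r13 PO HW mE q.
have [HI HO HE] := HG; have [OA BA BO] := env_mem HE; have [pA U nO JO] := HE.
have vO v : v < n -> v \in O by move=> vn; apply: nO; apply: ltnW.
have uE : uniq E by have := os_uJ HO; rewrite cat_uniq => /and3P[].
have core h u r1 d1 : (h = a /\ u = b) \/ (h = b /\ u = a) -> s h 13 <= s u 13 ->
  r1 12 = h -> r1 13 = u -> r1 11 = e -> (forall k, k < 11 -> r1 k = r k) -> d1 <= 5 ->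
  runs W P (ATTACH ;; Assign 14 (Var 12) ;; BUMP) r1 s A
    (fun r' s' A' dt => Q r' s' A' (d1 + dt)).
  move=> hu le q12 q13 q11 Hr1 d1le.
  have [hn un' hu'] : [/\ h < n, u < n & h != u] by case: hu => [] [-> ->]; rewrite // eq_sym.
  (* The head of an out-edge of [u] is at most two levels above [u], which limits the labels in the
     chain to be searched. *)
  apply: runs_seq; apply: (runs_ATTACH PW W16 K0 KW (e := e) (h := h) (t := u) (M := s u 13 + 2) HG) => //.
  - move=> y yE y1; rewrite /lab -y1; exact: (li_st HL).
  - by rewrite Hr1.
  - apply: leq_trans PO; rewrite leq_mul2l /= ltnS; apply: leq_trans (env_size HO HE) _.
    by rewrite !leq_add2l.
  move=> r2 s2 A2 Bk2 cl2 tl2 d2 H2 sz2 kp2 e20 e21 Hr2 _ dle2.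
  apply: runs_seq; apply: runs_assign => //=; rewrite Hr2 // q12.
  have k2v v f : v < n -> f \in [:: 0; 1; 12; 13; 14] -> s2 v f = s v f.
    move=> vn ff; apply: kp2; rewrite ?vO //; first by move: ff; rewrite !inE; repeat case/orP; move=> /eqP->.
    apply/orP; left; apply/andP; split; first by rewrite neq_ltn (ltn_trans vn ne).
    by move: ff; rewrite !inE; repeat case/orP; move=> /eqP->.
  have k2e y f : y \in E -> f \in [:: 0; 1] -> s2 y f = s y f.
    move=> yE ff; apply: kp2; first by apply: JO; rewrite mem_items yE orbT.
      by move: ff; rewrite !inE; case/orP => /eqP->.
    apply/orP; left; apply/andP; split; first by apply: contraNneq eE => <-.
    by move: ff; rewrite !inE; case/orP => /eqP->.
  have out2 : outside n s s2 O (e :: E).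
    by move=> y f yO ny yE fN; apply: kp2 => //; rewrite ny yE orbT.
  have lv v : v < n -> lev K s2 v = lev K s v by move=> vn; rewrite /lev k2v.
  have deq : {in E, hdf s2 =1 hdf s} by move=> y yE; apply: k2e.
  have dege v : deg (e :: E) (hdf s2) v = (h == v) + deg E (hdf s) v.
    by rewrite -(deg_mem v deq) /deg /= {1}/hdf e20.
  have HL2 : LI K n B s2 (e :: E) (fun v => if v == h then e :: sc v else sc v).
    split.
    - by move=> v vn; rewrite lv // k2v //; apply: (li_th HL).
    - by move=> v vn; rewrite lv // k2v //; apply: (li_lo HL).
    - by move=> v vn; rewrite lv // k2v //; apply: (li_hi HL).
    - move=> y; rewrite inE => /orP[/eqP->|yE].
        by rewrite e20 e21 !k2v //; apply: leq_trans le (leq_addr _ _).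
      have [_ y0n y1n _] := il_e HI yE.
      by rewrite !(k2e y) // !k2v //; apply: (li_st HL).
    - move=> v y vn.
      have base : y \in sc v -> s2 v 13 <= s2 (s2 y 1) 13 + 1.
        move=> yv; have yE : y \in E.
          by have := il_m HI y vn; rewrite mem_cat yv /= => /esym/andP[].
        have [_ y0n y1n _] := il_e HI yE.
        by rewrite (k2e y) // !k2v //; apply: (li_sc HL).
      case: (eqVneq v h) => [vh|_]; last exact: base.
      rewrite inE => /orP[/eqP->|]; last exact: base.
      by rewrite e21 vh !k2v //; apply: leq_trans le (leq_addr _ _).
  apply: (runs_BUMP PW W16 K0 KW H2 HL2 hn) => //.
  - by move=> v vn; rewrite dege k2v // St // addnC [h == v]eq_sym.
  - by rewrite /rset /= Hr2 // Hr1.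
  move=> r3 s3 A3 Bk3 sc3 un3 cl3 tl3 d3 H3 HL3 St3 ho3 out3 Hr3 dle3.
  have ho23 y : y \in e :: E -> (s3 y 0 = s2 y 0 /\ s3 y 1 = s2 y 1) \/ (s3 y 0 = s2 y 1 /\ s3 y 1 = s2 y 0) by apply: ho3.
  apply: q.
  - exists Bk3, sc3, un3, cl3, tl3; split=> // hd' tl' Ho.
    have Ho2 := orient_trans ho3 Ho.
    have HI2 := gi_il H2.
    have := @insert_pot K B n K0 L E (hdf s2) (tlf s2) e hd' tl'
      (X) (t + (400 * (K * vsum n (fun v => psi K B (lev K s v) (s v 12))) + 20 * vsum n (fun v => size (un v)))) 300 nL.
    move/(_ _ (il_proper HI2) _ _ Ho2).
    have Eh : hdf s2 e = h by []. have Et : tlf s2 e = u by [].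
    have dg v : v < n -> deg E (hdf s2) v = s v 12 by move=> vn; rewrite (deg_mem _ deq) St.
    rewrite Eh Et !dg //.
    have F1 v : v < n -> lev K s v <= fl K B (s v 12) <= lev K s v + 3 by apply: li_fl HL.
    have stb : stable K B 5 E (hdf s2) (tlf s2).
      move=> y yE; rewrite /hdf /tlf !(k2e y) //.
      have [_ y0n y1n _] := il_e HI yE; rewrite !dg //.
      have := F1 _ y0n; have := F1 _ y1n; have := li_st HL yE; rewrite /lev.
      by move: (fl _ _ _) (fl _ _ _) => f1 f2; clear; lia.
    have g3 : fl K B (s h 12) <= fl K B (s u 12) + 3.
      have := F1 _ hn; have := F1 _ un'; move: le; rewrite /lev.
      by move: (fl _ _ _) (fl _ _ _) => f1 f2; clear; lia.
    have uE' : uniq (e :: E) by rewrite /= eE.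
    move/(_ uE' stb g3) => IP.
    have PFE hd : {in E, hd =1 hdf s} -> PF K B n E hd = vsum n (fun v => Fpot K B (s v 12)).
      by move=> hE; apply: eq_vsum => v vn; rewrite (deg_mem _ hE) St.
    have {}IP := IP _; rewrite !PFE // in IP.
    have : t + (400 * (K * vsum n (fun v => psi K B (lev K s v) (s v 12))) + 20 * vsum n (fun v => size (un v))) +
       300 * (vsum n (fun v => Fpot K B (s v 12)) + fl K B (s h 12)) <=
       X + 300 * (slack K L + 4) + 300 * PF K B n (e :: E) hd'.
      apply: IP => hd'' tl'' Ho''.
      have : orient E (hdf s) (tlf s) hd'' tl''.
        by move=> y yE; have := Ho'' y yE; rewrite /hdf /tlf !(k2e y).
      by move=> /Cr; rewrite /Pot; clear; lia.
    have P2 : Pot K n B s2 un = Pot K n B s un.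
      rewrite /Pot; congr (_ * _ + _ * (_ * _) + _); apply: eq_vsum => v vn; rewrite ?lv ?k2v //.
    move: dle3 dle2; rewrite P2 k2v // /Pot /slack mulnDr.
    (* The level of [u] is at most [K * (L + 3)]; the shift of stored levels by [K] adds one class
       and the 2 at most two. *)
    have M1 : (s u 13 + 2) %/ K <= L + 6.
      have lu := li_lev HL St un' mE.
      rewrite -[X in _ <= X](mulnK _ K0); apply: leq_div2r.
      have [Ku _] := il_K HI un'; move: lu; rewrite /lev leq_subLR => lu.
      by move: lu K0; rewrite !mulnDl !mulnDr [K * L]mulnC; move: (L * K) => z; clear; lia.
    move: M1 K0 LK d1le; rewrite /slack mulnDr; move: (_ %/ _) (400 * _) (20 * _) (300 * vsum _ _) => M p1 p2 p3.
    move: (fl _ _ _) (300 * PF _ _ _ _ _) => f1 p4.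
    clear; lia.
  - by move=> y yE; have := ho23 y; rewrite inE yE orbT /hdf /tlf !(k2e y) //; apply.
  - have := ho23 e (mem_head _ _); rewrite e20 e21.
    by case: hu => [] [-> ->] [] []; [left|right|right|left].
  - by move=> y f yO ny yE fN; rewrite out3 // out2.
  - move=> k k11; rewrite Hr3 // /rset (lt_neq k11) // Hr2 ?Hr1 //; exact: leq_trans k11 _.
have aA : a \in A by apply: OA; apply: vO.
have bA : b \in A by apply: OA; apply: vO.
have [_ LWb] := il_K HI bn.
apply: runs_seq; apply: runs_if_lte; [by sf; rewrite ?r12 ?r13 //; apply: ltnW| |];
  rewrite /= r12 r13 => le.
  do 2![apply: runs_seq; apply: runs_assign => //=]; apply: runs_assign => //=; rewrite ?r12 ?r13.
  apply: (core b a _ (1 + (1 + 1)).+1); rewrite ?(ltnW le) //=; first by right.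
  by move=> k k11; rewrite /rset !(lt_neq k11).
apply: runs_skip; apply: (core a b _ 2) => //; by left.
Qed.



Lemma gi_free s A O E Bk sc un cl tl e : GI s A O E Bk sc un cl tl ->
  e \in O -> n < e -> e \notin E -> GI s (rem e A) (rem e O) E Bk sc un cl tl.
Proof.
move=> [HI HO [pA U nO JO]] eO ne eE; split=> //.
have uO : uniq O by move: U; rewrite cat_uniq => /and3P[].
have eA : e \in A by rewrite (perm_mem pA) mem_cat eO.
have pU : perm_eq (O ++ Bk) (e :: rem e O ++ Bk).
  by rewrite -cat_cons perm_cat2r perm_to_rem.
split.
- rewrite -(perm_cons e); apply: perm_trans pU; apply: perm_trans pA.
  by rewrite perm_sym perm_to_rem.
- by move: U; rewrite (perm_uniq pU) /= => /andP[].
- move=> a an; rewrite mem_rem_uniq // inE nO // andbT.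
  by rewrite neq_ltn (leq_ltn_trans an ne).
- move=> y yJ; rewrite mem_rem_uniq // inE JO // andbT.
  apply: contraTneq yJ => ->; by rewrite mem_items negb_or -leqNgt ltnW.
Qed.

(** Detaching leaves all stored degrees and levels alone and can only shorten the unscanned lists,
    so [Pot] does not grow; the former head then starts with a deficit of one. *)
Lemma runs_REMOVE B t X r s A O E e (Q : _ -> _ -> _ -> _ -> Prop) :
  Good B t X s A O E -> e \in E -> r 10 = K -> r 0 = e ->
  blksize * (size O + (n + size E)).+1 <= P ->
  8 * (size E + B + n + K) + 100 < W ->
  (forall r' s' A' dt, Good B (t + dt) (X + 80 * (100 * K)) s' A' (rem e O) (rem e E) ->
     orient (rem e E) (hdf s) (tlf s) (hdf s') (tlf s') ->
     outside n s s' (rem e O) (rem e E) ->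
     (forall k, k < 11 -> r' k = r k) -> Q r' s' A' dt) ->
  runs W P REMOVE r s A Q.
Proof.
move=> [Bk [sc [un [cl [tl [HG HL St Cr]]]]]] eE r10 r0 PO HW q.
have [HI HO HE] := HG; have [OA BA BO] := env_mem HE; have [pA U nO JO] := HE.
have vO v : v < n -> v \in O by move=> vn; apply: nO; apply: ltnW.
have EO y : y \in E -> y \in O by move=> yE; apply: JO; rewrite mem_items yE orbT.
have uE : uniq E by have := os_uJ HO; rewrite cat_uniq => /and3P[].
have uO : uniq O by move: U; rewrite cat_uniq => /and3P[].
have [ne h0 t0 ht] := il_e HI eE; set h := s e 0 in h0 ht.
have eO := EO _ eE; have eA := OA _ eO.
apply: runs_seq; apply: runs_assign => //=; rewrite r0.
apply: runs_seq; apply: runs_assign; first by sf.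
rewrite /= -/h.
apply: runs_seq; apply: (runs_DETACH W16 K0 HG eE) => //.
move=> r1 s1 A1 Bk1 cl1 tl1 d1 H1 sz1 kp1 e10 e11 Hr1 d1le.
have mr : e \notin rem e E by rewrite mem_rem_uniq // inE eqxx.
have rE y : y \in rem e E -> y \in E /\ y != e.
  by rewrite mem_rem_uniq // inE => /andP[].
have [_ _ HE1] := H1; have [OA1 _ _] := env_mem HE1.
apply: runs_seq; apply: (runs_free (A' := rem e A1)) => //=.
  by rewrite Hr1 //= perm_to_rem // OA1.
have H2 := gi_free H1 eO ne mr.
have k1v v f : v < n -> f \in [:: 0; 1; 12; 13; 14] -> s1 v f = s v f.
  move=> vn ff; apply: kp1; rewrite ?vO //; first by move: ff; rewrite !inE; repeat case/orP; move=> /eqP->.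
  apply/orP; left; apply/andP; split; first by rewrite neq_ltn (ltn_trans vn ne).
  by move: ff; rewrite !inE; repeat case/orP; move=> /eqP->.
have k1e y f : y \in rem e E -> f \in [:: 0; 1] -> s1 y f = s y f.
  move=> /rE[yE ye] ff; apply: kp1; rewrite ?EO ?ye //; by move: ff; rewrite !inE; case/orP => /eqP->.
have lv v : v < n -> lev K s1 v = lev K s v by move=> vn; rewrite /lev k1v.
have deq : {in rem e E, hdf s1 =1 hdf s} by move=> y yE; apply: k1e.
have HL1 : LI K n B s1 (rem e E) (fun v => [seq x <- sc v | x != e]).
  split.
  - by move=> v vn; rewrite lv // k1v //; apply: (li_th HL).
  - by move=> v vn; rewrite lv // k1v //; apply: (li_lo HL).
  - by move=> v vn; rewrite lv // k1v //; apply: (li_hi HL).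
  - move=> y yE'; have [yE ye] := rE y yE'; have [_ y0n y1n _] := il_e HI yE.
    by rewrite !(k1e y) // !k1v //; apply: (li_st HL).
  - move=> v y vn; rewrite mem_filter => /andP[ye yv]; have yE : y \in E.
      by have := il_m HI y vn; rewrite mem_cat yv /= => /esym/andP[].
    have [_ y0n y1n _] := il_e HI yE; have yE' : y \in rem e E by rewrite mem_rem_uniq // inE ye.
    by rewrite (k1e y) // !k1v //; apply: (li_sc HL).
have s2 : size (rem e E) <= size E by rewrite size_rem // leq_pred.
have s3 : size (rem e O) <= size O by rewrite size_rem // leq_pred.
apply: (runs_DROP PW W16 K0 KW H2 HL1 h0) => //.
- move=> v vn; rewrite (deg_mem _ deq) k1v // St // (deg_rem _ _ uE eE) addnC.
  by rewrite [v == h]eq_sym.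
- by rewrite Hr1.
- by rewrite Hr1.
- by apply: leq_trans PO; rewrite leq_mul2l /= ltnS !leq_add // leq_add2l.
- by apply: leq_ltn_trans HW; rewrite leq_add2r leq_mul2l /= !leq_add2r.
move=> r3 s3' A3 Bk3 sc3 un3 cl3 tl3 d3 H3 HL3 St3 ho3 out3 Hr3 dle3.
have ho13 : orient (rem e E) (hdf s) (tlf s) (hdf s3') (tlf s3').
  by move=> y yE; have := ho3 y yE; rewrite /hdf /tlf !(k1e y).
apply: q => //.
- exists Bk3, sc3, un3, cl3, tl3; split=> // hd' tl' Ho.
  have Ho2 := orient_trans ho13 Ho.
  have F1 v : v < n -> lev K s v <= fl K B (s v 12) <= lev K s v + 3 by apply: li_fl HL.
  have stb : stable K B 5 E (hdf s) (tlf s).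
    move=> y yE; rewrite /hdf /tlf.
    have [_ y0n y1n _] := il_e HI yE; rewrite -!St //.
    have := F1 _ y0n; have := F1 _ y1n; have := li_st HL yE; rewrite /lev.
    by move: (fl _ _ _) (fl _ _ _) => f1 f2; clear; lia.
  have PFE : PF K B n E (hdf s) = vsum n (fun v => Fpot K B (s v 12)).
    by apply: eq_vsum => v vn; rewrite St.
  have DP := @delete_pot K B n K0 L E (hdf s) (tlf s) e hd' tl'
    X (t + (400 * (K * vsum n (fun v => psi K B (lev K s v) (s v 12))) + 20 * vsum n (fun v => size (un v)))) 300 nL uE eE (il_proper HI) stb Ho2.
  rewrite PFE -[deg E (hdf s) _]St // in DP; have {}DP := DP _.
  have {}DP : t + (400 * (K * vsum n (fun v => psi K B (lev K s v) (s v 12))) + 20 * vsum n (fun v => size (un v))) +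
     300 * vsum n (fun v => Fpot K B (s v 12)) <=
     X + 300 * (slack K L + 1) + 300 * fl K B (s h 12).-1 + 300 * PF K B n (rem e E) hd'.
    by apply: DP => hd'' tl'' /Cr; rewrite /Pot; clear; lia.
  have P2 : Pot K n B s1 (fun v => [seq x <- un v | x != e]) <= Pot K n B s un.
    rewrite /Pot leq_add //; last by rewrite leq_mul2l; apply: leq_vsum => v _; rewrite size_filter count_size.
    rewrite eq_leq //; congr (_ * _ + _ * (_ * _)); apply: eq_vsum => v vn; rewrite ?lv ?k1v //.
  move: DP dle3 P2; rewrite k1v // [Pot K n B s un]/Pot /slack.
  move: K0 LK d1le (Pot _ _ _ _ _) (Pot _ _ _ _ _); move: (400 * _) (20 * _) (300 * vsum _ _) (fl _ _ _) (300 * PF _ _ _ _ _) => p1 p2 p3 f1 p4.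
  clear; lia.
- move=> y f yO ny yE fN; rewrite out3 //.
  have [yO1 ye] : y \in O /\ y != e by move: yO; rewrite mem_rem_uniq // inE => /andP[].
  apply: kp1 => //; apply/orP; right; rewrite ny inE negb_or ye /=.
  by apply: contra yE => yE; rewrite mem_rem_uniq // inE ye.
- move=> k k11; rewrite Hr3 // Hr1 ?(ltn_trans k11) //.
    by rewrite /rset !(lt_neq k11).
  by rewrite (lt_neq k11).
Qed.
End Updates.

(** * Rebuilding *)

Definition INC (x : nat) : cmd := Assign x (Bin Add (Var x) (Cst 1)).
(** Edges have addresses above [n] and vertices below, so a comparison with the root tells whether
    the in-list still contains an edge. *)
Definition DRAIN_STEP : cmd :=
  If (lte (Var 9) (fld 3 2))
    (Assign 11 (fld 3 2) ;; DETACH ;; LINK 2 9 11 30) (INC 3).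
Definition UNFILE_STEP : cmd := Assign 22 (Var 3) ;; UNFILE ;; INC 3.
Definition FILE_STEP : cmd :=
  adr 3 0 (Var 3) ;; adr 3 1 (Var 9) ;; adr 3 2 (Var 3) ;; adr 3 3 (Var 3) ;;
  adr 3 12 (Cst 0) ;; adr 3 13 (Var 10) ;; adr 3 14 (fld 9 15) ;; adr 3 15 (Var 3) ;;
  Assign 21 (Var 10) ;; Assign 22 (Var 3) ;; Assign 23 (Var 9) ;; FILE ;; INC 3.
Definition EACH (c : cmd) : cmd := Assign 3 (Cst 0) ;; While (lte (Var 3) (Var 9)) c.
Definition REINSERT : cmd :=
  While (lte (Var 9) (fld 9 2))
    (Assign 11 (fld 9 2) ;; UNLINK 2 11 30 31 ;;
     Assign 12 (fld 11 0) ;; Assign 13 (fld 11 1) ;; ADD).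

Section Rebuild.
Variables W P K n L : nat.
Hypothesis PW : P < W.
Hypothesis W16 : 100 < W.
Hypothesis K0 : 0 < K.
Hypothesis KW : K < W.
Hypothesis nL : n < 2 ^ L.
Hypothesis LK : L <= K.
Hypothesis nW : n.+2 < W.
Notation GI := (GI W K n).
Notation IL := (IL W K n).
Notation Good := (Good W K n).

Definition same (s s' : store) (E : seq nat) : Prop :=
  (forall y f, y \in E -> f \in [:: 0; 1] -> s' y f = s y f) /\
  (forall f, f \in [:: 12; 13; 14; 15] -> s' n f = s n f).

Lemma gi_frame0 s s' A O E Bk sc un cl tl : GI s A O E Bk sc un cl tl ->
  (forall a f, a \in A -> [|| 4 <= f <= 11, a < n | a \in E] -> s' a f = s a f) ->
  (forall b, b \in A -> b \notin O -> s' b 1 = s b 1) ->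
  GI s' A O E Bk sc un cl tl.
Proof.
move=> [HI HO HE] F F1; have [OA BA BO] := env_mem HE; have [_ _ nO JO] := HE.
have aA a : (a < n) || (a \in E) -> a \in A.
  by move=> h; apply: OA; apply: JO; rewrite mem_items.
split=> //.
  by apply: il_frame HI _ => a f aa _; apply: F; [exact: aA|rewrite aa orbT].
have Fv v f : v < n -> s' v f = s v f by move=> vn; apply: F; rewrite ?vn ?orbT ?aA ?vn.
have Fy y f : y \in items n E -> s' y f = s y f.
  by rewrite mem_items => h; apply: F; [exact: aA|rewrite h orbT].
apply: os_frame HO _ _ _ _ => [a f aa ff|b bB|y yJ|y yJ].
- apply: F; last by rewrite ff.
  by case/or3P: aa => [an|aJ|aB]; [apply: OA; apply: nO|apply: OA; apply: JO|apply: BA].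
- by apply: F1; [apply: BA|apply: BO].
- exact: Fy.
- by rewrite /lab (Fy y) // Fv // (il_lab HI yJ).
Qed.

Lemma good_frame0 B t X s s' A O E : Good B t X s A O E ->
  (forall a f, a \in A -> [|| 4 <= f <= 11, a < n | a \in E] -> s' a f = s a f) ->
  (forall b, b \in A -> b \notin O -> s' b 1 = s b 1) ->
  Good B t X s' A O E.
Proof.
move=> [Bk [sc [un [cl [tl [HG HL St Cr]]]]]] F F1.
have [HI HO HE] := HG; have [OA BA BO] := env_mem HE; have [_ _ nO JO] := HE.
have aA a : (a < n) || (a \in E) -> a \in A.
  by move=> h; apply: OA; apply: JO; rewrite mem_items.
have Fv v f : v < n -> s' v f = s v f by move=> vn; apply: F; rewrite ?vn ?orbT ?aA ?vn.
have Fe y f : y \in E -> s' y f = s y f.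
  by move=> yE; apply: F; rewrite ?yE ?orbT ?aA ?yE ?orbT.
have lv v : v < n -> lev K s' v = lev K s v by move=> vn; rewrite /lev Fv.
exists Bk, sc, un, cl, tl; split.
- exact: gi_frame0 HG F F1.
- split.
  + by move=> v vn; rewrite lv // Fv //; apply: (li_th HL).
  + by move=> v vn; rewrite lv // Fv //; apply: (li_lo HL).
  + by move=> v vn; rewrite lv // Fv //; apply: (li_hi HL).
  + move=> y yE; have [_ y0 y1 _] := il_e HI yE.
    by rewrite !(Fe y) // !Fv //; apply: (li_st HL).
  + move=> v y vn yv; have yE : y \in E.
      by have := il_m HI y vn; rewrite mem_cat yv /= => /esym/andP[].
    have [_ y0 y1 _] := il_e HI yE.
    by rewrite !(Fe y) // !Fv //; apply: (li_sc HL vn yv).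
- by move=> v vn; rewrite Fv // St //; apply: deg_mem => y yE; rewrite /hdf Fe.
- move=> hd' tl' Ho; have : orient E (hdf s) (tlf s) hd' tl'.
    by move=> y yE; have := Ho y yE; rewrite /hdf /tlf !Fe.
  move=> /Cr; rewrite /Pot.
  have -> : vsum n (fun v => Fpot K B (s' v 12)) = vsum n (fun v => Fpot K B (s v 12)).
    by apply: eq_vsum => v vn; rewrite Fv.
  have -> // : vsum n (fun v => psi K B (lev K s' v) (s' v 12)) = vsum n (fun v => psi K B (lev K s v) (s v 12)).
  by apply: eq_vsum => v vn; rewrite lv // Fv.
Qed.

Lemma gi_frame s s' A O E Bk sc un cl tl : GI s A O E Bk sc un cl tl ->
  (forall a f, [|| f \notin [:: 2; 3], a < n | a \in E] -> s' a f = s a f) ->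
  GI s' A O E Bk sc un cl tl.
Proof.
move=> HG F; apply: gi_frame0 HG _ _ => [a f _ h|b _ _]; apply: F => //.
case/or3P: h => [ff|->|->]; rewrite ?orbT //; apply/orP; left.
by rewrite !inE negb_or; apply/andP; split; apply: contraTneq ff => ->.
Qed.

Lemma good_frame B t X s s' A O E : Good B t X s A O E ->
  (forall a f, [|| f \notin [:: 2; 3], a < n | a \in E] -> s' a f = s a f) ->
  Good B t X s' A O E.
Proof.
move=> HG F; apply: good_frame0 HG _ _ => [a f _ h|b _ _]; apply: F => //.
case/or3P: h => [ff|->|->]; rewrite ?orbT //; apply/orP; left.
by rewrite !inE negb_or; apply/andP; split; apply: contraTneq ff => ->.
Qed.

(** The root has no in-edges, so its cells 2 and 3 are free to hold the list of pending edges. These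
    keep their ends in the cells 0 and 1, and the graph is not lost while no in-list contains
    them. *)
Lemma drain_loop N : forall v r s A O E Bk sc un cl tl pend (Q : _ -> _ -> _ -> _ -> Prop),
  size E + (n - v) < N -> GI s A O E Bk sc un cl tl -> v <= n ->
  (forall y, y \in E -> v <= s y 0) -> r 3 = v -> r 9 = n -> r 10 = K ->
  cyc s 2 n pend -> uniq (pend ++ E) -> {subset pend <= O} -> (forall y, y \in pend -> n < y) ->
  (forall r' s' A' Bk' sc' un' cl' tl' pend' dt,
     GI s' A' O [::] Bk' sc' un' cl' tl' -> cyc s' 2 n pend' -> perm_eq pend' (pend ++ E) ->
     same s s' (pend ++ E) -> (forall k, k < 11 -> k != 3 -> r' k = r k) ->
     dt <= 130 * (size E + (n - v)) + 2 -> Q r' s' A' dt) ->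
  runs W P (While (lte (Var 3) (Var 9)) DRAIN_STEP) r s A Q.
Proof.
elim: N => [|N IH] v r s A O E Bk sc un cl tl pend Q // leN HG vn Ev r3 r9 r10 Cp Up pO pn q.
have [HI HO HE] := HG; have [OA BA BO] := env_mem HE; have [pA U nO JO] := HE.
apply: runs_while => //.
- by sf; rewrite r3; apply: leq_ltn_trans nW; rewrite ltnS (leq_trans vn).
- rewrite lte_vl /= r3 r9 => /eqP; rewrite eqb0 -leqNgt => nv.
  have E0 : E = [::].
    case: (E) Ev (il_e HI) => // y m Ev /(_ y (mem_head _ _))[_ y0 _ _].
    by have := leq_ltn_trans (leq_trans nv (Ev y (mem_head _ _))) y0; rewrite ltnn.
  move: q HG; rewrite E0 cats0 => q HG.
  by apply: (q _ _ _ _ _ _ _ _ pend _ HG Cp) => //; rewrite addn2.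
rewrite lte_vl /= r3 r9 eqb0 negbK => vn'.
have vA : v \in A by apply: OA; apply: nO.
have v2 : s v 2 = head v (sc v ++ un v) := cyc_next (l1 := [::]) (il_c HI vn').
have mE y : y \in sc v ++ un v -> y \in E /\ s y 0 = v.
  by rewrite (il_m HI) // => /andP[-> /eqP].
apply: runs_if_lte; first by sf; rewrite ?r3 ?r9 // (ltn_trans _ nW).
all: rewrite /= r3 r9 v2 => le.
  case Es : (sc v ++ un v) mE v2 le => [|e m] mE v2 le; first by move: le; rewrite ltnNge ltnW.
  have [eE e0] := mE e (mem_head _ _); rewrite /= in v2.
  have eO : e \in O by apply: JO; rewrite mem_items eE orbT.
  have ep : e \notin pend.
    by apply: contraTN Up => ep; rewrite cat_uniq; apply/negP => /and3P[_ /hasPn /(_ e eE)]; rewrite /= ep.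
  apply: runs_seq; apply: runs_assign; first by sf; rewrite r3.
  rewrite /= r3 v2.
  apply: runs_seq; apply: (runs_DETACH W16 K0 HG eE) => //.
  move=> r1 s1 A1 Bk1 cl1 tl1 d1 H1 sz1 kp1 e10 e11 Hr1 d1le.
  have uE : uniq E by move: Up; rewrite cat_uniq => /and3P[].
  have [_ _ HE1] := H1; have [OA1 _ _] := env_mem HE1.
  have npE y : y \in n :: pend -> [/\ y \in O, n <= y & y \notin e :: E].
    rewrite inE => /orP[/eqP->|yp].
      split=> //; first exact: nO.
      rewrite inE negb_or; have [ne _ _ _] := il_e HI eE.
      rewrite neq_ltn ne; apply/negP => /(il_e HI)[]; by rewrite ltnn.
    split; [exact: pO|exact: ltnW (pn y yp)|].
    rewrite inE negb_or; apply/andP; split; first by apply: contraNneq ep => <-.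
    by apply: contraTN Up => yE; rewrite cat_uniq; apply/negP => /and3P[_ /hasPn /(_ y yE)]; rewrite /= yp.
  have k1 y f : y \in n :: pend -> ~~ (4 <= f <= 11) -> s1 y f = s y f.
    by move=> /npE[yO ny yE] ff; apply: kp1 => //; rewrite ny yE orbT.
  have C1 : cyc s1 2 n pend by apply: cyc_frame Cp => a ap; rewrite !k1.
  have pA1 a : a \in n :: pend -> a \in A1 by move=> /npE[aO _ _]; apply: OA1.
  have n2 : s1 n 2 \in n :: pend by apply: cyc_next_mem C1 _; rewrite mem_head.
  apply: runs_LINK => //; rewrite ?Hr1 //= ?r9.
  - exact: OA1.
  - by apply: pA1; rewrite mem_head.
  - exact: pA1.
  set s2 := link _ _ _ _.
  have F a f : [|| f \notin [:: 2; 3], a < n | a \in rem e E] -> s2 a f = s1 a f.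
    case/or3P => [ff|an|ar].
    - by rewrite /s2 link_fld //; apply: contraNneq ff => ->.
    - have aq y : n <= y -> a != y by move=> ny; rewrite neq_ltn (leq_trans an ny).
      have a1 : a != s1 n 2 by apply: aq; have [] := npE _ n2.
      have a2 : a != e by apply: aq; apply: ltnW; have [] := il_e HI eE.
      by rewrite /s2 /link !upd_adr // aq.
    - have [aE ae] : a \in E /\ a != e by move: ar; rewrite mem_rem_uniq // inE => /andP[].
      have an y : y \in n :: pend -> a != y.
        by move=> /npE[_ _ yE]; apply: contraNneq yE => <-; rewrite inE aE orbT.
      by rewrite /s2 /link !upd_adr // an // mem_head.
  have H2 := gi_frame H1 F.
  have C2 : cyc s2 2 n (e :: pend).
    apply: (cyc_link (l1 := [::]) (l2 := pend)) => //=.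
      move: Up; rewrite cat_uniq => /and3P[-> _ _]; rewrite andbT.
      by apply/negP => /pn; rewrite ltnn.
    rewrite inE negb_or ep andbT; have [ne _ _ _] := il_e HI eE; by rewrite neq_ltn ne orbT.
  have pr : perm_eq (e :: pend ++ rem e E) (pend ++ E).
    by rewrite -cat_cons -cat1s -catA perm_catCA perm_cat2l /= perm_sym perm_to_rem.
  have ky y f : y \in pend ++ E -> f \in [:: 0; 1] -> s2 y f = s y f.
    move=> yy ff; rewrite /s2 link_fld; try by move: ff; rewrite !inE => /orP[] /eqP->.
    case: (eqVneq y e) => [->|ye]; first by move: ff; rewrite !inE => /orP[] /eqP->; rewrite ?e10 ?e11.
    move: yy; rewrite mem_cat => /orP[yp|yE].
      by rewrite k1 ?inE ?yp ?orbT //; move: ff; rewrite !inE => /orP[] /eqP->.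
    apply: kp1; first by apply: JO; rewrite mem_items yE orbT.
      by move: ff; rewrite !inE => /orP[] /eqP->.
    by rewrite ye; move: ff; rewrite !inE => /orP[] /eqP->.
  apply: (IH v _ _ _ O (rem e E) Bk1 _ _ cl1 tl1 (e :: pend) _ _ H2) => //.
  - by rewrite size_rem //; move: leN; case: (E) eE => // y l _ /=; clear; lia.
  - move=> y yr; have yE := mem_rem yr; rewrite ky ?mem_cat ?yE ?orbT //; exact: Ev.
  - by rewrite /= Hr1.
  - by rewrite /= Hr1.
  - by rewrite /= Hr1.
  - by rewrite (perm_uniq pr).
  - by move=> y; rewrite inE => /orP[/eqP->//|/pO].
  - by move=> y; rewrite inE => /orP[/eqP->|/pn//]; have [] := il_e HI eE.
  move=> r4 s4 A4 Bk4 sc4 un4 cl4 tl4 pend4 d4 H4 C4 p4 [k40 k41] Hr4 dle4.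
  apply: (q _ _ _ Bk4 sc4 un4 cl4 tl4 pend4 _ H4 C4).
  - exact: perm_trans p4 pr.
  - split=> [y f yy ff|f ff].
      by rewrite k40 // ?ky // (perm_mem pr).
    rewrite k41 // /s2 link_fld; try by move: ff; rewrite !inE; repeat case/orP; move=> /eqP->.
    by rewrite k1 ?mem_head //; move: ff; rewrite !inE; repeat case/orP; move=> /eqP->.
  - move=> k k11 k3; by rewrite Hr4 // /rset (lt_neq k11) // Hr1 ?(ltn_trans k11) ?(lt_neq k11) // /rset (lt_neq k11).
  - move: dle4 d1le; rewrite size_rem //; case: (E) eE => // y l _ /=; clear; lia.
case Es : (sc v ++ un v) mE v2 le => [|e m] mE v2 le; last first.
  by have [/(il_e HI)[ne _ _ _] _] := mE e (mem_head _ _); move: le; rewrite /= leqNgt ne.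
apply: runs_assign; first by apply: (safe_inc W16) => //=; rewrite r3; apply: leq_ltn_trans nW; rewrite ltnS (leq_trans vn).
rewrite /= r3 addn1.
apply: (IH v.+1 _ _ _ O E Bk sc un cl tl pend _ _ HG) => //.
- by move: leN vn'; clear; lia.
- move=> y yE; rewrite ltn_neqAle Ev // andbT; apply/eqP => vy.
  by have := il_m HI y vn'; rewrite Es yE vy eqxx.
move=> r4 s4 A4 Bk4 sc4 un4 cl4 tl4 pend4 d4 H4 C4 p4 k4 Hr4 dle4.
apply: (q _ _ _ Bk4 sc4 un4 cl4 tl4 pend4 _ H4 C4) => //.
- by move=> k k11 k3; rewrite Hr4 // /rset (negbTE k3).
- by move: dle4 vn'; clear; lia.
Qed.
End Rebuild.

Section Rebuild2.
Variables W P K n L : nat.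
Hypothesis PW : P < W.
Hypothesis W16 : 100 < W.
Hypothesis K0 : 0 < K.
Hypothesis KW2 : K.+2 < W.
Hypothesis nL : n < 2 ^ L.
Hypothesis LK : L <= K.
Hypothesis nW : n.+2 < W.
Notation GI := (GI W K n).
Notation IL := (IL W K n).
Notation Good := (Good W K n).
Let KW : K < W := ltnW (ltnW KW2).

(** Only vertices are still filed. When they have left, no bucket can remain, because none is ever
    empty. *)
Lemma unfile_loop N : forall v r s A O Bk own lab cl tl (Q : _ -> _ -> _ -> _ -> Prop),
  n - v < N -> OS K n s [::] Bk (iota v (n - v)) own lab cl tl ->
  env n A O Bk (iota v (n - v)) -> v <= n -> r 3 = v -> r 9 = n -> r 10 = K ->
  {in Bk, forall b, (s b 11).+1 < W} ->
  (forall r' s' A' cl' tl' dt, OS K n s' [::] [::] [::] own lab cl' tl' ->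
     env n A' O [::] [::] -> keeps s s' O -> (forall k, k < 11 -> k != 3 -> r' k = r k) ->
     dt <= 70 * (n - v) + 2 -> Q r' s' A' dt) ->
  runs W P (While (lte (Var 3) (Var 9)) UNFILE_STEP) r s A Q.
Proof.
elim: N => [|N IH] v r s A O Bk own lab cl tl Q // leN HO HE vn r3 r9 r10 lbW q.
apply: runs_while => //.
- by sf; rewrite r3; apply: leq_ltn_trans nW; rewrite ltnS (leq_trans vn).
- rewrite lte_vl /= r3 r9 => /eqP; rewrite eqb0 -leqNgt => nv.
  have vE : n - v = 0 by apply/eqP; rewrite subn_eq0.
  have Bk0 : Bk = [::] by apply: size0nil; have := os_size HO; rewrite vE leqn0 => /eqP.
  move: HO HE; rewrite vE Bk0 => HO HE.
  by apply: (q _ _ _ _ _ _ HO HE) => //; rewrite addn2.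
rewrite lte_vl /= r3 r9 eqb0 negbK => vn'.
have Ei : iota v (n - v) = v :: iota v.+1 (n - v.+1) by rewrite -(subnSK vn').
have Er : rem v (iota v (n - v)) = iota v.+1 (n - v.+1) by rewrite Ei /= eqxx.
apply: runs_seq; apply: runs_assign => //=; rewrite r3.
apply: runs_seq; apply: (runs_UNFILE W16 K0 HO HE (y := v)) => //.
  by rewrite Ei mem_head.
move=> r1 s1 A1 Bk1 cl1 tl1 d1; rewrite Er => H1 E1 sz1 lb1 kp1 Hr1 d1le.
apply: runs_assign.
  by apply: (safe_inc W16) => //=; rewrite Hr1 //= r3; apply: leq_ltn_trans nW; rewrite ltnS (leq_trans vn).
rewrite /= Hr1 //= r3 addn1.
apply: (IH v.+1 _ _ _ O Bk1 own lab cl1 tl1) => //.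
- by move: leN vn'; clear; lia.
- by rewrite /= Hr1.
- by rewrite /= Hr1.
move=> r4 s4 A4 cl4 tl4 d4 H4 E4 kp4 Hr4 dle4.
apply: (q _ _ _ cl4 tl4 _ H4 E4).
- by move=> a f aO ff; rewrite kp4 // kp1.
- move=> k k11 k3; rewrite Hr4 // /rset (negbTE k3) Hr1 ?(leq_trans k11) // /rset (lt_neq k11) //.
- by move: dle4 d1le vn'; clear; lia.
Qed.

Definition vcell (B w f : nat) : nat :=
  if f == 1 then n else if f == 12 then 0 else if f == 13 then K else if f == 14 then B else w.
Definition clean (B : nat) (s : store) (v : nat) : Prop :=
  forall w f, w < v -> f \in [:: 0; 1; 2; 3; 12; 13; 14; 15] -> s w f = vcell B w f.

Lemma os_item s Bk J own lab cl tl b : OS K n s [::] Bk J own lab cl tl -> b \in Bk ->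
  exists2 y, y \in J & s b 11 = lab y.
Proof.
move=> H bB; have := os_ne H bB isT; have := os_tl H _ bB.
case: (tl b) => [|y m] // h _; have := h y; rewrite mem_head => /esym/andP[yJ /eqP yb].
by exists y => //; have [_ _ <- _] := os_J H yJ; rewrite yb.
Qed.

(** Used by the initialisation and by every rebuilding. All vertices are filed at level 0, that is
    under the label [K], so each search takes constant time. *)
Lemma file_loop B N : forall v r s A O Bk J cl tl (Q : _ -> _ -> _ -> _ -> Prop),
  n - v < N -> OS K n s [::] Bk J (fun _ => n) (fun _ => K) cl tl ->
  env n A O Bk J -> perm_eq J (iota 0 v) -> v <= n -> clean B s v ->
  r 3 = v -> r 9 = n -> r 10 = K -> s n 15 = B ->
  blksize * (size O + n).+1 <= P ->
  (forall r' s' A' Bk' J' cl' tl' dt, OS K n s' [::] Bk' J' (fun _ => n) (fun _ => K) cl' tl' ->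
     env n A' O Bk' J' -> perm_eq J' (iota 0 n) -> clean B s' n ->
     (forall a f, a \in O -> n <= a -> ~~ (4 <= f <= 11) -> s' a f = s a f) ->
     (forall k, k < 11 -> k != 3 -> r' k = r k) ->
     dt <= 110 * (n - v) + 2 -> Q r' s' A' dt) ->
  runs W P (While (lte (Var 3) (Var 9)) FILE_STEP) r s A Q.
Proof.
elim: N => [|N IH] v r s A O Bk J cl tl Q // leN HO HE pJ vn Cl r3 r9 r10 nB PO q.
have [OA BA BO] := env_mem HE; have [pA U nO JO] := HE.
apply: runs_while => //.
- by sf; rewrite r3; apply: leq_ltn_trans nW; rewrite ltnS (leq_trans vn).
- rewrite lte_vl /= r3 r9 => /eqP; rewrite eqb0 -leqNgt => nv.
  have vE : v = n by apply/eqP; rewrite eqn_leq vn.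
  move: pJ Cl; rewrite vE => pJ Cl.
  by apply: (q _ _ _ _ _ _ _ _ HO HE) => //; rewrite addn2.
rewrite lte_vl /= r3 r9 eqb0 negbK => vn'.
have vO : v \in O by apply: nO.
have vA := OA _ vO; have nA : n \in A by apply: OA; apply: nO.
do 8![apply: runs_seq; apply: (runs_adr W16);
  [by [] | by rewrite r3 | by sf; rewrite ?r9 | rewrite ?r3 ?r9 ?r10 /= ?r3 ?r9 ?r10]].
set s1 := upd _ _ 15 _.
have nv : (n == v) = false by rewrite gtn_eqF.
have s1v f : f \in [:: 0; 1; 2; 3; 12; 13; 14; 15] -> s1 v f = vcell B v f.
  rewrite /s1 !updE !eqxx !nv /= -nB => ff; move: ff; rewrite !inE; by repeat case/orP; move=> /eqP->.
have s1a a f : a != v -> s1 a f = s a f by move=> av; rewrite /s1 !upd_adr.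
have s1f a f : 4 <= f <= 11 -> s1 a f = s a f.
  move=> ff; have fl g : ~~ (4 <= g <= 11) -> f != g by move=> gg; apply: contraTneq ff => ->.
  by rewrite /s1 !upd_fld // fl.
do 3![apply: runs_seq; apply: runs_assign => //=]; rewrite ?r3 ?r9 ?r10.
have H1 : OS K n s1 [::] Bk J (fun _ => n) (fun _ => K) cl tl.
  apply: os_frame HO _ _ _ _ => // [a f _ ff|b bB]; first exact: s1f.
  rewrite s1a //; by apply: contraNneq (BO b bB) => ->.
have lb : {in Bk, forall b, s1 b 11 = K} by move=> b /(os_item H1)[y _ ->].
have vJ : v \notin J by rewrite (perm_mem pJ) mem_iota /= ltnn.
apply: runs_seq; apply: (runs_FILE PW W16 K0 (y := v) (u := n) (T := K) (M := K) H1 HE) => //.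
- exact: ltnW.
- by move=> b; rewrite (os_cl H1) // => /andP[/lb-> _].
- by move=> b /lb->; apply: ltnW.
- apply: leq_trans PO; rewrite leq_mul2l /= ltnS (perm_size pA) size_cat leq_add2l.
  apply: leq_trans (os_size HO) _; by rewrite (perm_size pJ) size_iota.
move=> r2 s2 A2 Bk2 cl2 tl2 d2 H2 E2 _ _ _ kp2 Hr2 dle _.
have s2v w f : w < v.+1 -> f \in [:: 0; 1; 2; 3; 12; 13; 14; 15] -> s2 w f = vcell B w f.
  move=> wv ff; rewrite kp2; first last.
  - by move: ff; rewrite !inE; repeat case/orP; move=> /eqP->.
  - by apply: nO; apply: leq_trans vn; rewrite -ltnS.
  case: (eqVneq w v) => [->|wx]; first exact: s1v.
  by rewrite s1a // Cl // ltn_neqAle wx -ltnS.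
apply: runs_assign.
  by apply: (safe_inc W16) => //=; rewrite Hr2 //= r3; apply: leq_ltn_trans nW; rewrite ltnS (leq_trans vn).
rewrite /= Hr2 //= r3 addn1.
have s2a a f : a \in O -> n <= a -> ~~ (4 <= f <= 11) -> s2 a f = s a f.
  move=> aO na ff; rewrite kp2 // s1a //; by rewrite neq_ltn (leq_trans vn' na) orbT.
apply: (IH v.+1 _ _ _ O Bk2 (v :: J) cl2 tl2) => //.
- by move: leN vn'; clear; lia.
- by apply: os_frame H2 _ _ _ _ => // z _; case: eqP.
- by rewrite -[v.+1]addn1 iotaD add0n /= cats1 perm_sym perm_rcons perm_cons perm_sym.
- by rewrite /= Hr2.
- by rewrite /= Hr2.
- by rewrite s2a // nO.
move=> r4 s4 A4 Bk4 J4 cl4 tl4 d4 H4 E4 p4 Cl4 k4 Hr4 dle4.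
apply: (q _ _ _ Bk4 J4 cl4 tl4 _ H4 E4) => //.
- by move=> a f aO na ff; rewrite k4 // s2a.
- move=> k k11 k3; rewrite Hr4 // /rset (negbTE k3) Hr2 ?(ltn_trans k11) // /rset !(lt_neq k11) //.
- by move: dle4 dle vn'; clear; lia.
Qed.

(** Without edges every sum in [Pot] vanishes, so the credit inequality reduces to [t <= X] whatever
    the rival orientation. *)
Lemma good_clean B s A O Bk J cl tl t X : OS K n s [::] Bk J (fun _ => n) (fun _ => K) cl tl ->
  env n A O Bk J -> perm_eq J (iota 0 n) -> clean B s n -> t <= X -> Good B t X s A O [::].
Proof.
move=> HO HE pJ Cl tX; have c v f := Cl v f.
have pI : perm_eq J (items n [::]) by rewrite /items cats0.
have lv v : v < n -> lev K s v = 0 by move=> vn; rewrite /lev c // subnn.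
exists Bk, (fun _ => [::]), (fun _ => [::]), cl, tl; split.
- split.
  + split=> //.
    * by move=> v vn; rewrite !c.
    * by move=> v vn; rewrite /cyc /= /lk !c // eqxx.
    * by move=> v vn; rewrite c.
    * by move=> v vn; rewrite c //; split.
  + apply: os_frame (os_perm pI HO) _ _ _ _ => // v; rewrite mem_items orbF => vn.
      by rewrite /own c.
    by rewrite /lab (c v 0) // c.
  + by case: HE => h1 h2 h3 h4; split=> // v; rewrite -(perm_mem pI); apply: h4.
- split=> //.
  + by move=> v vn; rewrite lv // c.
  + by move=> v vn; rewrite lv.
  + by move=> v vn; rewrite c.
- by move=> v vn; rewrite c.
- move=> hd' tl' _; rewrite /Pot.
  have z g : (forall v, v < n -> g v = 0) -> vsum n g = 0.
    by move=> h; rewrite (eq_vsum h) /vsum big1.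
  rewrite !z ?muln0 ?addn0 ?muln0 //; first exact: leq_trans tX (leq_addr _ _).
  + by move=> v vn; rewrite lv // c.
  + by move=> v vn; rewrite c // /Fpot big_geq.
Qed.

Lemma good_le B t t' X X' s A O E : t' <= t -> X <= X' -> Good B t X s A O E -> Good B t' X' s A O E.
Proof.
move=> tt XX [Bk [sc [un [cl [tl [h1 h2 h3 h4]]]]]]; exists Bk, sc, un, cl, tl; split=> // hd' tl' Ho.
by have := h4 hd' tl' Ho; move: tt XX; clear; lia.
Qed.

(** Per edge, [80 * (100 * K)] for [ADD] and the rest for taking the edge from the pending list. The
    upper limit on the number of edges is asked for the final graph and so holds for every
    intermediate one. *)
Lemma reinsert_loop B : forall pend t X r s A O E (Q : _ -> _ -> _ -> _ -> Prop),
  Good B t X s A O E -> cyc s 2 n pend -> uniq (pend ++ E) -> {subset pend <= O} ->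
  (forall y, y \in pend -> [/\ n < y, s y 0 < n, s y 1 < n & s y 0 != s y 1]) ->
  r 9 = n -> r 10 = K ->
  blksize * (size O + (n + (size pend + size E))).+1 <= P ->
  8 * (size pend + size E + B + n + K) + 100 < W -> size pend + size E <= 4 * (n * B.+1) ->
  (forall r' s' A' E' dt, Good B (t + dt) (X + size pend * (81 * (100 * K)) + 2) s' A' O E' ->
     perm_eq E' (pend ++ E) -> cyc s' 2 n [::] ->
     orient (pend ++ E) (hdf s) (tlf s) (hdf s') (tlf s') ->
     (forall f, f \in [:: 12; 13; 14; 15] -> s' n f = s n f) ->
     (forall k, k < 11 -> r' k = r k) -> Q r' s' A' dt) ->
  runs W P REINSERT r s A Q.
Proof.
elim=> [|e pend IH] t X r s A O E Q HG C Up pO pp r9 r10 PO HW mE q.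
all: have [Bk [sc [un [cl [tl [[HI HO HE] _ _ _]]]]]] := HG.
all: have [OA BA BO] := env_mem HE; have [pA U nO JO] := HE.
all: have nOn : n \in O by apply: nO.
all: have s2 := cyc_next (l1 := [::]) C; rewrite /= in s2.
all: apply: runs_while; [by sf; rewrite ?r9 ?OA // (ltn_trans _ nW) | | ];
  rewrite lte_vl /= r9 s2.
- move=> _; apply: (q _ _ _ E) => //.
    by rewrite mul0n addn0; apply: good_time HG.
  by move=> y yE; left.
- by rewrite ltnn.
- by have [ne _ _ _] := pp e (mem_head _ _); rewrite ne.
move=> _; have [ne e0 e1 e01] := pp e (mem_head _ _).
have inO a : a \in n :: e :: pend -> a \in O.
  by rewrite inE => /orP[/eqP->//|/pO].
have eO : e \in O by apply: inO; rewrite !inE eqxx orbT.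
apply: runs_seq; apply: runs_assign; first by sf; rewrite r9 OA.
rewrite /= r9 s2.
have m2 : s e 2 \in n :: e :: pend by apply: (cyc_next_mem C); rewrite !inE eqxx orbT.
have m3 : s e 3 \in n :: e :: pend by apply: (cyc_prev_mem C); rewrite !inE eqxx orbT.
have eA : e \in A by apply: OA.
have m2A : s e 2 \in A by apply: OA; apply: inO.
have m3A : s e 3 \in A by apply: OA; apply: inO.
apply: runs_seq; apply: (runs_UNLINK W16) => //=.
set s1 := unlink _ _ _.
have nE a : a \in n :: e :: pend -> n <= a /\ a \notin E.
  rewrite inE => /orP[/eqP->|ap].
    by split=> //; apply/negP => /(il_e HI)[]; rewrite ltnn.
  split; first by have [/ltnW] := pp a ap.
  by apply: contraTN Up => aE; rewrite cat_uniq; apply/negP => /and3P[_ /hasPn /(_ a aE)]; rewrite /= ap.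
have F a f : [|| f \notin [:: 2; 3], a < n | a \in E] -> s1 a f = s a f.
  have F' : (forall b, b \in n :: e :: pend -> a != b) -> s1 a f = s a f.
    by move=> h; rewrite /s1 /unlink !upd_adr // h.
  case/or3P => [ff|an|ar].
  - by rewrite /s1 unlink_fld //; apply: contraNneq ff => ->.
  - by apply: F' => b /nE[nb _]; rewrite neq_ltn (leq_trans an nb).
  - by apply: F' => b /nE[_]; apply: contraNneq => <-.
have U1 : uniq (n :: e :: pend).
  rewrite cons_uniq; move: Up; rewrite cat_uniq => /and3P[-> _ _]; rewrite andbT.
  by apply/negP => /pp[]; rewrite ltnn.
have C1 : cyc s1 2 n pend := cyc_unlink (l1 := [::]) U1 C.
have Gd := good_frame HG F.
have F2 a f : f \notin [:: 2; 3] -> s1 a f = s a f by move=> ff; apply: F; rewrite ff.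
do 2![apply: runs_seq; apply: runs_assign; [by sf | rewrite /= ?F2 //]].
have [_ eE] : n <= e /\ e \notin E by apply: nE; rewrite !inE eqxx orbT.
have ep : e \notin pend by move: Up => /= /andP[]; rewrite mem_cat negb_or => /andP[].
apply: (runs_ADD PW W16 K0 KW nL LK (e := e) (a := s e 0) (b := s e 1) Gd) => //=.
- by apply: leq_trans PO; rewrite leq_mul2l /= ltnS !leq_add2l addSn ltnS leq_addl.
- by apply: leq_ltn_trans HW; rewrite leq_add2r leq_mul2l /= !leq_add2r addSn ltnS leq_addl.
- by apply: leq_trans mE; rewrite leq_addl.
move=> r2 s2' A2 d2 G2 Ho2 He2 out2 Hr2.
have kp y f : y \in n :: pend -> f \in [:: 0; 1; 2; 3; 12; 13; 14; 15] -> s2' y f = s1 y f.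
  move=> yp ff; have yM : y \in [:: n, e & pend] by move: yp; rewrite !inE => /orP[] ->; rewrite ?orbT.
  have [ny yE] := nE y yM; apply: out2 => //; first exact: inO.
    rewrite inE negb_or yE andbT; move: yp; rewrite inE => /orP[/eqP->|yp].
      by rewrite neq_ltn ne.
    by apply: contraNneq ep => <-.
  by move: ff; rewrite !inE; repeat case/orP; move=> /eqP->.
have pyM y : y \in pend -> y \in n :: pend by move=> yp; rewrite inE yp orbT.
have szE : size pend + size (e :: E) = size (e :: pend) + size E by rewrite /= addnS addSn.
apply: (IH (t + d2 + 8) (X + 80 * (100 * K) + 100 * K) _ _ _ O (e :: E)) => //.
- apply: good_time G2; move: K0; clear; lia.
- by apply: cyc_frame C1 => a /kp h; rewrite !h.
- by rewrite (perm_uniq (_ : perm_eq _ (e :: pend ++ E))) // perm_catC /= perm_cons perm_catC.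
- by move=> y yp; apply: pO; rewrite inE yp orbT.
- move=> y yp; have [] := pp y; first by rewrite inE yp orbT.
  by rewrite !kp ?pyM // !F2.
- by rewrite Hr2 //= r9.
- by rewrite Hr2 //= r10.
- by rewrite szE.
- by rewrite szE.
- by rewrite szE.
move=> r4 s4 A4 E4 d4 G4 p4 C4 Ho4 k4 Hr4.
apply: (q _ _ _ E4) => //.
- apply: good_le G4; first by clear; lia.
  by rewrite [size (_ :: _)]/= [(size pend).+1 * _]mulSn; move: (size pend * _); clear; lia.
- by apply: perm_trans p4 _; rewrite perm_catC /= perm_cons perm_catC.
- move=> y; rewrite inE => /orP[/eqP->|yp].
    have := Ho4 e; rewrite mem_cat mem_head orbT => /(_ isT); rewrite /hdf /tlf.
    by case: He2 => [] [-> ->] [] h; [left|right|right|left].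
  have := Ho4 y; rewrite !(mem_cat, inE) orbCA -mem_cat yp orbT => /(_ isT); rewrite /hdf /tlf.
  case: (boolP (y \in pend)) => yp'; first by rewrite !kp ?pyM // !F2.
  have yE : y \in E by move: yp; rewrite mem_cat (negbTE yp').
  have := Ho2 y yE; rewrite /hdf /tlf !F2 //.
  by case=> [] [-> ->] [] [-> ->]; [left|right|right|left].
- move=> f ff; rewrite k4 // kp ?mem_head ?F2 //.
    by move: ff; rewrite !inE; repeat case/orP; move=> /eqP->.
  by move: ff; rewrite !inE; repeat case/orP; move=> /eqP->.
- move=> k k11; rewrite Hr4 // Hr2 // /rset !(lt_neq k11) //.
Qed.
End Rebuild2.

Definition REBUILD : cmd :=
  EACH DRAIN_STEP ;; EACH UNFILE_STEP ;;
  adr 9 15 (dive (fld 9 14) (Bin Add (Var 9) (Var 9))) ;; EACH FILE_STEP ;; REINSERT.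
Definition HIGH : expr :=
  lte (Bin Mul (Cst 4) (Bin Mul (Var 9) (Bin Add (fld 9 15) (Cst 1)))) (fld 9 14).
Definition LOW : expr := lte (fld 9 14) (Bin Mul (Var 9) (fld 9 15)).
Definition CHECK : cmd := If (Bin Add HIGH LOW) REBUILD Skip.

(** * When a rebuilding takes place and how it is paid for *)

Section Top.
Variables W P K kk n L : nat.
Hypothesis PW : P < W.
Hypothesis W16 : 100 < W.
Hypothesis K0 : 0 < K.
Hypothesis KW2 : K.+2 < W.
Hypothesis nL : n < 2 ^ L.
Hypothesis LK : L <= K.
Hypothesis n0 : 0 < n.
Notation GI := (GI W K n).
Notation IL := (IL W K n).
Notation Good := (Good W K n).
Let KW : K < W := ltnW (ltnW KW2).

Lemma good_perm B t X s A O E E' : perm_eq E E' -> Good B t X s A O E -> Good B t X s A O E'.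
Proof.
move=> p [Bk [sc [un [cl [tl [HG HL St Cr]]]]]]; exists Bk, sc, un, cl, tl; split.
- exact: gi_perm p HG.
- by case: HL => h1 h2 h3 h4 h5; split=> // e; rewrite -(perm_mem p); apply: h4.
- by move=> v vn; rewrite St // /deg (permP p).
- move=> hd' tl' Ho; rewrite -(PF_perm _ _ _ _ p); apply: (Cr hd' tl') => e.
  by rewrite (perm_mem p); apply: Ho.
Qed.

(** The current orientation is one of the rivals, and its [PF] cancels the first sum of [Pot]. *)
Lemma good_credit B t X s A O E : Good B t X s A O E -> t <= X.
Proof.
move=> [Bk [sc [un [cl [tl [_ _ St Cr]]]]]].
have Ho : orient E (hdf s) (tlf s) (hdf s) (tlf s) by move=> e _; left.
have := Cr _ _ Ho; rewrite /Pot.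
have -> : vsum n (fun v => Fpot K B (s v 12)) = PF K B n E (hdf s).
  by apply: eq_vsum => v vn; rewrite St.
clear; lia.
Qed.

(** A potential that vanishes between [2 * n * B] and [2 * n * B.+1], where a rebuilding puts [m].
    An update changes it by at most 2, and when [CHECK] decides to rebuild it is at least half of
    [m + n]; the weight 2 on the upper side provides for the [n]. *)
Definition rho (B m : nat) : nat := 2 * (m - 2 * (n * B.+1)) + (2 * (n * B) - m).
(** A reinsertion costs [81 * (100 * K)] and there are at most [2 * rho] of them; the 8 beyond twice
    81 pay for the passes over vertices and edges. *)
Definition cR : nat := 170 * (100 * K).

Definition Root (s : store) (m B : nat) : Prop :=
  [/\ s n 12 = K, s n 13 = kk, s n 14 = m & s n 15 = B].

Record Top (B t X : nat) (s : store) (A E : seq nat) : Prop := MkTop {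
  top_O : exists2 O, perm_eq O (iota 0 n.+1 ++ E) & Good B (t + rho B (size E) * cR) X s A O E;
  top_root : Root s (size E) B;
  top_pend : cyc s 2 n [::];
  top_lo : n * B <= size E;
  top_hi : size E <= 4 * (n * B.+1) }.

(** The limits may have been violated by the update that has just been made. The weaker
    [n * B <= (size E).+1] still bounds [B], so the tests can be evaluated within a word. *)
Lemma runs_CHECK B t X r s A O E (Q : _ -> _ -> _ -> _ -> Prop) :
  perm_eq O (iota 0 n.+1 ++ E) -> Good B (t + rho B (size E) * cR) X s A O E ->
  Root s (size E) B -> cyc s 2 n [::] -> n * B <= (size E).+1 ->
  r 9 = n -> r 10 = K ->
  blksize * (size O + (n + size E)).+1 <= P ->
  20 * (size E + n + K) + 1000 < W ->
  (forall r' s' A' B' dt, Top B' (t + dt) (X + 200) s' A' E ->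
     orient E (hdf s) (tlf s) (hdf s') (tlf s') -> r' 2 = r 2 -> Q r' s' A' dt) ->
  runs W P CHECK r s A Q.
Proof.
move=> pO HG [R1 R2 R3 R4] C lo r9 r10 PO HW q.
have tX := good_credit HG.
have [Bk [sc [un [cl [tl [GG _ _ _]]]]]] := HG; have [HI HO HE] := GG.
have [OA BA BO] := env_mem HE; have [pA U nO JO] := HE.
have nA : n \in A by apply: OA; apply: nO.
have uE : uniq E by have := os_uJ HO; rewrite cat_uniq => /and3P[].
have nW : n.+2 < W by move: HW; clear; lia.
have BE : B <= (size E).+1 by apply: leq_trans lo; rewrite leq_pmull.
have W4 : 4 * (n * B.+1) + 1 < W by rewrite mulnS; move: lo HW; clear; lia.
have nB1 : n * (B + 1) < W by rewrite addn1; move: W4; clear; lia.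
have vH : vl r s HIGH = (4 * (n * B.+1) < size E) by rewrite lte_vl /= r9 R3 R4 addn1.
have vL : vl r s LOW = (size E < n * B) by rewrite lte_vl /= r9 R3 R4.
have vC : vl r s (Bin Add HIGH LOW) = (4 * (n * B.+1) < size E) + (size E < n * B).
  by rewrite -vH -vL.
apply: runs_if.
- split.
  + apply: safe_lte => //; [|by sf; rewrite r9|by rewrite /= r9 R4 addn1 -addn1].
    split=> //; [exact: ltn_trans W16| |by rewrite /= r9 R4 addn1; move: W4; clear; lia].
    split=> //; [|by rewrite /= r9 R4].
    apply: (safe_inc W16); first by sf; rewrite r9.
    by rewrite /= r9 R4; move: BE HW; clear; lia.
  + apply: safe_lte => //; [by sf; rewrite r9| |by rewrite /= r9 R3; move: HW; clear; lia].
    split=> //; [by sf; rewrite r9|rewrite /= r9 R4; move: nB1; rewrite mulnDr; clear; lia].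
  + rewrite vH vL; apply: leq_ltn_trans W16; by case: (_ < _); case: (_ < _).
all: rewrite vC => cond.
  (* The released potential must pay for [n] as well, since every vertex is visited; this uses
     [m > 4 * n] in the first case and [B > 0] in the second. *)
  have big : size E + n <= 2 * rho B (size E).
    rewrite /rho; move: cond; case: (ltnP (4 * (n * B.+1))) => [h _|_]; last case: ltnP => // h _.
      by move: h; rewrite !mulnS; move: (n * B) => nB; clear; lia.
    have : n <= n * B by rewrite leq_pmulr //; case: (B) h => //; rewrite muln0.
    by move: h; rewrite !mulnS; move: (n * B) => nB; clear; lia.
  have v0 : 0 < W by apply: leq_ltn_trans W16.
  apply: runs_seq; apply: runs_seq; apply: runs_assign => //=.
  apply: (drain_loop W16 K0 nW (pend := [::]) (ltnSn _) GG (leq0n n)) => //=.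
  move=> r1 s1 A1 Bk1 sc1 un1 cl1 tl1 pend d1 G1 C1 p1 [k10 k11] Hr1 d1le.
  have [HI1 HO1 HE1] := G1.
  apply: runs_seq; apply: runs_seq; apply: runs_assign => //=.
  have it : items n [::] = iota 0 (n - 0) by rewrite /items cats0 subn0.
  rewrite it in HO1 HE1.
  apply: (unfile_loop W16 K0 nW (ltnSn _) HO1 HE1 (leq0n n)) => //=.
  - by rewrite Hr1.
  - by rewrite Hr1.
  - exact: gi_lbW G1.
  move=> r2 s2 A2 cl2 tl2 d2 HO2 HE2 k2 Hr2 d2le.
  have [OA2 _ _] := env_mem HE2.
  have nO2 : n \in O by apply: nO.
  have nA2 : n \in A2 by apply: OA2.
  have k12 f : f \in [:: 12; 13; 14; 15] -> s2 n f = s n f.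
    by move=> ff; rewrite k2 ?k11 //; move: ff; rewrite !inE; repeat case/orP; move=> /eqP->.
  have r29 : r2 9 = n by rewrite Hr2 //= Hr1.
  apply: runs_seq; apply: (runs_adr W16); [by [] | by rewrite r29 | |].
    apply: safe_div; [by sf; rewrite r29|split=> //=|rewrite /= r29 k12 // R3].
      by rewrite r29; move: HW; clear; lia.
    by move: HW; clear; lia.
  rewrite /= r29 k12 // R3; set B' := size E %/ (n + n); set s3 := upd s2 n 15 B'.
  have B'1 : n * B' * 2 <= size E by rewrite mulnAC muln2 -addnn mulnC leq_trunc_div.
  have B'2 : size E < 2 * (n * B'.+1).
    by rewrite mulnA mul2n -addnn mulnC ltn_ceil // addn_gt0 n0.
  have s3E a f : (f != 15) || (a != n) -> s3 a f = s2 a f.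
    by case/orP=> h; [rewrite /s3 upd_fld | rewrite /s3 upd_adr].
  apply: runs_seq; apply: runs_seq; apply: runs_assign => //=.
  have H3 : OS K n s3 [::] [::] [::] (fun _ => n) (fun _ => K) cl2 tl2.
    apply: os_frame HO2 _ _ _ _ => // a f _ ff; rewrite s3E //.
    by apply/orP; left; apply: contraTneq ff => ->.
  apply: (file_loop PW W16 K0 KW2 nW (B := B') (ltnSn _) H3 HE2 _ (leq0n n)) => //=.
  - by rewrite Hr2 //= Hr1.
  - by rewrite /s3 upd_eq.
  - by apply: leq_trans PO; rewrite leq_mul2l /= ltnS leq_add2l leq_addr.
  move=> r4 s4 A4 Bk4 J4 cl4 tl4 d4 H4 E4 p4 Cl4 k4 Hr4 d4le.
  have [_ _ nO4 JO4] := E4.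
  have EO y : y \in E -> y \in O by move=> yE; apply: JO; rewrite mem_items yE orbT.
  have cE y f : y \in E -> f \in [:: 0; 1] -> s4 y f = s y f.
    move=> yE ff; have [ny _ _ _] := il_e HI yE.
    have f4 : ~~ (4 <= f <= 11) by move: ff; rewrite !inE => /orP[] /eqP->.
    rewrite k4 ?EO // ?(ltnW ny) // s3E ?k2 ?EO // ?k10 //.
    by apply/orP; right; rewrite neq_ltn ny orbT.
  pose t4 := (t + d1 + d2 + d4 + 10).
  have G4 := good_clean KW2 H4 E4 p4 Cl4 (leqnn t4).
  have pE x : (x \in pend) = (x \in E) by rewrite (perm_mem p1).
  have sE : size pend = size E by rewrite (perm_size p1).
  apply: (reinsert_loop PW W16 K0 KW2 nL LK nW (pend := pend) G4) => //=.
  - apply: cyc_frame C1 => a; rewrite inE pE => aP.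
    have [aO na] : a \in O /\ n <= a.
      case/orP: aP => [/eqP->|aE]; first by split=> //; apply: nO.
      by split; [apply: EO|have [/ltnW] := il_e HI aE].
    by rewrite !k4 // !s3E // !k2.
  - by rewrite cats0 (perm_uniq p1).
  - by move=> y; rewrite pE; apply: EO.
  - by move=> y; rewrite pE => yE; rewrite !cE //; apply: (il_e HI).
  - by rewrite Hr4 //= Hr2 //= Hr1.
  - by rewrite Hr4 //= Hr2 //= Hr1.
  - by rewrite sE addn0.
  - rewrite sE addn0; move: HW B'1; have : B' <= n * B' by rewrite leq_pmull.
    by move: (n * B'); clear; lia.
  - by rewrite sE addn0; move: B'2; clear; lia.
  move=> r5 s5 A5 E5 d5 G5 p5 C5 Ho5 k5 Hr5.
  have pE5 : perm_eq E5 E by apply: perm_trans p5 _; rewrite cats0.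
  have rho0 : rho B' (size E) = 0.
    by rewrite /rho; move: B'1 B'2; rewrite !mulnS; move: (n * B') => z; clear; lia.
  have k45 f : f \in [:: 12; 13; 14; 15] -> s5 n f = s3 n f.
    move=> ff; rewrite k5 // k4 //.
    by move: ff; rewrite !inE; repeat case/orP; move=> /eqP->.
  apply: (q _ _ _ B').
  - split=> //.
    + exists O => //; rewrite rho0 mul0n addn0; apply: good_perm pE5 _; apply: good_le G5.
        by rewrite /t4; clear; lia.
      rewrite sE /t4; move: tX d1le d2le d4le big K0; rewrite /cR !subn0.
      move: (rho _ _) => rh; move: (size E) => m h0 h1 h2 h3 h4 k0.
      have h5 : m * (81 * (100 * K)) <= 2 * rh * (81 * (100 * K)).
        by rewrite leq_mul2r; apply/orP; right; apply: leq_trans h4; apply: leq_addr.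
      have h6 : rh <= rh * K by rewrite leq_pmulr.
      have h7 : rh * (170 * (100 * K)) = 170 * (100 * (rh * K)) by rewrite mulnCA [rh * (100 * _)]mulnCA.
      have h8 : 2 * rh * (81 * (100 * K)) = 2 * (81 * (100 * (rh * K))).
        by rewrite -mulnA; congr (_ * _); rewrite mulnCA [rh * (100 * _)]mulnCA.
      rewrite h7 in h0; rewrite h8 in h5; move: h0 h1 h2 h3 h4 h5 h6.
      by move: (rh * K) (m * _) => z w; clear; lia.
    + by split; rewrite k45 //; last (by rewrite /s3 upd_eq); rewrite s3E // k12.
    + by move: B'1; clear; lia.
    + by move: B'2; clear; lia.
  - move=> y yE; have := Ho5 y; rewrite cats0 pE yE => /(_ isT).
    by rewrite /hdf /tlf !cE.
  - by rewrite Hr5 //= Hr4 //= Hr2 //= Hr1.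
apply: runs_skip; apply: (q _ _ _ B) => //; last by move=> y _; left.
move: cond; case: ltnP => // h1; case: ltnP => // h2 _.
split=> //; exists O => //.
have -> : t + 2 + rho B (size E) * cR = t + rho B (size E) * cR + 2 by rewrite addnAC.
exact: good_time HG.
Qed.
End Top.

(** * The operations *)

(** Nothing but memory survives between calls: the root is found in cell 1 of an end of the edge,
    and [K] in cell 12 of the root. Register 2 keeps the name of the edge for its emission. *)
Definition INSERT : cmd :=
  Assign 9 (fld 0 1) ;; Assign 10 (fld 9 12) ;; Assign 12 (Var 0) ;; Assign 13 (Var 1) ;;
  Alloc 11 (Cst blksize) ;; Assign 2 (Var 11) ;; ADD ;;
  adr 9 14 (Bin Add (fld 9 14) (Cst 1)) ;; CHECK.
Definition DELETE : cmd :=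
  Assign 9 (fld 0 0) ;; Assign 9 (fld 9 1) ;; Assign 10 (fld 9 12) ;; REMOVE ;;
  adr 9 14 (Bin Defs.Sub (fld 9 14) (Cst 1)) ;; CHECK.

Section Operations.
Variables W P K kk n L : nat.
Hypothesis PW : P < W.
Hypothesis W16 : 100 < W.
Hypothesis K0 : 0 < K.
Hypothesis KW2 : K.+2 < W.
Hypothesis nL : n < 2 ^ L.
Hypothesis LK : L <= K.
Hypothesis n0 : 0 < n.
Notation GI := (GI W K n).
Notation IL := (IL W K n).
Notation Good := (Good W K n).
Notation Top := (Top W K kk n).
Let KW : K < W := ltnW (ltnW KW2).

Lemma good_alloc B t X s A O E b : Good B t X s A O E -> b \notin A ->
  Good B t X (clear s b) (b :: A) (b :: O) E.
Proof.
move=> HG bA; have ne a : a \in A -> a != b by apply: contraTneq => ->.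
have : Good B t X (clear s b) A O E.
  by apply: good_frame0 HG _ _ => [a f aA _|a aA _]; rewrite /clear (negbTE (ne a aA)).
move=> [Bk [sc [un [cl [tl [[h1 h2 [pA U nO JO]] h4 h5 h6]]]]]].
exists Bk, sc, un, cl, tl; split=> //; split=> //; split.
- by rewrite /= perm_cons.
- by rewrite /= -(perm_mem pA) bA.
- by move=> a an; rewrite inE nO ?orbT.
- by move=> a aJ; rewrite inE JO ?orbT.
Qed.

Lemma good_root B t X s A O E f x : Good B t X s A O E -> ~~ (4 <= f <= 11) ->
  Good B t X (upd s n f x) A O E.
Proof.
move=> HG ff; have [Bk [sc [un [cl [tl [[HI HO HE] _ _ _]]]]]] := HG.
have [_ _ nO _] := HE.
apply: good_frame0 HG _ _ => [a g _ h|b _ bO].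
  case/or3P: h => [gg|an|aE]; first by rewrite upd_fld //; apply: contraNneq ff => <-.
    by rewrite upd_adr // neq_ltn an.
  by rewrite upd_adr // neq_ltn; have [-> _ _ _] := il_e HI aE; rewrite orbT.
by rewrite upd_adr //; apply: contraNneq bO => ->; apply: nO.
Qed.

Lemma rhoS B m : rho n B m.+1 <= rho n B m + 2 /\ rho n B m <= rho n B m.+1 + 2.
Proof. by rewrite /rho; move: (n * _) (n * _) => x y; clear; split; lia. Qed.

(** 80 for the update, twice 170 for the change of [rho] by at most 2, and 10 for the remaining
    steps, including those of [CHECK]. *)
Definition cU : nat := 430 * (100 * K).

Lemma good_rho B t d X s A O E m m' : rho n B m' <= rho n B m + 2 ->
  Good B (t + rho n B m * cR K + d) (X + 80 * (100 * K)) s A O E ->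
  Good B (t + (d + 40) + rho n B m' * cR K) (X + cU - 300) s A O E.
Proof.
move=> h; have : rho n B m' * cR K <= rho n B m * cR K + 2 * cR K by rewrite -mulnDl leq_mul2r h orbT.
move: (rho n B m' * _) (rho n B m * _) => x y h2 [Bk [sc [un [cl [tl [h3 h4 h5 h6]]]]]].
exists Bk, sc, un, cl, tl; split=> // hd' tl' Ho; have := h6 hd' tl' Ho.
by move: h2; rewrite /cR /cU; move: K0; clear; lia.
Qed.

Lemma top_good B t X s A E : Top B t X s A E ->
  exists O, [/\ perm_eq O (iota 0 n.+1 ++ E), Good B (t + rho n B (size E) * cR K) X s A O E &
    [/\ {subset O <= A}, size O = n.+1 + size E, uniq E,
      (forall v, v < n -> s v 0 = v /\ s v 1 = n) &
      forall e, e \in E -> [/\ n < e, s e 0 < n, s e 1 < n & s e 0 != s e 1]]].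
Proof.
case=> [[O pO HG] _ _ _ _]; exists O; split=> //.
have [Bk [sc [un [cl [tl [[HI HO HE] _ _ _]]]]]] := HG; have [OA _ _] := env_mem HE.
split=> //; first by rewrite (perm_size pO) size_cat size_iota.
- by have := os_uJ HO; rewrite cat_uniq => /and3P[].
- exact: il_v HI.
- exact: il_e HI.
Qed.

Lemma runs_INSERT B t X r s A E u v (Q : _ -> _ -> _ -> _ -> Prop) :
  Top B t X s A E -> r 0 = u -> r 1 = v -> u < n -> v < n -> u != v ->
  blksize * (2 * (n + size E) + 4) <= P ->
  40 * (size E + n + K) + 2000 < W ->
  (forall r' s' A' B' e dt, Top B' (t + dt) (X + cU) s' A' (e :: E) ->
     n < e -> e \notin E -> e \notin A -> r' 2 = e ->
     orient E (hdf s) (tlf s) (hdf s') (tlf s') ->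
     s' e 0 = u /\ s' e 1 = v \/ s' e 0 = v /\ s' e 1 = u -> Q r' s' A' dt) ->
  runs W P INSERT r s A Q.
Proof.
move=> HT r0 r1 un vn uv PO HW q.
have [O [pO HG [OA sO uE Hv He]]] := top_good HT.
have [_ [R1 R2 R3 R4] C lo hi] := HT.
have vO w : w <= n -> w \in O by move=> wn; rewrite (perm_mem pO) mem_cat mem_iota /= ltnS wn.
have [Bk [sc [un' [cl [tl [[HI HO HE] _ _ _]]]]]] := HG.
have sA := env_size HO HE; have [pA U _ _] := HE.
have BE : B <= size E by apply: leq_trans lo; rewrite leq_pmull.
apply: runs_seq; apply: runs_assign; first by sf; rewrite r0; apply: OA; apply: vO; apply: ltnW.
rewrite /= r0; have [_ ->] := Hv u un.
apply: runs_seq; apply: runs_assign; first by sf; apply: OA; apply: vO.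
rewrite /= R1.
apply: runs_seq; apply: runs_assign => //=; rewrite r0.
apply: runs_seq; apply: runs_assign => //=; rewrite r1.
apply: runs_seq; apply: (runs_alloc PW); first exact: leq_ltn_trans W16.
  apply: leq_trans PO; rewrite leq_mul2l /=; move: sA; rewrite sO; clear; lia.
move=> e eA eL eW; have nE : n < e.
  by rewrite ltnNge; apply: contraNN eA => en; apply: OA; apply: vO.
have eE : e \notin E.
  by apply: contraNN eA => eE; apply: OA; rewrite (perm_mem pO) mem_cat eE orbT.
apply: runs_seq; apply: runs_assign => //=.
have G1 := good_alloc HG eA.
have ce a f : a \in A -> clear s e a f = s a f.
  by move=> aA; rewrite /clear; case: eqP => // ae; move: eA; rewrite -ae aA.
have nA : n \in A by apply: OA; apply: vO.
apply: runs_seq; apply: (runs_ADD PW W16 K0 KW nL LK (e := e) (a := u) (b := v) G1) => //=.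
- exact: mem_head.
- by apply: leq_trans PO; rewrite leq_mul2l /= sO; clear; lia.
- by move: HW BE; clear; lia.
move=> r2 s2 A2 d2 G2 Ho2 He2 out2 Hr2.
have r29 : r2 9 = n by rewrite Hr2.
have [Bk2 [sc2 [un2 [cl2 [tl2 [[_ _ HE2] _ _ _]]]]]] := G2; have [OA2 _ _] := env_mem HE2.
have nA2 : n \in A2 by apply: OA2; rewrite inE vO ?orbT.
have k2 f : ~~ (4 <= f <= 11) -> s2 n f = s n f.
  move=> ff; rewrite out2 // ?ce // inE ?vO ?orbT //.
  rewrite negb_or neq_ltn nE /=; by apply/negP => /He[]; rewrite ltnn.
apply: runs_seq; apply: (runs_adr W16); [by [] | by rewrite r29 | |].
  apply: (safe_inc W16); [by sf; rewrite r29|rewrite /= r29 k2 // R3].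
  by move: HW; clear; lia.
rewrite /= r29 k2 // R3 addn1; set s3 := upd s2 n 14 _.
have s3E a f : (f != 14) || (a != n) -> s3 a f = s2 a f.
  by case/orP=> h; [rewrite /s3 upd_fld | rewrite /s3 upd_adr].
have nE3 y : y \in e :: E -> y != n.
  by rewrite inE => /orP[/eqP->|/He[ny _ _ _]]; rewrite neq_ltn ?nE ?ny orbT.
have G3 : Good B (t + (d2 + 40) + rho n B (size (e :: E)) * cR K) (X + cU - 300) s3 A2 (e :: O) (e :: E).
  by apply: good_root => //; apply: good_rho G2; have [] := rhoS B (size E).
have pO3 : perm_eq (e :: O) (iota 0 n.+1 ++ e :: E).
  by rewrite -cat_rcons -cats1 -catA perm_sym perm_catCA /= perm_cons perm_sym.
apply: (runs_CHECK (kk := kk) PW W16 K0 KW2 nL LK n0 pO3 G3) => //.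
- by split; rewrite /s3 ?upd_eq ?upd_fld ?k2.
- by rewrite /cyc /= /lk !s3E // !k2 //; move: C; rewrite /cyc /= /lk.
- by apply: leq_trans lo _; apply: leq_trans (leqnSn _) (leqnSn _).
- by rewrite Hr2.
- by apply: leq_trans PO; rewrite leq_mul2l /= sO; clear; lia.
- by move: HW; rewrite /=; clear; lia.
move=> r4 s4 A4 B4 d4 T4 Ho4 r42.
have Ho3 : orient E (hdf s) (tlf s) (hdf s3) (tlf s3).
  move=> y yE; have := Ho2 y yE; have yA : y \in A by apply: OA; rewrite (perm_mem pO) mem_cat yE orbT.
  by rewrite /hdf /tlf !ce // !s3E // nE3 ?orbT // inE yE orbT.
apply: (q _ _ _ B4 e) => //.
- case: T4 => [[O4 p4 g4] h2 h3 h4 h5]; split=> //; exists O4 => //.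
  have : 300 <= cU by rewrite /cU; move: K0; clear; lia.
  move: g4; move: (rho _ _ _ * _) => z g4 c300; apply: good_le g4; first by rewrite /blksize; clear; lia.
  by move: c300; clear; lia.
- by rewrite r42 Hr2.
- apply: orient_trans Ho3 _ => y yE; apply: Ho4; by rewrite inE yE orbT.
- have := Ho4 e (mem_head _ _); rewrite /hdf /tlf !s3E ?nE3 ?mem_head ?orbT //.
  by case: He2 => [] [-> ->] [] h; [left|right|right|left].
Qed.

Lemma runs_DELETE B t X r s A E e (Q : _ -> _ -> _ -> _ -> Prop) :
  Top B t X s A E -> r 0 = e -> e \in E ->
  blksize * (2 * (n + size E) + 4) <= P ->
  40 * (size E + n + K) + 2000 < W ->
  (forall r' s' A' B' dt, Top B' (t + dt) (X + cU) s' A' (rem e E) ->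
     orient (rem e E) (hdf s) (tlf s) (hdf s') (tlf s') -> Q r' s' A' dt) ->
  runs W P DELETE r s A Q.
Proof.
move=> HT r0 eE PO HW q.
have [O [pO HG [OA sO uE Hv He]]] := top_good HT.
have [_ [R1 R2 R3 R4] C lo hi] := HT.
have vO w : w <= n -> w \in O by move=> wn; rewrite (perm_mem pO) mem_cat mem_iota /= ltnS wn.
have BE : B <= size E by apply: leq_trans lo; rewrite leq_pmull.
have eO : e \in O by rewrite (perm_mem pO) mem_cat eE orbT.
have [ne e0 e1 e01] := He e eE.
have nA : n \in A by apply: OA; apply: vO.
apply: runs_seq; apply: runs_assign; first by sf; rewrite r0; apply: OA.
rewrite /= r0; apply: runs_seq; apply: runs_assign; first by sf; apply: OA; apply: vO; apply: ltnW.
rewrite /=; have [_ ->] := Hv _ e0.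
apply: runs_seq; apply: runs_assign; first by sf.
rewrite /= R1.
apply: runs_seq; apply: (runs_REMOVE PW W16 K0 KW nL LK (e := e) HG) => //=.
- by apply: leq_trans PO; rewrite leq_mul2l /= sO; clear; lia.
- by move: HW BE; clear; lia.
move=> r2 s2 A2 d2 G2 Ho2 out2 Hr2.
have r29 : r2 9 = n by rewrite Hr2.
have uO : uniq O.
  rewrite (perm_uniq pO) cat_uniq iota_uniq uE andbT; apply/hasPn => y /He[ny _ _ _].
  by rewrite mem_iota /= -leqNgt.
have nO2 : n \in rem e O by rewrite mem_rem_uniq // inE vO // andbT neq_ltn ne.
have [Bk2 [sc2 [un2 [cl2 [tl2 [[_ _ HE2] _ _ _]]]]]] := G2; have [OA2 _ _] := env_mem HE2.
have nA2 : n \in A2 by apply: OA2.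
have nE' y : y \in rem e E -> y != n.
  by move=> /mem_rem /He[ny _ _ _]; rewrite neq_ltn ny orbT.
have k2 f : ~~ (4 <= f <= 11) -> s2 n f = s n f.
  by move=> ff; rewrite out2 //; apply/negP => /nE'; rewrite eqxx.
have sE : size (rem e E) = (size E).-1 by rewrite size_rem.
have E0 : 0 < size E by case: (E) eE.
apply: runs_seq; apply: (runs_adr W16); [by [] | by rewrite r29 | |].
  apply: (safe_dec W16); [by sf; rewrite r29|rewrite /= r29 k2 // R3].
  by move: HW; clear; lia.
rewrite /= r29 k2 // R3 subn1 -sE; set s3 := upd s2 n 14 _.
have s3E a f : (f != 14) || (a != n) -> s3 a f = s2 a f.
  by case/orP=> h; [rewrite /s3 upd_fld | rewrite /s3 upd_adr].
have G3 : Good B (t + (d2 + 40) + rho n B (size (rem e E)) * cR K) (X + cU - 300) s3 A2 (rem e O) (rem e E).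
  apply: good_root => //; apply: good_rho G2; have [_] := rhoS B (size (rem e E)).
  by rewrite sE prednK.
have pO3 : perm_eq (rem e O) (iota 0 n.+1 ++ rem e E).
  rewrite -(perm_cons e); apply: perm_trans (_ : perm_eq _ O) _; first by rewrite perm_sym perm_to_rem.
  apply: perm_trans pO _; rewrite perm_sym -cat1s perm_catCA perm_cat2l /= perm_sym; exact: perm_to_rem.
have sO2 : size (rem e O) <= size O by rewrite size_rem // leq_pred.
apply: (runs_CHECK (kk := kk) PW W16 K0 KW2 nL LK n0 pO3 G3) => //.
- by split; rewrite /s3 ?upd_eq ?upd_fld ?k2.
- by rewrite /cyc /= /lk !s3E // !k2 //; move: C; rewrite /cyc /= /lk.
- by rewrite sE prednK.
- by rewrite Hr2.
- apply: leq_trans PO; rewrite leq_mul2l /=; apply: leq_ltn_trans (leq_add sO2 (leqnn _)) _.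
  by rewrite sE sO; clear; lia.
- by move: HW; rewrite sE; clear; lia.
move=> r4 s4 A4 B4 d4 T4 Ho4 r42.
apply: (q _ _ _ B4) => //.
- case: T4 => [[O4 p4 g4] h2 h3 h4 h5]; split=> //; exists O4 => //.
  have : 300 <= cU by rewrite /cU; move: K0; clear; lia.
  move: g4; move: (rho _ _ _ * _) => z g4 c300; apply: good_le g4; first by clear; lia.
  by move: c300; clear; lia.
- apply: orient_trans Ho4 => y yE; have := Ho2 y yE.
  by rewrite /hdf /tlf !s3E // nE' ?orbT.
Qed.
End Operations.

(** * Initialisation *)

Definition ALLOC_STEP : cmd :=
  Alloc 11 (Cst blksize) ;; adr 11 7 (Var 11) ;; adr 11 8 (Var 11) ;; adr 11 9 (Var 11) ;;
  adr 11 10 (Var 11) ;; INC 3.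
Definition LOG_STEP : cmd := Assign 4 (Bin Add (Var 4) (Var 4)) ;; INC 5.
Definition INIT : cmd :=
  Assign 4 (Cst 1) ;; While (Bin Leq (Var 4) (Var 0)) LOG_STEP ;;
  Assign 6 (Bin Mul (Cst 4) (Var 1)) ;;
  Assign 10 (Bin Mul (Cst 2) (Bin Mul (Bin Mul (Var 6) (Var 6)) (Var 5))) ;;
  While (Bin Leq (Var 3) (Var 0)) ALLOC_STEP ;;
  Assign 9 (Var 0) ;; adr 9 2 (Var 9) ;; adr 9 3 (Var 9) ;; adr 9 12 (Var 10) ;;
  adr 9 13 (Var 6) ;; EACH FILE_STEP.

Definition lgn (n : nat) : nat := (trunc_log 2 n).+1.
(** With [kk = 4 * k] this is [kk] times [2 * kk * lgn n], and the second factor bounds the number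
    of thresholds that a report spans. Over so many thresholds, [1 / kk] of [K], degrees change by a
    factor of about [1 + 1 / kk]. *)
Definition KK (n k : nat) : nat := 2 * (4 * k * (4 * k) * lgn n).

Lemma lgn_lt n : n < 2 ^ lgn n.
Proof. exact: trunc_log_ltn. Qed.

Lemma lgn_ge n i : 0 < n -> 2 ^ i <= n -> i < lgn n.
Proof. by move=> n0 h; rewrite ltnS trunc_log_max. Qed.

Lemma lgn_le n i : 0 < n -> n < 2 ^ i -> lgn n <= i.
Proof.
move=> n0 h; have := leq_ltn_trans (trunc_logP (isT : 1 < 2) n0) h.
by rewrite ltn_exp2l.
Qed.

Lemma lgn_n n : 0 < n -> lgn n <= n.
Proof. by move=> n0; apply: lgn_le => //; apply: ltn_expl. Qed.

Section Init.
Variables W P n k : nat.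
Hypothesis PW : P < W.
Hypothesis W16 : 100 < W.
Hypothesis n0 : 0 < n.
Hypothesis k0 : 0 < k.
Hypothesis nW : 2 * n + 2 < W.
Notation K := (KK n k).
Hypothesis KW2 : K.+2 < W.

Lemma KK_gt0 : 0 < K.
Proof. by rewrite /KK !muln_gt0 k0. Qed.

Lemma lgn_KK : lgn n <= K.
Proof. by rewrite /KK mulnA leq_pmull // !muln_gt0 k0. Qed.

Lemma log_loop N : forall i r s A (Q : _ -> _ -> _ -> _ -> Prop),
  lgn n - i < N -> i <= lgn n -> r 4 = 2 ^ i -> r 5 = i -> r 0 = n ->
  (forall r' dt, r' 5 = lgn n -> (forall x, x != 4 -> x != 5 -> r' x = r x) ->
     dt <= 3 * (lgn n - i) + 1 -> Q r' s A dt) ->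
  runs W P (While (Bin Leq (Var 4) (Var 0)) LOG_STEP) r s A Q.
Proof.
elim: N => [|N IH] i r s A Q // leN iL r4 r5 r0 q.
apply: runs_while => //.
- by apply: safe_leq.
- rewrite /= r4 r0 => /eqP; rewrite eqb0 -ltnNge => h.
  have E : i = lgn n by apply/eqP; rewrite eqn_leq iL lgn_le.
  by apply: q; rewrite // -?E // addn1.
rewrite /= r4 r0 eqb0 negbK => h; have iL' := lgn_ge n0 h.
apply: runs_seq; apply: runs_assign.
  split=> //=; rewrite r4 addnn -mul2n; apply: leq_ltn_trans nW; move: h; clear; lia.
apply: runs_assign.
  apply: (safe_inc W16) => //=; rewrite /rset /= r5; have := lgn_n n0; move: iL' nW; clear; lia.
rewrite /= r4 addnn -mul2n -expnS /rset /= r5 addn1.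
apply: (IH i.+1) => //=.
  by move: leN iL'; clear; lia.
move=> r' dt r'5 Hr' dle; apply: q => //.
- by move=> x x4 x5; rewrite Hr' //= (negbTE x4) (negbTE x5).
- by move: dle iL'; clear; lia.
Qed.

Definition blank (s : store) (v : nat) : Prop :=
  forall u f, u < v -> s u f = if 7 <= f <= 10 then u else 0.

Lemma alloc_loop N : forall v r s A (Q : _ -> _ -> _ -> _ -> Prop),
  n.+1 - v < N -> v <= n.+1 -> perm_eq A (iota 0 v) -> blank s v -> r 3 = v -> r 0 = n ->
  blksize * n.+1 <= P ->
  (forall r' s' A' dt, perm_eq A' (iota 0 n.+1) -> blank s' n.+1 ->
     (forall x, x != 3 -> x != 11 -> r' x = r x) ->
     dt <= 30 * (n.+1 - v) + 1 -> Q r' s' A' dt) ->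
  runs W P (While (Bin Leq (Var 3) (Var 0)) ALLOC_STEP) r s A Q.
Proof.
elim: N => [|N IH] v r s A Q // leN vn pA bl r3 r0 PO q.
apply: runs_while => //.
- by apply: safe_leq.
- rewrite /= r3 r0 => /eqP; rewrite eqb0 -ltnNge => h.
  have E : v = n.+1 by apply/eqP; rewrite eqn_leq vn.
  by move: pA bl; rewrite E => pA bl; apply: q => //; rewrite addn1.
rewrite /= r3 r0 eqb0 negbK => h.
apply: runs_seq; apply: (runs_alloc PW); first exact: leq_ltn_trans W16.
  by apply: leq_trans PO; rewrite leq_mul2l /= (perm_size pA) size_iota ltnS.
(* The addresses below [v] are the live ones, and the machine returns the least free address. *)
move=> b bA bL bW; have bv : b = v.
  move: bA; rewrite (perm_mem pA) mem_iota /= add0n -leqNgt => vb.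
  apply/eqP; rewrite eqn_leq vb andbT leqNgt; apply/negP => /bL.
  by rewrite (perm_mem pA) mem_iota /= ltnn.
subst b; do 4![apply: runs_seq; apply: (runs_adr W16) => //=; first by rewrite mem_head].
set s1 := upd _ _ _ _.
have s1a u f : u != v -> s1 u f = s u f.
  by move=> uv; rewrite /s1 !upd_adr // /clear (negbTE uv).
have s1v f : s1 v f = if 7 <= f <= 10 then v else 0.
  rewrite /s1 !updE eqxx /clear eqxx /=.
  by case: f => [|[|[|[|[|[|[|[|[|[|[|f]]]]]]]]]]].
apply: runs_assign.
  by apply: (safe_inc W16) => //=; rewrite /rset /= r3; move: h nW; clear; lia.
rewrite /= /rset /= r3 addn1.
have pv : perm_eq (v :: A) (iota 0 v.+1).
  by rewrite -[v.+1]addn1 iotaD add0n /= cats1 perm_sym perm_rcons perm_cons perm_sym.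
apply: (IH v.+1 _ _ (v :: A)) => //=.
- by move: leN h; clear; lia.
- move=> u f; rewrite ltnS leq_eqVlt => /orP[/eqP->//|uv].
  by rewrite s1a ?bl // neq_ltn uv.
move=> r' s' A' dt p' bl' Hr' dle; apply: q => //.
- by move=> x x3 x11; rewrite Hr' //= (negbTE x3) (negbTE x11).
- by move: dle h; rewrite /blksize; clear; lia.
Qed.

Lemma runs_INIT r (Q : _ -> _ -> _ -> _ -> Prop) :
  r 0 = n -> r 1 = k -> r 3 = 0 -> r 5 = 0 ->
  blksize * (2 * n + 4) <= P ->
  (forall r' s' A' dt, Top W K (4 * k) n 0 0 0 s' A' [::] -> dt <= 400 * n -> Q r' s' A' dt) ->
  runs W P INIT r (fun _ _ => 0) [::] Q.
Proof.
move=> r0 r1 r3 r5 PO q.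
have K0 := KK_gt0.
have W1 : 1 < W by apply: ltn_trans W16.
have KW : K < W by apply: ltnW; apply: ltnW.
have a0 : 0 < 4 * k by rewrite muln_gt0.
have h1 : 4 * k * (4 * k) * lgn n < W by apply: leq_ltn_trans KW; rewrite leq_pmull.
have h2 : 4 * k * (4 * k) < W by apply: leq_ltn_trans h1; rewrite leq_pmulr.
have kW : 4 * k < W by apply: leq_ltn_trans h2; rewrite leq_pmulr.
apply: runs_seq; apply: runs_assign => //=.
apply: runs_seq; apply: (log_loop (i := 0) (ltnSn _)) => //=.
move=> r1' d1 q5 Hr1 d1le; rewrite /rset in Hr1.
apply: runs_seq; apply: runs_assign.
  split=> //=; first exact: ltn_trans W16.
  by rewrite Hr1 //= r1.
rewrite /= Hr1 //= r1.
apply: runs_seq; apply: runs_assign.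
  split; [exact: ltn_trans W16|split=> //=|]; rewrite /rset /= ?q5 //.
rewrite /= /rset /= q5 -/(KK n k).
apply: runs_seq; apply: (alloc_loop (v := 0) (ltnSn _)) => //.
- by rewrite /rset /= Hr1.
- by rewrite /rset /= Hr1.
- by apply: leq_trans PO; rewrite leq_mul2l /=; clear; lia.
move=> r2 s2 A2 d2 pA2 bl2 Hr2 d2le.
have Hb f : s2 n f = if 7 <= f <= 10 then n else 0 by rewrite bl2.
have nA : n \in A2 by rewrite (perm_mem pA2) mem_iota add0n ltnSn.
apply: runs_seq; apply: runs_assign => //=; rewrite Hr2 //= Hr1 //= r0.
do 4![apply: runs_seq; apply: (runs_adr W16) => //=]; rewrite /rset /= !Hr2 //=.
set s3 := upd _ _ _ _.
have s3E u f : (u != n) || (f \notin [:: 2; 3; 12; 13]) -> s3 u f = s2 u f.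
  case/orP => [un|]; first by rewrite /s3 !upd_adr.
  by rewrite !inE !negb_or => /and4P[f2 f3 f12 f13]; rewrite /s3 !upd_fld.
have Hc u f : u <= n -> 7 <= f <= 10 -> s3 u f = u.
  move=> un ff; rewrite s3E ?bl2 ?ff // orbC.
  by rewrite !inE !negb_or; apply/orP; left; apply/and4P; split; apply: contraTneq ff => ->.
apply: runs_seq; apply: runs_assign => //=; first exact: ltn_trans W1.
set O := iota 0 n.+1.
have HO : OS K n s3 [::] [::] [::] (fun _ => n) (fun _ => K) (fun _ => [::]) (fun _ => [::]).
  split=> //.
  - by move=> u un; rewrite /cyc /= /lk !Hc // eqxx.
  - by move=> u un; rewrite /cyc /= /lk !Hc // eqxx.
  - by move=> u un; rewrite s3E ?orbT // bl2.
have HE : env n A2 O [::] [::].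
  split; rewrite ?cats0 ?iota_uniq //.
  by move=> a an; rewrite mem_iota /= add0n ltnS.
apply: (file_loop PW W16 K0 KW2 _ (B := 0) (ltnSn _) HO HE _ (leq0n n)) => //=.
- by move: nW; clear; lia.
- by rewrite Hr2.
- by rewrite s3E ?orbT // Hb.
- by apply: leq_trans PO; rewrite leq_mul2l /= size_iota; clear; lia.
move=> r4 s4 A4 Bk4 J4 cl4 tl4 d4 H4 E4 p4 Cl4 k4 Hr4 d4le.
have nO : n \in O by rewrite mem_iota /= add0n.
have k4n f : ~~ (4 <= f <= 11) -> s4 n f = s3 n f by move=> ff; apply: k4.
apply: q; last first.
  by have := lgn_n n0; move: n0 d1le d2le d4le; rewrite !subn0; clear; lia.
split=> //.
- exists O; first by rewrite cats0.
  have -> : 0 + rho n 0 (size (nil : seq nat)) * cR K = 0 by rewrite /rho sub0n !muln0.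
  exact: (good_clean KW2 H4 E4 p4 Cl4).
- by split; rewrite k4n // /s3 !updE !eqxx /= ?Hb ?Hr2.
- by rewrite /cyc /= /lk !k4n // /s3 !updE !eqxx /= ?eqxx.
- by rewrite muln0.
Qed.
End Init.

(** * Reporting a dense subgraph *)

Definition EMIT_STEP : cmd := Emit (fld 7 0) ;; INC 6 ;; Assign 7 (fld 7 4).
Definition BUCKET_STEP : cmd :=
  Assign 7 (fld 3 4) ;;
  While (Bin Defs.Sub (Cst 1) (eqe (Var 7) (Var 3))) EMIT_STEP ;;
  Assign 3 (fld 3 7).
Definition PROC : cmd := While (Bin Leq (Var 4) (fld 3 11)) BUCKET_STEP.
Definition GROW_STEP : cmd := Assign 5 (Var 6) ;; Assign 4 (Bin Defs.Sub (Var 4) (Cst 2)) ;; PROC.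
(** Register 6 counts the emitted vertices and 5 those before the last step. The descent goes on
    while the ratio exceeds [1 + 1 / kk]; as register 5 is 0 at first, at least one step is made. *)
Definition GROW : expr :=
  lte (Bin Mul (Bin Add (fld 9 13) (Cst 1)) (Var 5)) (Bin Mul (fld 9 13) (Var 6)).
Definition REPORT : cmd :=
  Assign 9 (fld 0 1) ;; Assign 3 (fld 9 7) ;; Assign 4 (fld 3 11) ;; PROC ;;
  While GROW GROW_STEP.

(** * Rules for commands that only read the memory and emit words *)

Section Reads.
Variable W : nat.

Definition reads (c : cmd) (r : regfile) (s : store) (A : seq nat)
    (Q : regfile -> seq nat -> nat -> Prop) : Prop :=
  forall h o t p, model h s A ->
  exists r' o' dt, exec W c (State r h o t p) (State r' h (o ++ o') (t + dt) p) /\ Q r' o' dt.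

Lemma reads_seq c1 c2 r s A Q :
  reads c1 r s A (fun r1 o1 d1 => reads c2 r1 s A (fun r2 o2 d2 => Q r2 (o1 ++ o2) (d1 + d2))) ->
  reads (Seq c1 c2) r s A Q.
Proof.
move=> H h o t p M; have [r1 [o1 [d1 [E1 H1]]]] := H h o t p M.
have [r2 [o2 [d2 [E2 q]]]] := H1 h (o ++ o1) (t + d1) p M.
exists r2, (o1 ++ o2), (d1 + d2); split=> //; rewrite catA addnA; exact: ExecSeq E1 E2.
Qed.

Lemma reads_assign x e r s A (Q : _ -> _ -> _ -> Prop) :
  safe W r s A e -> Q (rset r x (vl r s e)) [::] 1 -> reads (Assign x e) r s A Q.
Proof.
move=> ok q h o t p M; exists (rset r x (vl r s e)), [::], 1; split=> //.
rewrite cats0; exact: (ExecAssign x (eval_vl o t p M ok)).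
Qed.

Lemma reads_emit e r s A (Q : _ -> _ -> _ -> Prop) :
  safe W r s A e -> Q r [:: vl r s e] 1 -> reads (Emit e) r s A Q.
Proof.
move=> ok q h o t p M; exists r, [:: vl r s e], 1; split=> //.
rewrite cats1; exact: (ExecEmit (eval_vl o t p M ok)).
Qed.

Lemma reads_while e c r s A (Q : _ -> _ -> _ -> Prop) :
  safe W r s A e ->
  (vl r s e = 0 -> Q r [::] 1) ->
  (vl r s e != 0 -> reads c r s A (fun r1 o1 d1 =>
     reads (While e c) r1 s A (fun r2 o2 d2 => Q r2 (o1 ++ o2) (d1 + d2).+1))) ->
  reads (While e c) r s A Q.
Proof.
move=> ok q1 q2 h o t p M; case: (eqVneq (vl r s e) 0) => H.
  exists r, [::], 1; split; last exact: q1.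
  rewrite cats0 (_ : State r h o (t + 1) p = tick 1 (State r h o t p)) //.
  by apply: ExecWhileEnd; rewrite (eval_vl o t p M ok) H.
have [r1 [o1 [d1 [E1 H1]]]] := q2 H h o t.+1 p M.
have [r2 [o2 [d2 [E2 q]]]] := H1 h (o ++ o1) (t.+1 + d1) p M.
exists r2, (o1 ++ o2), (d1 + d2).+1; split=> //.
have -> : t + (d1 + d2).+1 = t.+1 + d1 + d2 by clear; lia.
rewrite catA; apply: ExecWhileLoop E2; [exact: (eval_vl o t p M ok)|by []|].
by rewrite /tick /= addn1.
Qed.
End Reads.

(** * The descent through the levels *)

Section Report.
Variables W K kk n : nat.
Variables (s : store) (A O Bk J : seq nat) (cl tl : nat -> seq nat).
Hypothesis W16 : 100 < W.
Hypothesis K8 : 8 <= K.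
Hypothesis kk0 : 0 < kk.
Hypothesis n0 : 0 < n.
Hypothesis nW : (kk + 1) * n + 1 < W.
Hypothesis HO : OS K n s [::] Bk J (own s) (lab s) cl tl.
Hypothesis HE : env n A O Bk J.
Hypothesis Jn : forall y, (y \in J) && (s y 1 == n) = (y < n).
Hypothesis s0 : forall v, v < n -> s v 0 = v.
Hypothesis sk : s n 13 = kk.
Hypothesis sK : forall v, v < n -> K <= s v 13.
Hypothesis sW : forall v, v < n -> s v 13 < W.
Hypothesis s01 : forall v, v < n -> s v 1 = n.

Definition flat (bs : seq nat) : seq nat := flatten (map tl bs).
Definition above_cnt (l : nat) : nat := count (fun v => l <= s v 13) (iota 0 n).

Lemma chain_mem b : (b \in cl n) = (b \in Bk) && (s b 1 == n).
Proof. exact: (os_cl HO b (leqnn n)). Qed.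

Lemma bucket_items b y : b \in cl n -> y \in tl b -> [/\ y < n, s y 13 = s b 11 & s y 6 = b].
Proof.
rewrite chain_mem => /andP[bB /eqP b1]; rewrite (os_tl HO) // => /andP[yJ /eqP y6].
have [_ h2 h3 _] := os_J HO yJ; rewrite y6 b1 in h2 h3.
have yn : y < n by rewrite -Jn yJ -/(own s y) -h2 eqxx.
by split=> //; rewrite h3 /lab s0.
Qed.

Lemma flat_uniq bs : uniq bs -> {subset bs <= cl n} -> uniq (flat bs).
Proof.
elim: bs => [|b bs IH] //= /andP[bb ub] sub.
have bc : b \in cl n by apply: sub; rewrite mem_head.
have bB : b \in Bk by move: bc; rewrite chain_mem => /andP[].
have sub' : {subset bs <= cl n} by move=> c cc; apply: sub; rewrite inE cc orbT.
rewrite /flat /= cat_uniq IH // andbT (os_t HO bB).2 /=.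
apply/hasPn => y /flattenP[l /mapP[c cb ->] yc]; apply/negP => yb.
have [_ _ y6] := bucket_items bc yb; have [_ _ y6'] := bucket_items (sub' _ cb) yc.
by move: bb; rewrite -y6 y6' cb.
Qed.

Lemma flat_mem bs rest l y : cl n = bs ++ rest -> all (fun b => l <= s b 11) bs ->
  all (fun b => s b 11 < l) rest -> (y \in flat bs) = (y < n) && (l <= s y 13).
Proof.
move=> Ec /allP a1 /allP a2; apply/flattenP/andP => [[m /mapP[b bb ->] yb]|[yn ly]].
  have bc : b \in cl n by rewrite Ec mem_cat bb.
  by have [-> -> _] := bucket_items bc yb; split=> //; apply: a1.
have := Jn y; rewrite yn => /andP[yJ /eqP y1].
have [h1 h2 h3 _] := os_J HO yJ.
have bc : s y 6 \in cl n by rewrite chain_mem h1 h2 /own y1 eqxx.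
have yt : y \in tl (s y 6) by rewrite (os_tl HO) // yJ eqxx.
exists (tl (s y 6)) => //; apply: map_f; move: bc; rewrite Ec mem_cat => /orP[//|/a2].
by rewrite h3 /lab s0 // ltnNge ly.
Qed.

Lemma chain_uniq : uniq (cl n).
Proof.
have := os_sorted HO (leqnn n); apply: pairwise_uniq; exact: above_irr.
Qed.

Lemma flat_size bs rest l : cl n = bs ++ rest -> all (fun b => l <= s b 11) bs ->
  all (fun b => s b 11 < l) rest -> size (flat bs) = above_cnt l.
Proof.
move=> Ec a1 a2; rewrite /above_cnt -size_filter; apply: perm_size; apply: uniq_perm.
- apply: flat_uniq; first by have := chain_uniq; rewrite Ec cat_uniq => /and3P[].
  by move=> b bb; rewrite Ec mem_cat bb.
- by rewrite filter_uniq // iota_uniq.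
- by move=> y; rewrite (flat_mem _ Ec a1 a2) mem_filter mem_iota /= andbC.
Qed.

Lemma above_cnt_le l : above_cnt l <= n.
Proof. by apply: leq_trans (count_size _ _) _; rewrite size_iota. Qed.

Lemma chain_A b : b \in n :: cl n -> b \in A.
Proof. exact: (os_chain_mem HO HE (leqnn n)). Qed.

Lemma items_loop b : b \in cl n -> forall rest done r (Q : _ -> _ -> _ -> Prop),
  tl b = done ++ rest -> r 3 = b -> r 7 = head b rest -> r 6 + size rest <= n ->
  (forall r' dt, r' 6 = r 6 + size rest -> (forall x, x != 6 -> x != 7 -> r' x = r x) ->
     dt <= 4 * size rest + 1 -> Q r' rest dt) ->
  reads W (While (Bin Defs.Sub (Cst 1) (eqe (Var 7) (Var 3))) EMIT_STEP) r s A Q.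
Proof.
move=> bc; have [OA BA BO] := env_mem HE; have [_ _ _ JO] := HE.
have bA : b \in A by apply: chain_A; rewrite inE bc orbT.
have bB : b \in Bk by move: bc; rewrite chain_mem => /andP[].
have [ct ut] := os_t HO bB.
elim=> [|y rest IH] done r Q Et r3 r7 r6 q.
all: have mt x : x \in tl b -> x \in A by
  [rewrite (os_tl HO) // => /andP[/JO xO _]; apply: OA].
all: have v2 : vl r s (Bin Defs.Sub (Cst 1) (eqe (Var 7) (Var 3))) = 1 - (r 7 == r 3) by
  [rewrite -(eqe_vl r s (Var 7) (Var 3))].
all: have W1 : 1 < W by [apply: ltn_trans W16].
all: apply: reads_while; [
  split; [by [] | by apply: safe_eqe |
    by rewrite -[binop_fun _ _ _]/(vl r s (Bin Defs.Sub (Cst 1) (eqe (Var 7) (Var 3)))) v2;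
       apply: leq_ltn_trans W1; apply: leq_subr] | |]; rewrite v2 r3 r7 /=.
- by move=> _; apply: q => //; rewrite ?addn0.
- by rewrite eqxx.
- have yb : y != b.
    have yt : y \in tl b by rewrite Et mem_cat mem_head orbT.
    have [yn _ _] := bucket_items bc yt; have [nb _] := os_BJ HO bB.
    by rewrite neq_ltn (ltn_trans yn nb).
  by rewrite (negbTE yb).
move=> _; have yt : y \in tl b by rewrite Et mem_cat mem_head orbT.
have yA := mt y yt; have [yn _ _] := bucket_items bc yt.
apply: reads_seq; apply: reads_emit; first by sf; rewrite r7.
apply: reads_seq; apply: reads_assign.
  apply: (safe_inc W16) => //=; move: r6 nW => /=; rewrite mulnDl; clear; lia.
apply: reads_assign; first by sf; rewrite /rset /= r7.
rewrite /= /rset /= r7 /= s0 //.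
have nx : s y 4 = head b rest.
  by move: ct; rewrite Et -cat_rcons => /cyc_next; rewrite last_rcons.
rewrite nx; apply: (IH (rcons done y)) => //=.
- by rewrite cat_rcons.
- by move: r6 => /=; rewrite addn1 addSn addnS.
move=> r' dt r'6 Hr' dle; apply: q.
- by rewrite r'6 /= addn1 addSn addnS.
- by move=> x x6 x7; rewrite Hr' //= (negbTE x6) (negbTE x7).
- by move: dle => /=; clear; lia.
Qed.

(** Buckets are nonempty, so the overhead of each one is charged to the vertices that it emits. *)
Lemma proc_loop l rest : 0 < l -> forall done r (Q : _ -> _ -> _ -> Prop),
  cl n = done ++ rest -> all (fun b => l <= s b 11) done ->
  r 3 = head n rest -> r 4 = l -> r 6 = size (flat done) ->
  (forall r' done' rest' mid dt, cl n = done' ++ rest' -> done' = done ++ mid ->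
     all (fun b => l <= s b 11) done' ->
     all (fun b => s b 11 < l) rest' -> r' 3 = head n rest' -> r' 6 = size (flat done') ->
     (forall x, x != 3 -> x != 6 -> x != 7 -> r' x = r x) ->
     dt <= 8 * size (flat mid) + 1 -> Q r' (flat mid) dt) ->
  reads W PROC r s A Q.
Proof.
move=> l0; elim: rest => [|b rest IH] done r Q Ec al r3 r4 r6 q.
all: have rA : r 3 \in A by [rewrite r3; apply: chain_A; rewrite ?mem_head // Ec inE mem_cat mem_head !orbT].
all: apply: reads_while; [by sf| |]; rewrite /= r3 r4 /=.
- move=> _; apply: (q _ done [::] [::]) => //; by rewrite ?cats0.
- by rewrite (os_0 HO) // leqNgt l0.
- move=> /eqP; rewrite eqb0 -ltnNge => bl.
  apply: (q _ done (b :: rest) [::]) => //; first by rewrite cats0.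
  rewrite /= bl /=; have := os_sorted HO (leqnn n); rewrite Ec pairwise_cat => /and3P[_ _ /= /andP[/allP h _]].
  by apply/allP => c /h cb; apply: ltn_trans cb bl.
rewrite eqb0 negbK => bl.
have bc : b \in cl n by rewrite Ec mem_cat mem_head orbT.
have bB : b \in Bk by move: bc; rewrite chain_mem => /andP[].
have bA : b \in A by apply: chain_A; rewrite inE bc orbT.
have [ct _] := os_t HO bB.
have fs : size (flat done) + size (tl b) <= n.
  have : uniq (flat (rcons done b)).
    apply: flat_uniq; first by have := chain_uniq; rewrite Ec -cat_rcons cat_uniq => /and3P[].
    by move=> c cc; rewrite Ec -cat_rcons mem_cat cc.
  move=> u; have := uniq_leq_size u (s2 := iota 0 n); rewrite size_iota.
  rewrite /flat map_rcons flatten_rcons size_cat; apply=> y.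
  rewrite -flatten_rcons -map_rcons => /flattenP[m /mapP[c cc ->] yc].
  have cc' : c \in cl n by rewrite Ec -cat_rcons mem_cat cc.
  by have [yn _ _] := bucket_items cc' yc; rewrite mem_iota.
apply: reads_seq; apply: reads_assign; first by sf.
apply: reads_seq; apply: (items_loop bc (done := [::]) (rest := tl b)) => //=.
- by rewrite /rset /= r3 /=; apply: (cyc_next (l1 := [::]) ct).
- by rewrite /rset /= r6.
move=> r1 d1 r16 Hr1 d1le.
apply: reads_assign; first by sf; rewrite Hr1.
rewrite /= Hr1 //= /rset /= r3 /=.
have nx : s b 7 = head n rest.
  by have := os_c HO (leqnn n); rewrite Ec -cat_rcons => /cyc_next; rewrite last_rcons.
rewrite nx; apply: (IH (rcons done b)) => //=.
- by rewrite cat_rcons.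
- by rewrite all_rcons bl.
- by rewrite Hr1.
- by rewrite r16 /rset /= r6 /flat map_rcons flatten_rcons size_cat.
move=> r' done' rest' mid dt E' D' a1 a2 q3 q6 Hr' dle.
have fm : flat (b :: mid) = tl b ++ flat mid by [].
rewrite cats0 -fm; apply: (q _ done' rest' (b :: mid)) => //.
- by rewrite D' cat_rcons.
- by move=> x x3 x6 x7; rewrite Hr' //= (negbTE x3) Hr1 // /rset (negbTE x7).
- have : 0 < size (tl b) by have := os_ne HO bB isT; case: (tl b).
  by rewrite fm size_cat; move: d1le dle; clear; lia.
Qed.

Lemma above_cnt_all l : l <= K -> above_cnt l = n.
Proof.
move=> lK; rewrite /above_cnt -[RHS](size_iota 0); apply/eqP; rewrite -all_count.
by apply/allP => v; rewrite mem_iota => /= vn; apply: leq_trans (sK vn).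
Qed.

Lemma above_cnt_mono l l' : l <= l' -> above_cnt l' <= above_cnt l.
Proof. by move=> h; apply: sub_count => v; apply: leq_trans. Qed.

(** After [j] steps down from level [top], [cold] is the size before the last step; it has grown by
    [(kk + 1) / kk] in each step but the first and the last, whence the exponent [i]. Powers replace
    the fractions. *)
Definition grown (top j l cold : nat) : Prop :=
  l + 2 * j = top /\ if j is i.+1 then cold = above_cnt (l + 2) /\ (kk + 1) ^ i <= kk ^ i * cold else cold = 0.

(** Once the level is at most [K] the set is everything; a further step makes [cold] equal to [n],
    and the test fails. So the level stays near [K] at least, and [l - 2] is never truncated. A step
    that is executed enlarges the set, which pays for its overhead. *)
Lemma report_loop top N : forall l j cold done rest r (Q : _ -> _ -> _ -> Prop),
  l < N -> cl n = done ++ rest -> all (fun b => l <= s b 11) done ->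
  all (fun b => s b 11 < l) rest -> r 3 = head n rest -> r 4 = l -> r 5 = cold ->
  r 6 = size (flat done) -> r 9 = n -> grown top j l cold -> cold <= above_cnt l ->
  0 < above_cnt l -> l < W -> (K <= l + 2) \/ (cold = n /\ K <= l + 4) ->
  (forall r' done' rest' mid l' j' dt, cl n = done' ++ rest' -> done' = done ++ mid ->
     all (fun b => l' <= s b 11) done' -> all (fun b => s b 11 < l') rest' ->
     grown top j'.+1 l' (above_cnt (l' + 2)) ->
     kk * above_cnt l' <= (kk + 1) * above_cnt (l' + 2) ->
     dt <= 8 * size (flat mid) + 12 * (above_cnt l' - cold) + 3 -> Q r' (flat mid) dt) ->
  reads W (While GROW GROW_STEP) r s A Q.
Proof.
elim: N => [|N IH] l j cold done rest r Q // leN Ec a1 a2 r3 r4 r5 r6 r9 [tj gr] cc c0 lW inv q.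
have nA : n \in A by apply: chain_A; rewrite mem_head.
have fs := flat_size Ec a1 a2; rewrite fs in r6.
have nW' : (kk + 1) * n < W by apply: leq_ltn_trans nW; apply: leq_addr.
have m1 : (kk + 1) * cold < W.
  by apply: leq_ltn_trans nW'; rewrite leq_mul2l (leq_trans cc (above_cnt_le l)) orbT.
have m2 : kk * above_cnt l < W.
  by apply: leq_ltn_trans nW'; apply: leq_mul (above_cnt_le l); apply: leq_addr.
have k1 : kk + 1 < W by apply: leq_ltn_trans nW'; rewrite leq_pmulr.
have vG : vl r s GROW = ((kk + 1) * cold < kk * above_cnt l).
  by rewrite lte_vl /= r9 r5 r6 sk.
have W1 : 1 < W by apply: ltn_trans W16.
apply: reads_while.
- apply: (safe_lte W16).
  + split; [|by []|by rewrite /= r9 sk r5].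
    by apply: (safe_inc W16); [sf; rewrite r9|rewrite /= r9 sk -addn1].
  + by split; [sf; rewrite r9|by []|rewrite /= r9 sk r6].
  + rewrite /= r9 sk r5 -addn1; apply: leq_ltn_trans nW; rewrite leq_add2r leq_mul2l.
    by rewrite (leq_trans cc (above_cnt_le l)) orbT.
- rewrite vG => /eqP; rewrite eqb0 -leqNgt => st.
  case: j tj gr => [|i] tj gr.
    by move: st; rewrite gr muln0 leqn0 muln_eq0 -!leqn0 leqNgt kk0 leqNgt c0.
  have [gc _] := gr; rewrite gc in st.
  apply: (q _ done rest [::] l i) => //; [by rewrite cats0 | by rewrite -gc | by rewrite addn3].
rewrite vG eqb0 negbK => go.
(* The test succeeded, so [cold] is smaller than a count that is at most [n]. *)
have cn : cold != n.
  apply/eqP => E; move: go; rewrite E ltnNge; apply/negP/negPn.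
  by apply: leq_mul (above_cnt_le l); apply: leq_addr.
have Kl : K <= l + 2 by case: inv => // [[E _]]; rewrite E eqxx in cn.
have l2 : l - 2 + 2 = l by apply: subnK; move: Kl K8; clear; lia.
apply: reads_seq; apply: reads_assign => //=; rewrite r6.
apply: reads_seq; apply: reads_assign.
  by split=> //=; [apply: leq_ltn_trans W16|rewrite /rset /= r4; apply: leq_ltn_trans lW; apply: leq_subr].
rewrite /= /rset /= r4.
have a1' : all (fun b => l - 2 <= s b 11) done.
  by apply: sub_all a1 => b; apply: leq_trans; apply: leq_subr.
apply: (proc_loop (l := l - 2) _ Ec a1') => //=.
- by move: Kl K8; clear; lia.
- by rewrite r6.
move=> r1 done1 rest1 mid1 d1 E1 D1 b1 b2 q3 q6 Hr1 d1le.
apply: (IH (l - 2) j.+1 (above_cnt l) done1 rest1) => //=.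
- by move: leN l2; clear; lia.
- by rewrite Hr1.
- by rewrite Hr1.
- by rewrite Hr1.
- split; first by move: tj; rewrite -{1}l2; clear; lia.
  rewrite l2; split=> //; case: j tj gr => [|i] tj gr; first by rewrite !expn0 mul1n.
  have [_ gr2] := gr; rewrite !expnS -mulnA mulnCA.
  apply: leq_trans (_ : kk ^ i * ((kk + 1) * cold) <= _).
    by rewrite [kk ^ i * _]mulnCA leq_mul2l gr2 orbT.
  by rewrite leq_mul2l ltnW ?orbT.
- by apply: above_cnt_mono; apply: leq_subr.
- by apply: leq_trans c0 _; apply: above_cnt_mono; apply: leq_subr.
- by apply: leq_ltn_trans lW; apply: leq_subr.
- case: (leqP K l) => [h|h]; first by left; rewrite l2.
  by right; split; [apply: above_cnt_all; apply: ltnW|move: Kl l2; clear; lia].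
move=> r' done' rest' mid l' j' dt E' D' c1 c2 g' st dle.
have fm : flat mid1 ++ flat mid = flat (mid1 ++ mid) by rewrite /flat map_cat flatten_cat.
rewrite fm; apply: (q _ done' rest' _ l' j') => //; first by rewrite D' D1 catA.
have : cold < above_cnt l.
  rewrite -(ltn_pmul2l kk0); apply: leq_ltn_trans go; rewrite leq_mul2r; apply/orP; right; exact: leq_addr.
have : above_cnt l <= above_cnt l'.
  rewrite -(flat_size Ec a1 a2) -(flat_size E' c1 c2) D' D1 /flat !map_cat !flatten_cat !size_cat.
  by rewrite -addnA leq_addr.
by rewrite -fm size_cat; move: d1le dle; clear; lia.
Qed.

Lemma reads_REPORT r (Q : _ -> _ -> _ -> Prop) :
  r 0 = 0 -> r 5 = 0 -> r 6 = 0 ->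
  (forall r' o l j top dt, uniq o -> (forall y, (y \in o) = (y < n) && (l <= s y 13)) ->
     K <= top -> (forall v, v < n -> s v 13 <= top) ->
     grown top j.+1 l (above_cnt (l + 2)) ->
     kk * above_cnt l <= (kk + 1) * above_cnt (l + 2) ->
     dt <= 40 * size o -> Q r' o dt) ->
  reads W REPORT r s A Q.
Proof.
move=> r0 r5 r6 q.
have [OA BA BO] := env_mem HE; have [_ _ nO JO] := HE.
have nA : n \in A by apply: chain_A; rewrite mem_head.
have item v : v < n -> s v 6 \in cl n /\ s (s v 6) 11 = s v 13.
  move=> vn; have := Jn v; rewrite vn => /andP[yJ /eqP y1].
  have [h1 h2 h3 _] := os_J HO yJ; rewrite h3 /lab s0 // chain_mem h1 h2 /own y1 eqxx.
  by split.
have [c0 _] := item 0 n0.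
case Ec : (cl n) (c0) => [|b bs] // _.
have bc : b \in cl n by rewrite Ec mem_head.
have bA : b \in A by apply: chain_A; rewrite inE bc orbT.
have bB : b \in Bk by move: bc; rewrite chain_mem => /andP[].
set top := s b 11.
have mx v : v < n -> s v 13 <= top.
  move=> /item[]; rewrite Ec inE => /orP[/eqP->|vb] <- //.
  have := os_sorted HO (leqnn n); rewrite Ec /= => /andP[/allP /(_ _ vb) h _].
  exact: ltnW.
have [y yb] : exists y, y \in tl b.
  by have := os_ne HO bB isT; case: (tl b) => // y m _; exists y; rewrite mem_head.
have [yn yt _] := bucket_items bc yb.
have Kt : K <= top by rewrite /top -yt sK.
have a0 : 0 < above_cnt top.
  rewrite /above_cnt -has_count; apply/hasP; exists y; first by rewrite mem_iota.
  by rewrite yt.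
have n7 : s n 7 = b.
  by have := os_c HO (leqnn n); rewrite Ec => /(cyc_next (l1 := [::])).
apply: reads_seq; apply: reads_assign; first by sf; rewrite r0 OA // nO // ltnW.
rewrite /= r0 s01 //; apply: reads_seq; apply: reads_assign; first by sf.
rewrite /= /rset /= n7; apply: reads_seq; apply: reads_assign; first by sf.
rewrite /= /rset /= -/top.
apply: reads_seq; apply: (proc_loop (l := top) (rest := b :: bs) _ (done := [::])) => //=.
- by move: Kt K8; clear; lia.
move=> r1 done1 rest1 mid1 d1 E1 D1 b1 b2 q3 q6 Hr1 d1le.
apply: (report_loop (top := top) (l := top) (j := 0) (cold := 0) (ltnSn _) E1 b1 b2) => //=.
- by rewrite Hr1.
- by rewrite Hr1.
- by rewrite Hr1.
- by split=> //; rewrite muln0 addn0.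
- by rewrite /top -yt sW.
- by left; apply: leq_trans Kt (leq_addr _ _).
move=> r' done' rest' mid l' j' dt E' D' c1 c2 g' st dle.
have fm : flat mid1 ++ flat mid = flat done' by rewrite D' D1 /flat /= map_cat flatten_cat.
have u : uniq (flat done').
  apply: flat_uniq; first by have := chain_uniq; rewrite E' cat_uniq => /and3P[].
  by move=> c cb; rewrite E' mem_cat cb.
rewrite fm; apply: (q _ _ l' j' top) => // [z|].
  exact: flat_mem E' c1 c2.
have sz := flat_size E' c1 c2.
have : 0 < above_cnt l'.
  apply: leq_trans a0 _; apply: above_cnt_mono; case: g' => <- _; exact: leq_addr.
move: d1le dle; rewrite -sz -fm size_cat; clear; lia.
Qed.
End Report.

(* The integer form of [thr (i + r) <= (thr i + r) / (1 - r / K)]. *)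
Lemma thr_gap K B i r : 0 < K -> r <= K -> (K - r) * thr K B (i + r) <= K * (thr K B i + r).
Proof.
move=> K0; elim: r => [|r IH] rK; first by rewrite subn0 !addn0.
have {}IH := IH (ltnW rK); rewrite addnS thrE /nxt.
move: (thr K B i) (thr K B (i + r)) IH => a t IH.
rewrite -(leq_pmul2l K0).
have dK : K * (t %/ K) <= t by rewrite mulnC leq_trunc_div.
have h1 : K * (t + t %/ K + 1) <= t * (K + 1) + K.
  by rewrite !mulnDr !muln1 leq_add2r [t * K]mulnC leq_add2l.
apply: (@leq_trans ((K - r.+1) * (t * (K + 1) + K))).
  by rewrite mulnCA leq_mul2l h1 orbT.
apply: (@leq_trans (K * ((K - r) * t) + K * K)).
  rewrite mulnDr leq_add ?leq_mul2r ?leq_subr ?orbT //.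
  rewrite mulnCA [K * _]mulnCA mulnC [_ * (K * t)]mulnCA [K * (_ * t)]mulnA [X in _ <= X]mulnC.
  rewrite [t * _]mulnC leq_mul2r; apply/orP; right.
  rewrite -{2 3 4}(subnK rK); move: (K - r.+1) => z; rewrite -addSnnS.
  rewrite (_ : z + r.+1 - r = z.+1); last by clear; lia.
  by rewrite !mulnDr !mulnDl; clear; nia.
apply: (@leq_trans (K * (K * (a + r)) + K * K)); first by rewrite leq_add2r leq_mul2l IH orbT.
by rewrite -mulnDr addnS mulnS [K + _]addnC.
Qed.

(** The inequality [1 + j / q <= (1 + 1 / q) ^ j] with denominators cleared. *)
Lemma bernoulli q j : q ^ j * (q + j) <= q * (q + 1) ^ j.
Proof.
elim: j => [|j IH]; first by rewrite !expn0 mul1n muln1 addn0.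
have h : q ^ j <= (q + 1) ^ j.
  by case: j {IH} => [|j]; rewrite // leq_exp2r // leq_addr.
rewrite !expnS; move: (q ^ j) ((q + 1) ^ j) IH h => x y IH h.
rewrite -mulnA leq_mul2l; apply/orP; right.
by rewrite addnS -addn1 mulnDr muln1 mulnDl mul1n leq_add.
Qed.

(** By Bernoulli [(1 + 1 / q) ^ q] is at least 2, so [q * L] steps of growth would exceed
    [2 ^ L]. *)
Lemma pow_ratio q L j m : 0 < q -> (q + 1) ^ j <= q ^ j * m -> m < 2 ^ L -> j < q * L.
Proof.
move=> q0 h mL; rewrite ltnNge; apply/negP => le.
have h2 : q ^ q * 2 <= (q + 1) ^ q.
  rewrite -(leq_pmul2l q0) mulnCA; apply: leq_trans (bernoulli q q).
  by rewrite muln2 addnn.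
have h3 : q ^ (q * L) * 2 ^ L <= (q + 1) ^ (q * L).
  rewrite !expnM -expnMn; case: (L) => // l; by rewrite leq_exp2r.
have h4 : q ^ (j - q * L) <= (q + 1) ^ (j - q * L).
  by case: (j - _) => // l; rewrite leq_exp2r // leq_addr.
have := leq_mul h3 h4; rewrite mulnAC -!expnD subnKC // => /leq_trans /(_ h).
by rewrite leq_pmul2l ?expn_gt0 ?q0 // leqNgt mL.
Qed.

(** * The density of the reported set *)

Section Quality.
Variables W n k : nat.
Hypothesis W16 : 100 < W.
Hypothesis n0 : 0 < n.
Hypothesis k0 : 0 < k.
Notation K := (KK n k).
Notation kk := (4 * k).
Hypothesis nW : (kk + 1) * n + 1 < W.

Lemma KK_ge : 2 * kk * lgn n * kk = K.
Proof. by rewrite /KK; move: (4 * k) (lgn n) => a b; clear; lia. Qed.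

(** [N] counts the inner set, two levels above the lowest level in [o], and [T] bounds its
    in-degrees from below. The in-edges of the inner set lie inside [o], and [o] is hardly larger.
    [D] bounds all in-degrees and is only [c] thresholds away from [T]. *)
Lemma reads_top B t X s A E r (Q : _ -> _ -> _ -> Prop) :
  Top W K kk n B t X s A E -> r 0 = 0 -> r 5 = 0 -> r 6 = 0 ->
  (forall r' o dt N D T c, uniq o -> (forall y, y \in o -> y < n) ->
     (forall v, v < n -> deg E (hdf s) v <= D) ->
     c <= 2 * kk * lgn n -> (K - c) * D <= K * (T + c) ->
     N * T <= count (fun e => (s e 0 \in o) && (s e 1 \in o)) E ->
     kk * size o <= (kk + 1) * N -> 0 < size o -> dt <= 40 * size o -> Q r' o dt) ->
  reads W REPORT r s A Q.
Proof.
move=> HT r0 r5 r6 q; have K0 : 0 < K := KK_gt0 n k0.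
have a4 : 4 <= kk by rewrite -{1}[4]muln1 leq_mul2l.
have K8 : 8 <= K.
  rewrite -KK_ge -[8]/(2 * 4); apply: leq_trans (leq_pmulr _ _); last exact: leq_trans a4.
  by apply: leq_trans (leq_pmulr _ _) => //; rewrite leq_mul2l.
have [O [pO HG [OA sO uE Hv He]]] := top_good HT.
have [Bk [sc [un [cl [tl [[HI HO HE] HL St _]]]]]] := HG.
have [_ [R1 R2 R3 R4] _ lo hi] := HT.
have Jn y : (y \in items n E) && (s y 1 == n) = (y < n).
  rewrite mem_items; case: (ltnP y n) => yn /=; first by have [_ ->] := Hv y yn; rewrite eqxx.
  apply/negP => /andP[/He[_ _ y1 _] /eqP y1n]; by rewrite y1n ltnn in y1.
have s0 v : v < n -> s v 0 = v by move=> vn; have [] := Hv v vn.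
have s1 v : v < n -> s v 1 = n by move=> vn; have [] := Hv v vn.
have sK v : v < n -> K <= s v 13 by move=> vn; have [] := il_K HI vn.
have sW v : v < n -> s v 13 < W by move=> vn; have [_ /ltnW/ltnW] := il_K HI vn.
have kk0 : 0 < kk by apply: leq_trans a4.
apply: (reads_REPORT W16 K8 kk0 n0 nW HO HE Jn s0 R2 sK sW s1) => //.
move=> r' o l j top dt uo mo Kt mx [tj [_ gr]] st dle.
set N := above_cnt n s (l + 2) in gr st.
have N0 : 0 < N by rewrite lt0n; apply: contraTneq gr => ->; rewrite muln0 -ltnNge expn_gt0 addn1.
have Nn : N <= n by apply: above_cnt_le.
have jL : j < kk * lgn n := pow_ratio kk0 gr (leq_ltn_trans Nn (lgn_lt n)).
have so : size o = above_cnt n s l.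
  rewrite /above_cnt -size_filter; apply: perm_size; apply: uniq_perm => //.
    by rewrite filter_uniq // iota_uniq.
  by move=> y; rewrite mo mem_filter mem_iota /= andbC.
have So : N <= size o by rewrite so; apply: above_cnt_mono; apply: leq_addr.
(* [i0] is the lowest level of the inner set. The highest level is at most [top - K], so in-degrees
   are at most the threshold of index [top - K + 2], which does not exceed [i0 + c]. *)
pose i0 := l + 2 - K; pose c := 2 * j.+1.
have cL : c <= 2 * kk * lgn n by rewrite /c -mulnA leq_mul2l.
apply: (q r' o dt N (thr K B (i0 + c)) (thr K B i0) c) => //.
- by move=> y; rewrite mo => /andP[].
- move=> v vn; rewrite -St //; apply: leq_trans (li_hi HL vn) _; apply: thr_mono.
  have := mx v vn; rewrite /lev /i0 /c; move: tj (sK v vn); clear; lia.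
- apply: thr_gap => //; apply: leq_trans cL _; rewrite -KK_ge; exact: leq_pmulr.
(* At level 0 the lower bound on degrees may fail; but then [o] contains all vertices, and
   [n * B <= size E] replaces it. *)
- case: (leqP (l + 2) K) => lK.
    have -> : i0 = 0 by apply/eqP; rewrite subn_eq0.
    have ao v : v < n -> v \in o.
      by move=> vn; rewrite mo vn; apply: leq_trans (leq_trans lK (sK v vn)); apply: leq_addr.
    have -> : count (fun e => (s e 0 \in o) && (s e 1 \in o)) E = size E.
      by apply/eqP; rewrite -all_count; apply/allP => e /He[_ e0 e1 _]; rewrite !ao.
    by apply: leq_trans lo; rewrite leq_mul2r Nn orbT.
  have i00 : 0 < i0 by rewrite subn_gt0.
  pose S := [seq v <- iota 0 n | l + 2 <= s v 13].
  have uS : uniq S by rewrite filter_uniq // iota_uniq.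
  apply: (@leq_trans (\sum_(v <- S) deg E (hdf s) v)).
    rewrite /N /above_cnt -size_filter -/S -sum1_size big_distrl /= !big_seq.
    apply: leq_sum => v; rewrite mem_filter mem_iota /= mul1n => /andP[lv vn].
    have iv : i0 <= lev K s v by apply: leq_sub2r.
    by rewrite -St //; apply: leq_trans (li_lo HL vn (leq_trans i00 iv)); apply: thr_mono.
  (* The tail of an edge is at most two levels below its head, so an edge with its head in [S] has
     both ends in [o]. *)
  rewrite sum_deg //; apply: count_subseq => // e eE; rewrite /hdf mem_filter mem_iota /= => /andP[le0 e0n].
  have [_ _ e1n _] := He e eE; rewrite !mo e0n e1n /=; apply/andP; split.
    by apply: leq_trans le0; apply: leq_addr.
  by have := leq_trans le0 (li_st HL eE); rewrite leq_add2r.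
- by rewrite so.
- exact: leq_trans N0 So.
Qed.
End Quality.

From mathcomp Require Import finmap.

(** * Reachable memories *)

(** The emission of the name is added here because [runs] deals with silent commands. *)
Definition orienting : dyn_struct := DynStruct INIT (INSERT ;; Emit (Var 2)) DELETE REPORT.

Section Calls.
Variables W n k : nat.
Hypothesis n0 : 0 < n.
Hypothesis k0 : 0 < k.
Notation K := (KK n k).
Notation fits := (fits W n k 20).
Notation Top := (Top W K (4 * k) n).

Lemma fits_le m m' : m <= m' -> fits m' -> fits m.
Proof.
move=> h; apply: leq_trans; rewrite leq_exp2r // leq_add2r leq_add2l //.
Qed.

(** With [x = n + m + k >= 2], all quantities are below [2048 * x ^ 3]; of the exponent 20, 17 are
    spent on the constant factor. *)
Lemma fits_bounds m : fits m ->
  [/\ 100 < W, K.+2 < W, blksize * (2 * (n + m) + 6) < W, 40 * (m + n + K) + 2000 < W &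
   (4 * k + 1) * n + 1 < W /\ 2 * n + 2 < W].
Proof.
rewrite /Defs.fits; set x := n + m + k => fW.
have x2 : 2 <= x by rewrite /x; move: n0 k0; clear; lia.
have yW : 2048 * x ^ 3 <= W.
  apply: leq_trans fW; rewrite -[20]/(17 + 3) expnD leq_mul2r; apply/orP; right.
  apply: (@leq_trans (2 ^ 17)); first by rewrite -[2048]/(2 ^ 11) leq_pexp2l.
  by rewrite leq_exp2r.
have h1 : x * x <= x ^ 3 by rewrite 2!expnS expn1 mulnA leq_pmulr // (ltn_trans _ x2).
have h2 : 2 * x <= x * x by rewrite leq_mul2r x2 orbT.
have kx : k <= x by apply: leq_addl.
have nx : n <= x by rewrite /x -addnA leq_addr.
have mx : m <= x by rewrite /x addnAC leq_addl.
have Ky : K <= 32 * x ^ 3.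
  have -> : K = 32 * (k * k * lgn n).
    by rewrite /KK; move: (lgn n) => l; clear; lia.
  rewrite leq_mul2l /= 2!expnS expn1 mulnA; apply: leq_mul; first exact: leq_mul.
  exact: leq_trans (lgn_n n0) nx.
have kn : k * n <= x * x by apply: leq_mul.
have -> : (4 * k + 1) * n = 4 * (k * n) + n by rewrite mulnDl mul1n -mulnA.
rewrite /blksize; move: yW h1 h2 kn Ky mx nx x2; move: (x ^ 3) (x * x) (k * n) K => y xx kn KK0.
by clear; split; [| | | |split]; lia.
Qed.

Definition represents (s : store) (E : seq nat) (G : mgraph n) : Prop :=
  forall e, match G.[? e]%fmap with
    | Some p => e \in E /\ (s e 0 = p.1 /\ s e 1 = p.2 \/ s e 0 = p.2 /\ s e 1 = p.1)
    | None => e \notin E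
    end.

Definition Inv (h : heap) (G : mgraph n) (t X : nat) : Prop :=
  exists s A E B, [/\ model h s A, Top B t X s A E, represents s E G & fits (size E)].

Lemma represents_mem s E G e : represents s E G -> (e \in E) = (e \in domf G).
Proof.
by move=> /(_ e); case: fndP => [eG []->|eG /negbTE->].
Qed.

Lemma represents_size s E G : represents s E G -> uniq E -> size E = nb_edges G.
Proof.
move=> H U; apply: perm_size; apply: uniq_perm => //; first exact: fset_uniq.
by move=> e; apply: represents_mem H.
Qed.

Lemma represents_edge s E G (e : domf G) : represents s E G ->
  s (val e) 0 = (G e).1 /\ s (val e) 1 = (G e).2 \/ s (val e) 0 = (G e).2 /\ s (val e) 1 = (G e).1.
Proof.
move=> /(_ (val e)); rewrite (in_fnd (valP e)) => -[_].
have -> : G.[valP e]%fmap = G e by congr (G _); apply: val_inj.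
by [].
Qed.

Lemma card_edges s E G (p : pred nat) : represents s E G -> uniq E ->
  #|[set e : domf G | p (val e)]%SET| = count p E.
Proof.
move=> H U; rewrite cardE -(size_map val) -size_filter; apply: perm_size.
apply: uniq_perm; [by rewrite map_inj_uniq ?enum_uniq //; apply: val_inj|exact: filter_uniq|].
move=> e; rewrite mem_filter (represents_mem e H); apply/mapP/andP => [[y yp ->]|[pe eG]].
  by move: yp; rewrite mem_enum inE; split=> //; apply: valP.
by exists [` eG]%fset; rewrite ?mem_enum ?inE.
Qed.

Lemma inv_used h G t X : Inv h G t X -> used_space h <= blksize * (2 * (n + nb_edges G) + 1).
Proof.
move=> [s [A [E [B [M HT R F]]]]]; have [O [pO HG [OA sO uE _ _]]] := top_good HT.
have [Bk [sc [un [cl [tl [[HI HO HE] _ _ _]]]]]] := HG.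
rewrite (model_used M) leq_mul2l /= -(represents_size R uE).
have := env_size HO HE; rewrite sO; clear; lia.
Qed.

Lemma call_init : fits 0 ->
  exists h t pk, [/\ call W (ds_init orienting) [:: n; k] [::] h [::] t pk, t <= 400 * n,
    pk <= blksize * (2 * n + 4) & Inv h [fmap]%fmap 0 0].
Proof.
move=> F; have [W16 KW2 PW HW [nW nW2]] := fits_bounds F; rewrite addn0 in PW.
have PW' : blksize * (2 * n + 4) < W by apply: leq_ltn_trans PW; rewrite leq_mul2l /= leq_add2l.
have := @runs_INIT W (blksize * (2 * n + 4)) n k PW' W16 n0 k0 nW2 KW2 (nth 0 [:: n; k])
  (fun r' s' A' dt => Top 0 0 0 s' A' [::] /\ dt <= 400 * n) erefl erefl erefl erefl (leqnn _).
case/(_ _ [::] [::] 0 (used_space [::]) model_nil) => [r s A dt h1 h2|//|]; first by split.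
move=> r [h [s [A [dt [pk [Ex M pP [HT dle]]]]]]].
exists h, dt, pk; split=> //; first by exists r.
  by apply: leq_trans pP; apply: leq_maxl.
exists s, A, [::], 0; split=> // e; by rewrite fnd_fmap0.
Qed.

Lemma call_insert h G t X (u v : 'I_n) : Inv h G t X -> u != v -> fits (nb_edges G).+1 ->
  exists h' e t' pk, [/\ call W (ds_insert orienting) [:: val u; val v] h h' [:: e] t' pk,
    e \notin domf G, pk <= blksize * (2 * (n + nb_edges G) + 6) &
    Inv h' G.[e <- (u, v)]%fmap (t + t') (X + (cU K).+1)].
Proof.
move=> HInv uv F; have hu := inv_used HInv; have [s [A [E [B [M HT R _]]]]] := HInv.
have [O [pO HG [OA sO uE Hv He]]] := top_good HT.
have sE := represents_size R uE; rewrite -sE in F hu *.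
have [W16 KW2 PW HW _] := fits_bounds F.
set P := blksize * (2 * (n + size E) + 6).
have PW' : P < W by apply: leq_ltn_trans PW; rewrite leq_mul2l /= leq_add2r leq_mul2l /= leq_add2l.
have uv' : val u != val v by [].
have := @runs_INSERT W P K (4 * k) n (lgn n) PW' W16 (KK_gt0 n k0) KW2 (lgn_lt n) (lgn_KK n k0) n0
  B t X (nth 0 [:: val u; val v]) s A E (val u) (val v)
  (fun r' s' A' dt => exists B' e, [/\ Top B' (t + dt) (X + cU K) s' A' (e :: E), e \notin E, r' 2 = e,
     orient E (hdf s) (tlf s) (hdf s') (tlf s') &
     s' e 0 = u /\ s' e 1 = v \/ s' e 0 = v /\ s' e 1 = u]) HT erefl erefl (ltn_ord u) (ltn_ord v) uv'.
case/(_ _ _ _ h [::] 0 (used_space h) M).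
- by rewrite leq_mul2l /= leq_add2l.
- by move: HW; clear; lia.
- by move=> r' s' A' B' e dt h1 h2 h3 h4 h5 h6 h7; exists B', e.
- by rewrite maxnn; apply: leq_trans hu _; rewrite leq_mul2l /= leq_add2l.
move=> r [h' [s' [A' [dt [pk [Ex M' pP [B' [e [HT' eE r2 Ho He']]]]]]]]].
have eG : e \notin domf G by rewrite -(represents_mem e R).
exists h', e, dt.+1, pk; split=> //.
- exists r; apply: ExecSeq Ex _.
  by have := @ExecEmit W (State r h' [::] (0 + dt) pk) (Var 2) (r 2) erefl; rewrite /emit /tick /= r2 addn1.
- by apply: leq_trans pP; apply: leq_maxl.
exists s', A', (e :: E), B'; split=> //.
- case: HT' => [[O' p' g'] h2 h3 h4 h5]; split=> //; exists O' => //.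
  by rewrite !addnS addSn -addn1 -[(X + _).+1]addn1; apply: good_time g'.
- move=> y; rewrite fnd_set inE; case: (eqVneq y e) => [->|ye] /=; first by split.
  have := R y; case: (G.[? y])%fmap => [p [yE hy]|//]; split=> //.
  by have := Ho y yE; rewrite /hdf /tlf; case: hy => [] [-> ->] [] [-> ->]; [left|right|right|left].
Qed.

Lemma call_delete h G t X e : Inv h G t X -> e \in domf G ->
  exists h' t' pk, [/\ call W (ds_delete orienting) [:: e] h h' [::] t' pk,
    pk <= blksize * (2 * (n + nb_edges G) + 6) &
    Inv h' G.[~ e]%fmap (t + t') (X + cU K)].
Proof.
move=> HInv eG; have hu := inv_used HInv; have [s [A [E [B [M HT R F]]]]] := HInv.
have [O [pO HG [OA sO uE Hv He]]] := top_good HT.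
have sE := represents_size R uE; rewrite -sE in hu *.
have eE : e \in E by rewrite (represents_mem e R).
have [W16 KW2 PW HW _] := fits_bounds F.
set P := blksize * (2 * (n + size E) + 6).
have := @runs_DELETE W P K (4 * k) n (lgn n) PW W16 (KK_gt0 n k0) KW2 (lgn_lt n) (lgn_KK n k0) n0
  B t X (nth 0 [:: e]) s A E e
  (fun r' s' A' dt => exists B', Top B' (t + dt) (X + cU K) s' A' (rem e E) /\
     orient (rem e E) (hdf s) (tlf s) (hdf s') (tlf s')) HT erefl eE.
case/(_ _ HW _ h [::] 0 (used_space h) M).
- by rewrite leq_mul2l /= leq_add2l.
- by move=> r' s' A' B' dt h1 h2; exists B'.
- by rewrite maxnn; apply: leq_trans hu _; rewrite leq_mul2l /= leq_add2l.
move=> r [h' [s' [A' [dt [pk [Ex M' pP [B' [HT' Ho]]]]]]]].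
exists h', dt, pk; split=> //; first by exists r.
  by apply: leq_trans pP; apply: leq_maxl.
exists s', A', (rem e E), B'; split=> //; last by apply: fits_le F; rewrite size_rem // leq_pred.
move=> y; rewrite fnd_rem1; case: (eqVneq y e) => [->|ye] /=; first by rewrite mem_rem_uniq // inE eqxx.
have := R y; case: (G.[? y])%fmap => [p [yE hy]|yE]; last by rewrite mem_rem_uniq // inE ye.
have yr : y \in rem e E by rewrite mem_rem_uniq // inE ye.
split=> //; have := Ho y yr; rewrite /hdf /tlf.
by case: hy => [] [-> ->] [] [-> ->]; [left|right|right|left].
Qed.

Lemma call_fun p args h h1 h2 o1 o2 t1 t2 pk1 pk2 :
  call W p args h h1 o1 t1 pk1 -> call W p args h h2 o2 t2 pk2 ->
  [/\ h1 = h2, o1 = o2 & t1 = t2].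
Proof. by move=> [r1 e1] [r2 e2]; have [_ -> -> ->] := exec_deterministic e1 e2. Qed.

(** [reach] only says that some call has ended in the given memory; determinism of the machine
    identifies it with the call constructed for the invariant. The extra unit per update is the
    emission. *)
Lemma reach_inv h G T t : reach orienting W k 20 h G T t -> Inv h G t (T * (cU K).+1).
Proof.
elim=> {h G T t}.
- move=> h t pk F C; have [h' [t' [pk' [C' _ _ H]]]] := call_init F.
  by have [-> _ _] := call_fun C C'.
- move=> h G T t u v h' e t' pk _ IH uv F C.
  have [h2 [e2 [t2 [pk2 [C2 _ _ H]]]]] := call_insert IH uv F.
  have [-> [->] ->] := call_fun C C2; by rewrite mulSn [_.+1 + _]addnC.
- move=> h G T t e h' t' pk _ IH eG C.
  have [h2 [t2 [pk2 [C2 _ H]]]] := call_delete IH eG.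
  have [-> _ ->] := call_fun C C2; rewrite mulSn [_.+1 + _]addnC.
  have [s [A [E [B [M [[O pO HG] h3 h4 h5 h6] R F]]]]] := H.
  exists s, A, E, B; split=> //; split=> //; exists O => //.
  by apply: good_le HG; rewrite // leq_add2l.
Qed.
End Calls.

(** * In-degrees, densities and the outcome of a report *)

Section Answers.
Variables W n k : nat.
Hypothesis n0 : 0 < n.
Hypothesis k0 : 0 < k.
Notation Inv := (Inv W k).

Definition inside (G : mgraph n) (S : {set 'I_n}) (E : seq nat) (s : store) : nat :=
  count (fun e => [exists v in S, val v == s e 0] && [exists v in S, val v == s e 1]) E.

Lemma in_val (S : {set 'I_n}) (v : 'I_n) : [exists u in S, val u == val v] = (v \in S).
Proof.
apply/exists_inP/idP => [[u uS /eqP/val_inj <-]//|vS]; by exists v.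
Qed.

Lemma edges_inE (G : mgraph n) (S : {set 'I_n}) s E : represents s E G -> uniq E ->
  edges_in G S = inside G S E s.
Proof.
move=> H U; rewrite /edges_in /inside -(card_edges _ H U); apply: eq_card => e; rewrite !inE.
by case: (represents_edge e H) => [] [-> ->]; rewrite !in_val // andbC.
Qed.

Definition head_of (G : mgraph n) (s : store) (e : domf G) : 'I_n :=
  if s (val e) 0 == val (G e).1 then (G e).1 else (G e).2.

Lemma head_ofE s E (G : mgraph n) e : represents s E G -> val (@head_of G s e) = s (val e) 0.
Proof.
by move=> /(represents_edge e); rewrite /head_of; case: eqP => [->|ne] [] [].
Qed.

Lemma indegreeE s E (G : mgraph n) (v : 'I_n) : represents s E G -> uniq E ->
  indegree (@head_of G s) v = deg E (hdf s) v.
Proof.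
move=> H U; rewrite /deg -(card_edges _ H U); apply: eq_card => e.
by rewrite !inE -(inj_eq val_inj) (head_ofE e H).
Qed.

(** An edge inside [S] has its head in [S]: the easy half of the duality between density and maximum
    in-degree. *)
Lemma inside_le (G : mgraph n) S E s D : (forall v, v < n -> deg E (hdf s) v <= D) ->
  (forall e, e \in E -> s e 0 < n) -> inside G S E s <= #|S| * D.
Proof.
move=> HD He; set A := [seq val v | v <- enum S].
have uA : uniq A by rewrite map_inj_uniq ?enum_uniq //; apply: val_inj.
have mA x : [exists v in S, val v == x] -> x \in A.
  by move=> /exists_inP[v vS /eqP<-]; apply: map_f; rewrite mem_enum.
apply: (@leq_trans (count (fun e => hdf s e \in A) E)).
  by apply: sub_count => e /andP[/mA].
rewrite -sum_deg // cardE -(size_map val) -/A -sum1_size big_distrl /= !big_seq.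
apply: leq_sum => x /mapP[v _ ->]; rewrite mul1n; apply: HD; exact: ltn_ord.
Qed.

(** One number [D] serves both claims: it bounds the in-degrees, and with them every density from
    above, while the density of [S] nearly reaches it. *)
Lemma call_report h G t X : Inv h G t X ->
  exists (s : store) (E o : seq nat) (S : {set 'I_n}) (dt D c : nat),
  [/\ represents s E G, uniq E, call W (ds_report orienting) [::] h h o dt (used_space h),
      perm_eq o [seq val v | v <- enum S] & S != set0] /\
  [/\ forall v, v < n -> deg E (hdf s) v <= D,
      forall e, e \in E -> [/\ s e 0 < n, s e 1 < n & s e 0 != s e 1],
      c <= 2 * (4 * k) * lgn n,
      (4 * k - 1) * D * #|S| <= (4 * k + 1) * (edges_in G S + c * #|S|) &
      dt <= 40 * #|S|] /\
  (stores_orientation h (@head_of G s) /\ orientation (@head_of G s)).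
Proof.
move=> [s [A [E [B [M HT R F]]]]].
have [O [pO HG [OA sO uE Hv He]]] := top_good HT.
have [W16 KW2 PW HW [nW _]] := fits_bounds n0 k0 F.
have := @reads_top W n k W16 n0 k0 nW B t X s A E (nth 0 [::])
  (fun _ o dt => exists (S : {set 'I_n}) D c, [/\ perm_eq o [seq val v | v <- enum S], S != set0,
      forall v, v < n -> deg E (hdf s) v <= D, c <= 2 * (4 * k) * lgn n & 
      (4 * k - 1) * D * #|S| <= (4 * k + 1) * (edges_in G S + c * #|S|) /\ dt <= 40 * #|S|]) HT erefl erefl erefl.
case/(_ _ h [::] 0 (used_space h) M).
  move=> r o dt N D T c uo on HD cL hK hN st so dle.
  pose S := [set v : 'I_n | val v \in o].
  have pS : perm_eq o [seq val v | v <- enum S].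
    apply: uniq_perm => //; first by rewrite map_inj_uniq ?enum_uniq //; apply: val_inj.
    move=> y; apply/idP/mapP => [yo|[v + ->]]; last by rewrite mem_enum inE.
    by exists (Ordinal (on y yo)); rewrite // mem_enum inE.
  have sS : size o = #|S| by rewrite (perm_size pS) size_map -cardE.
  have mo x : x < n -> [exists v in S, val v == x] = (x \in o).
    by move=> xn; rewrite (in_val S (Ordinal xn)) inE.
  exists S, D, c; rewrite sS in st so dle; split=> //; first by rewrite -card_gt0.
  split=> //; rewrite (edges_inE S R uE).
  have -> : inside G S E s = count (fun e => (s e 0 \in o) && (s e 1 \in o)) E.
    by apply: eq_in_count => e /He[_ e0 e1 _]; rewrite !mo.
  have q0 : 0 < 2 * (4 * k) * lgn n by rewrite !muln_gt0 k0.
  have a0 : 0 < 4 * k by rewrite muln_gt0.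
  have hD : (4 * k - 1) * D <= 4 * k * (T + c).
    rewrite -(leq_pmul2l q0) mulnA [X in _ <= X]mulnA KK_ge; apply: leq_trans hK.
    rewrite leq_mul2r; apply/orP; right; rewrite mulnBr KK_ge muln1; exact: leq_sub2l.
  apply: (@leq_trans (4 * k * (T + c) * #|S|)); first by rewrite leq_mul2r hD orbT.
  rewrite mulnDr mulnDl [X in _ <= X]mulnDr; apply: leq_add.
    apply: (@leq_trans ((4 * k + 1) * (N * T))); last by rewrite leq_mul2l hN orbT.
    by rewrite mulnAC mulnA leq_mul2r st orbT.
  by rewrite -mulnA leq_mul2r leq_addr orbT.
move=> r [o [dt [Ex [S [D [c [pS S0 HD cL [h1 h2]]]]]]]].
exists s, E, o, S, dt, D, c; split; [|split].
- by split=> //; exists r.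
- by split=> // e /He[].
- split=> [e|e].
    have eE : val e \in E by rewrite (represents_mem _ R); apply: valP.
    have eA : val e \in A by apply: OA; rewrite (perm_mem pO) mem_cat eE orbT.
    by rewrite (model_size M eA) (model_cell M eA) // (head_ofE e R).
  by rewrite /head_of; case: eqP; [left|right].
Qed.

End Answers.

From mathcomp Require Import all_order all_algebra finmap ring lra.
From mathcomp Require Import reals exp.
Import Order.TTheory GRing.Theory Num.Theory.
Local Open Scope ring_scope.

(** * The bounds over the reals *)

Section Reals.
Variable R : realType.

Lemma density_bound (k s D M c : nat) : (0 < k)%N -> (0 < s)%N ->
  ((4 * k - 1) * D * s <= (4 * k + 1) * (M + c * s))%N ->
  (4 * k%:R - 1) * D%:R <= (4 * k%:R + 1) * (M%:R / s%:R + c%:R) :> R.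
Proof.
move=> k0 s0; have s0R : 0 < s%:R :> R by rewrite ltr0n.
have e1 : (4 * k + 1)%:R = 4 * k%:R + 1 :> R by rewrite natrD natrM.
have e2 : (M + c * s)%:R = M%:R + c%:R * s%:R :> R by rewrite natrD natrM.
have e3 : (4 * k - 1)%:R = 4 * k%:R - 1 :> R by rewrite natrB ?muln_gt0 // natrM.
rewrite -(ler_nat R) !natrM e1 e2 e3 => h.
have E : M%:R + c%:R * s%:R = (M%:R / s%:R + c%:R) * s%:R :> R.
  by rewrite mulrDl divfK // gt_eqF.
by rewrite -(ler_pM2r s0R) -[X in _ <= X]mulrA -E.
Qed.

(** From [ln (1 + x) <= x] at [x = -1/2]. *)
Lemma ln2_ge : 1 <= 2 * ln 2 :> R.
Proof.
have h : -1 < - 2^-1 :> R by lra.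
have := le_ln1Dx h; have -> : 1 + - 2^-1 = 2^-1 :> R by field.
rewrite lnV ?posrE //; lra.
Qed.

(** For [n > 1] both the truncated binary logarithm and the added 1 are at most [2 * ln n], because
    [ln 2] is at least one half. *)
Lemma lgn_ln n : (1 < n)%N -> (lgn n)%:R <= 4 * ln n%:R :> R.
Proof.
move=> n1; have n0 : (0 < n)%N by apply: ltnW.
have h2 : ln 2 <= ln n%:R :> R by rewrite ler_ln ?posrE ?ltr0n // ler_nat.
have h : (trunc_log 2 n)%:R * ln 2 <= ln n%:R :> R.
  rewrite mulr_natl -lnXn // -natrX ler_ln ?posrE ?ltr0n ?expn_gt0 // ler_nat.
  exact: trunc_logP.
have l2 := ln2_ge; rewrite /lgn -natr1.
have : (trunc_log 2 n)%:R * 1 <= (trunc_log 2 n)%:R * (2 * ln 2) :> R by rewrite ler_wpM2l.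
move: h; move: ((trunc_log 2 n)%:R : R) (ln 2 : R) (ln n%:R : R) h2 l2 => a b c; nra.
Qed.

Lemma precision (eps : R) (k := `|Num.ceil eps^-1|%N) : 0 < eps ->
  [/\ (0 < k)%N, 1 <= k%:R * eps & k%:R * Num.min eps 1 <= 2].
Proof.
move=> e0; have v0 : 0 < eps^-1 by rewrite invr_gt0.
have /andP[c1 c2] := ceil_itv eps^-1.
have kE : k%:R = (Num.ceil eps^-1)%:~R :> R.
  by rewrite /k natr_absz ger0_norm // ceil_ge0 (lt_trans _ v0) // ltrN10.
rewrite -kE in c2; rewrite intrB -kE in c1.
have ev : eps^-1 * eps = 1 by rewrite mulVf ?gt_eqF.
split.
- by rewrite -(ltr0n R); apply: lt_le_trans v0 c2.
- by rewrite -[X in X <= _]ev ler_wpM2r // ltW.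
- case: (leP eps 1) => h; last first.
    have : eps^-1 <= 1 by rewrite invf_le1 // ltW.
    by rewrite mulr1; lra.
  have : k%:R * eps <= (eps^-1 + 1) * eps by rewrite ler_wpM2r ?ltW //; lra.
  by rewrite mulrDl ev mul1r; lra.
Qed.

(** [4k + 1 <= (4k - 1) * (1 + eps)] holds because [(4k - 1) * eps >= 3 * k * eps >= 3], and
    [4k + 1 <= 2 * (4k - 1)] accounts for the factor 2 on the additive term. *)
Lemma max_indegree_bound (k D q opt dens c eps : R) : 1 <= k -> 0 <= eps -> 1 <= k * eps ->
  0 <= c -> 0 <= opt -> dens <= opt ->
  (4 * k - 1) * D <= (4 * k + 1) * (dens + c) -> 2 * c <= q -> D <= (1 + eps) * opt + q.
Proof.
move=> k1 e0 ke c0 o0 ledo h cq.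
have p : 0 < 4 * k - 1 by lra.
rewrite -(ler_pM2l p); apply: le_trans h _.
have h1 : (4 * k + 1) * (dens + c) <= (4 * k + 1) * (opt + c) by rewrite ler_wpM2l //; lra.
apply: le_trans h1 _.
have h2 : (4 * k + 1) * opt <= (4 * k - 1) * ((1 + eps) * opt).
  rewrite mulrA ler_wpM2r //; nra.
have h3 : (4 * k + 1) * c <= (4 * k - 1) * q.
  apply: (@le_trans _ _ ((4 * k - 1) * (2 * c))); last by rewrite ler_wpM2l // ltW.
  by rewrite mulrA ler_wpM2r //; lra.
by rewrite !mulrDr; apply: lerD h2 h3.
Qed.

(** For [eps > 1] the claim is trivial; otherwise [(4k + 1) * (1 - eps) <= 4k - 1], as
    [(4k + 1) * eps] is at least 4. *)
Lemma density_lower (k D q opt dens c eps : R) : 1 <= k -> 0 <= eps -> 1 <= k * eps ->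
  0 <= c -> 0 <= opt -> opt <= D -> 0 <= dens ->
  (4 * k - 1) * D <= (4 * k + 1) * (dens + c) -> c <= q -> (1 - eps) * opt - q <= dens.
Proof.
move=> k1 e0 ke c0 o0 oD d0 h cq; rewrite lerBlDr.
suff : (1 - eps) * opt <= dens + c by lra.
have p : 0 < 4 * k + 1 by lra.
case: (leP eps 1) => e1; last by nra.
rewrite -(ler_pM2l p); apply: le_trans h.
apply: (@le_trans _ _ ((4 * k + 1) * ((1 - eps) * D))).
  by apply: ler_wpM2l; [exact: ltW|apply: ler_wpM2l; rewrite ?subr_ge0].
by rewrite mulrA ler_wpM2r //; [lra|nra].
Qed.
End Reals.

(** On one vertex [ln n] is 0, so the time bound is 0; it holds because loops are excluded and no
    update is possible. *)
Lemma reach_one W n k h (G : mgraph n) T t : n = 1%N -> (0 < n)%N -> (0 < k)%N ->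
  reach orienting W k 20 h G T t -> T = 0%N.
Proof.
move=> n1 n0 k0; elim=> {h G T t} // [h G T t u v h' e t' pk _ _ uv|h G T t e h' t' pk H _ eG _].
  by case/eqP: uv; apply: val_inj; case: u v => [u +] [v +] /=; rewrite n1; case: u v => [|u] [|v].
have [s [A [E [B [_ HT R _]]]]] := reach_inv n0 k0 H.
have [O [_ _ [_ _ _ _ He]]] := top_good HT.
have /He[_] : e \in E by rewrite (represents_mem e R).
by rewrite n1; case: (s e 0%N) (s e 1%N) => [|x] [|y].
Qed.

(** [KK n k] is 32 times [k ^ 2 * lgn n]; squaring [k * e <= 2] gives a factor 4, and the logarithm
    another 4. *)
Lemma KK_bound (R : realType) (n k : nat) (e l : R) : 0 < e -> k%:R * e <= 2 ->
  (lgn n)%:R <= 4 * l -> (KK n k)%:R <= 512 * (l / e ^+ 2).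
Proof.
move=> e0 ke hL; rewrite mulrA ler_pdivlMr ?exprn_gt0 //.
have -> : KK n k = (32 * (k * k * lgn n))%N by rewrite /KK; move: (lgn n) => a; clear; lia.
have k0 : 0 <= k%:R * e by rewrite mulr_ge0 ?ler0n // ltW.
have h : k%:R * e * (k%:R * e) * (lgn n)%:R <= 2 * 2 * (4 * l).
  by apply: ler_pM => //; [exact: mulr_ge0|exact: ler_pM].
rewrite !natrM; move: h; move: (k%:R : R) ((lgn n)%:R : R) => a b; lra.
Qed.

Lemma slack_bound (R : realType) (n k c : nat) (e l : R) : 0 < e -> k%:R * e <= 2 ->
  (lgn n)%:R <= 4 * l -> (c <= 2 * (4 * k) * lgn n)%N -> c%:R <= 64 * (l / e).
Proof.
move=> e0 ke hL; rewrite -(ler_nat R) !natrM => hc; rewrite mulrA ler_pdivlMr //.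
have h : k%:R * e * (lgn n)%:R <= 2 * (4 * l).
  by apply: ler_pM; rewrite ?ler0n // mulr_ge0 ?ler0n // ltW.
apply: (@le_trans _ _ (2 * (4 * k%:R) * (lgn n)%:R * e)); first by rewrite ler_wpM2r // ltW.
move: h; move: (k%:R : R) ((lgn n)%:R : R) => a b; lra.
Qed.

Lemma cU_bound K : (0 < K)%N -> ((cU K).+1 <= 43 * (1024 * K))%N.
Proof. by rewrite /cU; clear; lia. Qed.

Theorem theorem3p1 (R : realType) :
  exists (D : dyn_struct) (C c : nat),
  forall (eps : R) (n : nat), 0 < eps -> (0 < n)%N ->
  (* the O-bounds refer to the range eps <= 1 *)
  let eps1 : R := Num.min eps 1 in
  let logn : R := ln n%:R in
  (* the precision handed to the program *)
  let k : nat := `|Num.ceil eps^-1|%N in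
  forall W : nat,
  (fits W n k c 0 ->
     exists h t pk, [/\ call W (ds_init D) [:: n; k] [::] h [::] t pk,
       (t <= C * n)%N & (pk <= C * n)%N]) /\
  forall (h : heap) (G : mgraph n) (T t : nat), reach D W k c h G T t ->
  let m := nb_edges G in
  (forall u v : 'I_n, u != v -> fits W n k c m.+1 ->
     exists h' e t' pk,
       [/\ call W (ds_insert D) [:: val u; val v] h h' [:: e] t' pk,
           e \notin domf G & (pk <= C * (m.+1 + n))%N]) /\
  (forall e, e \in domf G ->
     exists h' t' pk, call W (ds_delete D) [:: e] h h' [::] t' pk /\
       (pk <= C * (m + n))%N) /\
  t%:R <= C%:R * T%:R * (logn / eps1 ^+ 2) /\
  (used_space h <= C * (m + n))%N /\
  (exists o : domf G -> 'I_n,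
     [/\ orientation o, stores_orientation h o &
         forall v, (indegree o v)%:R <=
           (1 + eps) * OPT R G + C%:R * (logn / eps1)]) /\
  (exists (S : {set 'I_n}) (s : seq nat) (t' pk : nat),
     [/\ S != set0,
         (1 - eps) * OPT R G - C%:R * (logn / eps1) <= density R G S,
         call W (ds_report D) [::] h h s t' pk,
         perm_eq s [seq val v | v <- enum S] &
         (t' <= C * #|S|)%N /\ (pk <= C * (m + n))%N]).
Proof.
(* [C] is kept abstract with two lower bounds: 512 for space, report and additive errors, and
   [43 * 1024 * 512] for the time, where [43 * 1024 * K] bounds the cost of an update and 512 is the
   factor of [KK_bound]. *)
have [C [C1 C2]] : exists C : nat, (512 <= C)%N /\ (43 * (1024 * 512) <= C)%N.
  exists (64 * (1024 * 512))%N; split; last by rewrite leq_mul2r orbT.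
  by apply: leq_trans (leq_pmull 512 (isT : 0 < 1024)%N) (leq_pmull _ _).
exists orienting, C, 20%N => eps n eps0 n0 eps1 logn k W.
have [k0 ke ke1] := precision eps0; rewrite -/k -/eps1 in k0 ke ke1.
have mC a b : (a <= 512 * b)%N -> (a <= C * b)%N.
  by move=> h; apply: leq_trans h _; rewrite leq_mul2r C1 orbT.
split.
  move=> F; have [h [t [pk [c1 c2 c3 _]]]] := call_init n0 k0 F.
  exists h, t, pk; split=> //; apply: mC; first by move: c2; clear; lia.
  by apply: leq_trans c3 _; rewrite /blksize; move: n0; clear; lia.
move=> h G T t Hr m; have HI := reach_inv n0 k0 Hr; have hu := inv_used HI.
have sp a : (a <= blksize * (2 * (n + m) + 6))%N -> (a <= C * (m + n))%N.
  by move=> ha; apply: mC; apply: leq_trans ha _; rewrite /blksize; move: n0; clear; lia.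
have us : (used_space h <= C * (m + n))%N.
  by apply: sp; apply: leq_trans hu _; rewrite leq_mul2l /= leq_add2l.
have e10 : 0 < eps1 by rewrite lt_min eps0 ltr01.
have l0 : 0 <= logn by rewrite ln_ge0 // ler1n.
have q0 : 0 <= logn / eps1 by rewrite divr_ge0 // ltW.
have [s [E [o [S [dt [D [c [[Rp uE cl pS S0] [[HD He cL hM dle] [sto ori]]]]]]]]]] := call_report n0 k0 HI.
have lgl : (1 < n)%N -> (lgn n)%:R <= 4 * logn by move=> n1; apply: lgn_ln.
have S1 : (0 < #|S|)%N by rewrite card_gt0.
(* For [n = 1] the additive error must vanish together with [logn]; there are no edges then, and
   zero serves for both numbers. *)
have [D' [c' [HD' cq hM']]] : exists D' c' : nat, [/\ forall v, (v < n)%N -> (deg E (hdf s) v <= D')%N,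
   c'%:R <= 64 * (logn / eps1) &
   ((4 * k - 1) * D' * #|S| <= (4 * k + 1) * (edges_in G S + c' * #|S|))%N].
  case: (ltngtP n 1) => n1; first by move: n0 n1; clear; lia.
    by exists D, c; split=> //; apply: slack_bound cL; rewrite ?lgl.
  exists 0%N, 0%N; split; [move=> v vn|by rewrite mulr_ge0|by rewrite muln0].
  case: (E) He => // e E' /(_ e (mem_head _ _))[].
  by rewrite n1; case: (s e 0%N) (s e 1%N) => [|x] [|y].
have C64 : 64 * (logn / eps1) * 2 <= C%:R * (logn / eps1).
  rewrite mulrAC ler_wpM2r // -natrM ler_nat; exact: leq_trans C1.
have kr : 1 <= k%:R :> R by rewrite ler1n.
have main := density_bound R k0 S1 hM'.
have d0 : 0 <= density R G S by rewrite divr_ge0 // ler0n.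
have dO : density R G S <= OPT R G by apply: le_bigmax_cond.
have o0 := le_trans d0 dO.
have oD : OPT R G <= D'%:R.
  apply: bigmax_le => [|S' S'0]; first by rewrite ler0n.
  rewrite /density ler_pdivrMr ?ltr0n ?card_gt0 // -natrM ler_nat mulnC (edges_inE _ Rp uE).
  by apply: inside_le => // e /He[].
split=> [u v uv F|]; last split=> [e eG|]; last split; last split=> //; last split.
- have [h' [e [t' [pk [c1 c2 c3 _]]]]] := call_insert n0 k0 HI uv F.
  exists h', e, t', pk; split=> //; apply: leq_trans (sp _ c3) _.
  by rewrite leq_mul2l addSn leqnSn orbT.
- have [h' [t' [pk [c1 c3 _]]]] := call_delete n0 k0 HI eG.
  by exists h', t', pk; split=> //; apply: sp.
- have [s' [A [E' [B [_ HT _ _]]]]] := HI; have [O [_ HG _]] := top_good HT.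
  have tX : (t <= T * (cU (KK n k)).+1)%N.
    by apply: leq_trans (good_credit HG); apply: leq_addr.
  case: (ltngtP n 1) => n1; first by move: n0 n1; clear; lia.
    have h1 : (t <= T * (43 * (1024 * KK n k)))%N.
      by apply: leq_trans tX _; rewrite leq_mul2l cU_bound ?orbT // KK_gt0.
    apply: (@le_trans _ _ (T%:R * (43%:R * (1024%:R * (KK n k)%:R)))).
      by rewrite -!natrM ler_nat.
    rewrite [C%:R * _]mulrC -mulrA ler_wpM2l ?ler0n //.
    have hK := KK_bound e10 ke1 (lgl n1).
    apply: (@le_trans _ _ (43%:R * (1024%:R * (512 * (logn / eps1 ^+ 2))))).
      by apply: ler_wpM2l; rewrite ?ler0n //; apply: ler_wpM2l; rewrite ?ler0n.
    have z0 : 0 <= logn / eps1 ^+ 2 by rewrite divr_ge0 // exprn_ge0 // ltW.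
    move: z0; move: (logn / _) => z z0.
    have -> : 43%:R * (1024%:R * (512 * z)) = (43 * (1024 * 512))%:R * z.
      by rewrite 2!natrM -!mulrA.
    by apply: ler_wpM2r => //; rewrite ler_nat.
  have T0 := reach_one n1 n0 k0 Hr; rewrite T0 mul0n leqn0 in tX.
  by rewrite (eqP tX) T0 mulr0 mul0r.
- exists (@head_of n G s); split=> // v.
  rewrite (indegreeE _ Rp uE); apply: (@le_trans _ _ D'%:R).
    by rewrite ler_nat; apply: HD'; apply: ltn_ord.
  apply: (max_indegree_bound kr (ltW eps0) ke (ler0n R c') o0 dO main).
  by apply: le_trans C64; rewrite mulrC ler_wpM2r.
- exists S, o, dt, (used_space h); split=> //.
    apply: (density_lower kr (ltW eps0) ke (ler0n R c') o0 oD d0 main).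
    by apply: le_trans cq _; apply: le_trans C64; move: q0; move: (logn / eps1) => z z0; lra.
  by split=> //; apply: mC; apply: leq_trans dle _; rewrite leq_mul2r orbT.
Qed.
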